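(* Let $\mathbf k$ be a commutative $\mathbb Q$-algebra. The right action of $GRT_{ell}(\mathbf k)$ on $\underline{Ell}(\mathbf k)$ restricts to an action on $Ell(\mathbf k)\subset\underline{Ell}(\mathbf k)$, and this restricted action is free and transitive.
   Context: $(g,h)=ghg^{-1}h^{-1}$. $\mathfrak t_n^{\mathbf k}$: generators $t_{ij}=t_{ji}$ ($1\le i\ne j\le n$), relations $[t_{ij},t_{ik}+t_{jk}]=0$, $[t_{ij},t_{kl}]=0$ for distinct indices. $\mathfrak t_{1,n}^{\mathbf k}$: generators $x_i^\pm$, relations $\sum_ix_i^\pm=0$, $[x_i^\pm,x_j^\pm]=0$ and $[x_i^+,x_j^-]=[x_j^+,x_i^-]$ ($i\ne j$), $[x_k^\pm,[x_i^+,x_j^-]]=0$ ($i,j,k$ distinct). Write $x_i=x_i^+,y_i=x_i^-$. Hats are degree completions. $x\mapsto\{x\}$ is the morphism $\mathfrak t_n\to\mathfrak t_{1,n}$, $t_{ij}\mapsto[x_i^+,x_j^-]=:t_{ij}$. For disjoint $I_1,\dots,I_n\subset\{1,\dots,p\}$, $x\mapsto x^{I_1,\dots,I_n}$ is $\mathfrak t_n\to\mathfrak t_p$, $t_{ij}\mapsto\sum_{a\in I_i,b\in I_j}t_{ab}$, and, when the $I_i$ partition $\{1,\dots,p\}$, $\mathfrak t_{1,n}\to\mathfrak t_{1,p}$, $x_i^\pm\mapsto\sum_{a\in I_i}x_a^\pm$. $\hat{\mathfrak f}_2^{\mathbf k}$ is the completed free Lie algebra on $A,B$, embedded in $\hat{\mathfrak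 t}_3^{\mathbf k}$ by $A\mapsto t_{12},B\mapsto t_{23}$. $\mathfrak t_{1,2}^{\mathbf k}$ is free on $x_1,y_1$. $\underline M(\mathbf k)$: pairs $(\mu,\Phi)\in\mathbf k\times\exp(\hat{\mathfrak f}_2^{\mathbf k})$ such that $\Phi^{3,2,1}=\Phi^{-1}$, $e^{\mu t_{23}/2}\Phi^{1,2,3}e^{\mu t_{12}/2}\Phi^{3,1,2}e^{\mu t_{31}/2}\Phi^{2,3,1}=e^{\mu(t_{12}+t_{13}+t_{23})/2}$, $\Phi^{2,3,4}\Phi^{1,23,4}\Phi^{1,2,3}=\Phi^{1,2,34}\Phi^{12,3,4}$. $\underline{Ell}(\mathbf k)$: quadruples $(\mu,\Phi,A_+,A_-)$ with $(\mu,\Phi)\in\underline M(\mathbf k)$, $A_\pm\in\exp(\hat{\mathfrak t}_{1,2}^{\mathbf k})$, such that $\alpha_\pm^{3,1,2}\alpha_\pm^{2,3,1}\alpha_\pm^{1,2,3}=1$ with $\alpha_\pm=\{e^{\pm\mu(t_{12}+t_{13})/2}\}A_\pm^{1,23}\{\Phi^{1,2,3}\}$, and $\{e^{\mu t_{12}}\}=\big(\{\Phi\}^{-1}A_-^{1,23}\{\Phi\},\{e^{-\mu t_{12}/2}(\Phi^{2,1,3})^{-1}\}(A_+^{2,13})^{-1}\{\Phi^{2,1,3}e^{-\mu t_{12}/2}\}\big)$. $Ell(\mathbf k)$ is the subset where $\mu\in\mathbf k^\times$. $GRT_1(\mathbf k)$: set of $g\in\exp(\hat{\mathfrak f}_2^{\mathbf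 k})$ with $g^{3,2,1}=g^{-1}$, $g^{3,1,2}g^{2,3,1}g^{1,2,3}=1$, $t_{12}+\mathrm{Ad}(g^{1,2,3})^{-1}(t_{23})+\mathrm{Ad}(g^{2,1,3})^{-1}(t_{13})=t_{12}+t_{13}+t_{23}$, $g^{2,3,4}g^{1,23,4}g^{1,2,3}=g^{1,2,34}g^{12,3,4}$; product $(g_1*g_2)(A,B)=g_1(\mathrm{Ad}(g_2(A,B))(A),B)g_2(A,B)$. $GRT_1^{ell}(\mathbf k)$: set of $(g,u_+,u_-)$, $g\in GRT_1(\mathbf k)$, $u_\pm\in\hat{\mathfrak t}_{1,2}^{\mathbf k}$, such that in $\hat{\mathfrak t}_{1,3}^{\mathbf k}$ (elements of $\exp\hat{\mathfrak t}_3$ acting through $\{\cdot\}$): $\mathrm{Ad}(g^{1,2,3})^{-1}(u_\pm^{1,23})+\mathrm{Ad}(g^{2,1,3})^{-1}(u_\pm^{2,13})+u_\pm^{3,12}=0$; $[\mathrm{Ad}(g^{1,2,3})^{-1}(u_\pm^{1,23}),u_\pm^{3,12}]=0$; $[\mathrm{Ad}(g^{1,2,3})^{-1}(u_+^{1,23}),\mathrm{Ad}(g^{2,1,3})^{-1}(u_-^{2,13})]=t_{12}$; group law $(g_1,u^1_\pm)*(g_2,u^2_\pm)=(g_1*g_2,u^1_\pm(u^2_+,u^2_-))$. $\mathbf k^\times$ acts by $(c\cdot g)(A,B)=g(c^{-1}A,c^{-1}B)$, $(c\cdot u_+)(x_1,y_1)=u_+(x_1,c^{-1}y_1)$, $(c\cdot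 u_-)(x_1,y_1)=cu_-(x_1,c^{-1}y_1)$; $GRT_{ell}(\mathbf k)=GRT_1^{ell}(\mathbf k)\rtimes\mathbf k^\times$. The right action of $GRT_{ell}(\mathbf k)$ on $\underline{Ell}(\mathbf k)$ is: for $(g,u_\pm)\in GRT_1^{ell}(\mathbf k)$, $(\mu,\Phi,A_\pm)*(g,u_\pm)=(\mu,\tilde\Phi,\tilde A_\pm)$ with $\tilde\Phi(t_{12},t_{23})=\Phi(\mathrm{Ad}(g^{1,2,3})(t_{12}),t_{23})g^{1,2,3}$ and $\tilde A_\pm(x_1,y_1)=A_\pm(u_+(x_1,y_1),u_-(x_1,y_1))$; for $c\in\mathbf k^\times$, $(\mu,\Phi,A_\pm)*c=(c\mu,\Phi(cA,cB),A_\pm(x_1,cy_1))$. *)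

(* Defs.v *)
From HB Require Import structures.
From mathcomp Require Import all_boot all_order all_algebra.
From mathcomp Require Import boolp.

Set Implicit Arguments.
Unset Strict Implicit.
Unset Printing Implicit Defensive.

Import GRing.Theory.
Local Open Scope ring_scope.

(* The ring k<<X>> of noncommutative power series: f w is the coefficient of  *)
(* the word w.  The ring k is not assumed to be nontrivial.                   *)
Definition series (k : comPzRingType) (X : finType) := seq X -> k.

Section SeriesRing.
Variables (k : comPzRingType) (X : finType).
Implicit Types f g h : series k X.

Definition series_one : series k X := fun w => (w == [::])%:R.

Definition series_mul f g : series k X := fun w =>
  \sum_(i < (size w).+1) f (take i w) * g (drop i w).

HB.instance Definition _ := Choice.on (series k X).

Definition series_zero : series k X := fun _ => 0.
Definition series_opp f : series k X := fun w => - f w.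
Definition series_add f g : series k X := fun w => f w + g w.

Fact series_addA : associative series_add.
Proof. by move=> f g h; apply/funext => w; exact: addrA. Qed.

Fact series_addC : commutative series_add.
Proof. by move=> f g; apply/funext => w; exact: addrC. Qed.

Fact series_add0 : left_id series_zero series_add.
Proof. by move=> f; apply/funext => w; exact: add0r. Qed.

Fact series_addN : left_inverse series_zero series_opp series_add.
Proof. by move=> f; apply/funext => w; exact: addNr. Qed.

HB.instance Definition _ := GRing.isZmodule.Build (series k X)
  series_addA series_addC series_add0 series_addN.

Definition series_scale (c : k) f : series k X := fun w => c * f w.

Fact series_scaleA a b f : series_scale a (series_scale b f) = series_scale (a * b) f.
Proof. by apply/funext => w; rewrite /series_scale mulrA. Qed.

Fact series_scale1 : left_id 1 series_scale.
Proof. by move=> f; apply/funext => w; rewrite /series_scale mul1r. Qed.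

Fact series_scaleDr : right_distributive series_scale +%R.
Proof. by move=> c f g; apply/funext => w; exact: mulrDr. Qed.

Fact series_scaleDl f : {morph series_scale^~ f : a b / a + b}.
Proof. by move=> a b; apply/funext => w; exact: mulrDl. Qed.

HB.instance Definition _ := GRing.Zmodule_isLmodule.Build k (series k X)
  series_scaleA series_scale1 series_scaleDr series_scaleDl.

Lemma series_mul_nil f g : series_mul f g [::] = f [::] * g [::].
Proof. by rewrite /series_mul big_ord_recl big_ord0 addr0. Qed.

Lemma series_mul_cons f g x w : series_mul f g (x :: w) =
  f [::] * g (x :: w) + series_mul (fun v => f (x :: v)) g w.
Proof. by rewrite /series_mul big_ord_recl. Qed.

Fact series_mulDl : left_distributive series_mul +%R.
Proof.
move=> f g h; apply/funext => w; rewrite {1}/series_mul.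
rewrite (eq_bigr _ (fun i _ => mulrDl _ _ _)).
exact: big_split.
Qed.

Fact series_mulDr : right_distributive series_mul +%R.
Proof.
move=> f g h; apply/funext => w; rewrite {1}/series_mul.
rewrite (eq_bigr _ (fun i _ => mulrDr _ _ _)).
exact: big_split.
Qed.

Fact series_mulZl c f g w :
  series_mul (series_scale c f) g w = c * series_mul f g w.
Proof.
by rewrite /series_mul mulr_sumr; apply: eq_bigr => i _; rewrite mulrA.
Qed.

Fact series_mulA : associative series_mul.
Proof.
move=> f g h; apply/funext => w; elim: w f g => [|x w IHw] f g.
  by rewrite !series_mul_nil mulrA.
rewrite !series_mul_cons series_mul_nil IHw mulrDr -mulrA -addrA; congr (_ + _).
have -> : (fun v => series_mul f g (x :: v)) =
    series_scale (f [::]) (fun v => g (x :: v))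
    + series_mul (fun v => f (x :: v)) g.
  by apply/funext => v; rewrite series_mul_cons.
by rewrite series_mulDl -series_mulZl.
Qed.

Fact series_mul1 : left_id series_one series_mul.
Proof.
move=> f; apply/funext => w; rewrite /series_mul big_ord_recl take0 drop0.
rewrite mul1r big1 ?addr0 // => -[i lti] _ /=.
by case: w lti => //= x w _; rewrite mul0r.
Qed.

Fact series_mulr1 : right_id series_one series_mul.
Proof.
move=> f; apply/funext => w; rewrite /series_mul big_ord_recr /=.
rewrite take_size drop_size mulr1 big1 ?add0r // => -[i lti] _ /=.
have : size (drop i w) != 0 by rewrite size_drop subn_eq0 -ltnNge.
by rewrite /series_one; case: (drop i w) => //= *; rewrite mulr0.
Qed.

HB.instance Definition _ := GRing.Zmodule_isPzRing.Build (series k X)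
  series_mulA series_mul1 series_mulr1 series_mulDl series_mulDr.

Definition letter (x : X) : series k X := fun w => (w == [:: x])%:R.

(* homogeneous component of degree d *)
Definition hcomp (d : nat) f : series k X :=
  fun w => if size w == d then f w else 0.

Definition lie_br f g : series k X := f * g - g * f.

(* The free Lie algebra on X, realized inside the free associative algebra.   *)
Inductive free_lie : series k X -> Prop :=
| free_lie_letter x : free_lie (letter x)
| free_lie0 : free_lie 0
| free_lieD f g : free_lie f -> free_lie g -> free_lie (f + g)
| free_lieZ c f : free_lie f -> free_lie (c *: f)
| free_lie_br f g : free_lie f -> free_lie g -> free_lie (lie_br f g).

(* The Lie ideal of the free Lie algebra generated by a set R of relators.    *)
Inductive lie_ideal (R : series k X -> Prop) : series k X -> Prop :=
| lie_ideal_gen f : R f -> lie_ideal R f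
| lie_ideal0 : lie_ideal R 0
| lie_idealD f g : lie_ideal R f -> lie_ideal R g -> lie_ideal R (f + g)
| lie_idealZ c f : lie_ideal R f -> lie_ideal R (c *: f)
| lie_ideal_br f g : free_lie f -> lie_ideal R g -> lie_ideal R (lie_br f g).

(* Degree completion of the free Lie algebra, all letters having degree 1.    *)
Definition lie_series f := forall d, free_lie (hcomp d f).

(* Elements of the degree completion of the Lie algebra presented by          *)
(* generators X and homogeneous relators R are represented by Lie series;     *)
(* two of them are equal iff they agree modulo the ideal in every degree.     *)
Definition lie_eq (R : series k X -> Prop) f g :=
  forall d, lie_ideal R (hcomp d (f - g)).

End SeriesRing.

Section Exponentials.
Variables (k : comPzRingType) (iota : {rmorphism rat -> k}) (X : finType).
Implicit Types f g h : series k X.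

(* In the next definitions the terms omitted from the series vanish on w,     *)
(* since f, resp. g - 1, has no constant term.                                *)
Definition sexp f : series k X := fun w =>
  \sum_(n < (size w).+1) iota (n`!%:R^-1) * (f ^+ n) w.

Definition slog g : series k X := fun w =>
  \sum_(1 <= n < (size w).+1) iota ((-1) ^+ n.-1 / n%:R) * ((g - 1) ^+ n) w.

Definition sinv g : series k X := fun w =>
  \sum_(n < (size w).+1) ((1 - g) ^+ n) w.

Definition Ad g f : series k X := g * f * sinv g.
Definition AdV g f : series k X := sinv g * f * g.

Definition gcomm g h : series k X := g * h * sinv g * sinv h.

(* The group exp of the completed free Lie algebra on X.                      *)
Definition exp_lie g := exists2 f, lie_series f & g = sexp f.

(* Equality in exp of the completed Lie algebra presented by X and R, the     *)
(* quotient of the group exp_lie: exp x = exp y iff x = y in that algebra.    *)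
Definition exp_eq (R : series k X -> Prop) g h := lie_eq R (slog g) (slog h).

End Exponentials.

(* The continuous algebra morphism sending each letter x to a x, which must   *)
(* have no constant term: words longer than w do not contribute to w.         *)
Definition subst (k : comPzRingType) (X Y : finType) (f : series k X)
    (a : X -> series k Y) : series k Y := fun w =>
  \sum_(n < (size w).+1) \sum_(v : n.-tuple X) f v * (\prod_(x <- v) a x) w.

(* Free Lie algebra on two letters: the letters false and true are A and B,   *)
(* or x_1 and y_1 when it is viewed as t_{1,2}.                               *)
Section TwoLetters.
Variable k : comPzRingType.

Definition lA : series k bool := letter k false.
Definition lB : series k bool := letter k true.

Definition subst2 (Y : finType) (f : series k bool) (a b : series k Y) :=
  subst f (fun l : bool => if l then b else a).

End TwoLetters.

(* Ordered pairs (i, j) with i != j; the relation t_ij = t_ji is t_rel_sym.   *)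
(* Ordinals count from 0, but the labels in t, x_ and in the lists of blocks  *)
(* I_1, ..., I_n below count from 1.                                          *)
Definition t_alph (n : nat) : finType :=
  {q : 'I_n * 'I_n | q.1 != q.2}.

(* (true, i) stands for x_i^+ and (false, i) for x_i^-.                       *)
Definition e_alph (n : nat) : finType := (bool * 'I_n)%type.

Unset Implicit Arguments.

Section BraidLie.
Variable k : comPzRingType.

(* The sums below have a single term, or none if the labels are invalid.      *)
Definition t (n i j : nat) : series k (t_alph n) :=
  \sum_(q : t_alph n | ((val q).1.+1 == i) && ((val q).2.+1 == j)) letter k q.

Definition x_ (n : nat) (s : bool) (i : nat) : series k (e_alph n) :=
  \sum_(q : e_alph n | (q.1 == s) && (q.2.+1 == i)) letter k q.

Inductive t_rel {n : nat} : series k (t_alph n) -> Prop :=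
| t_rel_sym (i j : 'I_n) : i != j ->
    t_rel (t n i.+1 j.+1 - t n j.+1 i.+1)
| t_rel3 (i j l : 'I_n) : uniq [:: i; j; l] ->
    t_rel (lie_br (t n i.+1 j.+1) (t n i.+1 l.+1 + t n j.+1 l.+1))
| t_rel4 (i j l m : 'I_n) : uniq [:: i; j; l; m] ->
    t_rel (lie_br (t n i.+1 j.+1) (t n l.+1 m.+1)).

Inductive e_rel {n : nat} : series k (e_alph n) -> Prop :=
| e_rel_sum s : e_rel (\sum_(i < n) x_ n s i.+1)
| e_rel_comm s (i j : 'I_n) : i != j ->
    e_rel (lie_br (x_ n s i.+1) (x_ n s j.+1))
| e_rel_sym (i j : 'I_n) : i != j ->
    e_rel (lie_br (x_ n true i.+1) (x_ n false j.+1)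
           - lie_br (x_ n true j.+1) (x_ n false i.+1))
| e_rel3 s (i j l : 'I_n) : uniq [:: i; j; l] ->
    e_rel (lie_br (x_ n s l.+1) (lie_br (x_ n true i.+1) (x_ n false j.+1))).

Definition curly {n : nat} (f : series k (t_alph n)) : series k (e_alph n) :=
  subst f (fun q => lie_br (x_ n true (val q).1.+1) (x_ n false (val q).2.+1)).

(* f^{I_1,...,I_n} for I = [:: I_1; ...; I_n] *)
Definition t_ins {n : nat} (p : nat) (I : seq (seq nat)) (f : series k (t_alph n)) :
    series k (t_alph p) :=
  subst f (fun q => \sum_(a <- nth [::] I (val q).1)
                    \sum_(b <- nth [::] I (val q).2) t p a b).

Definition e_ins {n : nat} (p : nat) (I : seq (seq nat)) (f : series k (e_alph n)) :
    series k (e_alph p) :=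
  subst f (fun q => \sum_(a <- nth [::] I q.2) x_ p q.1 a).

(* f_2 -> t_3, A |-> t_12, B |-> t_23 *)
Definition f2_t3 (f : series k bool) : series k (t_alph 3) :=
  subst2 f (t 3 1 2) (t 3 2 3).

(* identification of the free Lie algebra on x_1, y_1 with t_{1,2} *)
Definition f2_t12 (f : series k bool) : series k (e_alph 2) :=
  subst2 f (x_ 2 true 1) (x_ 2 false 1).

Definition f2_ins (p : nat) (I1 I2 I3 : seq nat) (f : series k bool) :
  series k (t_alph p) := t_ins p [:: I1; I2; I3] (f2_t3 f).

Definition t12_ins (p : nat) (I1 I2 : seq nat) (f : series k bool) :
  series k (e_alph p) := e_ins p [:: I1; I2] (f2_t12 f).

End BraidLie.

Arguments curly {k n} f.
Arguments t_ins {k n} p I f.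
Arguments e_ins {k n} p I f.
Arguments f2_ins {k} p I1 I2 I3 f.
Arguments t12_ins {k} p I1 I2 f.
Arguments t_rel k n : clear implicits.
Arguments e_rel k n : clear implicits.

Set Implicit Arguments.

Section EllipticAssociators.
Variables (k : comPzRingType) (iota : {rmorphism rat -> k}).
Implicit Types (mu : k) (Phi g A u : series k bool).

Local Notation half := (iota (1 / 2%:R)).
Local Notation Exp := (sexp iota).
Local Notation "f =t[ n ] g" := (lie_eq (t_rel k n) f g) (at level 70).
Local Notation "f =e[ n ] g" := (lie_eq (e_rel k n) f g) (at level 70).
Local Notation "f =T[ n ] g" := (exp_eq iota (t_rel k n) f g) (at level 70).
Local Notation "f =E[ n ] g" := (exp_eq iota (e_rel k n) f g) (at level 70).
Local Notation t3 := (t k 3).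

Definition pentagon Phi :=
  f2_ins 4 [:: 2] [:: 3] [:: 4] Phi * f2_ins 4 [:: 1] [:: 2; 3] [:: 4] Phi
    * f2_ins 4 [:: 1] [:: 2] [:: 3] Phi
  =T[4] f2_ins 4 [:: 1] [:: 2] [:: 3; 4] Phi
          * f2_ins 4 [:: 1; 2] [:: 3] [:: 4] Phi.

Definition duality Phi :=
  f2_ins 3 [:: 3] [:: 2] [:: 1] Phi
  =T[3] sinv (f2_ins 3 [:: 1] [:: 2] [:: 3] Phi).

Definition M_ mu Phi := [/\ exp_lie iota Phi, duality Phi,
    Exp ((mu * half) *: t3 2 3) * f2_ins 3 [:: 1] [:: 2] [:: 3] Phi
      * Exp ((mu * half) *: t3 1 2) * f2_ins 3 [:: 3] [:: 1] [:: 2] Phi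
      * Exp ((mu * half) *: t3 3 1) * f2_ins 3 [:: 2] [:: 3] [:: 1] Phi
    =T[3] Exp ((mu * half) *: (t3 1 2 + t3 1 3 + t3 2 3))
  & pentagon Phi].

Record ell_data := EllData {
  ell_mu : k;
  ell_Phi : series k bool;
  ell_Ap : series k bool;
  ell_Am : series k bool }.

(* alpha_+ is alpha mu Phi A_+ and alpha_- is alpha (- mu) Phi A_-. *)
Definition alpha mu Phi A : series k (e_alph 3) :=
  curly (Exp ((mu * half) *: (t3 1 2 + t3 1 3)))
  * t12_ins 3 [:: 1] [:: 2; 3] A * curly (f2_ins 3 [:: 1] [:: 2] [:: 3] Phi).

Definition alpha_rel mu Phi A :=
  e_ins 3 [:: [:: 3]; [:: 1]; [:: 2]] (alpha mu Phi A)
  * e_ins 3 [:: [:: 2]; [:: 3]; [:: 1]] (alpha mu Phi A)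
  * e_ins 3 [:: [:: 1]; [:: 2]; [:: 3]] (alpha mu Phi A) =E[3] 1.

Definition comm_rel mu Phi Ap Am :=
  curly (Exp (mu *: t3 1 2)) =E[3]
  gcomm
    (sinv (curly (f2_ins 3 [:: 1] [:: 2] [:: 3] Phi))
     * t12_ins 3 [:: 1] [:: 2; 3] Am
     * curly (f2_ins 3 [:: 1] [:: 2] [:: 3] Phi))
    (curly (Exp ((- (mu * half)) *: t3 1 2)
            * sinv (f2_ins 3 [:: 2] [:: 1] [:: 3] Phi))
     * sinv (t12_ins 3 [:: 2] [:: 1; 3] Ap)
     * curly (f2_ins 3 [:: 2] [:: 1] [:: 3] Phi
              * Exp ((- (mu * half)) *: t3 1 2))).

(* \underline{Ell}(k) and Ell(k) *)
Definition Ell_ (e : ell_data) :=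
  [/\ M_ (ell_mu e) (ell_Phi e),
      exp_lie iota (ell_Ap e) /\ exp_lie iota (ell_Am e),
      alpha_rel (ell_mu e) (ell_Phi e) (ell_Ap e),
      alpha_rel (- ell_mu e) (ell_Phi e) (ell_Am e)
    & comm_rel (ell_mu e) (ell_Phi e) (ell_Ap e) (ell_Am e)].

Definition Ell (e : ell_data) := Ell_ e /\ exists nu, ell_mu e * nu = 1.

Definition GRT1 g := [/\ exp_lie iota g, duality g,
    f2_ins 3 [:: 3] [:: 1] [:: 2] g * f2_ins 3 [:: 2] [:: 3] [:: 1] g
      * f2_ins 3 [:: 1] [:: 2] [:: 3] g =T[3] 1,
    t3 1 2 + AdV (f2_ins 3 [:: 1] [:: 2] [:: 3] g) (t3 2 3)
      + AdV (f2_ins 3 [:: 2] [:: 1] [:: 3] g) (t3 1 3)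
    =t[3] t3 1 2 + t3 1 3 + t3 2 3
  & pentagon g].

Definition GRT1_mul g1 g2 : series k bool :=
  subst2 g1 (Ad g2 (lA k)) (lB k) * g2.

Record grt1_data := Grt1Data {
  grt_g : series k bool;
  grt_up : series k bool;
  grt_um : series k bool }.

(* Ad(g^{1,2,3})^{-1}(u^{1,23}), Ad(g^{2,1,3})^{-1}(u^{2,13}) and u^{3,12} *)
Definition u1_23 g u : series k (e_alph 3) :=
  AdV (curly (f2_ins 3 [:: 1] [:: 2] [:: 3] g)) (t12_ins 3 [:: 1] [:: 2; 3] u).
Definition u2_13 g u : series k (e_alph 3) :=
  AdV (curly (f2_ins 3 [:: 2] [:: 1] [:: 3] g)) (t12_ins 3 [:: 2] [:: 1; 3] u).
Definition u3_12 u : series k (e_alph 3) := t12_ins 3 [:: 3] [:: 1; 2] u.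

Definition u_rel g u :=
  u1_23 g u + u2_13 g u + u3_12 u =e[3] 0 /\
  lie_br (u1_23 g u) (u3_12 u) =e[3] 0.

Definition GRT1ell (s : grt1_data) :=
  let: Grt1Data g up um := s in
  [/\ GRT1 g, lie_series up /\ lie_series um, u_rel g up, u_rel g um
    & lie_br (u1_23 g up) (u2_13 g um) =e[3] curly (t3 1 2)].

Definition GRT1ell_mul (s1 s2 : grt1_data) : grt1_data :=
  Grt1Data (GRT1_mul (grt_g s1) (grt_g s2))
           (subst2 (grt_up s1) (grt_up s2) (grt_um s2))
           (subst2 (grt_um s1) (grt_up s2) (grt_um s2)).

Definition GRT1ell_one : grt1_data := Grt1Data 1 (lA k) (lB k).

(* k^\times, a unit being given together with its inverse *)
Definition kunits := {c : k * k | c.1 * c.2 == 1}.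
Definition uval (c : kunits) : k := (val c).1.
Definition uinv (c : kunits) : k := (val c).2.

Fact kunits_one_subproof : (1 : k, 1 : k).1 * (1 : k, 1 : k).2 == 1.
Proof. by rewrite mulr1. Qed.

Fact kunits_mul_subproof (c d : kunits) :
  (uval c * uval d, uinv c * uinv d).1 * (uval c * uval d, uinv c * uinv d).2
  == 1.
Proof.
case: c d => -[c c'] /= cc' [[d d'] /= dd']; rewrite /uval /uinv /=.
by rewrite mulrACA (eqP cc') (eqP dd') mulr1.
Qed.

Definition kunits_one : kunits := exist _ (1 : k, 1 : k) kunits_one_subproof.
Definition kunits_mul (c d : kunits) : kunits :=
  exist _ (uval c * uval d, uinv c * uinv d) (kunits_mul_subproof c d).

Definition unit_act (c : kunits) (s : grt1_data) : grt1_data :=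
  let: Grt1Data g up um := s in
  Grt1Data (subst2 g (uinv c *: lA k) (uinv c *: lB k))
           (subst2 up (lA k) (uinv c *: lB k))
           (uval c *: subst2 um (lA k) (uinv c *: lB k)).

(* GRT_ell(k), the semidirect product of GRT_1^ell(k) by k^\times *)
Definition grt_data : Type := (grt1_data * kunits)%type.

Definition GRTell (s : grt_data) := GRT1ell s.1.

Definition GRTell_mul (s1 s2 : grt_data) : grt_data :=
  (GRT1ell_mul s1.1 (unit_act s1.2 s2.1), kunits_mul s1.2 s2.2).

Definition GRTell_one : grt_data := (GRT1ell_one, kunits_one).

Definition act1 (e : ell_data) (s : grt1_data) : ell_data :=
  EllData (ell_mu e)
    (subst2 (ell_Phi e) (Ad (grt_g s) (lA k)) (lB k) * grt_g s)
    (subst2 (ell_Ap e) (grt_up s) (grt_um s))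
    (subst2 (ell_Am e) (grt_up s) (grt_um s)).

Definition act_unit (e : ell_data) (c : kunits) : ell_data :=
  EllData (uval c * ell_mu e)
    (subst2 (ell_Phi e) (uval c *: lA k) (uval c *: lB k))
    (subst2 (ell_Ap e) (lA k) (uval c *: lB k))
    (subst2 (ell_Am e) (lA k) (uval c *: lB k)).

Definition ell_act (e : ell_data) (s : grt_data) : ell_data :=
  act_unit (act1 e s.1) s.2.

End EllipticAssociators.

(* Right actions of a group carried by a subset G of a type, with product mul *)
(* and neutral element one, on a subset S of a type.                          *)
Section RightActions.
Variables (T E : Type) (G : T -> Prop) (mul : T -> T -> T) (one : T).
Variables (S : E -> Prop) (act : E -> T -> E).

Definition right_action :=
  [/\ forall e s, S e -> G s -> S (act e s),
      forall e, S e -> act e one = e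
    & forall e s1 s2, S e -> G s1 -> G s2 ->
        act (act e s1) s2 = act e (mul s1 s2)].

Definition free_action := forall e s, S e -> G s -> act e s = e -> s = one.

Definition transitive_action :=
  forall e1 e2, S e1 -> S e2 -> exists2 s, G s & act e1 s = e2.

End RightActions.

(* Main.v *)
(** Freeness and transitivity are proved in completed associative algebras: the
    defining relations of M, GRT_1, Ell and GRT_1^ell become identities between
    evaluations of noncommutative power series, valid for all systems of elements
    that satisfy the relations of t_3, t_4 or t_{1,3}; by the Dynkin operator this
    loses nothing compared with equality in the completed Lie algebras.  An element
    (g, u) turns a system (t_ij) or (x_i) into a twisted one, which gives stability
    under the action.  Conversely, given two elements with the same invertible mu,
    g and u are obtained from fixpoint equations.  The hexagon determines t_13 from
    t_12 and the conjugate of exp(mu t_23) by Phi, which yields the equations for g;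
    the pentagon of g follows degree by degree, since its defect is central modulo
    the next degree.  For u, the group words X_i attached to an element of Ell
    satisfy relations whose leading terms are the relations of t_{1,3} (here the
    determinant of the linear parts of A_+ and A_-, equal to mu, is inverted), so
    that the words of one element are mapped to those of the other by a morphism. *)
From HB Require Import structures.
Require Import Defs.
From mathcomp Require Import all_boot all_order all_algebra.
From mathcomp Require Import generic_quotient boolp ring.

Set Implicit Arguments.
Unset Strict Implicit.
Unset Printing Implicit Defensive.

Import GRing.Theory.
Local Open Scope ring_scope.

(** * A decision procedure for noncommutative ring identities *)

(** Over an arbitrary Q-algebra only [mu] and the positive integers may be inverted, so each
    construction is a successive approximation along the degree filtration. Quantifying over all
    systems in all complete algebras turns stability into specialization: the twisted elements form
    a system in the same algebra, on which the relations of the old associator can be evaluated. Two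
    obstacles shape the converse. The pentagon of the old associator can be evaluated on the six
    twisted elements of t_4 only if these satisfy the relations of t_4, which would follow from the
    pentagon of g, the very thing to be proved. The circle is broken because the twist only requires
    the two sides of that pentagon to act equally by conjugation, and this holds one degree further
    than the pentagon itself. For u, no morphism out of t_{1,3} is given beforehand: it is produced
    by showing that one evaluation of a free algebra, which is onto, has its kernel contained in
    that of another evaluation. *)

Inductive nexp := NVar of nat | NAdd of nexp & nexp | NMul of nexp & nexp
  | NOpp of nexp | NZero | NOne.

(** Equal monomials are kept apart here; [ncheck] collects their coefficients and tests that each
    sum vanishes. *)
Fixpoint nmon (e : nexp) : seq (int * seq nat) :=
  match e with
  | NVar n => [:: (1, [:: n])]
  | NAdd a b => nmon a ++ nmon b
  | NMul a b => [seq (p.1 * q.1, p.2 ++ q.2) | p <- nmon a, q <- nmon b]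
  | NOpp a => [seq (- p.1, p.2) | p <- nmon a]
  | NZero => [::]
  | NOne => [:: (1, [::])]
  end.

Definition ncheck (L : seq (int * seq nat)) :=
  all (fun m => foldr (fun p c => if p.2 == m then p.1 + c else c) 0 L == 0)
      (undup [seq p.2 | p <- L]).

Section NonCommutativeRing.
Variables (R : pzRingType) (env : seq R).

Fixpoint neval (e : nexp) : R :=
  match e with
  | NVar n => env`_n
  | NAdd a b => neval a + neval b
  | NMul a b => neval a * neval b
  | NOpp a => - neval a
  | NZero => 0
  | NOne => 1
  end.

Let word (m : seq nat) : R := \prod_(i <- m) env`_i.

Lemma nmonE e : neval e = \sum_(p <- nmon e) word p.2 *~ p.1.
Proof.
elim: e => [n|a IHa b IHb|a IHa b IHb|a IHa||] /=.
- by rewrite big_seq1 /word big_seq1 mulr1z.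
- by rewrite big_cat IHa IHb.
- rewrite IHa IHb big_allpairs_dep mulr_suml; apply: eq_bigr => p _.
  rewrite mulr_sumr; apply: eq_bigr => q _.
  by rewrite /word big_cat /= mulrzAl mulrzAr -mulrzA [q.1 * _]mulrC.
- rewrite big_map IHa -sumrN; apply: eq_bigr => p _; by rewrite mulrNz.
- by rewrite big_nil.
- by rewrite big_seq1 /word big_nil mulr1z.
Qed.

(** The expanded difference is regrouped by monomials, and each group has coefficient zero. *)
Lemma ncheckP e1 e2 : ncheck (nmon (NAdd e1 (NOpp e2))) -> neval e1 = neval e2.
Proof.
move=> chk; apply/eqP; rewrite -subr_eq0; apply/eqP.
rewrite -[LHS]/(neval (NAdd e1 (NOpp e2))) nmonE.
move: (nmon _) chk => L chk.
transitivity (\sum_(m <- undup [seq p.2 | p <- L]) \sum_(p <- L | p.2 == m) word m *~ p.1).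
  rewrite (exchange_big_dep xpredT) //=; rewrite !big_seq; apply: eq_bigr => p pL.
  rewrite (big_rem p.2) /=; last by rewrite mem_undup map_f.
  rewrite eqxx big1_seq ?addr0 // => m /andP[/eqP <-].
  by rewrite mem_rem_uniq ?undup_uniq // inE eqxx.
rewrite big1_seq // => m /andP[_ Hm].
have /allP/(_ m Hm)/eqP := chk.
have -> : foldr (fun p c => if p.2 == m then p.1 + c else c) 0 L =
   \sum_(p <- L | p.2 == m) p.1.
  by elim: (L) => [|p L' IH]; rewrite ?big_nil // big_cons /= IH.
by move=> H; rewrite -mulrz_sumr H mulr0z.
Qed.

End NonCommutativeRing.

Ltac nr_lookup env x :=
  lazymatch env with
  | @nil _ => fail
  | cons x _ => constr:(O)
  | cons _ ?env' => let n := nr_lookup env' x in constr:(S n)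
  end.
(** The dummy [match] on [Set] serves for backtracking: when [nr_lookup] fails on an atom, the
    second branch appends it to the environment. *)
Ltac nr_env env t :=
  lazymatch t with
  | (?a + ?b)%R => let e := nr_env env a in nr_env e b
  | (?a * ?b)%R => let e := nr_env env a in nr_env e b
  | (- ?a)%R => nr_env env a
  | (0)%R => env
  | (1)%R => env
  | _ => match constr:(Set) with
         | _ => let _ := nr_lookup env t in env
         | _ => let T := lazymatch type of env with seq ?T => T end in
                let e := eval cbv [cat] in (cat env (@cons T t (@nil T))) in e
         end
  end.
Ltac nr_reify env t :=
  lazymatch t with
  | (?a + ?b)%R => let x := nr_reify env a in let y := nr_reify env b in constr:(NAdd x y)
  | (?a * ?b)%R => let x := nr_reify env a in let y := nr_reify env b in constr:(NMul x y)
  | (- ?a)%R => let x := nr_reify env a in constr:(NOpp x)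
  | (0)%R => constr:(NZero)
  | (1)%R => constr:(NOne)
  | _ => let n := nr_lookup env t in constr:(NVar n)
  end.
Ltac ncring :=
  lazymatch goal with
  | |- @eq ?T ?x ?y =>
    let R := constr:(T : pzRingType) in
    let e0 := constr:(@nil T) in
    let e1 := nr_env e0 x in
    let env := nr_env e1 y in
    let a := nr_reify env x in
    let b := nr_reify env y in
    refine (@ncheckP _ env a b _); vm_compute; reflexivity
  end.

(** * Complete filtered algebras *)

Section SeriesFiltration.
Variables (k : comPzRingType) (X : finType).
Implicit Types f g h : series k X.

Definition sfil n f := forall w, (size w < n)%N -> f w = 0.

Definition shift (x : X) f : series k X := fun w => f (x :: w).

Lemma addsE f g w : (f + g) w = f w + g w. Proof. by []. Qed.
Lemma oppsE f w : (- f) w = - f w. Proof. by []. Qed.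
Lemma subsE f g w : (f - g) w = f w - g w. Proof. by []. Qed.
Lemma zerosE w : (0 : series k X) w = 0. Proof. by []. Qed.
Lemma scalesE c f w : (c *: f) w = c * f w. Proof. by []. Qed.
Lemma onesE w : (1 : series k X) w = (w == [::])%:R. Proof. by []. Qed.
Lemma mulsE f g w :
  (f * g) w = \sum_(i < (size w).+1) f (take i w) * g (drop i w).
Proof. by []. Qed.

Lemma mulsE_nil f g : (f * g) [::] = f [::] * g [::].
Proof. exact: series_mul_nil. Qed.

Lemma mulsE_cons f g x w :
  (f * g) (x :: w) = f [::] * g (x :: w) + (shift x f * g) w.
Proof. exact: series_mul_cons. Qed.

Lemma sumsE I (r : seq I) (P : pred I) (F : I -> series k X) w :
  (\sum_(i <- r | P i) F i) w = \sum_(i <- r | P i) F i w.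
Proof. by elim/big_rec2: _ => // i y1 y2 _ <-. Qed.

Lemma scaleAl_series c f g : c *: (f * g) = (c *: f) * g.
Proof. by apply/funext => w; rewrite scalesE -series_mulZl. Qed.

Lemma scaleAr_series c f g : c *: (f * g) = f * (c *: g).
Proof.
apply/funext => w; rewrite scalesE !mulsE mulr_sumr.
by apply: eq_bigr => i _; rewrite scalesE mulrCA.
Qed.

Lemma shiftM x f g : shift x (f * g) = f [::] *: shift x g + shift x f * g.
Proof. by apply/funext => w; rewrite /shift mulsE_cons. Qed.

Lemma shift_letterM x y f :
  shift x (letter k y * f) = if x == y then f else 0.
Proof.
apply/funext => w; rewrite /shift mulsE_cons {1}/letter mul0r add0r.
have -> : shift x (letter k y) = if x == y then 1 else 0.
  apply/funext => v; rewrite /shift /letter eqseq_cons andbC.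
  case: (x == y); by rewrite ?andbT ?andbF.
by case: (x == y); rewrite ?mul1r ?mul0r.
Qed.

(** Splitting off the first letter. Letters have filtration 1, so this identity turns statements
    about morphisms into inductions on the filtration. *)
Lemma series_decomp f :
  f = f [::] *: (1 : series k X) + \sum_(x : X) letter k x * shift x f.
Proof.
apply/funext => -[|x w]; rewrite addsE sumsE scalesE onesE.
  rewrite mulr1 big1 ?addr0 // => x _; by rewrite mulsE_nil mul0r.
rewrite mulr0 add0r (bigD1 x) //= big1 ?addr0.
  by rewrite -[RHS]/(shift x _ w) shift_letterM eqxx.
by move=> y nyx; rewrite -[LHS]/(shift x _ w) shift_letterM eq_sym (negPf nyx).
Qed.

Lemma sfil_shift n f x : sfil n.+1 f -> sfil n (shift x f).
Proof. by move=> Hf w ltw; apply: Hf. Qed.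

Lemma sfil0 f : sfil 0 f. Proof. by []. Qed.
Lemma sfil_zero n : sfil n 0. Proof. by []. Qed.
Lemma sfilD n f g : sfil n f -> sfil n g -> sfil n (f + g).
Proof. by move=> Hf Hg w ltw; rewrite addsE Hf // Hg // addr0. Qed.
Lemma sfilZ n c f : sfil n f -> sfil n (c *: f).
Proof. by move=> Hf w ltw; rewrite scalesE Hf // mulr0. Qed.
Lemma sfilM m n f g : sfil m f -> sfil n g -> sfil (m + n) (f * g).
Proof.
move=> Hf Hg w ltw; rewrite mulsE big1 // => i _.
case: (ltnP i m) => [lti|lei].
  by rewrite Hf ?mul0r // size_take_min (leq_ltn_trans (geq_minl _ _)).
rewrite Hg ?mulr0 // size_drop.
have lei' : (i <= size w)%N by rewrite -ltnS.
by rewrite ltn_subLR // (leq_trans ltw) // leq_add2r.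
Qed.
Lemma sfilS n f : sfil n.+1 f -> sfil n f.
Proof. by move=> Hf w ltw; apply: Hf; apply: ltnW. Qed.
Lemma sfil_sep f : (forall n, sfil n f) -> f = 0.
Proof. by move=> Hf; apply/funext => w; apply: (Hf (size w).+1). Qed.
Lemma sfil_letter x : sfil 1 (letter k x).
Proof. by move=> [|y w]. Qed.
Lemma sfil1 f : f [::] = 0 -> sfil 1 f.
Proof. by move=> f0 [|y w]. Qed.

End SeriesFiltration.

(** Completeness is encoded by an evaluation operator in place of limits, so that quotients of
    series by closed ideals are instances as well. Its laws are required at arguments of filtration
    1. *)
HB.mixin Record isComplete (k : comPzRingType) S of GRing.PzRing S := {
  cst : k -> S;
  cstD_subdef : forall c d, cst (c + d) = cst c + cst d;
  cstM_subdef : forall c d, cst (c * d) = cst c * cst d;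
  cst1_subdef : cst 1 = 1;
  cstC_subdef : forall c x, cst c * x = x * cst c;
  fil : nat -> S -> Prop;
  fil0_subdef : forall x, fil 0 x;
  fil_zero_subdef : forall n, fil n 0;
  filD_subdef : forall n x y, fil n x -> fil n y -> fil n (x + y);
  filM_subdef : forall m n x y, fil m x -> fil n y -> fil (m + n)%N (x * y);
  filS_subdef : forall n x, fil n.+1 x -> fil n x;
  fil_sep_subdef : forall x, (forall n, fil n x) -> x = 0;
  ev_subdef : forall X : finType, (X -> S) -> series k X -> S;
  evD_subdef : forall (X : finType) (a : X -> S) (f g : series k X),
    (forall x, fil 1 (a x)) ->
    ev_subdef X a (f + g) = ev_subdef X a f + ev_subdef X a g;
  evM_subdef : forall (X : finType) (a : X -> S) (f g : series k X),
    (forall x, fil 1 (a x)) ->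
    ev_subdef X a (f * g) = ev_subdef X a f * ev_subdef X a g;
  ev_cst_subdef : forall (X : finType) (a : X -> S) c, (forall x, fil 1 (a x)) ->
    ev_subdef X a (c *: (1 : series k X)) = cst c;
  ev_fil_subdef : forall (X : finType) (a : X -> S) n (f : series k X),
    (forall x, fil 1 (a x)) -> sfil n f -> fil n (ev_subdef X a f);
  ev_letter_subdef : forall (X : finType) (a : X -> S) x,
    (forall x, fil 1 (a x)) -> ev_subdef X a (letter k x) = a x }.

(* separated filtered k-algebras in which power series can be evaluated at
   elements of positive filtration *)
#[short(type="complAlgType")]
HB.structure Definition ComplAlg (k : comPzRingType) :=
  {S of isComplete k S & GRing.PzRing S}.

Section Subst.
Variables (k : comPzRingType) (X Y : finType) (a : X -> series k Y).
Hypothesis a1 : forall x, sfil 1 (a x).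
Implicit Types f g : series k X.

Lemma prod_seq_fil (v : seq X) : sfil (size v) (\prod_(x <- v) a x).
Proof.
elim: v => [|x v IH]; first exact: sfil0.
by rewrite big_cons; apply: (sfilM (a1 x) IH).
Qed.

(** A product over [v] has filtration [size v], so longer words do not contribute at [w] and the
    bound may be any [N] above [size w]. *)
Lemma subst_wide f w N : (size w < N)%N -> subst f a w =
  (\sum_(n < N) \sum_(v : n.-tuple X) f v *: (\prod_(x <- v) a x)) w.
Proof.
move=> ltN; rewrite /subst sumsE.
rewrite (big_ord_widen N (fun n => \sum_(v : n.-tuple X) f v * (\prod_(x <- v) a x) w)) //.
rewrite big_mkcond /=; apply: eq_bigr => n _; rewrite sumsE.
case: ifP => // /negbT.
rewrite -ltnNge => ltn; rewrite big1 // => v _.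
by rewrite scalesE prod_seq_fil ?mulr0 // size_tuple.
Qed.

Lemma subst_decomp f :
  subst f a = f [::] *: (1 : series k Y) + \sum_(x : X) a x * subst (shift x f) a.
Proof.
apply/funext => w.
rewrite (@subst_wide _ _ (size w).+2) // big_ord_recl addsE [RHS]addsE.
congr (_ + _).
  rewrite (bigD1 [tuple]) //= [X in _ + X]big1 ?addr0 => [|v].
    by rewrite big_nil.
  by rewrite tuple0.
have -> : (\sum_(x : X) a x * subst (shift x f) a) w =
   (\sum_(x : X) a x * \sum_(n < (size w).+1) \sum_(v : n.-tuple X)
      shift x f v *: (\prod_(y <- v) a y)) w.
  rewrite !sumsE; apply: eq_bigr => x _; rewrite !mulsE; apply: eq_bigr => i _.
  by congr (_ * _); apply: subst_wide; rewrite ltnS size_drop leq_subr.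
congr (_ w); under [RHS]eq_bigr do rewrite mulr_sumr.
rewrite [RHS]exchange_big /=; apply: eq_bigr => n _.
under [RHS]eq_bigr do rewrite mulr_sumr.
rewrite pair_big /=.
rewrite (reindex (fun p : X * n.-tuple X => [tuple of p.1 :: p.2])) /=.
  by apply: eq_bigr => -[x v] _; rewrite /= big_cons scaleAr_series.
exists (fun v : n.+1.-tuple X => (thead v, [tuple of behead v])) => [[x v] _|v _] /=.
  by congr (_, _); apply/val_inj.
by rewrite -tuple_eta.
Qed.

Lemma substD f g : subst (f + g) a = subst f a + subst g a.
Proof.
apply/funext => w; rewrite /subst addsE -big_split; apply: eq_bigr => n _.
by rewrite -big_split; apply: eq_bigr => v _; rewrite addsE mulrDl.
Qed.

Lemma substZ c f : subst (c *: f) a = c *: subst f a.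
Proof.
apply/funext => w; rewrite /subst scalesE mulr_sumr; apply: eq_bigr => n _.
by rewrite mulr_sumr; apply: eq_bigr => v _; rewrite scalesE mulrA.
Qed.

Lemma subst0 : subst 0 a = 0.
Proof.
apply/funext => w; rewrite /subst big1 // => n _; rewrite big1 // => v _.
by rewrite zerosE mul0r.
Qed.

Lemma subst1 : subst 1 a = 1.
Proof.
rewrite subst_decomp onesE scale1r big1 ?addr0 // => x _.
by rewrite (_ : shift x 1 = 0) ?subst0 ?mulr0 //; apply/funext => w.
Qed.

Lemma subst_letter x : subst (letter k x) a = a x.
Proof.
rewrite subst_decomp scale0r add0r (bigD1 x) //= big1 ?addr0.
  by rewrite -[letter k x]mulr1 shift_letterM eqxx subst1 mulr1.
move=> y nyx; rewrite -[letter k x]mulr1 shift_letterM (negPf nyx).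
by rewrite subst0 mulr0.
Qed.

Lemma subst_fil n f : sfil n f -> sfil n (subst f a).
Proof.
move=> Hf w ltw; rewrite /subst big1 // => i _; rewrite big1 // => v _.
by rewrite Hf ?mul0r // size_tuple (leq_ltn_trans _ ltw) // -ltnS.
Qed.

Lemma sfil_sum n I (r : seq I) (P : pred I) (F : I -> series k Y) :
  (forall i, P i -> sfil n (F i)) -> sfil n (\sum_(i <- r | P i) F i).
Proof. by move=> HF; elim/big_ind: _ => //; apply: sfilD. Qed.

(** Both sides are compared modulo filtration [n], by induction on [n]: once the first letter of [f]
    is split off, the discrepancy is multiplied by some [a x], of filtration 1. *)
Lemma substM f g : subst (f * g) a = subst f a * subst g a.
Proof.
apply/eqP; rewrite -subr_eq0; apply/eqP/sfil_sep => n; elim: n f g => // n IH f g.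
rewrite [subst (f * g) a]subst_decomp [subst f a]subst_decomp mulrDl.
rewrite -scaleAl_series mul1r {1}[subst g a]subst_decomp.
rewrite scalerDr scalerA mulsE_nil -[X in _ - X]addrA opprD addrACA subrr add0r.
rewrite mulr_suml scaler_sumr -big_split -sumrB; apply: sfil_sum => x _.
rewrite shiftM substD substZ mulrDr -scaleAr_series opprD addrACA subrr add0r.
by rewrite -mulrA -mulrBr; apply: (sfilM (a1 x)).
Qed.

End Subst.

Section SeriesCst.
Variables (k : comPzRingType) (X : finType).
Local Notation S := (series k X).
Definition series_cst (c : k) : S := c *: (1 : S).

Fact series_cstD c d : series_cst (c + d) = series_cst c + series_cst d.
Proof. exact: scalerDl. Qed.
Fact series_cstM c d : series_cst (c * d) = series_cst c * series_cst d.
Proof. by rewrite /series_cst -scaleAl_series mul1r scalerA. Qed.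
Fact series_cst1 : series_cst 1 = 1.
Proof. exact: scale1r. Qed.
Fact series_cstC c f : series_cst c * f = f * series_cst c.
Proof. by rewrite /series_cst -scaleAl_series -scaleAr_series mul1r mulr1. Qed.
Fact subst_cst (Y : finType) (a : Y -> S) c : (forall x, sfil 1 (a x)) ->
  subst (c *: (1 : series k Y)) a = series_cst c.
Proof. by move=> Ha; rewrite substZ subst1. Qed.

HB.instance Definition _ := @isComplete.Build k S
    series_cst series_cstD series_cstM series_cst1 series_cstC
    (@sfil k X) (@sfil0 k X) (@sfil_zero k X) (@sfilD k X) (@sfilM k X)
    (@sfilS k X) (@sfil_sep k X)
    (fun Y a f => subst f a)
    (fun Y a f g _ => substD a f g)
    (fun Y a f g Ha => substM Ha f g)
    subst_cst
    (fun Y a n f _ => @subst_fil k Y X a n f)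
    (fun Y a x Ha => subst_letter Ha x).
End SeriesCst.

(** * Continuous morphisms and evaluation of series *)

HB.mixin Record isContinuous (k : comPzRingType) (S S' : complAlgType k)
    (f : S -> S') := {
  chom_cst_subdef : forall c : k, f (cst c) = cst c;
  chom_fil_subdef : forall n (x : S), fil n x -> fil n (f x) }.

#[short(type="chomType")]
HB.structure Definition CHom (k : comPzRingType) (S S' : complAlgType k) :=
  {f of @GRing.RMorphism S S' f & @isContinuous k S S' f}.

Section ChomTheory.
Variables (k : comPzRingType) (S S' : complAlgType k) (th : chomType S S').
Lemma chom_cst c : th (cst c) = cst c. Proof. exact: chom_cst_subdef. Qed.
Lemma chom_fil n x : fil n x -> fil n (th x). Proof. exact: chom_fil_subdef. Qed.
Lemma chomD x y : th (x + y) = th x + th y. Proof. exact: rmorphD. Qed.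
Lemma chomB x y : th (x - y) = th x - th y. Proof. exact: rmorphB. Qed.
Lemma chomM x y : th (x * y) = th x * th y. Proof. exact: rmorphM. Qed.
Lemma chom0 : th 0 = 0. Proof. exact: rmorph0. Qed.
Lemma chom1 : th 1 = 1. Proof. exact: rmorph1. Qed.
Lemma chom_sum I (r : seq I) (P : pred I) (F : I -> S) :
  th (\sum_(i <- r | P i) F i) = \sum_(i <- r | P i) th (F i).
Proof. exact: rmorph_sum. Qed.
End ChomTheory.

Section ChomInstances.
Variables (k : comPzRingType) (S1 S2 S3 : complAlgType k).

HB.instance Definition _ := isContinuous.Build k S1 S1 idfun
  (fun c => erefl) (fun n x Hx => Hx).

Fact comp_cst (g : chomType S2 S3) (f : chomType S1 S2) (c : k) :
  (g \o f) (cst c) = cst c.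
Proof. by rewrite /= !chom_cst. Qed.
Fact comp_fil (g : chomType S2 S3) (f : chomType S1 S2) n x :
  fil n x -> fil n ((g \o f) x).
Proof. by move=> Hx /=; do 2 apply: chom_fil. Qed.
HB.instance Definition _ (g : chomType S2 S3) (f : chomType S1 S2) :=
  isContinuous.Build k S1 S3 (g \o f) (comp_cst g f) (fun n x => @comp_fil g f n x).

End ChomInstances.

Section ComplAlgTheory.
Variables (k : comPzRingType) (S : complAlgType k).
Implicit Types (x y z : S) (c d : k).

Lemma cstC c x : cst c * x = x * cst c. Proof. exact: cstC_subdef. Qed.
Lemma fil0 x : fil 0 x. Proof. exact: fil0_subdef. Qed.
Lemma fil_zero n : fil n (0 : S). Proof. exact: fil_zero_subdef. Qed.
Lemma filD n x y : fil n x -> fil n y -> fil n (x + y).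
Proof. exact: filD_subdef. Qed.
Lemma filM m n x y : fil m x -> fil n y -> fil (m + n) (x * y).
Proof. exact: filM_subdef. Qed.
Lemma filS n x : fil n.+1 x -> fil n x. Proof. exact: filS_subdef. Qed.
Lemma fil_sep x : (forall n, fil n x) -> x = 0. Proof. exact: fil_sep_subdef. Qed.
Lemma cstD c d : cst (c + d) = cst c + cst d :> S. Proof. exact: cstD_subdef. Qed.
Lemma cstM c d : cst (c * d) = cst c * cst d :> S. Proof. exact: cstM_subdef. Qed.
Lemma cst1 : cst 1 = 1 :> S. Proof. exact: cst1_subdef. Qed.
Lemma cst0 : cst 0 = 0 :> S.
Proof. by apply: (addrI (cst 0)); rewrite -cstD !addr0. Qed.
Lemma cstN c : cst (- c) = - cst c :> S.
Proof. by apply: (addrI (cst c)); rewrite -cstD !subrr cst0. Qed.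
Lemma cst_nat n : cst n%:R = n%:R :> S.
Proof. by elim: n => [|n IH]; rewrite ?cst0 // !mulrS cstD cst1 IH. Qed.

Lemma filMl n x y : fil n y -> fil n (x * y).
Proof. by move=> Hy; rewrite -[n]add0n; apply: filM Hy; exact: fil0. Qed.
Lemma filMr n x y : fil n x -> fil n (x * y).
Proof. by move=> Hx; rewrite -[n]addn0; apply: filM Hx (fil0 y). Qed.
Lemma filN n x : fil n x -> fil n (- x).
Proof. by move=> Hx; rewrite -mulN1r; apply: filMl. Qed.
Lemma filB n x y : fil n x -> fil n y -> fil n (x - y).
Proof. by move=> Hx Hy; apply: filD Hx (filN Hy). Qed.
Lemma filBC n x y : fil n (x - y) -> fil n (y - x).
Proof. by move=> H; rewrite -opprB; apply: filN. Qed.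
Lemma fil_trans n x y z : fil n (x - y) -> fil n (y - z) -> fil n (x - z).
Proof. by move=> H1 H2; rewrite -(subrKA y); apply: filD. Qed.
Lemma fil_le m n x : (m <= n)%N -> fil n x -> fil m x.
Proof.
move=> /subnK <-; elim: (n - m)%N => // j IH; rewrite addSn => /filS; exact: IH.
Qed.
Lemma fil_sum n I (r : seq I) (P : pred I) (F : I -> S) :
  (forall i, P i -> fil n (F i)) -> fil n (\sum_(i <- r | P i) F i).
Proof. by move=> HF; elim/big_ind: _ => //; [apply: fil_zero | apply: filD]. Qed.
Lemma filX n x : fil 1 x -> fil n (x ^+ n).
Proof.
by move=> Hx; elim: n => [|n IH]; [exact: fil0 | rewrite exprS; apply: (filM Hx IH)].
Qed.
Lemma filMB n x x' y y' : fil n (x - x') -> fil n (y - y') ->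
  fil n (x * y - x' * y').
Proof.
move=> Hx Hy; apply: (@fil_trans _ _ (x' * y)).
  by rewrite -mulrBl; apply: filMr.
by rewrite -mulrBr; apply: filMl.
Qed.
Lemma eq_fil x y : (forall n, fil n (x - y)) -> x = y.
Proof. by move=> H; apply/eqP; rewrite -subr_eq0; apply/eqP/fil_sep. Qed.
Lemma lie_br_fil m n x y : fil m x -> fil n y -> fil (m + n) (x * y - y * x).
Proof. by move=> Hx Hy; apply: filB; [|rewrite addnC]; apply: filM. Qed.

End ComplAlgTheory.

Lemma scale_cst (k : comPzRingType) (X : finType) c (f : series k X) :
  c *: f = cst c * f.
Proof. by rewrite -[cst c]/(c *: (1 : series k X)) -scaleAl_series mul1r. Qed.

Lemma fil_letter (k : comPzRingType) (X : finType) (x : X) : fil 1 (letter k x).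
Proof. exact: sfil_letter. Qed.

Section Chom.
Variables (k : comPzRingType) (X : finType) (S : complAlgType k).
Implicit Types (f : series k X) (th : chomType (series k X) S).

Lemma chom_decomp th f : th f =
  cst (f [::]) + \sum_(x : X) th (letter k x) * th (shift x f).
Proof.
rewrite {1}[f]series_decomp chomD chom_sum scale_cst mulr1 chom_cst.
by congr (_ + _); apply: eq_bigr => x _; rewrite chomM.
Qed.

Lemma chom_approx th1 th2 n :
  (forall x, fil n (th1 (letter k x) - th2 (letter k x))) ->
  forall f, fil n (th1 f - th2 f).
Proof.
move=> Hl f.
suff H j : (j <= n)%N -> fil j (th1 f - th2 f) by exact: H.
elim: j f => [|j IH] f lejn; first exact: fil0.
rewrite (chom_decomp th1) (chom_decomp th2) opprD addrACA subrr add0r -sumrB.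
apply: fil_sum => x _.
have -> : th1 (letter k x) * th1 (shift x f) - th2 (letter k x) * th2 (shift x f)
   = (th1 (letter k x) - th2 (letter k x)) * th1 (shift x f)
     + th2 (letter k x) * (th1 (shift x f) - th2 (shift x f)).
  by rewrite mulrBl mulrBr addrA subrK.
apply: filD; first by apply: filMr; apply: fil_le (Hl x).
by apply: (@filM _ _ 1%N); [apply: chom_fil; exact: fil_letter | apply: IH; exact: ltnW].
Qed.

(** In a word of length at least 2, replacing one letter changes the product by an element of
    filtration [n], and another letter contributes one more degree. This gain makes the fixpoint
    equations contracting. *)
Lemma chom_approx2 th1 th2 n :
  (forall x, fil n (th1 (letter k x) - th2 (letter k x))) ->
  forall f, fil 2 f -> fil n.+1 (th1 f - th2 f).
Proof.
move=> Hl f Hf; rewrite (chom_decomp th1) (chom_decomp th2).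
rewrite opprD addrACA subrr add0r -sumrB.
apply: fil_sum => x _.
have -> : th1 (letter k x) * th1 (shift x f) - th2 (letter k x) * th2 (shift x f)
   = (th1 (letter k x) - th2 (letter k x)) * th1 (shift x f)
     + th2 (letter k x) * (th1 (shift x f) - th2 (shift x f)).
  by rewrite mulrBl mulrBr addrA subrK.
apply: filD.
  by rewrite -addn1; apply: filM => //; apply: chom_fil; exact: sfil_shift.
by apply: (@filM _ _ 1%N); [apply: chom_fil; exact: fil_letter | apply: chom_approx].
Qed.

Lemma chom_ext th1 th2 : (forall x, th1 (letter k x) = th2 (letter k x)) ->
  forall f, th1 f = th2 f.
Proof.
move=> Hl f; apply: eq_fil => n; apply: chom_approx => x.
rewrite Hl subrr; exact: fil_zero.
Qed.

(* The hypothesis says that the a x generate the power series algebra. *)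
Lemma chom_gen th1 th2 (a : X -> series k X) (N : X -> X -> k) :
  (forall x, fil 2 (letter k x - \sum_y N x y *: a y)) ->
  (forall x, th1 (a x) = th2 (a x)) -> forall f, th1 f = th2 f.
Proof.
move=> Ha Heq; apply: chom_ext => x; apply: eq_fil => n.
elim: n x => [|n IH] x; first exact: fil0.
(* The remainder has filtration 2, so agreement on letters modulo [n] becomes agreement on it modulo
   [n.+1]; the combination of the [a y] drops out. *)
have := chom_approx2 IH (Ha x).
have E (th : chomType (series k X) S) : th (letter k x - \sum_y N x y *: a y) =
   th (letter k x) - \sum_y cst (N x y) * th (a y).
  rewrite chomB chom_sum; congr (_ - _); apply: eq_bigr => y _.
  by rewrite scale_cst chomM chom_cst.
rewrite !E; under [X in _ - (_ - X)]eq_bigr do rewrite -Heq.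
by rewrite opprB addrA subrK.
Qed.

End Chom.

Section Eval.
Variables (k : comPzRingType) (S : complAlgType k).

(** A family that is not of positive filtration is replaced by [0], so that [ev a] is a continuous
    morphism for every [a] and can carry canonical instances. *)
Definition evarg (X : finType) (a : X -> S) : X -> S :=
  if pselect (forall x, fil 1 (a x)) then a else fun _ => 0.

Fact evarg_fil (X : finType) (a : X -> S) x : fil 1 (evarg a x).
Proof. by rewrite /evarg; case: pselect => [//|Ha]; exact: fil_zero. Qed.

Definition ev (X : finType) (a : X -> S) (f : series k X) : S :=
  @ev_subdef k S X (evarg a) f.

Section Instance.
Variables (X : finType) (a : X -> S).
Local Notation eva := (ev a).
Fact ev_is_zmod_morphism : zmod_morphism eva.
Proof.
move=> f g; apply: (addIr (eva g)); rewrite subrK.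
by rewrite -evD_subdef ?subrK //; exact: evarg_fil.
Qed.
Fact ev_is_monoid_morphism : monoid_morphism eva.
Proof.
split; last by move=> f g; apply: evM_subdef; exact: evarg_fil.
rewrite -[X in eva X](scale1r (1 : series k X)) /ev ev_cst_subdef ?cst1 //.
exact: evarg_fil.
Qed.
HB.instance Definition _ :=
  GRing.isZmodMorphism.Build _ _ eva ev_is_zmod_morphism.
HB.instance Definition _ :=
  GRing.isMonoidMorphism.Build _ _ eva ev_is_monoid_morphism.
Fact ev_cst c : eva (cst c) = cst c.
Proof. apply: ev_cst_subdef; exact: evarg_fil. Qed.
Fact ev_fil n f : fil n f -> fil n (eva f).
Proof. apply: ev_fil_subdef; exact: evarg_fil. Qed.
HB.instance Definition _ := isContinuous.Build k (series k X) S eva ev_cst ev_fil.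
End Instance.

Lemma ev_letter (X : finType) (a : X -> S) x :
  (forall x, fil 1 (a x)) -> ev a (letter k x) = a x.
Proof.
move=> Ha; rewrite /ev ev_letter_subdef /evarg; first by case: pselect.
exact: evarg_fil.
Qed.

End Eval.

Section EvalTheory.
Variables (k : comPzRingType) (S : complAlgType k) (X : finType) (a : X -> S).
Implicit Types f g : series k X.
Lemma evD f g : ev a (f + g) = ev a f + ev a g. Proof. exact: chomD. Qed.
Lemma evB f g : ev a (f - g) = ev a f - ev a g. Proof. exact: chomB. Qed.
Lemma evM f g : ev a (f * g) = ev a f * ev a g. Proof. exact: chomM. Qed.
Lemma ev_zero : ev a 0 = 0. Proof. exact: chom0. Qed.
Lemma ev_one : ev a 1 = 1. Proof. exact: chom1. Qed.
Lemma ev_sum I (r : seq I) (P : pred I) (F : I -> series k X) :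
  ev a (\sum_(i <- r | P i) F i) = \sum_(i <- r | P i) ev a (F i).
Proof. exact: chom_sum. Qed.
Lemma evZ c f : ev a (c *: f) = cst c * ev a f.
Proof. by rewrite scale_cst evM ev_cst. Qed.
End EvalTheory.

Lemma ev_subst (k : comPzRingType) (X Y : finType) (a : X -> series k Y) f :
  (forall x, fil 1 (a x)) -> ev a f = subst f a.
Proof. by move=> Ha; rewrite /ev /evarg; case: pselect. Qed.

Lemma chom_ev (k : comPzRingType) (S S' : complAlgType k) (X : finType)
    (th : chomType S S') (a : X -> S) f :
  (forall x, fil 1 (a x)) -> th (ev a f) = ev (th \o a) f.
Proof.
move=> Ha.
apply: (chom_ext (th1 := th \o ev a) (th2 := ev (th \o a))) => x.
by rewrite /= !ev_letter // => y /=; exact: chom_fil.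
Qed.

Lemma chomE (k : comPzRingType) (S : complAlgType k) (X : finType)
  (th : chomType (series k X) S) f : th f = ev (fun x => th (letter k x)) f.
Proof.
apply: (chom_ext (th1 := th) (th2 := ev (fun x => th (letter k x)))) => x.
by rewrite /= ev_letter // => y; apply: chom_fil; exact: fil_letter.
Qed.

Lemma eq_ev (k : comPzRingType) (S : complAlgType k) (X : finType)
  (a b : X -> S) : a =1 b -> ev a =1 ev b.
Proof. by move=> /funext ->. Qed.

Lemma ev_id (k : comPzRingType) (X : finType) (f : series k X) :
  ev (fun x => letter k x) f = f.
Proof. by rewrite -[RHS]/((idfun : chomType (series k X) _) f) chomE. Qed.

(** * Power series in one variable and inverses *)

Notation ev1 x := (ev (fun _ : unit => x)).
Notation tser c := ((fun w : seq unit => c (size w)) : series _ unit).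
Notation tvar k := (letter k tt).

Section OneLetter.
Variables (k : comPzRingType) (S : complAlgType k).
Implicit Types (x y : S) (f g : series k unit).

Lemma ev1_letter x : fil 1 x -> ev1 x (tvar k) = x.
Proof. by move=> Hx; rewrite ev_letter. Qed.

Lemma ev1_decomp x f : fil 1 x ->
  ev1 x f = cst (f [::]) + x * ev1 x (shift tt f).
Proof.
move=> Hx; rewrite chom_decomp (bigD1 tt) //= big1 ?addr0 => [|[]//].
by rewrite ev1_letter.
Qed.

Lemma ev1_approx x f N : fil 1 x ->
  fil N (ev1 x f - \sum_(n < N) cst (f (nseq n tt)) * x ^+ n).
Proof.
move=> Hx; elim: N f => [|N IH] f; first exact: fil0.
rewrite big_ord_recl ev1_decomp //= expr0 mulr1 opprD addrACA subrr add0r.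
have -> : \sum_(i < N) cst (f (tt :: nseq i tt)) * x ^+ i.+1 =
   x * \sum_(i < N) cst (shift tt f (nseq i tt)) * x ^+ i.
  by rewrite mulr_sumr; apply: eq_bigr => i _; rewrite exprS !mulrA cstC.
by rewrite -mulrBr -add1n; apply: filM.
Qed.

(** A word in one letter is determined by its length, so reversing the summation index exchanges the
    two factors. *)
Lemma series_unit_comm f g : f * g = g * f.
Proof.
apply/funext => w; rewrite !mulsE (reindex_inj rev_ord_inj) /=.
have unitw (v v' : seq unit) : size v = size v' -> v = v'.
  by elim: v v' => [|[] v IH] [|[] v'] //= [] /IH ->.
apply: eq_bigr => i _; rewrite subSS mulrC; congr (g _ * f _); apply: unitw.
  by rewrite size_drop size_takel ?leq_subr ?subKn // -ltnS.
by rewrite size_drop size_takel ?leq_subr.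
Qed.

Lemma ev1_comm x y f : fil 1 x -> x * y = y * x -> ev1 x f * y = y * ev1 x f.
Proof.
move=> Hx xy; apply: eq_fil => N; elim: N f => [|N IH] f; first exact: fil0.
rewrite (ev1_decomp _ Hx) mulrDl mulrDr cstC opprD addrACA subrr add0r.
by rewrite [y * (x * _)]mulrA -xy -!mulrA -mulrBr -add1n; apply: filM.
Qed.

Definition geo : series k unit := tser (fun _ => 1).
Definition cinv x := ev1 (1 - x) geo.

End OneLetter.

Section Inverse.
Variables (k : comPzRingType) (S : complAlgType k).
Implicit Types (x y z : S) (f g : series k unit).
Definition grp x := fil 1 (x - 1).

Lemma grp_fil x : grp x -> fil 1 (1 - x).
Proof. exact: filBC. Qed.

Lemma geo_eq : geo k = 1 + tvar k * geo k.
Proof.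
rewrite {1}[geo k]series_decomp scale1r (bigD1 tt) //= big1 ?addr0 => [|[]//].
by congr (_ + _ * _).
Qed.

Lemma gmulrV x : grp x -> x * cinv x = 1.
Proof.
move=> Hx; have H1 := grp_fil Hx.
have : ev1 (1 - x) ((1 - tvar k) * geo k) = 1.
  by rewrite mulrBl mul1r {1}geo_eq addrK ev_one.
by rewrite evM evB ev_one ev1_letter // subKr.
Qed.

Lemma gmulVr x : grp x -> cinv x * x = 1.
Proof.
move=> Hx; have H1 := grp_fil Hx.
have : ev1 (1 - x) (geo k * (1 - tvar k)) = 1.
  by rewrite series_unit_comm mulrBl mul1r {1}geo_eq addrK ev_one.
by rewrite evM evB ev_one ev1_letter // subKr.
Qed.

Lemma gmulVKr x y : grp x -> cinv x * (x * y) = y.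
Proof. by move=> Hx; rewrite mulrA gmulVr // mul1r. Qed.
Lemma gmulKVr x y : grp x -> x * (cinv x * y) = y.
Proof. by move=> Hx; rewrite mulrA gmulrV // mul1r. Qed.
Lemma gmulrVK x y : grp x -> y * cinv x * x = y.
Proof. by move=> Hx; rewrite -mulrA gmulVr // mulr1. Qed.
Lemma gmulrKV x y : grp x -> y * x * cinv x = y.
Proof. by move=> Hx; rewrite -mulrA gmulrV // mulr1. Qed.

Lemma mulrI_grp x y z : grp x -> x * y = x * z -> y = z.
Proof. by move=> Hx /(congr1 ( *%R (cinv x))); rewrite !gmulVKr. Qed.
Lemma mulIr_grp x y z : grp x -> y * x = z * x -> y = z.
Proof. by move=> Hx /(congr1 ( *%R^~ (cinv x))); rewrite !gmulrKV. Qed.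

Lemma grp1 : grp (1 : S).
Proof. by rewrite /grp subrr; apply: fil_zero. Qed.
Lemma grpM x y : grp x -> grp y -> grp (x * y).
Proof.
rewrite /grp => Hx Hy; rewrite -[1]mulr1; exact: filMB.
Qed.
Lemma grpV x : grp x -> grp (cinv x).
Proof.
move=> Hx; rewrite /grp -[in cinv x - 1](gmulVr Hx) -[X in X - _]mulr1 -mulrBr.
by apply: filMl; apply: grp_fil.
Qed.
Lemma grp_ev1 x f : f [::] = 1 -> grp (ev1 x f).
Proof.
move=> f1; rewrite /grp -(ev_one (fun _ : unit => x)) -evB; apply: ev_fil.
by apply: sfil1; rewrite subsE f1 onesE subrr.
Qed.

Lemma cinv_uniq x y : grp x -> x * y = 1 -> y = cinv x.
Proof. by move=> Hx xy; apply: (mulrI_grp Hx); rewrite xy gmulrV. Qed.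
Lemma cinv1 : cinv 1 = 1 :> S.
Proof. by apply/esym/cinv_uniq; [exact: grp1 | rewrite mul1r]. Qed.
Lemma cinvK x : grp x -> cinv (cinv x) = x.
Proof. by move=> Hx; apply/esym/cinv_uniq; [apply: grpV | rewrite gmulVr]. Qed.
Lemma cinvM x y : grp x -> grp y -> cinv (x * y) = cinv y * cinv x.
Proof.
move=> Hx Hy; apply/esym/cinv_uniq; first exact: grpM.
by rewrite mulrA gmulrKV // gmulrV.
Qed.
Lemma cinv_comm x y : grp x -> x * y = y * x -> cinv x * y = y * cinv x.
Proof.
by move=> Hx xy; apply: (mulrI_grp Hx); rewrite gmulKVr // mulrA xy gmulrKV.
Qed.

End Inverse.

Lemma chom_grp (k : comPzRingType) (S S' : complAlgType k) (th : chomType S S') x :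
  grp x -> grp (th x).
Proof. by rewrite /grp => Hx; rewrite -(chom1 th) -chomB; apply: chom_fil. Qed.

Lemma chom_cinv (k : comPzRingType) (S S' : complAlgType k) (th : chomType S S') x :
  grp x -> th (cinv x) = cinv (th x).
Proof.
move=> Hx; apply: cinv_uniq; first exact: chom_grp.
by rewrite -chomM gmulrV ?chom1.
Qed.

Section Pser.
Variables (k : comPzRingType) (X : finType).
Implicit Types f g : series k X.

(** Link between series given by their coefficients, such as [sexp], [slog] and [sinv], and
    evaluations in a complete algebra: powers of [f] beyond the length of [w] vanish at [w]. *)
Lemma pserE (c : nat -> k) f w : fil 1 f ->
  ev1 f (tser c) w = \sum_(n < (size w).+1) c n * (f ^+ n) w.
Proof.
move=> Hf; have := ev1_approx (tser c) (size w).+1 Hf.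
move=> /(_ w (ltnSn _)) /eqP; rewrite subsE subr_eq0 => /eqP ->.
rewrite sumsE; apply: eq_bigr => n _; rewrite size_nseq.
by rewrite -scale_cst.
Qed.

Lemma sinvE f : grp f -> sinv f = cinv f.
Proof.
move=> Hf; apply/funext => w; rewrite /cinv pserE; last exact: grp_fil.
by rewrite /sinv; apply: eq_bigr => i _; rewrite mul1r.
Qed.
End Pser.

Section ExpLog.
Variables (k : comPzRingType) (iota : {rmorphism rat -> k}).

Definition eser : series k unit := tser (fun n => iota (n`!%:R^-1)).
Definition lcoef n : k := if n is m.+1 then iota ((-1) ^+ m / n%:R) else 0.
Definition lser : series k unit := tser lcoef.
Definition cexp (S : complAlgType k) (x : S) := ev1 x eser.

Lemma sexpE (X : finType) (f : series k X) : fil 1 f -> sexp iota f = cexp f.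
Proof. by move=> Hf; apply/funext => w; rewrite /cexp pserE. Qed.

Lemma slogE (X : finType) (g : series k X) : grp g -> slog iota g = ev1 (g - 1) lser.
Proof.
move=> Hg; apply/funext => w; rewrite pserE // big_ord_recl mul0r add0r.
rewrite /slog big_add1 big_mkord; apply: eq_bigr => i _; congr (_ * _).
Qed.

Lemma chom_cexp (S S' : complAlgType k) (th : chomType S S') x :
  fil 1 x -> th (cexp x) = cexp (th x).
Proof. by move=> Hx; rewrite /cexp chom_ev. Qed.

Lemma grp_cexp (S : complAlgType k) (x : S) : grp (cexp x).
Proof. by apply: grp_ev1; rewrite /eser /= invr1 rmorph1. Qed.

Lemma iota_nat n : iota n%:R = n%:R. Proof. exact: rmorph_nat. Qed.

Lemma iota_inv n : (0 < n)%N -> iota n%:R^-1 * n%:R = 1.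
Proof.
move=> n0; rewrite -iota_nat -rmorphM mulVf ?rmorph1 //.
by rewrite Num.Theory.pnatr_eq0 -lt0n.
Qed.

End ExpLog.

(** * The Euler derivation *)

Section Euler.
Variables (k : comPzRingType) (X : finType).
Implicit Types f g h : series k X.

(** The derivation attached to the grading. With the constant term it determines a series over a
    Q-algebra, and it stands in for differentiation with respect to a parameter. *)
Definition euler f : series k X := fun w => (size w)%:R * f w.

Lemma eulerD f g : euler (f + g) = euler f + euler g.
Proof. by apply/funext => w; rewrite /euler addsE mulrDr. Qed.
Lemma eulerN f : euler (- f) = - euler f.
Proof. by apply/funext => w; rewrite /euler oppsE mulrN. Qed.
Lemma eulerB f g : euler (f - g) = euler f - euler g.
Proof. by rewrite eulerD eulerN. Qed.
Lemma eulerZ c f : euler (c *: f) = c *: euler f.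
Proof. by apply/funext => w; rewrite /euler scalesE mulrCA. Qed.
Lemma euler_sum I (r : seq I) (P : pred I) (F : I -> series k X) :
  euler (\sum_(i <- r | P i) F i) = \sum_(i <- r | P i) euler (F i).
Proof.
elim/big_rec2: _ => [|i x y _ <-]; last by rewrite eulerD.
by apply/funext => w; rewrite /euler zerosE mulr0.
Qed.
Lemma euler_cst c : euler (cst c) = 0.
Proof.
apply/funext => -[|x w]; rewrite /euler ?mul0r //.
by rewrite -[cst c]/(c *: (1 : series k X)) scalesE onesE !mulr0.
Qed.
Lemma euler1 : euler 1 = 0.
Proof. by rewrite -cst1 euler_cst. Qed.
Lemma eulerM f g : euler (f * g) = euler f * g + f * euler g.
Proof.
apply/funext => w; rewrite addsE /euler !mulsE mulr_sumr -big_split.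
apply: eq_bigr => i _ /=; have lei : (i <= size w)%N by rewrite -ltnS.
rewrite size_drop size_takel //.
rewrite mulrCA [f _ * (_ * _)]mulrCA -[_%:R * f _ * _]mulrA.
rewrite [(i%:R * _)]mulrCA [_%:R * (_ * _)]mulrCA -!mulrDr mulrCA -mulrDl.
by rewrite -natrD subnKC // mulrCA.
Qed.
Lemma euler_fil n f : fil n f -> fil n (euler f).
Proof. by move=> Hf w ltw; rewrite /euler Hf ?mulr0. Qed.
Lemma euler_letter x : euler (letter k x) = letter k x.
Proof.
apply/funext => -[|y [|z w]]; rewrite /euler ?mul0r ?mul1r // /letter.
by rewrite eqseq_cons /= andbF mulr0.
Qed.

Lemma euler_inj (iota : {rmorphism rat -> k}) f g :
  euler f = euler g -> f [::] = g [::] -> f = g.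
Proof.
move=> Efg fg0; apply/funext => -[//|x w].
have /(congr1 (fun z => iota (size (x :: w))%:R^-1 * z)) :
  euler f (x :: w) = euler g (x :: w) by rewrite Efg.
by rewrite /euler !mulrA iota_inv // !mul1r.
Qed.

Definition tderiv (f : series k unit) : series k unit :=
  fun w => (size w).+1%:R * f (tt :: w).

(** Chain rule, valid because [f] commutes with its derivative; proved modulo filtration [N] by
    splitting [p] into its constant term and a multiple of the variable. *)
Lemma euler_ev1 f (p : series k unit) : fil 1 f -> f * euler f = euler f * f ->
  euler (ev1 f p) = euler f * ev1 f (tderiv p).
Proof.
move=> Hf cf; apply: eq_fil => N; elim: N p => [|N IH] p; first exact: fil0.
(* Leibniz rule for [p] written as its constant term plus the variable times [shift tt p]. *)
have Ed : tderiv p = shift tt p + tvar k * tderiv (shift tt p).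
  rewrite {1}[tderiv p]series_decomp (bigD1 tt) //= big1 ?addr0 => [|[]//].
  rewrite {1}[shift tt p]series_decomp [X in _ = _ + X + _](bigD1 tt) //=.
  rewrite [X in _ = _ + (_ + X) + _]big1 ?addr0 => [|[]//].
  rewrite -addrA -mulrDr; congr (_ + _); first by rewrite /tderiv mul1r.
  congr (_ * _).
  apply/funext => w; rewrite addsE /shift /tderiv /= [in LHS]mulrS mulrDl mul1r.
  by [].
rewrite Ed evD evM ev1_letter // [ev1 f p]ev1_decomp // eulerD euler_cst add0r.
rewrite eulerM mulrDr opprD addrACA subrr add0r.
rewrite mulrA -cf -mulrA -mulrBr -add1n; exact: filM.
Qed.

End Euler.

Lemma big_triangle (V : zmodType) (G : nat -> nat -> V) N :
  \sum_(n < N) \sum_(i < n.+1) G (n - i)%N i = \sum_(i < N) \sum_(j < (N - i)%N) G j i.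
Proof.
elim: N G => [|N IH] G; first by rewrite !big_ord0.
under eq_bigr do rewrite big_ord_recl subn0.
rewrite big_split /= [RHS]big_ord_recl subn0; congr (_ + _).
rewrite big_ord_recl big_ord0 add0r.
have -> : \sum_(i < N) \sum_(j < (N.+1 - bump 0 i)%N) G j (bump 0 i) =
  \sum_(i < N) \sum_(j < (N - i)%N) G j i.+1 by [].
by rewrite -(IH (fun j i => G j i.+1)).
Qed.

(** For Cauchy products of truncated series: the terms of the square that lie outside the triangle
    have [i + j] at least [N]. *)
Lemma fil_triangle (k : comPzRingType) (S : complAlgType k) (G : nat -> nat -> S) N :
  (forall i j, fil (i + j) (G i j)) ->
  fil N (\sum_(n < N) \sum_(i < n.+1) G (n - i)%N i - \sum_(i < N) \sum_(j < N) G j i).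
Proof.
move=> HG; rewrite big_triangle -sumrB; apply: fil_sum => i _.
rewrite (big_ord_widen N (fun j => G j i)) ?leq_subr // big_mkcond -sumrB.
apply: fil_sum => j _; case: ifP => [_|/negbT]; first by rewrite subrr; exact: fil_zero.
rewrite -leqNgt leq_subLR => leN; rewrite sub0r; apply: filN.
by apply: fil_le (HG j i); rewrite addnC.
Qed.

(** * Exponential and logarithm *)

Section ExpLogInverse.
Variables (k : comPzRingType) (iota : {rmorphism rat -> k}).
Local Notation ef n := (iota (n`!%:R^-1)).

Lemma fact_binE n m : (m <= n)%N -> ef n *+ 'C(n, m) = ef (n - m)%N * ef m.
Proof.
move=> lemn; rewrite -mulr_natr -(rmorph_nat iota) -!rmorphM; congr (iota _).
have nz j : (j`!%:R : rat) != 0 by rewrite Num.Theory.pnatr_eq0 -lt0n fact_gt0.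
apply: (mulfI (nz n)); rewrite mulVKf // -(bin_fact lemn) !natrM.
by rewrite -mulrA -invfM [((n - m)`!%:R * _)]mulrC mulfV ?mulr1 // mulf_neq0.
Qed.

Lemma cexp_approx (S : complAlgType k) (x : S) N : fil 1 x ->
  fil N (cexp iota x - \sum_(n < N) cst (ef n) * x ^+ n).
Proof.
move=> Hx; have := ev1_approx (eser iota) N Hx.
by under eq_bigr do rewrite /eser size_nseq.
Qed.

Lemma cexp0 (S : complAlgType k) : cexp iota (0 : S) = 1.
Proof.
rewrite /cexp ev1_decomp; last exact: fil_zero.
by rewrite mul0r addr0 /eser /= invr1 rmorph1 cst1.
Qed.

Lemma cexpD (S : complAlgType k) (x y : S) : fil 1 x -> fil 1 y -> x * y = y * x ->
  cexp iota (x + y) = cexp iota x * cexp iota y.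
Proof.
move=> Hx Hy xy; apply: eq_fil => N.
apply: fil_trans (cexp_approx N (filD Hx Hy)) _.
apply: fil_trans _ (filBC (filMB (cexp_approx N Hx) (cexp_approx N Hy))).
have -> : (\sum_(n < N) cst (ef n) * x ^+ n) * (\sum_(n < N) cst (ef n) * y ^+ n)
  = \sum_(i < N) \sum_(j < N) (cst (ef j) * x ^+ j) * (cst (ef i) * y ^+ i).
  by rewrite mulr_suml exchange_big; apply: eq_bigr => i _; rewrite mulr_sumr.
have -> : \sum_(n < N) cst (ef n) * (x + y) ^+ n = \sum_(n < N) \sum_(i < n.+1)
   (cst (ef (n - i)%N) * x ^+ (n - i)) * (cst (ef i) * y ^+ i).
  apply: eq_bigr => n _; rewrite exprDn_comm // mulr_sumr; apply: eq_bigr => i _.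
  rewrite -[RHS]mulrA [x ^+ _ * (cst _ * _)]mulrA -cstC -!mulrA mulrA -cstM.
  by rewrite -fact_binE -1?ltnS // -[in RHS]mulr_natr cstM cst_nat -[in RHS]mulrA mulr_natl.
apply: (fil_triangle (G := fun j i => (cst (ef j) * x ^+ j) * (cst (ef i) * y ^+ i))).
by move=> i j; apply: filM; apply: filMl; apply: filX.
Qed.

Lemma cexpN (S : complAlgType k) (x : S) : fil 1 x -> cexp iota (- x) = cinv (cexp iota x).
Proof.
move=> Hx; apply: cinv_uniq; first exact: grp_cexp.
by rewrite -cexpD ?subrr ?cexp0 ?mulrN ?mulNr //; exact: filN.
Qed.

Lemma cexp_comm (S : complAlgType k) (x y : S) : fil 1 x -> x * y = y * x ->
  cexp iota x * y = y * cexp iota x.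
Proof. exact: ev1_comm. Qed.

Lemma fil_lser : fil 1 (lser iota).
Proof. exact: sfil1. Qed.

Definition altser : series k unit := tser (fun n => (-1) ^+ n).

Lemma altser_inv : (1 + tvar k) * altser = 1.
Proof.
rewrite mulrDl mul1r {1}[altser]series_decomp (bigD1 tt) //= big1 ?addr0 => [|[]//].
rewrite -[altser [::]]/(1 : k) scale1r -addrA -mulrDr.
rewrite (_ : shift tt altser + altser = 0) ?mulr0 ?addr0 //.
by apply/funext => w; rewrite addsE /shift /altser /= exprS mulN1r addNr.
Qed.

Lemma tderiv_lser : tderiv (lser iota) = altser.
Proof.
apply/funext => w; rewrite /tderiv /lser /= -(iota_nat iota) -rmorphM mulrC.
by rewrite mulfVK ?Num.Theory.pnatr_eq0 // rmorphXn rmorphN rmorph1.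
Qed.

Lemma tderiv_eser : tderiv (eser iota) = eser iota.
Proof.
apply/funext => w; rewrite /tderiv /eser /= -(iota_nat iota) -rmorphM factS natrM invfM.
by rewrite mulVKf ?Num.Theory.pnatr_eq0.
Qed.

Lemma fil_eser1 : fil 1 (eser iota - 1).
Proof. by apply: sfil1; rewrite subsE /eser onesE /= invr1 rmorph1 subrr. Qed.

Lemma ev1_tvar (f : series k unit) : ev1 (tvar k) f = f.
Proof.
by rewrite -[RHS]ev_id; apply: eq_ev => -[].
Qed.

Lemma fil_tvar : fil 1 (tvar k). Proof. exact: fil_letter. Qed.

Lemma euler_tser (p : series k unit) : euler p = tvar k * tderiv p.
Proof.
rewrite -{1}[p]ev1_tvar euler_ev1 ?euler_letter ?ev1_tvar //; exact: fil_tvar.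
Qed.

(** Both sides have the same Euler derivative, since the logarithm has derivative [altser], whose
    value at [eser iota - 1] is inverse to [eser iota]. *)
Lemma log_exp_ser : ev1 (eser iota - 1) (lser iota) = tvar k.
Proof.
have H1 := fil_eser1.
have altE : ev1 (eser iota - 1) altser * eser iota = 1.
  have : ev1 (eser iota - 1) ((1 + tvar k) * altser) = 1 by rewrite altser_inv ev_one.
  by rewrite evM evD ev_one ev1_letter // subrKC series_unit_comm.
apply: (euler_inj iota).
  rewrite euler_ev1 ?tderiv_lser //; last exact: series_unit_comm.
  rewrite eulerB euler1 subr0 euler_tser tderiv_eser.
  by rewrite -mulrA [eser iota * _]series_unit_comm altE mulr1 euler_letter.
by have /(_ [::] isT) -> : fil 1 (ev1 (eser iota - 1) (lser iota)) by apply/ev_fil/fil_lser.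
Qed.

(** The quotient [z] of the composite by [1 + tvar k] has zero Euler derivative and constant term
    1. *)
Lemma exp_log_ser : ev1 (lser iota) (eser iota) = 1 + tvar k.
Proof.
set y := ev1 _ _; have HL := fil_lser.
have Ey : (1 + tvar k) * euler y = tvar k * y.
  rewrite /y euler_ev1 ?tderiv_eser //; last exact: series_unit_comm.
  rewrite euler_tser tderiv_lser mulrA; congr (_ * _).
  by rewrite series_unit_comm -mulrA [altser * _]series_unit_comm altser_inv mulr1.
pose z := altser * y.
have yz : y = (1 + tvar k) * z by rewrite mulrA altser_inv mul1r.
suff z1 : z = 1 by rewrite yz z1 mulr1.
have Hg : grp (1 + tvar k) by rewrite /grp addrC addKr; exact: fil_tvar.
apply: (euler_inj iota).
  rewrite euler1; apply: (mulrI_grp Hg); apply: (mulrI_grp Hg).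
  apply: (addrI ((1 + tvar k) * (tvar k * z))).
  rewrite !mulr0 addr0 -mulrDr.
  move: Ey; rewrite yz eulerM eulerD euler1 add0r euler_letter => ->.
  by rewrite !mulrA [tvar k * _]series_unit_comm.
rewrite /z mulsE_nil /altser /= mul1r onesE /y ev1_decomp // addsE mulsE_nil HL //.
by rewrite mul0r addr0 -[cst _]/(_ *: (1 : series k unit)) scalesE onesE mulr1
  /eser /= invr1 rmorph1.
Qed.

Lemma log_cexp (S : complAlgType k) (x : S) : fil 1 x ->
  ev1 (cexp iota x - 1) (lser iota) = x.
Proof.
move=> Hx; rewrite -[RHS](ev1_letter (k := k) Hx) -log_exp_ser chom_ev; last first.
  by move=> ?; exact: fil_eser1.
by apply: eq_ev => u; rewrite /= evB ev_one.
Qed.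

Lemma cexp_log (S : complAlgType k) (g : S) : grp g ->
  cexp iota (ev1 (g - 1) (lser iota)) = g.
Proof.
move=> Hg; have : ev1 (g - 1) (1 + tvar k) = g by rewrite evD ev_one ev1_letter // subrKC.
rewrite -exp_log_ser chom_ev; last by move=> ?; exact: fil_lser.
by move=> {2}<-.
Qed.

Lemma slog_sexp (X : finType) (f : series k X) : fil 1 f -> slog iota (sexp iota f) = f.
Proof. by move=> Hf; rewrite sexpE // slogE ?log_cexp //; exact: grp_cexp. Qed.

Lemma sexp_slog (X : finType) (g : series k X) : grp g -> sexp iota (slog iota g) = g.
Proof.
by move=> Hg; rewrite slogE // sexpE ?cexp_log //; apply: ev_fil; exact: fil_lser.
Qed.

End ExpLogInverse.

(** * Lie series *)

Section HomogeneousComponents.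
Variables (k : comPzRingType) (X : finType).
Implicit Types f g h : series k X.

Lemma hcompD d f g : hcomp d (f + g) = hcomp d f + hcomp d g.
Proof. by apply/funext => w; rewrite addsE /hcomp; case: ifP; rewrite ?addr0. Qed.
Lemma hcompZ d c f : hcomp d (c *: f) = c *: hcomp d f.
Proof. by apply/funext => w; rewrite scalesE /hcomp; case: ifP; rewrite ?mulr0. Qed.
Lemma hcompN d f : hcomp d (- f) = - hcomp d f.
Proof. by apply/funext => w; rewrite oppsE /hcomp; case: ifP; rewrite ?oppr0. Qed.
Lemma hcompB d f g : hcomp d (f - g) = hcomp d f - hcomp d g.
Proof. by rewrite hcompD hcompN. Qed.
Lemma hcomp_zero d : hcomp d (0 : series k X) = 0.
Proof. by apply/funext => w; rewrite /hcomp zerosE if_same. Qed.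
Lemma hcomp_sum d I (r : seq I) (P : pred I) (F : I -> series k X) :
  hcomp d (\sum_(i <- r | P i) F i) = \sum_(i <- r | P i) hcomp d (F i).
Proof.
by elim/big_rec2: _ => [|i x y _ <-]; rewrite ?hcomp_zero ?hcompD.
Qed.

Lemma hcompM d f g :
  hcomp d (f * g) = \sum_(i < d.+1) hcomp i f * hcomp (d - i)%N g.
Proof.
apply/funext => w; rewrite sumsE {1}/hcomp; case: eqP => [<-|ne].
  rewrite mulsE; apply: eq_bigr => i _; have lei : (i <= size w)%N by rewrite -ltnS.
  rewrite mulsE (bigD1 i) //= /hcomp size_takel // size_drop !eqxx big1 ?addr0 // => j nji.
  by rewrite size_takel -1?ltnS // (inj_eq val_inj) (negPf nji) mul0r.
rewrite big1 // => i _; rewrite mulsE big1 // => j _; rewrite /hcomp.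
have [eqi|] := eqVneq (size (take j w)) i; last by rewrite mul0r.
have [eqd|] := eqVneq (size (drop j w)) (d - i)%N; last by rewrite mulr0.
case: ne; rewrite -[w in LHS](cat_take_drop j) size_cat eqi eqd subnKC //.
by rewrite -ltnS.
Qed.

Lemma hcomp_fil d f : fil d (hcomp d f).
Proof. by move=> w ltw; rewrite /hcomp (ltn_eqF ltw). Qed.

Lemma hcomp_fil0 d n f : fil n f -> (d < n)%N -> hcomp d f = 0.
Proof.
by move=> Hf ltd; apply/funext => w; rewrite /hcomp; case: eqP => // Ew; apply: Hf; rewrite Ew.
Qed.

Lemma eq_hcomp d n f g : fil n (f - g) -> (d < n)%N -> hcomp d f = hcomp d g.
Proof.
by move=> /hcomp_fil0 H /H /eqP; rewrite hcompB subr_eq0 => /eqP.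
Qed.

Lemma fil_sum_hcomp n f : fil n (f - \sum_(d < n) hcomp d f).
Proof.
move=> w ltw; rewrite subsE sumsE (bigD1 (Ordinal ltw)) //= big1 ?addr0.
  by rewrite /hcomp eqxx subrr.
by move=> i; rewrite -(inj_eq val_inj) /= /hcomp eq_sym => /negPf ->.
Qed.

Lemma hcomp_id d f : hcomp d (hcomp d f) = hcomp d f.
Proof. by apply/funext => w; rewrite /hcomp; case: (_ == _). Qed.

Lemma hcomp_ne d e f : d != e -> hcomp d (hcomp e f) = 0.
Proof.
move=> ne; apply/funext => w; rewrite /hcomp; case: eqP => // ->.
by rewrite (negPf ne).
Qed.

Lemma hcomp_letter d (x : X) : hcomp d (letter k x) = if d == 1%N then letter k x else 0.
Proof.
apply/funext => w; rewrite /hcomp; case: (eqVneq w [:: x]) => [->|ne] /=.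
  by rewrite eq_sym; case: eqP.
by rewrite /letter (negPf ne) if_same; case: eqP => _ //; rewrite (negPf ne).
Qed.

Lemma hcomp_euler d f : hcomp d (euler f) = d%:R *: hcomp d f.
Proof.
apply/funext => w; rewrite /hcomp scalesE /euler; case: eqP => [->//|_].
by rewrite mulr0.
Qed.

Lemma lie_brE f g : lie_br f g = f * g - g * f. Proof. by []. Qed.

Lemma hcomp_br d f g :
  hcomp d (lie_br f g) = \sum_(i < d.+1) lie_br (hcomp i f) (hcomp (d - i)%N g).
Proof.
rewrite lie_brE hcompB !hcompM sumrB; congr (_ - _).
rewrite (reindex_inj rev_ord_inj) /=; apply: eq_bigr => i _.
by rewrite subSS subKn // -ltnS.
Qed.

End HomogeneousComponents.

Section LieSeries.
Variables (k : comPzRingType) (X : finType).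
Implicit Types f g h w : series k X.

Lemma free_lie_sum I (r : seq I) (P : pred I) (F : I -> series k X) :
  (forall i, P i -> free_lie (F i)) -> free_lie (\sum_(i <- r | P i) F i).
Proof.
by move=> HF; elim/big_ind: _ => //; [apply: free_lie0 | apply: free_lieD].
Qed.
Lemma free_lieN f : free_lie f -> free_lie (- f).
Proof. by move=> Hf; rewrite -scaleN1r; apply: free_lieZ. Qed.

Lemma free_lie_hcomp d f : free_lie f -> free_lie (hcomp d f).
Proof.
move=> Hf; elim: Hf d => {f} [x|| f g _ IHf _ IHg|c f _ IHf|f g _ IHf _ IHg] d.
- by rewrite hcomp_letter; case: ifP => _; constructor.
- by rewrite hcomp_zero; constructor.
- by rewrite hcompD; constructor.
- by rewrite hcompZ; constructor.
- by rewrite hcomp_br; apply: free_lie_sum => i _; constructor.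
Qed.

Lemma free_lie_series f : free_lie f -> lie_series f.
Proof. by move=> Hf d; apply: free_lie_hcomp. Qed.
Lemma lie_series_letter (x : X) : lie_series (letter k x).
Proof. by apply: free_lie_series; constructor. Qed.
Lemma lie_series0 : lie_series (0 : series k X).
Proof. by apply: free_lie_series; constructor. Qed.
Lemma lie_seriesD f g : lie_series f -> lie_series g -> lie_series (f + g).
Proof. by move=> Hf Hg d; rewrite hcompD; constructor. Qed.
Lemma lie_seriesZ c f : lie_series f -> lie_series (c *: f).
Proof. by move=> Hf d; rewrite hcompZ; constructor. Qed.
Lemma lie_seriesN f : lie_series f -> lie_series (- f).
Proof. by move=> Hf; rewrite -scaleN1r; apply: lie_seriesZ. Qed.
Lemma lie_seriesB f g : lie_series f -> lie_series g -> lie_series (f - g).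
Proof. by move=> Hf Hg; apply: lie_seriesD (lie_seriesN Hg). Qed.
Lemma lie_series_sum I (r : seq I) (P : pred I) (F : I -> series k X) :
  (forall i, P i -> lie_series (F i)) -> lie_series (\sum_(i <- r | P i) F i).
Proof.
by move=> HF; elim/big_ind: _ => //; [apply: lie_series0 | apply: lie_seriesD].
Qed.
Lemma lie_series_br f g : lie_series f -> lie_series g -> lie_series (lie_br f g).
Proof.
by move=> Hf Hg d; rewrite hcomp_br; apply: free_lie_sum => i _; constructor.
Qed.
Lemma lie_series_euler f : lie_series f -> lie_series (euler f).
Proof. by move=> Hf d; rewrite hcomp_euler; constructor. Qed.

Lemma free_lie_nil f : free_lie f -> f [::] = 0.
Proof.
elim=> {f} [x|| f g _ IHf _ IHg|c f _ IHf|f g _ IHf _ IHg] //.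
- by rewrite addsE IHf IHg addr0.
- by rewrite scalesE IHf mulr0.
- by rewrite /lie_br subsE !mulsE_nil IHf IHg !mul0r subrr.
Qed.

Lemma lie_series_fil f : lie_series f -> fil 1 f.
Proof.
by move=> Hf; apply: sfil1; have := free_lie_nil (Hf 0%N); rewrite /hcomp.
Qed.

Lemma lie_series_lim f :
  (forall n, exists2 h, lie_series h & fil n (f - h)) -> lie_series f.
Proof.
move=> H d; have [h Hh /eq_hcomp -> //] := H d.+1; exact: Hh.
Qed.

Lemma lie_series_part n f : (forall d, (d < n)%N -> free_lie (hcomp d f)) ->
  lie_series (\sum_(d < n) hcomp d f).
Proof. by move=> H; apply: lie_series_sum => i _; apply: free_lie_series; apply: H. Qed.

End LieSeries.

Lemma lie_series_ev (k : comPzRingType) (X Y : finType) (a : X -> series k Y) f :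
  (forall x, lie_series (a x)) -> lie_series f -> lie_series (ev a f).
Proof.
move=> Ha; have Ha1 x : fil 1 (a x) by apply: lie_series_fil.
have H h : free_lie h -> lie_series (ev a h).
  elim=> {h} [x|| h g _ IHf _ IHg|c h _ IHf|h g _ IHf _ IHg].
  - by rewrite ev_letter.
  - by rewrite ev_zero; apply: lie_series0.
  - by rewrite evD; apply: lie_seriesD.
  - by rewrite evZ -scale_cst; apply: lie_seriesZ.
  - by rewrite /lie_br evB !evM; apply: lie_series_br.
move=> Hf; apply: lie_series_lim => n; exists (ev a (\sum_(d < n) hcomp d f)).
  by rewrite ev_sum; apply: lie_series_sum => i _; apply: H; apply: Hf.
by rewrite -evB; apply: ev_fil; apply: fil_sum_hcomp.
Qed.

(** * Logarithmic derivatives and exponentials of Lie series *)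

Section AdExp.
Variables (k : comPzRingType) (iota : {rmorphism rat -> k}) (X : finType).
Implicit Types f g h w : series k X.
Local Notation ef n := (iota (n`!%:R^-1)).

(** Brackets are taken with [f] on the right, as they arise when powers of [f] are moved to the left
    of [w]. *)
Definition adpow f m w := iter m (fun h => lie_br h f) w.

Lemma adpow_fil f m n w : fil 1 f -> fil n w -> fil (m + n) (adpow f m w).
Proof.
move=> Hf Hw; elim: m => // m IH; rewrite addSn -addn1 /=.
exact: lie_br_fil.
Qed.

Lemma adpow_lie f m w : lie_series f -> lie_series w -> lie_series (adpow f m w).
Proof. by move=> Hf Hw; elim: m => //= m IH; apply: lie_series_br. Qed.

Definition adsum (c : nat -> k) f w : series k X :=
  fun v => \sum_(m < (size v).+1) c m * adpow f m w v.

Lemma adsum_approx c f w N : fil 1 f ->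
  fil N (adsum c f w - \sum_(m < N) c m *: adpow f m w).
Proof.
move=> Hf v ltv; rewrite subsE sumsE /adsum.
rewrite (big_ord_widen N (fun m => c m * adpow f m w v)) // big_mkcond -sumrB big1 //.
move=> i _; rewrite scalesE; case: ifP => [_|/negbT]; first by rewrite subrr.
rewrite -leqNgt => lei; rewrite (adpow_fil (m := i) Hf (fil0 w)) ?mulr0 ?subr0 //.
by rewrite addn0.
Qed.

Lemma adsum_lie c f w : lie_series f -> lie_series w -> lie_series (adsum c f w).
Proof.
move=> Hf Hw; apply: lie_series_lim => n.
exists (\sum_(m < n) c m *: adpow f m w); last exact/adsum_approx/lie_series_fil.
by apply: lie_series_sum => i _; apply: lie_seriesZ; apply: adpow_lie.
Qed.

Lemma mulr_pow_ad f w n :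
  w * f ^+ n = \sum_(m < n.+1) (f ^+ (n - m) * adpow f m w) *+ 'C(n, m).
Proof.
elim: n w => [|n IH] w; first by rewrite big_ord_recl big_ord0 addr0 mulr1 mul1r.
have wf : w * f = f * w + lie_br w f by rewrite /lie_br addrC subrK.
rewrite exprS mulrA wf mulrDl -mulrA !IH.
have -> : \sum_(m < n.+1) (f ^+ (n - m) * adpow f m (lie_br w f)) *+ 'C(n, m) =
   \sum_(m < n.+1) (f ^+ (n - m) * adpow f m.+1 w) *+ 'C(n, m).
  by apply: eq_bigr => m _; rewrite /adpow iterSr.
rewrite mulr_sumr.
have -> : \sum_(m < n.+1) f * (f ^+ (n - m) * adpow f m w *+ 'C(n, m)) =
   \sum_(m < n.+2) (f ^+ (n.+1 - m) * adpow f m w) *+ 'C(n, m).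
  rewrite [RHS]big_ord_recr /= bin_small // mulr0n addr0; apply: eq_bigr => m _.
  by rewrite mulrnAr mulrA -exprS subSn // -ltnS.
rewrite big_ord_recl [RHS]big_ord_recl !bin0 -addrA -big_split /=.
by congr (_ + _); apply: eq_bigr => m _; rewrite /= subSS binS mulrnDr.
Qed.

Lemma euler_pow_ad f n : euler (f ^+ n) =
  \sum_(m < n) (f ^+ (n.-1 - m) * adpow f m (euler f)) *+ 'C(n, m.+1).
Proof.
elim: n => [|n IH]; first by rewrite big_ord0 expr0 euler1.
rewrite exprS eulerM mulr_pow_ad IH mulr_sumr /=.
have -> : \sum_(i < n) f * (f ^+ (n.-1 - i) * adpow f i (euler f) *+ 'C(n, i.+1)) =
  \sum_(m < n.+1) (f ^+ (n - m) * adpow f m (euler f)) *+ 'C(n, m.+1).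
  rewrite [RHS]big_ord_recr /= bin_small // mulr0n addr0; apply: eq_bigr => m _.
  rewrite mulrnAr mulrA -exprS -subSn ?prednK //; last by rewrite -ltnS prednK // (leq_ltn_trans _ (ltn_ord m)).
  by rewrite (leq_ltn_trans _ (ltn_ord m)).
by rewrite -big_split; apply: eq_bigr => m _; rewrite /= -mulrnDr addnC -binS.
Qed.

Lemma scaleMn c n f : c *: (f *+ n) = (c *+ n) *: f.
Proof. by rewrite -scaler_nat scalerA mulr_natr. Qed.

Lemma cexp_series_approx f N : fil 1 f ->
  fil N (cexp iota f - \sum_(n < N) ef n *: f ^+ n).
Proof.
move=> Hf; have := cexp_approx iota N Hf.
by under eq_bigr do rewrite -scale_cst.
Qed.

(** Conjugating [w] by the exponential of [f] yields a series of iterated brackets; this is why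
    conjugation by [exp_lie] elements preserves Lie series. *)
Lemma cexp_conj f w : fil 1 f ->
  w * cexp iota f = cexp iota f * adsum (fun m => ef m) f w.
Proof.
move=> Hf; apply: eq_fil => N.
have H0 : fil N (w - w) by rewrite subrr; exact: fil_zero.
apply: fil_trans (filMB H0 (cexp_series_approx Hf)) _.
apply: fil_trans _ (filBC (filMB (cexp_series_approx Hf) (adsum_approx _ w Hf))).

have -> : (\sum_(n < N) ef n *: f ^+ n) * (\sum_(m < N) ef m *: adpow f m w)
  = \sum_(i < N) \sum_(j < N) (ef j *: f ^+ j) * (ef i *: adpow f i w).
  by rewrite mulr_suml exchange_big; apply: eq_bigr => i _; rewrite mulr_sumr.
have -> : w * (\sum_(n < N) ef n *: f ^+ n) = \sum_(n < N) \sum_(i < n.+1)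
    (ef (n - i)%N *: f ^+ (n - i)) * (ef i *: adpow f i w).
  rewrite mulr_sumr; apply: eq_bigr => n _.
  rewrite -scaleAr_series mulr_pow_ad scaler_sumr; apply: eq_bigr => i _.
  rewrite scaleMn fact_binE -1?ltnS // -scaleAl_series -scaleAr_series scalerA.
  by [].
apply: (fil_triangle (G := fun j i => (ef j *: f ^+ j) * (ef i *: adpow f i w))) => i j.
apply: filM; first by apply: sfilZ; apply: filX.
by apply: sfilZ; apply: fil_le (adpow_fil (m := j) Hf (fil0 _)); rewrite addn0.
Qed.

(** Closed form of exp(-f) times the Euler derivative of exp(f): the coefficients are those of (e^x
    - 1)/x applied to the bracket with [f]. *)
Definition dlog f := adsum (fun m => ef m.+1) f (euler f).

Lemma euler_cexp f : fil 1 f -> euler (cexp iota f) = cexp iota f * dlog f.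
Proof.
move=> Hf; apply: eq_fil => N.
have : fil N (euler (cexp iota f - \sum_(n < N) ef n *: f ^+ n)).
  by apply: euler_fil; apply: cexp_series_approx.
have : fil N (euler (cexp iota f - \sum_(n < N.+1) ef n *: f ^+ n)).
  by apply: euler_fil; apply: sfilS; apply: cexp_series_approx.
rewrite eulerB euler_sum => /fil_trans H _; apply: H.
apply: fil_trans _ (filBC (filMB (cexp_series_approx Hf) (adsum_approx _ (euler f) Hf))).
have -> : (\sum_(n < N) ef n *: f ^+ n) * (\sum_(m < N) ef m.+1 *: adpow f m (euler f))
  = \sum_(i < N) \sum_(j < N) (ef j *: f ^+ j) * (ef i.+1 *: adpow f i (euler f)).
  by rewrite mulr_suml exchange_big; apply: eq_bigr => i _; rewrite mulr_sumr.
have -> : \sum_(n < N.+1) euler (ef n *: f ^+ n) = \sum_(n < N) \sum_(i < n.+1)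
    (ef (n - i)%N *: f ^+ (n - i)) * (ef i.+1 *: adpow f i (euler f)).
  rewrite big_ord_recl eulerZ expr0 euler1 scaler0 add0r; apply: eq_bigr => n _.
  rewrite eulerZ euler_pow_ad scaler_sumr; apply: eq_bigr => i _.
  rewrite scaleMn fact_binE // -scaleAl_series -scaleAr_series scalerA.
  by [].
apply: (fil_triangle (G := fun j i => (ef j *: f ^+ j) * (ef i.+1 *: adpow f i (euler f)))) => i j.
apply: filM; first by apply: sfilZ; apply: filX.
by apply: sfilZ; apply: fil_le (adpow_fil (m := j) Hf (fil0 _)); rewrite addn0.
Qed.

Lemma dlog_lie f : lie_series f -> lie_series (dlog f).
Proof. by move=> Hf; apply: adsum_lie => //; apply: lie_series_euler. Qed.

Lemma filMB1 n (a a' b b' : series k X) : fil 1 a' -> fil 1 b ->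
  fil n (a - a') -> fil n (b - b') -> fil n.+1 (a * b - a' * b').
Proof.
move=> Ha' Hb Haa Hbb; apply: (@fil_trans _ _ _ _ (a' * b)).
  by rewrite -mulrBl -addn1; apply: filM.
by rewrite -mulrBr -add1n; apply: filM.
Qed.

Lemma subBB (x y x' y' : series k X) : (x - y) - (x' - y') = (x - x') - (y - y').
Proof. by rewrite opprD addrACA -opprD. Qed.

Lemma adpow_fil1 f m : fil 1 f -> fil 1 (adpow f m (euler f)).
Proof.
move=> Hf; have := adpow_fil (m := m) Hf (euler_fil Hf).
by apply: fil_le; rewrite addn1.
Qed.

Lemma adpow_approx n f f' m : fil 1 f -> fil 1 f' -> fil n (f - f') ->
  fil n (adpow f m (euler f) - adpow f' m (euler f')).
Proof.
move=> Hf Hf' Hff; elim: m => [|m IH]; first by rewrite -eulerB; apply: euler_fil.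
by rewrite /= /lie_br subBB; apply: filB; apply: filMB.
Qed.

Lemma adpow_approxS n f f' m : fil 1 f -> fil 1 f' -> fil n (f - f') ->
  fil n.+1 (adpow f m.+1 (euler f) - adpow f' m.+1 (euler f')).
Proof.
move=> Hf Hf' Hff; rewrite /= /lie_br subBB.
by apply: filB; apply: filMB1 => //; try exact: adpow_fil1; exact: adpow_approx.
Qed.

(** Apart from its linear term [euler f], [dlog f] consists of brackets of at least two factors of
    positive filtration, so it depends on [f] with a gain of one degree. *)
Lemma dlog_approx n f f' : fil 1 f -> fil 1 f' -> fil n (f - f') ->
  fil n.+1 ((dlog f - euler f) - (dlog f' - euler f')).
Proof.
move=> Hf Hf' Hff.
have ef1 : ef 1%N = 1 by rewrite invr1 rmorph1.
have H h : fil 1 h -> fil n.+2 ((dlog h - euler h) -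
    \sum_(m < n.+1) ef m.+2 *: adpow h m.+1 (euler h)).
  move=> Hh; have := @adsum_approx (fun m => ef m.+1) h (euler h) n.+2 Hh.
  by rewrite big_ord_recl ef1 scale1r opprD addrA.
apply: fil_trans (sfilS (H _ Hf)) _; apply: fil_trans _ (filBC (sfilS (H _ Hf'))).
rewrite -sumrB; apply: fil_sum => m _; rewrite -scalerBr; apply: sfilZ.
exact: adpow_approxS.
Qed.

(** In degree d, [dlog f] is d times the component of [f] plus a Lie polynomial in the components of
    lower degree. The components of [f] are therefore recovered one after the other, dividing by
    d. *)
Lemma lie_series_dlog f : fil 1 f -> lie_series (dlog f) -> lie_series f.
Proof.
move=> Hf Hd d; elim/ltn_ind: d => -[|d] IH.
  by rewrite (hcomp_fil0 Hf) //; constructor.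
pose f' := \sum_(i < d.+1) hcomp i f.
have Hf' : lie_series f' by apply: lie_series_part.
have := dlog_approx Hf (lie_series_fil Hf') (@fil_sum_hcomp _ _ d.+1 f).
move=> /eq_hcomp /(_ (ltnSn _)); rewrite hcompB hcomp_euler => E.
have -> : hcomp d.+1 f = iota (d.+1%:R^-1) *:
    (hcomp d.+1 (dlog f) - hcomp d.+1 (dlog f' - euler f')).
  by rewrite -E opprB addrCA subrr addr0 scalerA iota_inv // scale1r.
apply: free_lieZ; apply: free_lieD; first exact: Hd.
apply: free_lieN; apply: lie_seriesB; first exact: dlog_lie.
exact: lie_series_euler.
Qed.

Lemma exp_lieE g : exp_lie iota g <-> grp g /\ lie_series (slog iota g).
Proof.
split=> [[f Hf ->]|[Hg Hl]]; last by exists (slog iota g) => //; rewrite sexp_slog.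
have Hf1 := lie_series_fil Hf.
by rewrite slog_sexp // sexpE //; split=> //; exact: grp_cexp.
Qed.

Lemma exp_lie_grp g : exp_lie iota g -> grp g.
Proof. by case/exp_lieE. Qed.

(** Criterion through the logarithmic derivative. The latter is additive up to conjugation, so
    closure under products follows without the Baker-Campbell-Hausdorff formula. *)
Lemma exp_lieP g : grp g ->
  (exp_lie iota g <-> exists2 w, lie_series w & euler g = g * w).
Proof.
move=> Hg; split=> [[f Hf ->]|[w Hw Ew]].
  exists (dlog f); first exact: dlog_lie.
  by rewrite sexpE ?euler_cexp //; exact: lie_series_fil.
apply/exp_lieE; split=> //; apply: lie_series_dlog.
  by rewrite slogE //; apply/ev_fil/fil_lser.
have Hs : fil 1 (slog iota g) by rewrite slogE //; apply/ev_fil/fil_lser.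
rewrite (_ : dlog _ = w) //; apply: (mulrI_grp Hg); rewrite -Ew.
by rewrite -[in RHS](sexp_slog iota Hg) sexpE // euler_cexp // -sexpE // sexp_slog.
Qed.

Lemma exp_lie_sexp f : lie_series f -> exp_lie iota (sexp iota f).
Proof. by move=> Hf; exists f. Qed.

Lemma exp_lie_cexp f : lie_series f -> exp_lie iota (cexp iota f).
Proof. by move=> Hf; exists f; rewrite ?sexpE //; apply: lie_series_fil. Qed.

Lemma exp_lie1 : exp_lie iota (1 : series k X).
Proof.
exists 0; first exact: lie_series0.
by rewrite sexpE ?cexp0 //; exact: fil_zero.
Qed.

Lemma exp_lieV g : exp_lie iota g -> exp_lie iota (cinv g).
Proof.
move=> [f Hf ->]; have Hf1 := lie_series_fil Hf; rewrite sexpE // -cexpN //.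
by apply: exp_lie_cexp; apply: lie_seriesN.
Qed.

Lemma AdV_lie g w : exp_lie iota g -> lie_series w -> lie_series (cinv g * w * g).
Proof.
move=> [f Hf ->] Hw; have Hf1 := lie_series_fil Hf; rewrite sexpE // -mulrA cexp_conj //.
rewrite gmulVKr; first exact: adsum_lie.
exact: grp_cexp.
Qed.

Lemma Ad_lie g w : exp_lie iota g -> lie_series w -> lie_series (g * w * cinv g).
Proof.
move=> Hg Hw; rewrite -{1}[g]cinvK; last exact: exp_lie_grp.
by apply: AdV_lie => //; apply: exp_lieV.
Qed.

Lemma exp_lieM g h : exp_lie iota g -> exp_lie iota h -> exp_lie iota (g * h).
Proof.
move=> Hg Hh; have Gg := exp_lie_grp Hg; have Gh := exp_lie_grp Hh.
have /(exp_lieP Gg) [w Hw Eg] := Hg; have /(exp_lieP Gh) [v Hv Eh] := Hh.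
apply/exp_lieP; first exact: grpM.
exists (cinv h * w * h + v); first by apply: lie_seriesD => //; apply: AdV_lie.
by rewrite eulerM Eg Eh mulrDr !mulrA gmulrKV.
Qed.

End AdExp.

Lemma exp_lie_ev (k : comPzRingType) (iota : {rmorphism rat -> k})
    (X Y : finType) (a : X -> series k Y) g :
  (forall x, lie_series (a x)) -> exp_lie iota g -> exp_lie iota (ev a g).
Proof.
move=> Ha [f Hf ->]; have Hf1 := lie_series_fil Hf.
by rewrite sexpE // chom_cexp //; apply: exp_lie_cexp; apply: lie_series_ev.
Qed.

(** * The Dynkin operator *)

Section Dynkin.
Variables (k : comPzRingType) (X : finType).
Implicit Types f g h : series k X.

Fixpoint rnbr (v : seq X) : series k X :=
  match v with
  | [::] => 0
  | [:: x] => letter k x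
  | x :: v' => lie_br (letter k x) (rnbr v')
  end.

Lemma rnbr_cons x v : v != [::] -> rnbr (x :: v) = lie_br (letter k x) (rnbr v).
Proof. by case: v. Qed.

Lemma rnbr_free v : free_lie (rnbr v).
Proof.
elim: v => [|x v IH]; first by constructor.
case: v IH => [|y v] IH; first by constructor.
by rewrite rnbr_cons //; constructor => //; constructor.
Qed.

Lemma lie_brDl f g h : lie_br (f + g) h = lie_br f h + lie_br g h.
Proof. by rewrite /lie_br mulrDl mulrDr opprD addrACA. Qed.
Lemma lie_brDr f g h : lie_br h (f + g) = lie_br h f + lie_br h g.
Proof. by rewrite /lie_br mulrDl mulrDr opprD addrACA. Qed.
Lemma lie_brZl c f h : lie_br (c *: f) h = c *: lie_br f h.
Proof. by rewrite /lie_br -scaleAl_series -scaleAr_series scalerBr. Qed.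
Lemma lie_brZr c f h : lie_br h (c *: f) = c *: lie_br h f.
Proof. by rewrite /lie_br -scaleAl_series -scaleAr_series scalerBr. Qed.
Lemma lie_br0l h : lie_br 0 h = 0.
Proof. by rewrite /lie_br mul0r mulr0 subrr. Qed.
Lemma lie_br0r h : lie_br h 0 = 0.
Proof. by rewrite /lie_br mul0r mulr0 subrr. Qed.
Lemma lie_br_sumr h I (r : seq I) (P : pred I) (F : I -> series k X) :
  lie_br h (\sum_(i <- r | P i) F i) = \sum_(i <- r | P i) lie_br h (F i).
Proof. by elim/big_rec2: _ => [|i x y _ <-]; rewrite ?lie_br0r ?lie_brDr. Qed.
Lemma lie_br_suml h I (r : seq I) (P : pred I) (F : I -> series k X) :
  lie_br (\sum_(i <- r | P i) F i) h = \sum_(i <- r | P i) lie_br (F i) h.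
Proof. by elim/big_rec2: _ => [|i x y _ <-]; rewrite ?lie_br0l ?lie_brDl. Qed.
Lemma lie_jacobi f g h :
  lie_br (lie_br f g) h = lie_br f (lie_br g h) - lie_br g (lie_br f h).
Proof. by rewrite /lie_br; ncring.
Qed.

Definition dyn d f : series k X := \sum_(v : d.-tuple X) f v *: rnbr v.

Lemma dynD d f g : dyn d (f + g) = dyn d f + dyn d g.
Proof. by rewrite -big_split; apply: eq_bigr => v _; rewrite addsE scalerDl. Qed.
Lemma dynZ d c f : dyn d (c *: f) = c *: dyn d f.
Proof. by rewrite scaler_sumr; apply: eq_bigr => v _; rewrite scalerA. Qed.
Lemma dynN d f : dyn d (- f) = - dyn d f.
Proof. by rewrite -!scaleN1r dynZ. Qed.
Lemma dyn0 d : dyn d 0 = 0.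
Proof. by rewrite /dyn big1 // => v _; rewrite scale0r. Qed.
Lemma dyn_sum d I (r : seq I) (P : pred I) (F : I -> series k X) :
  dyn d (\sum_(i <- r | P i) F i) = \sum_(i <- r | P i) dyn d (F i).
Proof. by elim/big_rec2: _ => [|i x y _ <-]; rewrite ?dyn0 ?dynD. Qed.

Lemma dyn_free d f : free_lie (dyn d f).
Proof. by apply: free_lie_sum => v _; constructor; exact: rnbr_free. Qed.

Lemma dyn_hcomp d f : dyn d (hcomp d f) = dyn d f.
Proof. by apply: eq_bigr => v _; rewrite /hcomp size_tuple eqxx. Qed.

Lemma dyn_letterM d x h : h [::] = 0 ->
  dyn d.+1 (letter k x * h) = lie_br (letter k x) (dyn d h).
Proof.
move=> h0; rewrite /dyn lie_br_sumr.
rewrite (reindex (fun p : X * d.-tuple X => [tuple of p.1 :: p.2])) /=; last first.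
  exists (fun v : d.+1.-tuple X => (thead v, [tuple of behead v])) => [[y v] _|v _] /=.
    by congr (_, _); apply/val_inj.
  by rewrite -tuple_eta.
rewrite -(pair_bigA _ (fun y (v : d.-tuple X) => (letter k x * h) (y :: v) *: rnbr (y :: v))) /=.
rewrite (bigD1 x) //= [X in _ + X]big1 ?addr0 => [|y nyx]; last first.
  rewrite big1 // => v _; rewrite -[(letter k x * h) (y :: v)]/(shift y (letter k x * h) v).
  by rewrite shift_letterM (negPf nyx) scale0r.
apply: eq_bigr => v _; rewrite -[(letter k x * h) (x :: v)]/(shift x (letter k x * h) v).
rewrite shift_letterM eqxx lie_brZr; case: (eqVneq (val v) [::]) => [->|nv].
  by rewrite h0 !scale0r.
by congr (_ *: _); apply: rnbr_cons.
Qed.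

(** The operator turns left multiplication by a Lie element into its adjoint action; brackets are
    treated by the Jacobi identity. The constant term of [h] must vanish because the bracketing of a
    single letter is that letter, not a bracket. *)
Lemma dyn_lieM f : free_lie f -> forall e d h, h [::] = 0 ->
  dyn (e + d) (hcomp e f * hcomp d h) = lie_br (hcomp e f) (dyn d h).
Proof.
elim=> {f} [x|| f g _ IHf _ IHg|c f _ IHf|f g Hf IHf Hg IHg] e d h h0.
- have hd0 : hcomp d h [::] = 0 by rewrite /hcomp h0 if_same.
  rewrite hcomp_letter; case: eqP => [->|_]; last by rewrite mul0r dyn0 lie_br0l.
  by rewrite add1n dyn_letterM // dyn_hcomp.
- by rewrite hcomp_zero mul0r dyn0 lie_br0l.
- by rewrite hcompD mulrDl dynD IHf // IHg // lie_brDl.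
- by rewrite hcompZ -scaleAl_series dynZ IHf // lie_brZl.
rewrite hcomp_br mulr_suml dyn_sum lie_br_suml; apply: eq_bigr => i _.
have lei : (i <= e)%N by rewrite -ltnS.
have H (u v : series k X) a b : (a + b)%N = e -> free_lie v ->
   (forall e d h, h [::] = 0 -> dyn (e + d) (hcomp e u * hcomp d h) = lie_br (hcomp e u) (dyn d h)) ->
   (forall e d h, h [::] = 0 -> dyn (e + d) (hcomp e v * hcomp d h) = lie_br (hcomp e v) (dyn d h)) ->
   dyn (e + d) (hcomp a u * hcomp b v * hcomp d h) =
   lie_br (hcomp a u) (lie_br (hcomp b v) (dyn d h)).
  move=> <- Hv IHu IHv; rewrite -IHv // -IHu; last first.
    by rewrite mulsE_nil [hcomp d h _]/hcomp h0 if_same mulr0.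
  rewrite -addnA -mulrA; congr (dyn _ (_ * _)).
  have ltb : (b < (b + d).+1)%N by rewrite ltnS leq_addr.
  rewrite hcompM (bigD1 (Ordinal ltb)) //= hcomp_id addKn hcomp_id big1 ?addr0 // => j.
  by rewrite -(inj_eq val_inj) /= => ne; rewrite hcomp_ne ?mul0r.
rewrite {1}/lie_br mulrBl dynD dynN; rewrite (H f g i (e - i)%N) ?subnKC //. rewrite (H g f (e - i)%N i) ?subnK //.
by rewrite lie_jacobi.
Qed.

(** Dynkin-Specht-Wever: on a bracket, [dyn_lieM] lets each factor contribute its own degree, and
    the degrees add up. *)
Lemma dyn_lie f d : free_lie f -> dyn d f = d%:R *: hcomp d f.
Proof.
move=> Hf; elim: Hf d => {f} [x|| f g _ IHf _ IHg|c f _ IHf|f g Hf IHf Hg IHg] d.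
- rewrite -dyn_hcomp hcomp_letter; case: eqP => [->|_]; last by rewrite dyn0 scaler0.
  rewrite /dyn (bigD1 [tuple x]) //= {1}/letter eqxx scale1r big1 ?addr0 ?scale1r // => v.
  rewrite -(inj_eq val_inj) /= => /negPf nv; rewrite /letter nv scale0r.
  by [].
- by rewrite dyn0 hcomp_zero scaler0.
- by rewrite dynD IHf IHg hcompD scalerDr.
- by rewrite dynZ IHf hcompZ !scalerA mulrC.
rewrite -dyn_hcomp hcomp_br dyn_sum scaler_sumr; apply: eq_bigr => i _.
have lei : (i <= d)%N by rewrite -ltnS.
have H (u v : series k X) a b : (a + b)%N = d -> free_lie u -> free_lie v ->
  dyn d (hcomp a u * hcomp b v) = lie_br (hcomp a u) (dyn b v).
  by move=> <- Hu Hv; rewrite dyn_lieM //; apply: free_lie_nil.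
rewrite {1}/lie_br dynD dynN (H f g) ?subnKC // (H g f) ?subnK // IHf IHg.
rewrite !lie_brZr -[lie_br (hcomp (d - i) g) _]opprK -/(lie_br _ _).
have -> : lie_br (hcomp (d - i) g) (hcomp i f) = - lie_br (hcomp i f) (hcomp (d - i) g).
  by rewrite /lie_br opprB.
by rewrite scalerN !opprK -scalerDl -natrD subnK.
Qed.

End Dynkin.

(** * Quotients by closed ideals *)

Record cideal (k : comPzRingType) (X : finType) := CIdeal {
  ci :> series k X -> Prop;
  ci0 : ci 0;
  ciD : forall f g, ci f -> ci g -> ci (f + g);
  ciMl : forall f g, ci g -> ci (f * g);
  ciMr : forall f g, ci f -> ci (f * g);
  ci_closed : forall f, (forall n, exists2 g, ci g & fil n (f - g)) -> ci f }.

Section Quotient.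
Variables (k : comPzRingType) (X : finType) (I : cideal k X).
Implicit Types f g h : series k X.

Lemma ciN f : I f -> I (- f).
Proof. by move=> If; rewrite -mulN1r; apply: ciMl. Qed.
Definition ci_rel f g := `[< I (f - g) >].

Fact ci_rel_refl : reflexive ci_rel.
Proof. by move=> f; apply/asboolP; rewrite subrr; exact: ci0. Qed.
Fact ci_rel_sym : symmetric ci_rel.
Proof.
by move=> f g; apply/asboolP/asboolP => H; rewrite -opprB; exact: ciN.
Qed.
Fact ci_rel_trans : transitive ci_rel.
Proof.
move=> g f h /asboolP fg /asboolP gh; apply/asboolP.
by rewrite -(subrKA g); apply: ciD.
Qed.
Canonical ci_equiv := EquivRel ci_rel ci_rel_refl ci_rel_sym ci_rel_trans.

Definition quo := {eq_quot ci_equiv}%qT.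
HB.instance Definition _ := Choice.on quo.

Definition qpi f : quo := (\pi_{eq_quot ci_equiv} f)%qT.
Definition qrepr (x : quo) : series k X := repr x.
Implicit Types x y z : quo.

Lemma qreprK x : qpi (qrepr x) = x. Proof. exact: reprK. Qed.
Lemma qpiP f g : qpi f = qpi g <-> I (f - g).
Proof.
split; first by move/eqmodP/asboolP.
by move=> H; apply/eqmodP/asboolP.
Qed.
Lemma qreprP f : I (qrepr (qpi f) - f).
Proof. by apply/qpiP; rewrite qreprK. Qed.

Definition quo_add x y := qpi (qrepr x + qrepr y).
Definition quo_opp x := qpi (- qrepr x).
Definition quo_mul x y := qpi (qrepr x * qrepr y).

Lemma quo_addE f g : quo_add (qpi f) (qpi g) = qpi (f + g).
Proof. by apply/qpiP; rewrite opprD addrACA; apply: ciD; apply: qreprP. Qed.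
Lemma quo_oppE f : quo_opp (qpi f) = qpi (- f).
Proof. by apply/qpiP; rewrite -opprD; apply/ciN/qreprP. Qed.
Lemma quo_mulE f g : quo_mul (qpi f) (qpi g) = qpi (f * g).
Proof.
apply/qpiP; have -> : qrepr (qpi f) * qrepr (qpi g) - f * g =
  (qrepr (qpi f) - f) * qrepr (qpi g) + f * (qrepr (qpi g) - g) by ncring.
by apply: ciD; [apply: ciMr | apply: ciMl]; apply: qreprP.
Qed.

Fact quo_addA : associative quo_add.
Proof.
by move=> x y z; rewrite -[x]qreprK -[y]qreprK -[z]qreprK !quo_addE addrA.
Qed.
Fact quo_addC : commutative quo_add.
Proof. by move=> x y; rewrite /quo_add addrC. Qed.
Fact quo_add0 : left_id (qpi 0) quo_add.
Proof. by move=> x; rewrite -[x]qreprK quo_addE add0r. Qed.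
Fact quo_addN : left_inverse (qpi 0) quo_opp quo_add.
Proof. by move=> x; rewrite -[x]qreprK quo_oppE quo_addE addNr. Qed.
HB.instance Definition _ := GRing.isZmodule.Build quo
  quo_addA quo_addC quo_add0 quo_addN.

Fact quo_mulA : associative quo_mul.
Proof.
by move=> x y z; rewrite -[x]qreprK -[y]qreprK -[z]qreprK !quo_mulE mulrA.
Qed.
Fact quo_mul1 : left_id (qpi 1) quo_mul.
Proof. by move=> x; rewrite -[x]qreprK quo_mulE mul1r. Qed.
Fact quo_mulr1 : right_id (qpi 1) quo_mul.
Proof. by move=> x; rewrite -[x]qreprK quo_mulE mulr1. Qed.
Fact quo_mulDl : left_distributive quo_mul quo_add.
Proof.
by move=> x y z; rewrite -[x]qreprK -[y]qreprK -[z]qreprK !(quo_mulE, quo_addE) mulrDl.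
Qed.
Fact quo_mulDr : right_distributive quo_mul quo_add.
Proof.
by move=> x y z; rewrite -[x]qreprK -[y]qreprK -[z]qreprK !(quo_mulE, quo_addE) mulrDr.
Qed.
HB.instance Definition _ := GRing.Zmodule_isPzRing.Build quo
  quo_mulA quo_mul1 quo_mulr1 quo_mulDl quo_mulDr.

Lemma qpiD f g : qpi (f + g) = qpi f + qpi g. Proof. by rewrite -quo_addE. Qed.
Lemma qpiM f g : qpi (f * g) = qpi f * qpi g. Proof. by rewrite -quo_mulE. Qed.
Lemma qpi1 : qpi 1 = 1. Proof. by []. Qed.
Lemma qpi0 : qpi 0 = 0. Proof. by []. Qed.
Lemma qpiN f : qpi (- f) = - qpi f. Proof. by rewrite -quo_oppE. Qed.

Definition quo_cst (c : k) : quo := qpi (cst c).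
Definition quo_fil n x := exists2 f, fil n f & x = qpi f.
(** A representative of positive filtration, with default [0]. Series are evaluated in the quotient
    by evaluating them at such representatives. *)
Definition quo_lift x : series k X :=
  if pselect (quo_fil 1 x) is left H then s2val (cid2 H) else 0.

Lemma quo_lift_fil x : fil 1 (quo_lift x).
Proof. by rewrite /quo_lift; case: pselect => [H|_]; [case: cid2 | exact: fil_zero]. Qed.
Lemma quo_liftK x : quo_fil 1 x -> qpi (quo_lift x) = x.
Proof. by rewrite /quo_lift; case: pselect => // H _; case: cid2. Qed.

Fact quo_cstD c d : quo_cst (c + d) = quo_cst c + quo_cst d.
Proof. by rewrite /quo_cst cstD qpiD. Qed.
Fact quo_cstM c d : quo_cst (c * d) = quo_cst c * quo_cst d.
Proof. by rewrite /quo_cst cstM qpiM. Qed.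
Fact quo_cst1 : quo_cst 1 = 1.
Proof. by rewrite /quo_cst cst1. Qed.
Fact quo_cstC c x : quo_cst c * x = x * quo_cst c.
Proof. by rewrite -[x]qreprK -!qpiM cstC. Qed.
Fact quo_fil0 x : quo_fil 0 x.
Proof. by exists (qrepr x); [exact: fil0 | rewrite qreprK]. Qed.
Fact quo_fil_zero n : quo_fil n 0.
Proof. by exists 0; [exact: fil_zero|]. Qed.
Fact quo_filD n x y : quo_fil n x -> quo_fil n y -> quo_fil n (x + y).
Proof. by move=> [f Hf ->] [g Hg ->]; exists (f + g); [exact: filD | rewrite qpiD]. Qed.
Fact quo_filM m n x y : quo_fil m x -> quo_fil n y -> quo_fil (m + n) (x * y).
Proof. by move=> [f Hf ->] [g Hg ->]; exists (f * g); [exact: filM | rewrite qpiM]. Qed.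
Fact quo_filS n x : quo_fil n.+1 x -> quo_fil n x.
Proof. by move=> [f Hf ->]; exists f => //; exact: filS. Qed.
Fact quo_fil_sep x : (forall n, quo_fil n x) -> x = 0.
Proof.
move=> H; rewrite -[x]qreprK; apply/qpiP; rewrite subr0; apply: ci_closed => n.
have [f Hf Ex] := H n; exists (qrepr x - f); last by rewrite subKr.
by apply/qpiP; rewrite qreprK.
Qed.

Section QuoEv.
Variables (Y : finType) (a : Y -> quo).
Definition quo_ev (p : series k Y) : quo := qpi (ev (fun j => quo_lift (a j)) p).
Hypothesis Ha : forall j, quo_fil 1 (a j).
Fact quo_evD p q : quo_ev (p + q) = quo_ev p + quo_ev q.
Proof. by rewrite /quo_ev evD qpiD. Qed.
Fact quo_evM p q : quo_ev (p * q) = quo_ev p * quo_ev q.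
Proof. by rewrite /quo_ev evM qpiM. Qed.
Fact quo_ev_cst c : quo_ev (c *: (1 : series k Y)) = quo_cst c.
Proof. by rewrite /quo_ev (ev_cst _ c). Qed.
Fact quo_ev_fil n p : sfil n p -> quo_fil n (quo_ev p).
Proof. by move=> Hf; exists (ev (fun j => quo_lift (a j)) p) => //; exact: ev_fil. Qed.
Fact quo_ev_letter j : quo_ev (letter k j) = a j.
Proof.
by rewrite /quo_ev ev_letter ?quo_liftK // => z; exact: quo_lift_fil.
Qed.
End QuoEv.

HB.instance Definition _ := @isComplete.Build k quo
  quo_cst quo_cstD quo_cstM quo_cst1 quo_cstC quo_fil quo_fil0 quo_fil_zero
  quo_filD quo_filM quo_filS quo_fil_sep quo_ev
  (fun Y a p q _ => quo_evD a p q) (fun Y a p q _ => quo_evM a p q)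
  (fun Y a c _ => quo_ev_cst a c) (fun Y a n p _ => @quo_ev_fil Y a n p)
  (fun Y a j Ha => @quo_ev_letter Y a Ha j).

Fact qpi_is_zmod_morphism : zmod_morphism qpi.
Proof. by move=> f g; rewrite qpiD qpiN. Qed.
Fact qpi_is_monoid_morphism : monoid_morphism qpi.
Proof. by split; last exact: qpiM. Qed.
HB.instance Definition _ := GRing.isZmodMorphism.Build _ _ qpi qpi_is_zmod_morphism.
HB.instance Definition _ := GRing.isMonoidMorphism.Build _ _ qpi qpi_is_monoid_morphism.
Fact qpi_cst c : qpi (cst c) = cst c. Proof. by []. Qed.
Fact qpi_fil n f : fil n f -> fil n (qpi f). Proof. by move=> Hf; exists f. Qed.
HB.instance Definition _ := isContinuous.Build k (series k X) quo qpi qpi_cst qpi_fil.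

Lemma qpi_filP n f : fil n (qpi f) -> exists2 g, I g & fil n (f - g).
Proof.
move=> [g Hg /qpiP fg]; exists (f - g) => //; by rewrite subKr.
Qed.
End Quotient.

Section QuotientMaps.
Variables (k : comPzRingType) (X : finType) (I : cideal k X) (S : complAlgType k).
Variable th : chomType (series k X) S.
Definition quo_map of (forall f, I f -> th f = 0) := fun x : quo I => th (qrepr x).

Hypothesis thI : forall f, I f -> th f = 0.
Local Notation qm := (quo_map thI).

Lemma quo_mapE f : qm (qpi I f) = th f.
Proof.
by apply/eqP; rewrite -subr_eq0 -chomB thI //; exact: qreprP.
Qed.

Fact quo_map_is_zmod_morphism : zmod_morphism qm.
Proof.
by move=> x y; rewrite -[x]qreprK -[y]qreprK -chomB !quo_mapE chomB.
Qed.
Fact quo_map_is_monoid_morphism : monoid_morphism qm.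
Proof.
split=> [|x y]; first by rewrite -qpi1 quo_mapE chom1.
by rewrite -[x]qreprK -[y]qreprK -chomM !quo_mapE chomM.
Qed.
HB.instance Definition _ := GRing.isZmodMorphism.Build _ _ qm quo_map_is_zmod_morphism.
HB.instance Definition _ := GRing.isMonoidMorphism.Build _ _ qm quo_map_is_monoid_morphism.
Fact quo_map_cst c : qm (cst c) = cst c.
Proof. by rewrite -qpi_cst quo_mapE chom_cst. Qed.
Fact quo_map_fil n x : fil n x -> fil n (qm x).
Proof. by move=> [f Hf ->]; rewrite quo_mapE; exact: chom_fil. Qed.
HB.instance Definition _ := isContinuous.Build k (quo I) S qm quo_map_cst quo_map_fil.
End QuotientMaps.

(** * Closed and truncated ideals generated by relators *)

Section GeneratedIdeal.
Variables (k : comPzRingType) (X : finType) (R : series k X -> Prop).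
Implicit Types f g : series k X.

Inductive idgen : series k X -> Prop :=
| idgen_gen f : R f -> idgen f
| idgen0 : idgen 0
| idgenD f g : idgen f -> idgen g -> idgen (f + g)
| idgenMl f g : idgen g -> idgen (f * g)
| idgenMr f g : idgen f -> idgen (f * g).

Definition idcl f := forall n, exists2 g, idgen g & fil n (f - g).

Fact idcl0 : idcl 0.
Proof. by move=> n; exists 0; [constructor | rewrite subrr; exact: fil_zero]. Qed.
Fact idclD f g : idcl f -> idcl g -> idcl (f + g).
Proof.
move=> Hf Hg n; have [f' If Hf'] := Hf n; have [g' Ig Hg'] := Hg n.
by exists (f' + g'); [constructor | rewrite opprD addrACA; apply: filD].
Qed.
Fact idclMl f g : idcl g -> idcl (f * g).
Proof.
move=> Hg n; have [g' Ig Hg'] := Hg n.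
by exists (f * g'); [constructor | rewrite -mulrBr; apply: filMl].
Qed.
Fact idclMr f g : idcl f -> idcl (f * g).
Proof.
move=> Hf n; have [f' If Hf'] := Hf n.
by exists (f' * g); [constructor | rewrite -mulrBl; apply: filMr].
Qed.
Fact idcl_closed f : (forall n, exists2 g, idcl g & fil n (f - g)) -> idcl f.
Proof.
move=> H n; have [g /(_ n)[h Ih Hh] Hg] := H n.
by exists h => //; apply: fil_trans Hg Hh.
Qed.
Definition idclosure := CIdeal idcl0 idclD idclMl idclMr idcl_closed.

Lemma idcl_gen f : idgen f -> idclosure f.
Proof. by move=> Hf n; exists f; rewrite ?subrr //; exact: fil_zero. Qed.

Lemma idcl_kill (S : complAlgType k) (th : chomType (series k X) S) :
  (forall f, R f -> th f = 0) -> forall f, idclosure f -> th f = 0.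
Proof.
move=> HR f Hf.
have H g : idgen g -> th g = 0.
  elim=> {g} [g /HR //||g h _ IHg _ IHh|g h _ IHh|g h _ IHg].
  - exact: chom0.
  - by rewrite chomD IHg IHh addr0.
  - by rewrite chomM IHh mulr0.
  - by rewrite chomM IHg mul0r.
apply: fil_sep => n; have [g /H Hg] := Hf n.
by move=> /(chom_fil th); rewrite chomB Hg subr0.
Qed.

Variable N : nat.
(** The generated ideal enlarged by all series of filtration [N]. Filtration [N] vanishes in the
    quotient, which allows the pentagon to be treated degree by degree. *)
Definition idtr f := exists2 g, idgen g & fil N (f - g).
Fact idtr0 : idtr 0.
Proof. by exists 0; [constructor | rewrite subrr; exact: fil_zero]. Qed.
Fact idtrD f g : idtr f -> idtr g -> idtr (f + g).
Proof.
move=> [f' If Hf'] [g' Ig Hg'].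
by exists (f' + g'); [constructor | rewrite opprD addrACA; apply: filD].
Qed.
Fact idtrMl f g : idtr g -> idtr (f * g).
Proof.
move=> [g' Ig Hg']; by exists (f * g'); [constructor | rewrite -mulrBr; apply: filMl].
Qed.
Fact idtrMr f g : idtr f -> idtr (f * g).
Proof.
move=> [f' If Hf']; by exists (f' * g); [constructor | rewrite -mulrBl; apply: filMr].
Qed.
Fact idtr_closed f : (forall n, exists2 g, idtr g & fil n (f - g)) -> idtr f.
Proof.
move=> /(_ N)[g [h Ih Hh] Hg]; by exists h => //; apply: fil_trans Hg Hh.
Qed.
Definition idtrunc := CIdeal idtr0 idtrD idtrMl idtrMr idtr_closed.

Lemma idtr_gen f : idgen f -> idtrunc f.
Proof. by move=> Hf; exists f; rewrite ?subrr //; exact: fil_zero. Qed.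

Lemma idtr_fil (x : quo idtrunc) : fil N x -> x = 0.
Proof.
move=> [f Hf ->]; apply/qpiP; rewrite subr0; exists 0; first by constructor.
by rewrite subr0.
Qed.
End GeneratedIdeal.

(** * Equality in a presented Lie algebra, tested in the associative quotient *)

Section LieIdeals.
Variables (k : comPzRingType) (iota : {rmorphism rat -> k}) (X : finType).
Variable R : series k X -> Prop.
Hypothesis Rlie : forall f, R f -> free_lie f.
Hypothesis Rhom : forall f, R f -> exists d, f = hcomp d f.
Implicit Types f g : series k X.

Lemma lie_ideal_sum J (r : seq J) (P : pred J) (F : J -> series k X) :
  (forall i, P i -> lie_ideal R (F i)) -> lie_ideal R (\sum_(i <- r | P i) F i).
Proof.
by move=> HF; elim/big_ind: _ => //; [apply: lie_ideal0 | apply: lie_idealD].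
Qed.

Lemma lie_ideal_idgen f : lie_ideal R f -> idgen R f.
Proof.
elim=> {f} [f|| f g _ If _ Ig|c f _ If|f g _ _ Ig].
- exact: idgen_gen.
- exact: idgen0.
- exact: idgenD.
- by rewrite scale_cst; apply: idgenMl.
- rewrite /lie_br -mulrN; apply: idgenD; first exact: idgenMl.
  by rewrite mulrN -mulN1r; apply/idgenMl/idgenMr.
Qed.

Definition word (v : seq X) : series k X := fun w => (w == v)%:R.

Lemma word_nil : word [::] = 1. Proof. by []. Qed.
Lemma word_cons x v : word (x :: v) = letter k x * word v.
Proof.
apply/funext => -[|y w]; first by rewrite mulsE_nil mul0r.
rewrite -[RHS]/(shift y (letter k x * word v) w) shift_letterM /word eqseq_cons.
by case: (y == x).
Qed.
Lemma word_cat u v : word (u ++ v) = word u * word v.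
Proof.
elim: u => [|x u IH]; first by rewrite word_nil mul1r.
by rewrite cat_cons !word_cons IH mulrA.
Qed.
Lemma hcomp_word v : hcomp (size v) (word v) = word v.
Proof.
by apply/funext => w; rewrite /hcomp /word; case: (eqVneq w v) => [->|_]; rewrite ?eqxx ?if_same.
Qed.

Lemma series_words d f : hcomp d f = \sum_(v : d.-tuple X) f v *: word v.
Proof.
apply/funext => w; rewrite sumsE /hcomp; case: eqP => [sw|sw].
  have Ew : tval (tcast sw (in_tuple w)) = w by rewrite val_tcast.
  rewrite (bigD1 (tcast sw (in_tuple w))) //= big1 ?addr0.
    by rewrite scalesE /word Ew eqxx mulr1.
  move=> v; rewrite -(inj_eq val_inj) /= Ew scalesE /word eq_sym => /negPf ->.
  by rewrite mulr0.
rewrite big1 // => v _; rewrite scalesE /word; case: eqP => [Ew|]; last by rewrite mulr0.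
by case: sw; rewrite Ew size_tuple.
Qed.

Lemma dyn_word_lie (u : seq X) f d : f [::] = 0 ->
  lie_ideal R (dyn d f) -> lie_ideal R (dyn (size u + d) (word u * f)).
Proof.
move=> f0 H; elim: u => [|x u IH]; first by rewrite word_nil mul1r.
rewrite word_cons -mulrA /= addSn dyn_letterM ?mulsE_nil ?f0 ?mulr0 //.
by apply: lie_ideal_br => //; constructor.
Qed.

Lemma lie_idealN f : lie_ideal R f -> lie_ideal R (- f).
Proof. by move=> Hf; rewrite -scaleN1r; apply: lie_idealZ. Qed.

(** The words [u] and [v] make the statement stable under multiplication on both sides. For a
    relator, the letters of [u] act by brackets; a nonempty [v] gives the bracket of the relator
    with the bracketing of [v], and an empty one a multiple of the relator. *)
Lemma dyn_idgen g : idgen R g -> forall d (u v : seq X),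
  lie_ideal R (dyn (size u + (d + size v)) (word u * hcomp d g * word v)).
Proof.
elim=> {g} [f Rf||f g _ If _ Ig|f g _ Ig|f g _ If] d u v.
- have [e Ee] := Rhom Rf; have Hf := Rlie Rf.
  have [->|ne] := eqVneq d e; last first.
    by rewrite Ee hcomp_ne // mulr0 mul0r dyn0; apply: lie_ideal0.
  rewrite -mulrA; apply: dyn_word_lie.
    by rewrite mulsE_nil -Ee (free_lie_nil Hf) mul0r.
  case: v => [|x v].
    rewrite word_nil mulr1 addn0 -Ee dyn_lie //; apply/lie_idealZ.
    by rewrite -Ee; apply: lie_ideal_gen.
  rewrite -hcomp_word dyn_lieM // -Ee /lie_br -opprB; apply: lie_idealN.
  by apply: lie_ideal_br; [exact: dyn_free | exact: lie_ideal_gen].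
- by rewrite hcomp_zero mulr0 mul0r dyn0; apply: lie_ideal0.
- by rewrite hcompD mulrDr mulrDl dynD; apply: lie_idealD.
- rewrite hcompM mulr_sumr mulr_suml dyn_sum; apply: lie_ideal_sum => i _.
  rewrite [hcomp i f]series_words mulr_suml mulr_sumr mulr_suml dyn_sum.
  apply: lie_ideal_sum => w _; rewrite -scaleAl_series -scaleAr_series -scaleAl_series.
  rewrite dynZ mulrA -word_cat; apply: lie_idealZ.
  have := Ig (d - i)%N (u ++ w) v; rewrite size_cat size_tuple.
  by rewrite -addnA [(i + _)%N]addnA subnKC // -ltnS.
- rewrite hcompM mulr_sumr mulr_suml dyn_sum; apply: lie_ideal_sum => i _.
  rewrite [hcomp (d - i) g]series_words mulr_sumr mulr_sumr mulr_suml dyn_sum.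
  apply: lie_ideal_sum => w _; rewrite -scaleAr_series -scaleAr_series -scaleAl_series.
  rewrite dynZ -!mulrA -word_cat mulrA; apply: lie_idealZ.
  have := If i u (w ++ v); rewrite size_cat size_tuple.
  by rewrite [(i + _)%N]addnA subnKC // -ltnS.
Qed.

(* The Dynkin operator sends the associative ideal generated by R into the Lie
   ideal, and multiplies a Lie element of degree d by d. *)
Lemma lie_ideal_idcl f : lie_series f -> idclosure R f ->
  forall d, lie_ideal R (hcomp d f).
Proof.
move=> Hf If d; case: d => [|d].
  by rewrite (hcomp_fil0 (lie_series_fil Hf)) //; apply: lie_ideal0.
have [g Ig /eq_hcomp Hg] := If d.+2.
have := dyn_idgen Ig d.+1 [::] [::].
rewrite word_nil mul1r mulr1 addn0 add0n -Hg // dyn_lie // hcomp_id => H.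
rewrite -[hcomp _ f]scale1r -(iota_inv iota (ltn0Sn d)) -scalerA.
exact: lie_idealZ.
Qed.

Notation pi := (qpi (idclosure R)).

Lemma lie_eq_pi f g : lie_eq R f g -> pi f = pi g.
Proof.
move=> H; apply/qpiP => n; exists (\sum_(d < n) hcomp d (f - g)).
  elim/big_ind: _ => [||i _]; [exact: idgen0 | exact: idgenD | ].
  exact: lie_ideal_idgen.
exact: fil_sum_hcomp.
Qed.

Lemma lie_eqP f g : lie_series f -> lie_series g -> lie_eq R f g <-> pi f = pi g.
Proof.
move=> Hf Hg; split=> [|/qpiP H d]; first exact: lie_eq_pi.
by apply: lie_ideal_idcl H d; apply: lie_seriesB.
Qed.

(** Exponential and logarithm are evaluations, hence pass to the associative quotient: equality of
    two group elements there is equality of their logarithms, to which [lie_eqP] applies. *)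
Lemma exp_eqP f g : exp_lie iota f -> exp_lie iota g ->
  exp_eq iota R f g <-> pi f = pi g.
Proof.
move=> /exp_lieE[Gf Lf] /exp_lieE[Gg Lg].
apply: (iff_trans (lie_eqP Lf Lg)); rewrite !slogE //; split=> E.
  have Hl (h : series k X) : fil 1 (ev1 (h - 1) (lser iota)) by apply/ev_fil/fil_lser.
  rewrite -(cexp_log iota Gf) -(cexp_log iota Gg).
  by rewrite (chom_cexp _ _ (Hl f)) (chom_cexp _ _ (Hl g)) /= E.
by rewrite !chom_ev //=; apply: eq_ev => u /=; rewrite !chomB /= E.
Qed.

End LieIdeals.

(** * Conjugation, series in two variables and twists *)

Section Conjugation.
Variables (k : comPzRingType) (S : complAlgType k).
Implicit Types (g h x y : S).

(** Set to the identity when [h] is not a group element, so that it is a continuous morphism for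
    every [h]. *)
Definition Adg (h x : S) : S := if pselect (grp h) then h * x * cinv h else x.

Lemma AdgE h x : grp h -> Adg h x = h * x * cinv h.
Proof. by rewrite /Adg; case: pselect. Qed.

Section Instance.
Variable h : S.
Fact Adg_is_zmod_morphism : zmod_morphism (Adg h).
Proof. by move=> x y; rewrite /Adg; case: pselect => // Hh; rewrite mulrBr mulrBl. Qed.
Fact Adg_is_monoid_morphism : monoid_morphism (Adg h).
Proof.
split=> [|x y]; rewrite /Adg; case: pselect => // Hh; first by rewrite mulr1 gmulrV.
by rewrite !mulrA gmulrVK.
Qed.
HB.instance Definition _ := GRing.isZmodMorphism.Build _ _ (Adg h) Adg_is_zmod_morphism.
HB.instance Definition _ := GRing.isMonoidMorphism.Build _ _ (Adg h) Adg_is_monoid_morphism.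
Fact Adg_cst c : Adg h (cst c) = cst c.
Proof. by rewrite /Adg; case: pselect => // Hh; rewrite -cstC gmulrKV. Qed.
Fact Adg_fil n x : fil n x -> fil n (Adg h x).
Proof. by rewrite /Adg; case: pselect => // Hh Hx; apply/filMr/filMl. Qed.
HB.instance Definition _ := isContinuous.Build k S S (Adg h) Adg_cst Adg_fil.
End Instance.

Lemma AdgD h x y : Adg h (x + y) = Adg h x + Adg h y. Proof. exact: chomD. Qed.
Lemma AdgB h x y : Adg h (x - y) = Adg h x - Adg h y. Proof. exact: chomB. Qed.
Lemma AdgM h x y : Adg h (x * y) = Adg h x * Adg h y. Proof. exact: chomM. Qed.
Lemma Adg_mul g h x : grp g -> grp h -> Adg (g * h) x = Adg g (Adg h x).
Proof.
by move=> Hg Hh; rewrite !AdgE ?cinvM ?mulrA //; exact: grpM.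
Qed.
Lemma Adg1 x : Adg 1 x = x.
Proof. by rewrite AdgE ?cinv1 ?mul1r ?mulr1 //; exact: grp1. Qed.
Lemma AdgK h x : grp h -> Adg (cinv h) (Adg h x) = x.
Proof. by move=> Hh; rewrite -Adg_mul ?gmulVr ?Adg1 //; exact: grpV. Qed.
Lemma AdgVK h x : grp h -> Adg h (Adg (cinv h) x) = x.
Proof. by move=> Hh; rewrite -Adg_mul ?gmulrV ?Adg1 //; exact: grpV. Qed.
Lemma Adg_id h x : grp h -> h * x = x * h -> Adg h x = x.
Proof. by move=> Hh hx; rewrite AdgE // hx gmulrKV. Qed.
Lemma AdgMl h x : grp h -> Adg h x * h = h * x.
Proof. by move=> Hh; rewrite AdgE // gmulrVK. Qed.
Lemma cinv_approx n g h : grp g -> grp h -> fil n (g - h) -> fil n (cinv g - cinv h).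
Proof.
move=> Hg Hh H; have -> : cinv g - cinv h = cinv g * (h - g) * cinv h.
  by rewrite mulrBr mulrBl gmulrKV // gmulVr // mul1r.
by apply/filMr/filMl/filBC.
Qed.

(** The difference of the conjugating elements is multiplied by [x], of filtration 1. The degree
    gained here drives both existence and uniqueness of [g]. *)
Lemma Adg_approx n g h x : grp g -> grp h -> fil 1 x -> fil n (g - h) ->
  fil n.+1 (Adg g x - Adg h x).
Proof.
move=> Hg Hh Hx H; rewrite !AdgE //; apply: (@fil_trans _ _ _ _ (h * x * cinv g)).
  by rewrite -mulrBl -mulrBl; apply: filMr; rewrite -addn1; apply: filM.
rewrite -mulrBr -add1n; apply: filM; last exact: cinv_approx.
exact: filMl.
Qed.

End Conjugation.

Lemma chom_Adg (k : comPzRingType) (S S' : complAlgType k) (th : chomType S S') h x :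
  grp h -> th (Adg h x) = Adg (th h) (th x).
Proof.
by move=> Hh; rewrite !AdgE ?chomM ?chom_cinv //; exact: chom_grp.
Qed.

Section TwoVariables.
Variables (k : comPzRingType).
Implicit Types f g : series k bool.

Definition ev2 (S : complAlgType k) f (a b : S) : S :=
  ev (fun l : bool => if l then b else a) f.

Lemma chom_ev2 (S S' : complAlgType k) (th : chomType S S') f a b :
  fil 1 a -> fil 1 b -> th (ev2 f a b) = ev2 f (th a) (th b).
Proof.
move=> Ha Hb; rewrite /ev2 chom_ev; first by apply: eq_ev => -[].
by case.
Qed.

Section Fixed.
Variable S : complAlgType k.
Implicit Types a b p q x y : S.

Lemma ev2_A a b : fil 1 a -> fil 1 b -> ev2 (lA k) a b = a.
Proof. by move=> Ha Hb; rewrite /ev2 ev_letter // => -[]. Qed.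
Lemma ev2_B a b : fil 1 a -> fil 1 b -> ev2 (lB k) a b = b.
Proof. by move=> Ha Hb; rewrite /ev2 ev_letter // => -[]. Qed.
Lemma ev2M f g a b : ev2 (f * g) a b = ev2 f a b * ev2 g a b. Proof. exact: evM. Qed.
Lemma ev2V f a b : grp f -> ev2 (cinv f) a b = cinv (ev2 f a b).
Proof. exact: chom_cinv. Qed.
Lemma ev2_grp f a b : grp f -> grp (ev2 f a b).
Proof. exact: chom_grp. Qed.
Lemma ev2_fil n f a b : fil n f -> fil n (ev2 f a b).
Proof. exact: ev_fil. Qed.

Lemma ev2_approx n f a b a' b' : fil 1 a -> fil 1 b -> fil 1 a' -> fil 1 b' ->
  fil n (a - a') -> fil n (b - b') -> fil n (ev2 f a b - ev2 f a' b').
Proof.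
move=> Ha Hb Ha' Hb' Haa Hbb.
apply: (chom_approx (th1 := ev (fun l : bool => if l then b else a))
   (th2 := ev (fun l : bool => if l then b' else a'))) => l.
by rewrite /= !ev_letter; case: l => //; case.
Qed.

Lemma ev2_ev2 f (p q : series k bool) a b : fil 1 p -> fil 1 q ->
  ev2 (ev2 f p q) a b = ev2 f (ev2 p a b) (ev2 q a b).
Proof. exact: chom_ev2. Qed.

Lemma Adg_ev2 h f a b : fil 1 a -> fil 1 b -> Adg h (ev2 f a b) = ev2 f (Adg h a) (Adg h b).
Proof. exact: chom_ev2. Qed.
End Fixed.
End TwoVariables.

Lemma ev_comm (k : comPzRingType) (S : complAlgType k) (X : finType) (a : X -> S) x f :
  (forall i, fil 1 (a i)) -> (forall i, x * a i = a i * x) -> x * ev a f = ev a f * x.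
Proof.
move=> Ha xa; apply: eq_fil => n; elim: n f => [|n IH] f; first exact: fil0.
rewrite chom_decomp mulrDl mulrDr cstC opprD addrACA subrr add0r.
rewrite mulr_sumr mulr_suml -sumrB; apply: fil_sum => i _.
rewrite /= ev_letter // mulrA xa -!mulrA -mulrBr -add1n; exact: filM.
Qed.

Lemma ev2_comm (k : comPzRingType) (S : complAlgType k) x (a b : S) f :
  fil 1 a -> fil 1 b -> x * a = a * x -> x * b = b * x -> x * ev2 f a b = ev2 f a b * x.
Proof. by move=> Ha Hb xa xb; apply: ev_comm => -[]. Qed.

(* the action of GRT_1 on associators *)
Definition twist (k : comPzRingType) (F g : series k bool) : series k bool :=
  ev2 F (Adg g (lA k)) (lB k) * g.

Section Twist.
Variables (k : comPzRingType) (S : complAlgType k) (F g : series k bool).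
Hypothesis Gg : grp g.
Implicit Types a b : S.

Lemma ev2_twist a b : fil 1 a -> fil 1 b ->
  ev2 (twist F g) a b = ev2 F (Adg (ev2 g a b) a) b * ev2 g a b.
Proof.
move=> Ha Hb; have HA : fil 1 (lA k) by exact: fil_letter.
have HB : fil 1 (lB k) by exact: fil_letter.
rewrite /twist ev2M ev2_ev2 ?ev2_B //; last exact: Adg_fil.
by rewrite [ev2 (Adg _ _) _ _](chom_Adg _ _ Gg) /= -/(ev2 _ _ _) -/(ev2 _ _ _) ev2_A.
Qed.

(** The conjugation moves from the first argument to the inverse conjugation of the second. In this
    form the twist keeps [a] fixed and replaces only [b]. *)
Lemma ev2_twist' a b : fil 1 a -> fil 1 b ->
  ev2 (twist F g) a b = ev2 g a b * ev2 F a (Adg (cinv (ev2 g a b)) b).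
Proof.
move=> Ha Hb; have GG : grp (ev2 g a b) by exact: ev2_grp.
rewrite ev2_twist // -(AdgMl _ GG) Adg_ev2 ?AdgVK //; exact: Adg_fil.
Qed.

Lemma grp_twist : grp F -> grp (twist F g).
Proof. by move=> GF; apply: grpM => //; exact: ev2_grp. Qed.

End Twist.

(** If [P] and [Q] agree modulo [n], the two values of [F] agree modulo [n.+1], hence so do [P] and
    [Q]. *)
Lemma twist_inj (k : comPzRingType) (S : complAlgType k) F (a b P Q : S) :
  fil 1 a -> fil 1 b -> grp P -> grp Q ->
  ev2 F (Adg P a) b * P = ev2 F (Adg Q a) b * Q -> grp F -> P = Q.
Proof.
move=> Ha Hb GP GQ E GF; apply: eq_fil; elim=> [|n IH]; first exact: fil0.
have GE : grp (ev2 F (Adg P a) b) by exact: ev2_grp.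
have -> : P - Q = cinv (ev2 F (Adg P a) b) * (ev2 F (Adg Q a) b - ev2 F (Adg P a) b) * Q.
  by rewrite mulrBr gmulVr // mulrBl mul1r -mulrA -E gmulVKr.
apply/filMr/filMl; apply: ev2_approx => //; try exact: Adg_fil.
  by apply: filBC; apply: Adg_approx.
by rewrite subrr; exact: fil_zero.
Qed.

(** * Fixpoints and inversion of systems of series *)

Section SeriesFixpoint.
Variables (k : comPzRingType) (J : Type) (Y : finType).
Local Notation V := (J -> series k Y).
Variables (P : V -> Prop) (T : V -> V) (x0 : V).
Hypothesis P0 : P x0.
Hypothesis PT : forall x, P x -> P (T x).
Hypothesis Tfil : forall n x y, P x -> P y ->
  (forall j, fil n (x j - y j)) -> forall j, fil n.+1 (T x j - T y j).
Hypothesis Plim : forall x,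
  (forall n, exists2 y, P y & forall j, fil n (x j - y j)) -> P x.

(** Contraction principle: the iterates stabilize in each degree. [P] is a closed invariant set, for
    instance that of Lie series, in which the fixpoint is found. *)
Lemma series_fixpoint : exists2 x, P x & forall j, T x j = x j.
Proof.
pose xs n := iter n T x0.
have Pxs n : P (xs n) by elim: n => //= n IH; exact: PT.
have step n j : fil n (xs n.+1 j - xs n j).
  elim: n j => [|n IH] j; first exact: fil0.
  by apply: Tfil => //; exact: (Pxs n.+1).
have step2 m n j : (n <= m)%N -> fil n (xs m j - xs n j).
  move=> /subnK <-; elim: (m - n)%N => [|d IH]; first by rewrite subrr; exact: fil_zero.
  rewrite addSn; apply: fil_trans IH; apply: fil_le (step (d + n)%N j).
  exact: leq_addl.
(* The coefficient at [w] is read off an iterate whose index exceeds the length of [w], from which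
   point on it is constant. *)
pose x j : series k Y := fun w => xs (size w).+1 j w.
have Hx n j : fil n (x j - xs n j).
  move=> w ltw; rewrite subsE /x; apply/eqP; rewrite subr_eq0; apply/eqP.
  have /(_ w (ltnSn _)) /eqP := step2 n (size w).+1 j ltw.
  by rewrite subsE subr_eq0 => /eqP.
have Px : P x by apply: Plim => n; exists (xs n) => // j; exact: Hx.
exists x => // j; apply: eq_fil => n.
apply: (@fil_trans _ _ _ _ (xs n.+1 j)); last by apply/filBC/sfilS/Hx.
by apply/sfilS/Tfil => // i; exact: Hx.
Qed.
End SeriesFixpoint.

Lemma exp_lie_lim (k : comPzRingType) (iota : {rmorphism rat -> k}) (X : finType)
    (g : series k X) :
  (forall n, exists2 h, exp_lie iota h & fil n (g - h)) -> exp_lie iota g.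
Proof.
move=> H; have Gg : grp g.
  by have [h /exp_lie_grp Gh Hh] := H 1%N; apply: fil_trans Hh Gh.
apply/exp_lieE; split=> //; apply: lie_series_lim => n.
have [h /exp_lieE[Gh Lh] Hh] := H n; exists (slog iota h) => //.
rewrite !slogE //; apply: (chom_approx (th1 := ev1 (g - 1)) (th2 := ev1 (h - 1))) => -[].
by rewrite /= !ev1_letter // opprB addrA subrK.
Qed.

(** [g] is a fixpoint of the map sending g to F(Ad(g) A, B)^-1 F', which is contracting because g
    enters only through a conjugation. *)
Lemma twist_surj (k : comPzRingType) (iota : {rmorphism rat -> k}) F F' :
  exp_lie iota F -> exp_lie iota F' -> exists2 g, exp_lie iota g & twist F g = F'.
Proof.
move=> EF EF'; have GF := exp_lie_grp EF.
have HA : fil 1 (lA k) by exact: fil_letter.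
have HB : fil 1 (lB k) by exact: fil_letter.
have LA : lie_series (lA k) by exact: lie_series_letter.
have LB : lie_series (lB k) by exact: lie_series_letter.
pose T (x : unit -> series k bool) (_ : unit) := cinv (ev2 F (Adg (x tt) (lA k)) (lB k)) * F'.
have [||n x y Ex Ey Hxy []|x H|x Ex Tx] :=
  @series_fixpoint k unit bool (fun x => exp_lie iota (x tt)) T (fun _ => 1).
- exact: exp_lie1.
- move=> x Ex; apply: exp_lieM => //; apply/exp_lieV/exp_lie_ev => // -[] //=.
  by rewrite AdgE; [apply: (Ad_lie Ex) | apply: exp_lie_grp Ex].
- rewrite /T -mulrBl; apply/filMr/cinv_approx; try exact: ev2_grp.
  have [Gx Gy] := (exp_lie_grp Ex, exp_lie_grp Ey).
  apply: ev2_approx => //; try exact: Adg_fil; first exact: Adg_approx.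
  by rewrite subrr; exact: fil_zero.
- by apply: exp_lie_lim => n; have [y Ey /(_ tt) Hy] := H n; exists (y tt).
exists (x tt) => //; rewrite /twist -{2}(Tx tt) /T gmulKVr //; exact: ev2_grp.
Qed.

(** Formal inversion theorem. The letter [x] is the combination of the [a y] given by [N] plus a
    remainder [r x] of filtration 2, so u solves u = N b + u(r). [L] makes the Lie property
    optional: it is taken [False] for plain substitutions and [True] when [a] and [b] are Lie
    series. *)
Lemma series_solve (k : comPzRingType) (X Y : finType) (a : X -> series k X)
    (b : X -> series k Y) (M N : X -> X -> k) (L : Prop) :
  (forall x, fil 2 (a x - \sum_y M x y *: letter k y)) ->
  (forall x z, \sum_y N x y * M y z = (x == z)%:R) ->
  (forall x z, \sum_y M x y * N y z = (x == z)%:R) ->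
  (forall x, fil 1 (b x)) ->
  (L -> forall x, lie_series (a x)) -> (L -> forall x, lie_series (b x)) ->
  exists u : X -> series k Y, [/\ forall x, fil 1 (u x),
    L -> forall x, lie_series (u x) & forall x, ev u (a x) = b x].
Proof.
move=> Ha NM MN Hb La Lb.
pose r x := letter k x - \sum_y N x y *: a y.
have Hr x : fil 2 (r x).
  have -> : r x = - \sum_y N x y *: (a y - \sum_z M y z *: letter k z).
    under eq_bigr do rewrite scalerBr scaler_sumr.
    rewrite sumrB opprB /r; congr (_ - _); rewrite exchange_big /=.
    under eq_bigr => z _ do (under eq_bigr do rewrite scalerA); under eq_bigr do rewrite -scaler_suml NM.
    rewrite (bigD1 x) //= eqxx scale1r big1 ?addr0 // => z nz.
    by rewrite eq_sym (negPf nz) scale0r.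
  by apply: filN; apply: fil_sum => y _; apply: sfilZ; exact: Ha.
pose T (u : X -> series k Y) x := \sum_y N x y *: b y + ev u (r x).
pose P (u : X -> series k Y) := (forall x, fil 1 (u x)) /\ (L -> forall x, lie_series (u x)).
have [||n u v [Pu _] [Pv _] Huv x|u H|u [Pu Lu] Tu] := @series_fixpoint k X Y P T (fun _ => 0).
- by split=> *; [exact: fil_zero | exact: lie_series0].
- move=> u [Pu Lu]; split=> [x|HL x].
    apply: filD; last by apply/ev_fil/filS.
    by apply: fil_sum => y _; apply: sfilZ; exact: Hb.
  apply: lie_seriesD; first by apply: lie_series_sum => y _; apply/lie_seriesZ/Lb.
  apply: lie_series_ev; first exact: Lu.
  apply: lie_seriesB; first exact: lie_series_letter.
  by apply: lie_series_sum => y _; apply/lie_seriesZ/La.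
- rewrite /T opprD addrACA subrr add0r.
  by apply: (chom_approx2 (th1 := ev u) (th2 := ev v)) => // y; rewrite /= !ev_letter.
- split=> [x|HL x].
    have [v [Pv _] /(_ x) Hv] := H 1%N.
    by rewrite -[u x](subrK (v x)); apply: filD.
  by apply: lie_series_lim => n; have [v [_ Lv] Hv] := H n; exists (v x) => //; apply: Lv.
exists u; split=> // x.
have E y : \sum_z N y z *: (b z - ev u (a z)) = 0.
  have := Tu y; rewrite /T /r evB ev_letter // ev_sum.
  under [X in _ + (_ - X)]eq_bigr do rewrite evZ -scale_cst.
  move=> /eqP; rewrite addrCA -subr_eq0 addrAC subrr add0r -sumrB => /eqP H.
  rewrite -[RHS]H.
  by apply: eq_bigr => z _; rewrite scalerBr.
(* The fixpoint equation says that [N] annihilates the defect; applying [M] removes [N]. *)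
have : \sum_y M x y *: (\sum_z N y z *: (b z - ev u (a z))) = 0.
  by rewrite big1 // => y _; rewrite E scaler0.
under eq_bigr do rewrite scaler_sumr.
rewrite exchange_big /=; under eq_bigr => z _ do (under eq_bigr do rewrite scalerA).
under eq_bigr do rewrite -scaler_suml MN.
rewrite (bigD1 x) //= eqxx scale1r big1 ?addr0 => [/eqP|z nz].
  by rewrite subr_eq0 => /eqP.
by rewrite eq_sym (negPf nz) scale0r.
Qed.

(** * Exponentials with a scalar coefficient *)

Section CExp.
Variables (k : comPzRingType) (iota : {rmorphism rat -> k}) (S : complAlgType k).
Implicit Types (x y h : S) (c d : k).

Definition cex c x : S := cexp iota (cst c * x).

Lemma cex_grp c x : grp (cex c x). Proof. exact: grp_cexp. Qed.
Lemma filcst n c x : fil n x -> fil n (cst c * x). Proof. exact: filMl. Qed.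
Lemma cst_commr c x y : x * y = y * x -> (cst c * x) * y = y * (cst c * x).
Proof. by move=> xy; rewrite -mulrA xy !mulrA cstC. Qed.
Lemma cex_comm c x y : fil 1 x -> x * y = y * x -> cex c x * y = y * cex c x.
Proof. by move=> Hx xy; apply: cexp_comm; [apply: filcst | apply: cst_commr]. Qed.
Lemma cexD c x y : fil 1 x -> fil 1 y -> x * y = y * x ->
  cex c (x + y) = cex c x * cex c y.
Proof.
move=> Hx Hy xy; rewrite /cex mulrDr cexpD //; try exact: filcst.
by apply: cst_commr; apply/esym/cst_commr.
Qed.
Lemma cexDl c d x : fil 1 x -> cex (c + d) x = cex c x * cex d x.
Proof.
move=> Hx; rewrite /cex cstD mulrDl cexpD //; try exact: filcst.
by apply: cst_commr; apply/esym/cst_commr.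
Qed.
Lemma cexN c x : fil 1 x -> cex (- c) x = cinv (cex c x).
Proof. by move=> Hx; rewrite /cex cstN mulNr cexpN //; exact: filcst. Qed.
End CExp.

Lemma chom_cex (k : comPzRingType) (iota : {rmorphism rat -> k})
  (S S' : complAlgType k) (th : chomType S S') c x : fil 1 x ->
  th (cex iota c x) = cex iota c (th x).
Proof.
by move=> Hx; rewrite /cex chom_cexp ?chomM ?chom_cst //; exact: filcst.
Qed.

Lemma Adg_cex (k : comPzRingType) (iota : {rmorphism rat -> k}) (S : complAlgType k)
  (h : S) c x : fil 1 x -> Adg h (cex iota c x) = cex iota c (Adg h x).
Proof. exact: chom_cex. Qed.

(* central sum: the defining property of (t12, t23, t13) *)
Definition tri (k : comPzRingType) (S : complAlgType k) (a b c : S) :=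
  [/\ fil 1 a, fil 1 b, fil 1 c,
      (a + b + c) * a = a * (a + b + c) & (a + b + c) * b = b * (a + b + c)].

(** * Relations of associators, evaluated on triples *)

Section Systems.
Variables (k : comPzRingType) (iota : {rmorphism rat -> k}).
Implicit Types (F g : series k bool) (nu : k).
Local Notation e := (cex iota).

Definition dualS F := forall (S : complAlgType k) (a b : S), fil 1 a -> fil 1 b ->
  ev2 F b a = cinv (ev2 F a b).
Definition cycS g := forall (S : complAlgType k) (a b c : S), tri a b c ->
  ev2 g c a * ev2 g b c * ev2 g a b = 1.
Definition sumS g := forall (S : complAlgType k) (a b c : S), tri a b c ->
  a + Adg (cinv (ev2 g a b)) b + Adg (cinv (ev2 g a c)) c = a + b + c.
(** [nu] is half of the coupling constant [mu], and [a], [b], [c] stand for t_12, t_23, t_13. *)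
Definition hexS nu F := forall (S : complAlgType k) (a b c : S), tri a b c ->
  e nu b * ev2 F a b * e nu a * ev2 F c a * e nu c * ev2 F b c = e nu (a + b + c).

Section Tri.
Variable S : complAlgType k.
Implicit Types a b c x : S.

Lemma tri_c a b c : tri a b c -> (a + b + c) * c = c * (a + b + c).
Proof.
case=> _ _ _ ca cb.
have -> : c = (a + b + c) - a - b by ncring.
rewrite !mulrBr !mulrBl; set T := a + b + c in ca cb *.
have -> : a + b + (T - a - b) = T by ncring.
by rewrite ca cb.
Qed.

Lemma tri_sym12 a b c : tri a b c -> tri a c b.
Proof.
move=> H; have cc := tri_c H; case: H => Ha Hb Hc ca cb.
have E : a + c + b = a + b + c by ncring.
by split; rewrite ?E.
Qed.
Lemma tri_rot a b c : tri a b c -> tri b c a.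
Proof.
move=> H; have cc := tri_c H; case: H => Ha Hb Hc ca cb.
have E : b + c + a = a + b + c by ncring.
by split; rewrite ?E.
Qed.
Lemma tri_fil a b c : tri a b c -> fil 1 (a + b + c).
Proof. by case=> Ha Hb Hc _ _; apply: filD => //; exact: filD. Qed.
Lemma tri_ev2 a b c F : tri a b c -> (a + b + c) * ev2 F a b = ev2 F a b * (a + b + c).
Proof. by case=> Ha Hb Hc ca cb; apply: ev2_comm. Qed.
End Tri.

Section TwistTriple.
Variables (S : complAlgType k) (a b c : S) (g : series k bool).
Hypothesis H : tri a b c.
Hypotheses (Gg : grp g) (gd : dualS g) (gs : sumS g).

(** By [sumS] the twisted triple has the same sum as the original one. This sum commutes with [a]
    and [b], hence with [g(a, b)] and with the conjugate of [b]. *)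
Lemma tri_twist : tri a (Adg (cinv (ev2 g a b)) b) (Adg (cinv (ev2 g a c)) c).
Proof.
have [Ha Hb Hc ca cb] := H; have E := gs H.
split; rewrite ?E //; try exact: Adg_fil.
rewrite AdgE; last by apply/grpV/ev2_grp.
rewrite cinvK; last exact: ev2_grp.
have Tg := tri_ev2 g H; set G := ev2 g a b in Tg *.
have TgV : cinv G * (a + b + c) = (a + b + c) * cinv G.
  by apply: cinv_comm => //; exact: ev2_grp.
by rewrite !mulrA -TgV -!mulrA -Tg; congr (_ * _); rewrite !mulrA cb.
Qed.
End TwistTriple.

Lemma twist_dual F g : grp F -> grp g -> dualS F -> dualS g -> dualS (twist F g).
Proof.
move=> GF Gg Fd gd S a b Ha Hb; apply: cinv_uniq.
  by apply: ev2_grp; apply: grp_twist.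
rewrite [ev2 _ a b]ev2_twist' // ev2_twist // (gd _ a b) //.
have GG : grp (ev2 g a b) by exact: ev2_grp.
set G := ev2 g a b in GG *; set b' := Adg (cinv G) b.
have Hb' : fil 1 b' by exact: Adg_fil.
by rewrite (Fd _ a b') // mulrA gmulrKV ?gmulrV //; exact: ev2_grp.
Qed.

Section CycFacts.
Variables (S : complAlgType k) (a b c : S) (g : series k bool).
Hypotheses (H : tri a b c) (Gg : grp g) (gd : dualS g) (gc : cycS g).

Lemma cyc_bc : ev2 g b c = ev2 g a c * cinv (ev2 g a b).
Proof.
have [Ha Hb Hc _ _] := H; have := gc H; rewrite [ev2 g c a]gd // => E.
have Gac : grp (ev2 g a c) by exact: ev2_grp.
have Gab : grp (ev2 g a b) by exact: ev2_grp.
apply: (mulrI_grp (grpV Gac)); rewrite gmulVKr //.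
by apply: (mulIr_grp Gab); rewrite E gmulVr.
Qed.
End CycFacts.

Lemma hex_twist F g (S : complAlgType k) (a b c : S) nu : tri a b c ->
  grp F -> grp g -> dualS g -> sumS g -> 
  let b' := Adg (cinv (ev2 g a b)) b in let c' := Adg (cinv (ev2 g a c)) c in
  ev2 F a b' = cinv (ev2 g a b) * ev2 (twist F g) a b /\
  ev2 F c' a = ev2 (twist F g) c a * ev2 g a c.
Proof.
move=> H GF Gg gd gs b' c'; have [Ha Hb Hc _ _] := H; split.
  by rewrite ev2_twist' // gmulVKr //; exact: ev2_grp.
rewrite ev2_twist // gd // gmulrVK //; last exact: ev2_grp.
Qed.

(** By the cyclic relation [g(b, c)] is [g(a, c) g(a, b)^-1], so the value of [F] at the two
    conjugates is a conjugate of F(Ad(g(b, c)) b, c), in which the twist is recognized. *)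
Lemma bc_twist F g (S : complAlgType k) (a b c : S) : tri a b c ->
  grp F -> grp g -> dualS g -> cycS g ->
  ev2 F (Adg (cinv (ev2 g a b)) b) (Adg (cinv (ev2 g a c)) c) =
  cinv (ev2 g a c) * ev2 (twist F g) b c * ev2 g a b.
Proof.
move=> H GF Gg gd gc; have [Ha Hb Hc _ _] := H.
have Gac : grp (ev2 g a c) by exact: ev2_grp.
have Gab : grp (ev2 g a b) by exact: ev2_grp.
rewrite ev2_twist // (cyc_bc H) // Adg_mul //; last exact: grpV.
have -> : ev2 F (Adg (ev2 g a c) (Adg (cinv (ev2 g a b)) b)) c =
  Adg (ev2 g a c) (ev2 F (Adg (cinv (ev2 g a b)) b) (Adg (cinv (ev2 g a c)) c)).
  by rewrite Adg_ev2 ?AdgVK //; exact: Adg_fil.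
set X := ev2 F (Adg (cinv (ev2 g a b)) b) _.
by rewrite [Adg _ X]AdgE // !mulrA gmulVr // mul1r !gmulrVK.
Qed.

(** The hexagon of [F] is applied to the twisted triple. Its sum is unchanged and the factors of [g]
    cancel between neighbours, leaving one conjugation by [g(a, b)], which the central exponential
    absorbs. *)
Lemma twist_hex nu F g : grp F -> grp g -> dualS F -> hexS nu F ->
  dualS g -> cycS g -> sumS g -> hexS nu (twist F g).
Proof.
move=> GF Gg Fd Fh gd gc gs S a b c H; have [Ha Hb Hc ca cb] := H.
have Gac : grp (ev2 g a c) by exact: ev2_grp.
have Gab : grp (ev2 g a b) by exact: ev2_grp.
have := Fh _ _ _ _ (tri_twist H Gg gs); rewrite (gs _ _ _ _ H).
have [-> ->] := hex_twist nu H GF Gg gd gs.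
rewrite bc_twist // -!Adg_cex // !AdgE ?cinvK //; try exact: grpV.
rewrite !mulrA !gmulrKV // => E.
have HT := tri_fil H.
have TG : e nu (a + b + c) * ev2 g a b = ev2 g a b * e nu (a + b + c).
  by apply: cex_comm => //; exact: tri_ev2.
apply: (mulIr_grp Gab); apply: (mulrI_grp (grpV Gab)).
by rewrite TG gmulVKr // !mulrA.
Qed.

End Systems.

(** * Group words *)

Inductive gexp := GVar of nat | GMul of gexp & gexp | GInv of gexp | GOne.

Fixpoint glist (inv : bool) (e : gexp) : seq (bool * nat) :=
  match e with
  | GVar n => [:: (inv, n)]
  | GMul a b => if inv then glist inv b ++ glist inv a else glist inv a ++ glist inv b
  | GInv a => glist (~~ inv) a
  | GOne => [::]
  end.

Fixpoint gvars (e : gexp) : seq nat :=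
  match e with
  | GVar n => [:: n] | GMul a b => gvars a ++ gvars b | GInv a => gvars a | GOne => [::]
  end.
(** Variables occurring under an inverse: to move inverses down to the letters, these must be known
    to be group elements. *)
Fixpoint givars (e : gexp) : seq nat :=
  match e with
  | GVar n => [::] | GMul a b => givars a ++ givars b | GInv a => gvars a | GOne => [::]
  end.

Definition gpush (x : bool * nat) (s : seq (bool * nat)) :=
  if s is y :: s' then if (x.2 == y.2) && (x.1 != y.1) then s' else x :: s else [:: x].
Definition greduce (s : seq (bool * nat)) := foldr gpush [::] s.

Section GroupWords.
Variables (k : comPzRingType) (S : complAlgType k) (env : seq S).

Fixpoint geval (e : gexp) : S :=
  match e with
  | GVar n => nth 0 env n | GMul a b => geval a * geval b
  | GInv a => cinv (geval a) | GOne => 1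
  end.
Definition gletter (x : bool * nat) : S := if x.1 then cinv (nth 0 env x.2) else nth 0 env x.2.
Definition gword (s : seq (bool * nat)) : S := \prod_(x <- s) gletter x.
Definition gok (l : seq nat) := foldr (fun n P => grp (nth 0 env n) /\ P) True l.

Lemma gokP l : gok l -> forall n, n \in l -> grp (nth 0 env n).
Proof.
elim: l => //= m l IH [Hm Hl] n; rewrite inE => /orP[/eqP->//|]; exact: IH.
Qed.

Lemma geval_inv e : (forall n, n \in gvars e -> grp (nth 0 env n)) ->
  [/\ grp (geval e), geval e = gword (glist false e) & cinv (geval e) = gword (glist true e)].
Proof.
elim: e => [n|a IHa b IHb|a IHa|] H /=.
- by rewrite /gword !big_seq1 /gletter; split=> //; apply: H; rewrite inE.
- have [|Ga Ea Eai] := IHa; first by move=> n na; apply: H; rewrite mem_cat na.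
  have [|Gb Eb Ebi] := IHb; first by move=> n nb; apply: H; rewrite mem_cat nb orbT.
  rewrite /gword !big_cat -!/(gword _) /= -Ea -Eb -Eai -Ebi cinvM //.
  by split=> //; exact: grpM.
- have [//|Ga Ea Eai] := IHa; split=> //; [exact: grpV | by rewrite cinvK].
- by rewrite /gword big_nil cinv1; split=> //; exact: grp1.
Qed.

Lemma geval_word e : (forall n, n \in givars e -> grp (nth 0 env n)) ->
  geval e = gword (glist false e).
Proof.
elim: e => [n|a IHa b IHb|a IHa|] H /=.
- by rewrite /gword big_seq1.
- rewrite /gword big_cat -!/(gword _) IHa ?IHb // => n nn; apply: H; rewrite mem_cat nn ?orbT //.
- by have [] := geval_inv H.
- by rewrite /gword big_nil.
Qed.

Lemma greduce_word s : (forall n, (true, n) \in s -> grp (nth 0 env n)) ->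
  gword s = gword (greduce s) /\ {subset greduce s <= s}.
Proof.
elim: s => [|x s IH] H //=.
have [|E sub] := IH; first by move=> n ns; apply: H; rewrite inE ns orbT.
rewrite /gword big_cons -/(gword s) E; case Es: (greduce s) => [|y s'] /=.
  split; first by rewrite /gword big_seq1 big_nil mulr1.
  by move=> z; rewrite !inE => ->.
case: ifP => [/andP[/eqP xy2 xy1]|_]; last first.
  split; first by rewrite /gword !big_cons.
  by move=> z; rewrite inE => /orP[/eqP->|zs]; rewrite inE ?eqxx // sub ?orbT // Es.
split; last by move=> z zs; rewrite inE sub ?orbT // Es inE zs orbT.
rewrite /gword big_cons mulrA.
have Gy : grp (nth 0 env y.2).
  have ys : y \in s by apply: sub; rewrite Es inE eqxx.
  case: x y xy1 xy2 ys {Es} H => [[] n] [[] m] //= _ -> ys; apply.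
    by rewrite inE eqxx.
  by rewrite inE ys orbT.
rewrite (_ : gletter x * gletter y = 1) ?mul1r //.
case: x y xy1 xy2 Gy {Es H} => [[] n] [[] m] //= _ -> Gm; rewrite /gletter /=.
  by rewrite gmulVr.
by rewrite gmulrV.
Qed.

Lemma gwordP e1 e2 :
  gok (undup (givars e1 ++ givars e2 ++
        [seq x.2 | x <- glist false e1 ++ glist false e2 & x.1])) ->
  greduce (glist false e1) == greduce (glist false e2) -> geval e1 = geval e2.
Proof.
move=> /gokP H /eqP E; rewrite !geval_word; last first.
- by move=> n nn; apply: H; rewrite mem_undup !mem_cat nn.
- by move=> n nn; apply: H; rewrite mem_undup !mem_cat nn orbT.
have [|-> _] := @greduce_word (glist false e1).
  move=> n nn; apply: H; rewrite mem_undup !mem_cat; apply/orP; right; apply/orP; right.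
  by apply/mapP; exists (true, n) => //; rewrite mem_filter mem_cat nn.
have [|-> _] := @greduce_word (glist false e2); last by rewrite E.
move=> n nn; apply: H; rewrite mem_undup !mem_cat; apply/orP; right; apply/orP; right.
by apply/mapP; exists (true, n) => //; rewrite mem_filter mem_cat nn orbT.
Qed.
End GroupWords.

Ltac gw_env env t :=
  lazymatch t with
  | (?a * ?b)%R => let e := gw_env env a in gw_env e b
  | cinv ?a => gw_env env a
  | (1)%R => env
  | _ => match constr:(Set) with
         | _ => let _ := nr_lookup env t in env
         | _ => let T := lazymatch type of env with seq ?T => T end in
                let e := eval cbv [cat] in (cat env (@cons T t (@nil T))) in e
         end
  end.
Ltac gw_reify env t :=
  lazymatch t with
  | (?a * ?b)%R => let x := gw_reify env a in let y := gw_reify env b in constr:(GMul x y)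
  | cinv ?a => let x := gw_reify env a in constr:(GInv x)
  | (1)%R => constr:(GOne)
  | _ => let n := nr_lookup env t in constr:(GVar n)
  end.
Ltac grps := repeat first
  [ assumption | match goal with H : forall _, grp _ |- _ => solve [apply: H] end
  | apply: grpM | apply: grpV | apply: cex_grp | apply: ev2_grp
  | apply: grp1 | apply: grp_twist | exact: chom_grp ].
(* proves equalities of group words *)
Ltac gw :=
  lazymatch goal with
  | |- @eq ?T ?u ?v =>
    let e0 := constr:(@nil T) in
    let e1 := gw_env e0 u in
    let env := gw_env e1 v in
    let a := gw_reify env u in
    let b := gw_reify env v in
    refine (@gwordP _ _ env a b _ _);
    [ let l := constr:(undup (givars a ++ givars b ++
        [seq x.2 | x <- glist false a ++ glist false b & x.1])) in
      let l' := eval vm_compute in l in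
      change (gok env l'); cbn [gok foldr nth]; repeat split; grps
    | vm_compute; reflexivity ]
  end.
(* proves x = y from E : u = v when x = u and y = v are equalities of group words *)
Ltac gby E := etransitivity; [|etransitivity; [exact: E|]]; gw.

Section Commutation.
Variables (k : comPzRingType) (S : complAlgType k) (t : S).
Lemma centM (x y : S) : t * x = x * t -> t * y = y * t -> t * (x * y) = x * y * t.
Proof. by move=> tx ty; rewrite mulrA tx -mulrA ty mulrA. Qed.
Lemma centV (x : S) : grp x -> t * x = x * t -> t * cinv x = cinv x * t.
Proof. by move=> Gx tx; apply/esym/cinv_comm. Qed.
Lemma centD (x y : S) : t * x = x * t -> t * y = y * t -> t * (x + y) = (x + y) * t.
Proof. by move=> tx ty; rewrite mulrDl mulrDr tx ty. Qed.
Lemma centN (x : S) : t * x = x * t -> t * - x = - x * t.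
Proof. by move=> tx; rewrite mulrN mulNr tx. Qed.
Lemma cent_cex (iota : {rmorphism rat -> k}) c (x : S) : fil 1 x ->
  t * x = x * t -> t * cex iota c x = cex iota c x * t.
Proof. by move=> Hx tx; apply/esym/cex_comm. Qed.
Lemma cent_Adg (h x : S) : grp h -> t * h = h * t -> t * x = x * t ->
  t * Adg h x = Adg h x * t.
Proof. by move=> Gh th tx; rewrite AdgE //; apply: centM; [apply: centM | apply: centV]. Qed.
End Commutation.
Ltac cent := repeat first
  [ assumption | apply: cent_cex | apply: ev2_comm | apply: cent_Adg
  | apply: centM | apply: centV | apply: centD | apply: centN | progress grps ].

Lemma conj_approx (k : comPzRingType) (S : complAlgType k) n (h x : S) :
  grp h -> fil n x -> fil n.+1 (cinv h * x * h - x).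
Proof.
move=> Gh Hx; have -> : cinv h * x * h - x = cinv h * (x * (h - 1) - (h - 1) * x).
  rewrite (_ : x * (h - 1) - (h - 1) * x = x * h - h * x); last by ncring.
  by rewrite mulrBr !mulrA gmulVr // mul1r.
apply: filMl; apply: filB.
  by rewrite -addn1; apply: filM.
by rewrite -add1n; apply: filM.
Qed.

Lemma cex_approx2 (k : comPzRingType) (iota : {rmorphism rat -> k}) (S : complAlgType k)
  c (x : S) : fil 1 x -> fil 2 (cex iota c x - 1 - cst c * x).
Proof.
move=> Hx; have := cexp_approx iota 2 (filcst c Hx).
rewrite !big_ord_recl big_ord0 /= !invr1 !rmorph1 !cst1 !mul1r addr0.
by rewrite opprD addrA.
Qed.

(** * Associators with the same invertible coupling constant *)

Section TransitivityM.
Variables (k : comPzRingType) (iota : {rmorphism rat -> k}).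
Variables (nu nu' : k) (nuV : nu * nu' = 1).
Implicit Types (F g : series k bool).
Local Notation e := (cex iota).

Lemma cex_inj (S : complAlgType k) (x y : S) : fil 1 x -> fil 1 y ->
  e nu x = e nu y -> x = y.
Proof.
move=> Hx Hy E; have := log_cexp iota (filcst nu Hx).
rewrite -/(cex iota nu x) E log_cexp; last exact: filcst.
move=> /(congr1 (fun z => cst nu' * z)); rewrite !mulrA -!cstM mulrC nuV cst1.
by rewrite !mul1r.
Qed.

(** Phi^-1 e^(mu t_23) Phi, the image of a pure braid generator under the associator; the
    exponential is squared because [nu] is half of [mu]. *)
Definition Yel F (S : complAlgType k) (a b : S) :=
  cinv (ev2 F a b) * (e nu b * e nu b) * ev2 F a b.

Lemma Yel_grp F (S : complAlgType k) (a b : S) : grp F -> grp (Yel F a b).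
Proof.
move=> GF; have GE := ev2_grp a b GF.
by do 2! [apply: grpM => //]; [exact: grpV | apply: grpM; exact: cex_grp].
Qed.

Lemma Yel_twist F g (S : complAlgType k) (a b : S) : grp F -> grp g ->
  fil 1 a -> fil 1 b ->
  Yel F a (Adg (cinv (ev2 g a b)) b) = Yel (twist F g) a b.
Proof.
move=> GF Gg Ha Hb; have GG := ev2_grp a b Gg.
have Eb : e nu (Adg (cinv (ev2 g a b)) b) = cinv (ev2 g a b) * e nu b * ev2 g a b.
  by rewrite -Adg_cex // AdgE ?cinvK //; exact: grpV.
by rewrite /Yel [ev2 (twist F g) a b]ev2_twist' // Eb; gw.
Qed.

(** To first order, [Yel - 1] is 2 nu times the second variable. As 2 nu is invertible, [a] and
    [Yel - 1] generate the series in two variables, and [chom_gen] applies. *)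
Lemma Yel_inj F (S : complAlgType k) (a b1 b2 : S) : grp F ->
  fil 1 a -> fil 1 b1 -> fil 1 b2 -> Yel F a b1 = Yel F a b2 -> b1 = b2.
Proof.
move=> GF Ha Hb1 Hb2 E.
have HA : fil 1 (lA k) by exact: fil_letter.
have HB : fil 1 (lB k) by exact: fil_letter.
pose Y := Yel F (lA k) (lB k).
pose al (l : bool) := if l then Y - 1 else lA k.
have ev2al b : fil 1 b -> ev2 (Y - 1) a b = Yel F a b - 1.
  move=> Hb; have E2 : ev2 F (lA k) (lB k) = F by rewrite -[RHS]ev_id; apply: eq_ev => -[].
  have Ee : ev2 (e nu (lB k)) a b = e nu b.
    have -> : ev2 (e nu (lB k)) a b = e nu (ev2 (lB k) a b) by exact: chom_cex.
    by rewrite ev2_B.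
  by rewrite /ev2 evB ev_one -[ev _ _]/(ev2 _ _ _) /Y /Yel E2 !ev2M ev2V ?Ee.
pose nV := iota (1 / 2%:R) * nu'.
have NuV : nV * (nu + nu) = 1.
  have h2 : iota (1 / 2%:R) + iota (1 / 2%:R) = 1.
    by rewrite -rmorphD (_ : 1 / 2%:R + 1 / 2%:R = 1 :> rat) ?rmorph1 //; apply/eqP.
  by rewrite /nV -mulrA mulrDr [nu' * nu]mulrC nuV -[X in _ * X]mulr2n mulr_natr mulr2n.
have HY : fil 2 (Y - 1 - cst (nu + nu) * lB k).
  have E2 : ev2 F (lA k) (lB k) = F by rewrite -[RHS]ev_id; apply: eq_ev => -[].
  have He : fil 1 (e (nu + nu) (lB k) - 1) by exact: cex_grp.
  apply: (@fil_trans _ _ _ _ (e (nu + nu) (lB k) - 1)).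
    have -> : Y - 1 = cinv F * (e (nu + nu) (lB k) - 1) * F.
      by rewrite mulrBr mulrBl mulr1 gmulVr // cexDl // /Y /Yel E2.
    exact: conj_approx.
  exact: cex_approx2.
(* Inverse of the linear part of [al]: the identity on the first variable, and the inverse [nV] of 2
   nu on the second. *)
pose N (x y : bool) : k := if x then (if y then nV else 0) else (~~ y)%:R.
rewrite -(ev2_B Ha Hb1) -(ev2_B Ha Hb2).
apply: (chom_gen (th1 := ev (fun l : bool => if l then b1 else a))
  (th2 := ev (fun l : bool => if l then b2 else a)) (a := al) (N := N)) => -[].
- rewrite big_bool /N /al /= scale0r addr0 -/(lB k).
  have -> : lB k - nV *: (Y - 1) = - (cst nV * (Y - 1 - cst (nu + nu) * lB k)).
    by rewrite mulrBr mulrA -cstM NuV cst1 mul1r opprB scale_cst.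
  by apply/filN/filcst.
- rewrite big_bool /N /al /= scale0r add0r scale1r subrr; exact: fil_zero.
- by rewrite /al /= -[LHS]/(ev2 _ _ _) -[RHS]/(ev2 _ _ _) !ev2al ?E.
- by rewrite /al /= -[LHS]/(ev2 _ _ _) -[RHS]/(ev2 _ _ _) !ev2_A.
Qed.

Section HexY.
Variables (F : series k bool) (S : complAlgType k) (a b c : S).
Hypotheses (GF : grp F) (Fd : dualS F) (Fh : hexS iota nu F) (H : tri a b c).

Lemma tri_cex_comm x : (a + b + c) * x = x * (a + b + c) ->
  e nu (a + b + c) * x = x * e nu (a + b + c).
Proof. by move=> cx; apply: cex_comm => //; apply: tri_fil H. Qed.

(** The hexagons for (a, b, c) and (a, c, b) are multiplied so that [F(b, c)] is eliminated. The
    outcome is the decomposition of the full twist of three strands into pure braid generators. *)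
Lemma hex_Y : Yel F a c = e nu (a + b + c) * e nu (a + b + c) *
  (cinv (e nu a) * cinv (Yel F a b) * cinv (e nu a)).
Proof.
have [Ha Hb Hc ca cb] := H; have cc := tri_c H.
have := Fh H; have := Fh (tri_sym12 H).
have -> : a + c + b = a + b + c by ncring.
rewrite (Fd Ha Hb) (Fd Ha Hc) (Fd Hb Hc) => h2 h1.
have Gab := ev2_grp a b GF; have Gac := ev2_grp a c GF; have Gbc := ev2_grp b c GF.
have Ea := cex_grp iota nu a; have Eb := cex_grp iota nu b; have Ec := cex_grp iota nu c.
have TF p q : (a + b + c) * p = p * (a + b + c) -> (a + b + c) * q = q * (a + b + c) ->
  fil 1 p -> fil 1 q -> e nu (a + b + c) * ev2 F p q = ev2 F p q * e nu (a + b + c).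
  by move=> cp cq Hp Hq; apply: tri_cex_comm; apply: ev2_comm.
have Tab := TF a b ca cb Ha Hb; have Tac := TF a c ca cc Ha Hc; have Tbc := TF b c cb cc Hb Hc.
have TE x : (a + b + c) * x = x * (a + b + c) -> fil 1 x ->
   e nu (a + b + c) * e nu x = e nu x * e nu (a + b + c).
  by move=> cx Hx; apply: tri_cex_comm; apply/esym/cex_comm.
have TEa := TE a ca Ha; have TEb := TE b cb Hb; have TEc := TE c cc Hc.
set T := e nu (a + b + c) in h1 h2 Tab Tac Tbc TEa TEb TEc *.
rewrite /Yel; move: Gab Gac Gbc Ea Eb Ec Tab Tac Tbc TEa TEb TEc h1 h2.
move: (ev2 F a b) (ev2 F a c) (ev2 F b c) (e nu a) (e nu b) (e nu c) => x y z p q r.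
move=> Gx Gy Gz Gp Gq Gr Tx Ty Tz Tp Tq Tr h1 h2.
have k1 : r * z = y * cinv p * cinv x * cinv q * T.
  by gby (congr1 (fun t => y * cinv p * cinv x * cinv q * t) h1).
have k2 : r * y * p * cinv x * q = T * z by rewrite -h2; gw.
have k3 : r * (r * y * p * cinv x * q) = T * (y * cinv p * cinv x * cinv q * T).
  by rewrite k2 -k1 mulrA -Tr mulrA.
have TWW : T * (y * cinv p * cinv x * cinv q) = (y * cinv p * cinv x * cinv q) * T by cent.
have TW : T * T * (y * cinv p * cinv x * cinv q) = y * cinv p * cinv x * cinv q * (T * T).
  by rewrite -mulrA TWW mulrA TWW mulrA.
have k4 : r * (r * y * p * cinv x * q) = T * T * (y * cinv p * cinv x * cinv q).
  by rewrite k3 TW mulrA TWW -mulrA.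
have TY : T * T * y = y * (T * T) by rewrite -mulrA Ty mulrA Ty mulrA.
transitivity (cinv y * (T * T * y) * (cinv p * cinv x * cinv q * cinv q * x * cinv p)).
  by gby (congr1 (fun t => cinv y * t * (cinv q * x * cinv p)) k4).
by rewrite TY; gw.
Qed.
End HexY.

Section QuotientOfAssociators.
Variables (F g : series k bool).
Hypotheses (GF : grp F) (Gg : grp g) (Fd : dualS F) (Fh : hexS iota nu F).
Hypotheses (Fd' : dualS (twist F g)) (Fh' : hexS iota nu (twist F g)).

(** [g(b, a)] and the inverse of [g(a, b)] solve the same twist equation, so [twist_inj] identifies
    them. *)
Lemma untwist_dual : dualS g.
Proof.
move=> S a b Ha Hb; have GG := ev2_grp a b Gg; have GG' := ev2_grp b a Gg.
apply: (twist_inj Hb Ha GG' (grpV GG) (F := F)) => //.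
rewrite -ev2_twist // (Fd' Ha Hb) ev2_twist' // cinvM //; last exact: ev2_grp.
by rewrite [ev2 F (Adg _ b) a]Fd //; exact: Adg_fil.
Qed.

(** With [b''] defined so that (a, b'', c') has the required sum, this triple is a system because
    [c'] commutes with the sum. [hex_Y] for [F] on it and for the twist on (a, b, c) then give [b'']
    and [b'] the same [Yel], hence equality. *)
Lemma untwist_sum : sumS g.
Proof.
move=> S a b c H; have [Ha Hb Hc ca cb] := H; have cc := tri_c H.
set b' := Adg _ b; set c' := Adg _ c.
have Hb' : fil 1 b' by exact: Adg_fil.
have Hc' : fil 1 c' by exact: Adg_fil.
pose b'' := a + b + c - a - c'.
have Hb'' : fil 1 b'' by apply/filB/Hc'/filB/Ha/tri_fil.
have Gac := ev2_grp a c Gg.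
have TG : (a + b + c) * ev2 g a c = ev2 g a c * (a + b + c) by cent.
have Tc' : (a + b + c) * c' = c' * (a + b + c) by cent.
have ET : a + b'' + c' = a + b + c.
  by rewrite /b''; set T := a + b + c; ncring.
have H'' : tri a b'' c'.
  split; rewrite ?ET // /b''; set T := a + b + c in ca Tc' *.
  by rewrite !mulrBr !mulrBl ca Tc'.
have := hex_Y GF Fd Fh H''; rewrite ET // Yel_twist // => Y1.
have := hex_Y (grp_twist Gg GF) Fd' Fh' H; rewrite Y1 => Y2.
have GE := cex_grp iota nu a.
have GT := cex_grp iota nu (a + b + c).
have Y3 : Yel F a b'' = Yel F a b'.
  rewrite [RHS]Yel_twist //; move: Y2.
  have := Yel_grp a b (grp_twist Gg GF); have := Yel_grp a b'' GF.
  move=> Gu Gv E.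
  by gby (congr1 (fun t => cinv (e nu a) * cinv t *
    (e nu (a + b + c) * e nu (a + b + c)) * cinv (e nu a)) E).
have -> : b' = b'' by apply: (Yel_inj GF Ha) => //; rewrite Y3.
by [].
Qed.

(** The hexagon of [F] on the twisted triple and that of the twist on the original one share all
    factors except those at (b, c). Cancelling leaves two solutions of one twist equation. *)
Lemma untwist_cyc : cycS g.
Proof.
have gd := untwist_dual; have gs := untwist_sum.
move=> S a b c H; have [Ha Hb Hc ca cb] := H; have cc := tri_c H.
have Gac := ev2_grp a c Gg; have Gab := ev2_grp a b Gg.
have GF' : grp (twist F g) by exact: grp_twist.
have := Fh (tri_twist H Gg gs); rewrite (gs _ _ _ _ H).
have [-> ->] := hex_twist nu H GF Gg gd gs.
set b' := Adg _ b; set c' := Adg _ c.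
have -> : e nu b' = cinv (ev2 g a b) * e nu b * ev2 g a b.
  by rewrite -Adg_cex // AdgE ?cinvK //; exact: grpV.
have -> : e nu c' = cinv (ev2 g a c) * e nu c * ev2 g a c.
  by rewrite -Adg_cex // AdgE ?cinvK //; exact: grpV.
have := Fh' H.
have Fbc : ev2 (twist F g) b c = ev2 F (Adg (ev2 g b c) b) c * ev2 g b c by rewrite ev2_twist.
have TG : e nu (a + b + c) * ev2 g a b = ev2 g a b * e nu (a + b + c).
  by apply: tri_cex_comm => //; cent.
have E : ev2 F b' c' = cinv (ev2 g a c) * (ev2 F (Adg (ev2 g a c * cinv (ev2 g a b)) b) c) * ev2 g a c.
  rewrite -[X in _ * X]cinvK // -AdgE ?Adg_ev2 //; try exact: grpV; try exact: Adg_fil.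
  by rewrite Adg_mul ?AdgK //; exact: grpV.
rewrite E Fbc => h' h.
have key : ev2 F (Adg (ev2 g b c) b) c * ev2 g b c =
  ev2 F (Adg (ev2 g a c * cinv (ev2 g a b)) b) c * (ev2 g a c * cinv (ev2 g a b)).
  have GX : grp (ev2 F (Adg (ev2 g b c) b) c) by exact: ev2_grp.
  have GX' : grp (ev2 F (Adg (ev2 g a c * cinv (ev2 g a b)) b) c) by exact: ev2_grp.
  have h2 := congr1 (fun t => ev2 g a b * t * cinv (ev2 g a b)) h.
  move: h2; rewrite -TG gmulrKV // -h' => h2.
  pose V := e nu b * ev2 (twist F g) a b * e nu a * ev2 (twist F g) c a * e nu c.
  have GV : grp V by rewrite /V; grps.
  apply: (mulrI_grp GV); rewrite /V.
  by apply/esym; gby h2.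
have := twist_inj Hb Hc (ev2_grp b c Gg) (grpM Gac (grpV Gab)) key GF => ->.
by rewrite (gd _ _ _ Ha Hc); gw.
Qed.
End QuotientOfAssociators.
End TransitivityM.

(** * The pentagon *)

Definition valid4 (l : seq nat) := uniq l && all (fun i => 0 < i <= 4)%N l.

Lemma valid4_rot l : valid4 (rot 1 l) = valid4 l.
Proof. by rewrite /valid4 rot_uniq; congr (_ && _); apply: perm_all; rewrite perm_rot. Qed.

Definition tsys4 (k : comPzRingType) (S : complAlgType k) (t : nat -> nat -> S) :=
  [/\ forall i j, fil 1 (t i j), forall i j, t i j = t j i,
      forall i j l, valid4 [:: i; j; l] ->
        t i j * (t i l + t j l) = (t i l + t j l) * t i j
    & forall i j l m, valid4 [:: i; j; l; m] -> t i j * t l m = t l m * t i j].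

Section PentagonSides.
Variables (k : comPzRingType) (S : complAlgType k) (F : series k bool) (t : nat -> nat -> S).
Definition pentL := ev2 F (t 2 3) (t 3 4) * ev2 F (t 1 2 + t 1 3) (t 2 4 + t 3 4)
  * ev2 F (t 1 2) (t 2 3).
Definition pentR := ev2 F (t 1 2) (t 2 3 + t 2 4) * ev2 F (t 1 3 + t 2 3) (t 3 4).
End PentagonSides.

Definition pentS (k : comPzRingType) (F : series k bool) :=
  forall (S : complAlgType k) (t : nat -> nat -> S), tsys4 t -> pentL F t = pentR F t.

Section TSys4.
Variables (k : comPzRingType) (S : complAlgType k) (t : nat -> nat -> S).
Hypothesis Ht : tsys4 t.

Lemma t4_fil i j : fil 1 (t i j). Proof. by case: Ht. Qed.
Lemma t4_sym i j : t i j = t j i. Proof. by case: Ht. Qed.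
Lemma t4_rel3 i j l : valid4 [:: i; j; l] ->
  t i j * (t i l + t j l) = (t i l + t j l) * t i j.
Proof. by case: Ht => _ _ H _; exact: H. Qed.
Lemma t4_rel4 i j l m : valid4 [:: i; j; l; m] -> t i j * t l m = t l m * t i j.
Proof. by case: Ht => _ _ _; exact. Qed.

Lemma t4_tri i j l : valid4 [:: i; j; l] -> tri (t i j) (t j l) (t i l).
Proof.
move=> v; split; try exact: t4_fil.
  have := t4_rel3 v; set a := t i j; set b := t i l; set c := t j l => E.
  have -> : (a + c + b) * a = a * a + (b + c) * a by ncring.
  by rewrite -E; ncring.
have v' : valid4 [:: j; l; i] by rewrite -(valid4_rot [:: i; j; l]) in v.
have := t4_rel3 v'; rewrite ![t _ i]t4_sym; set a := t i j; set b := t i l; set c := t j l => E.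
have -> : (a + c + b) * c = c * c + (a + b) * c by ncring.
by rewrite -E; ncring.
Qed.
End TSys4.

(** Conjugating [s'] by [g(c, a)] preserves the braid relation with [s]: the cyclic relation of [g],
    together with duality, is the cocycle condition required. *)
Lemma braid_twist (k : comPzRingType) (S : complAlgType k) (g : series k bool)
    (s s' : chomType S S) (a b c : S) :
  grp g -> dualS g -> cycS g -> tri a b c ->
  s a = a -> s b = c -> s c = b -> s' a = c -> s' b = b -> s' c = a ->
  (forall x, s (s' (s x)) = s' (s (s' x))) ->
  forall x, s (Adg (ev2 g c a) (s' (s x))) =
            Adg (ev2 g c a) (s' (s (Adg (ev2 g c a) (s' x)))).
Proof.
move=> Gg gd gc H sa sb sc s'a s'b s'c br x; have [Ha Hb Hc _ _] := H.
have GD p q := ev2_grp p q Gg.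
rewrite (chom_Adg s) // (chom_Adg s) // (chom_Adg s') //; last exact: chom_grp.
rewrite !(chom_ev2 s) // sc sa (chom_ev2 s') // s'b s'a br -Adg_mul //.
congr (Adg _ _).
have := gc _ _ _ _ H; rewrite (gd _ a b) // => E.
apply: (mulIr_grp (GD S a b)); rewrite E gmulVr //.
Qed.

(** * The twisted system of t_4 *)

Section Pentagon.
Variables (k : comPzRingType) (F g : series k bool).
Hypotheses (GF : grp F) (Gg : grp g) (gd : dualS g) (gc : cycS g) (gs : sumS g).
Hypothesis (Fp : pentS F).
Variables (S : complAlgType k) (t : nat -> nat -> S).
Hypothesis Ht : tsys4 t.
Variables s1 s2 s3 : chomType S S.
Hypotheses (s1K : forall x, s1 (s1 x) = x) (s2K : forall x, s2 (s2 x) = x)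
  (s3K : forall x, s3 (s3 x) = x) (s13 : forall x, s1 (s3 x) = s3 (s1 x))
  (s121 : forall x, s1 (s2 (s1 x)) = s2 (s1 (s2 x)))
  (s232 : forall x, s2 (s3 (s2 x)) = s3 (s2 (s3 x))).
Definition swp (a i : nat) : nat := if i == a then a.+1 else if i == a.+1 then a else i.
Hypotheses (s1t : forall i j, s1 (t i j) = t (swp 1 i) (swp 1 j))
  (s2t : forall i j, s2 (t i j) = t (swp 2 i) (swp 2 j))
  (s3t : forall i j, s3 (t i j) = t (swp 3 i) (swp 3 j)).

Let G := ev2 g (t 1 2) (t 2 3).
Let G1 := ev2 g (t 1 2 + t 1 3) (t 2 4 + t 3 4).
Let G2 := ev2 g (t 2 3) (t 3 4).
Let H := ev2 g (t 1 3 + t 2 3) (t 3 4).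
Let H1 := ev2 g (t 1 2) (t 2 3 + t 2 4).
Let L := G1 * G.
Let D2 := ev2 g (t 1 3) (t 1 2).
(** Weaker than the pentagon of [g]: only the conjugations by its two sides coincide. Modulo
    filtration [N.+1] this already follows from the pentagon modulo [N]. *)
Hypothesis Kz : forall x, Adg (G2 * G1 * G) x = Adg (H1 * H) x.

Let tf i j : fil 1 (t i j). Proof. exact: t4_fil. Qed.
Let tfD i j i' j' : fil 1 (t i j + t i' j'). Proof. exact: filD. Qed.
Let ts i j : t i j = t j i. Proof. exact: t4_sym. Qed.
Let tC i j i' j' : t i j + t i' j' = t i' j' + t i j. Proof. exact: addrC. Qed.
Let gG (x y : S) : grp (ev2 g x y). Proof. exact: ev2_grp. Qed.
Let GGG : grp G. Proof. exact: gG. Qed.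
Let GG1 : grp G1. Proof. exact: gG. Qed.
Let GG2 : grp G2. Proof. exact: gG. Qed.
Let GH : grp H. Proof. exact: gG. Qed.
Let GH1 : grp H1. Proof. exact: gG. Qed.
Let tri123 : tri (t 1 2) (t 2 3) (t 1 3). Proof. exact: t4_tri. Qed.
Let tri234 : tri (t 2 3) (t 3 4) (t 2 4). Proof. exact: t4_tri. Qed.
Let GL : grp L. Proof. by apply: grpM; exact: ev2_grp. Qed.

(** Together with [s1], the operators [S2] and [S3] satisfy the relations of the symmetric group on
    four letters; they are the transpositions twisted by [g]. The twisted system is the orbit of
    [t 1 2] under them. [R3] is [S3] seen after conjugation by [L]. *)
Definition S2 x := Adg D2 (s2 x).
Definition S3 x := Adg (cinv H * s3 H) (s3 x).
Definition R3 x := Adg (ev2 g (t 2 4) (t 2 3)) (s3 x).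

Lemma s2_ev2 f (x y : S) : fil 1 x -> fil 1 y -> s2 (ev2 f x y) = ev2 f (s2 x) (s2 y).
Proof. exact: chom_ev2. Qed.
Lemma s3_ev2 f (x y : S) : fil 1 x -> fil 1 y -> s3 (ev2 f x y) = ev2 f (s3 x) (s3 y).
Proof. exact: chom_ev2. Qed.
Lemma s1_ev2 f (x y : S) : fil 1 x -> fil 1 y -> s1 (ev2 f x y) = ev2 f (s1 x) (s1 y).
Proof. exact: chom_ev2. Qed.

(** By the cyclic relation on strands 1, 2, 3, [D2] is [L^-1 s2(L)]; the factor [G1] of [L] is fixed
    by [s2]. So [S2] is conjugate to [s2], in particular an involution. *)
Lemma S2E x : S2 x = Adg (cinv L) (s2 (Adg L x)).
Proof.
rewrite (chom_Adg s2) // -Adg_mul; try exact: grpV; last exact: chom_grp.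
congr (Adg _ _); rewrite /L chomM /G /G1 !s2_ev2 // !chomD !s2t /swp /=.
rewrite [t 1 3 + _]tC [t 3 4 + _]tC [t 3 2]ts.
have := gc tri123; rewrite (gd (tf 1 3) (tf 2 3)) -/D2 => E.
rewrite cinvM //; move: E; move: (gG (t 1 3) (t 2 3)) (gG (t 1 2) (t 2 3)) (gG (t 1 3) (t 1 2)).
move=> e1 e2 e3 E.
by gby (congr1 (fun z => z * cinv (ev2 g (t 1 2) (t 2 3)) * ev2 g (t 1 3) (t 2 3)) E).
Qed.

Lemma s3H1 : s3 H1 = H1.
Proof. by rewrite /H1 s3_ev2 // chomD !s3t /swp /= tC. Qed.

Lemma R3E x : R3 x = Adg (cinv G2) (s3 (Adg G2 x)).
Proof.
rewrite (chom_Adg s3) // -Adg_mul; try exact: grpV; last exact: chom_grp.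
congr (Adg _ _); rewrite /G2 s3_ev2 // !s3t /swp /= [t 4 3]ts.
have := gc tri234; rewrite (gd (tf 2 4) (tf 3 4)) => E.
move: (gG (t 2 4) (t 3 4)) (gG (t 2 3) (t 3 4)) (gG (t 2 4) (t 2 3)) => e1 e2 e3.
by gby (congr1 (fun z => z * cinv (ev2 g (t 2 3) (t 3 4)) * ev2 g (t 2 4) (t 3 4)) E).
Qed.

(** Passing from [H] to [L] exchanges the two sides of the pentagon of [g], by [Kz]; [H1] disappears
    because [s3] fixes it. *)
Lemma S3E x : S3 x = Adg (cinv L) (R3 (Adg L x)).
Proof.
rewrite R3E -!Adg_mul //; try exact: grpV.
have -> : cinv L * cinv G2 = cinv (G2 * G1 * G) by rewrite /L; gw.
have -> : G2 * L = G2 * G1 * G by rewrite /L mulrA.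
rewrite Kz Adg_mul // (chom_Adg s3) // s3H1.
have GK : grp (G2 * G1 * G) by grps.
have GK' : grp (H1 * H) by grps.
have KzV y : Adg (cinv (G2 * G1 * G)) y = Adg (cinv (H1 * H)) y.
  by rewrite -{1}[y](AdgVK _ GK') -Kz AdgK.
rewrite KzV -Adg_mul //; last exact: grpV.
rewrite (chom_Adg s3) // -Adg_mul; [|by grps| exact: chom_grp].
by rewrite /S3; congr (Adg _ _); gw; exact: chom_grp.
Qed.

Lemma S2K x : S2 (S2 x) = x. Proof. by rewrite !S2E AdgVK // s2K AdgK. Qed.
Lemma R3K x : R3 (R3 x) = x. Proof. by rewrite !R3E AdgVK // s3K AdgK. Qed.
Lemma S3K x : S3 (S3 x) = x. Proof. by rewrite !S3E AdgVK // R3K AdgK. Qed.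

Lemma S13 x : s1 (S3 x) = S3 (s1 x).
Proof.
have s1H : s1 H = H.
  by rewrite /H s1_ev2 // chomD !s1t /swp /= tC.
have GsH : grp (s3 H) by apply: chom_grp.
rewrite /S3 (chom_Adg s1); last by grps.
by rewrite chomM chom_cinv // s1H s13 s1H s13.
Qed.

Lemma S121 x : s1 (S2 (s1 x)) = S2 (s1 (S2 x)).
Proof.
apply: (braid_twist Gg gd gc tri123) => //; by rewrite ?s1t ?s2t /swp //= ts.
Qed.

(** After conjugation by [L] this is the braid relation between [s2] and [R3], an instance of
    [braid_twist] on strands 2, 3, 4. *)
Lemma S232 x : S2 (S3 (S2 x)) = S3 (S2 (S3 x)).
Proof.
rewrite !S2E !S3E !AdgVK //; congr (Adg _ _).
apply: (braid_twist Gg gd gc tri234) => //; by rewrite ?s2t ?s3t /swp //= ts.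
Qed.

Let y12 := t 1 2.
Let y13 := S2 y12.
Let y23 := s1 y13.
Let y14 := S3 y13.
Let y24 := s1 y14.
Let y34 := S2 y24.

Lemma tH : t 1 2 * H = H * t 1 2.
Proof.
apply: ev2_comm => //; first by rewrite (t4_rel3 Ht).
by rewrite (t4_rel4 Ht).
Qed.

Lemma S3y12 : S3 y12 = y12.
Proof.
have GsH : grp (s3 H) by apply: chom_grp.
have s3t12 : s3 (t 1 2) = t 1 2 by rewrite s3t.
rewrite /S3 /y12 s3t12 Adg_id //; first by grps.
apply/esym/centM; first by apply: centV => //; exact: tH.
by rewrite -{1}s3t12 -chomM tH chomM s3t12.
Qed.

Lemma s1y12 : s1 y12 = y12. Proof. by rewrite /y12 s1t ts. Qed.
Lemma s1y23 : s1 y23 = y13. Proof. by rewrite /y23 s1K. Qed.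
Lemma s1y24 : s1 y24 = y14. Proof. by rewrite /y24 s1K. Qed.
Lemma s1y34 : s1 y34 = y34.
Proof.
by rewrite /y34 /y24 S121 /y14 /y13 S232 S3y12 S13 -/y13.
Qed.
Lemma S2y13 : S2 y13 = y12. Proof. by rewrite /y13 S2K. Qed.
Lemma S2y23 : S2 y23 = y23.
Proof. by rewrite /y23 /y13 -S121 s1y12. Qed.
Lemma S2y14 : S2 y14 = y14.
Proof. by rewrite /y14 /y13 S232 S3y12. Qed.
Lemma S2y34 : S2 y34 = y24. Proof. by rewrite /y34 S2K. Qed.
Lemma S3y14 : S3 y14 = y13. Proof. by rewrite /y14 S3K. Qed.
Lemma S3y23 : S3 y23 = y24.
Proof. by rewrite /y23 -S13. Qed.
Lemma S3y24 : S3 y24 = y23.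
Proof. by rewrite -S3y23 S3K. Qed.
Lemma S3y34 : S3 y34 = y34.
Proof. by rewrite /y34 -{1}S3y23 -S232 S2y23 S3y23. Qed.

Definition ysys (i j : nat) : S :=
  match i, j with
  | 1%N, 2%N | 2%N, 1%N => y12 | 1%N, 3%N | 3%N, 1%N => y13
  | 2%N, 3%N | 3%N, 2%N => y23 | 1%N, 4%N | 4%N, 1%N => y14
  | 2%N, 4%N | 4%N, 2%N => y24 | 3%N, 4%N | 4%N, 3%N => y34
  | _, _ => 0
  end.

Lemma ysys_sym i j : ysys i j = ysys j i.
Proof. by case: i => [|[|[|[|[|i]]]]]; case: j => [|[|[|[|[|j]]]]]. Qed.

Lemma ysys_fil i j : fil 1 (ysys i j).
Proof.
have f12 : fil 1 y12 by exact: tf.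
have f13 : fil 1 y13 by apply: Adg_fil; apply: chom_fil.
have f14 : fil 1 y14 by apply: Adg_fil; apply: chom_fil.
have f23 : fil 1 y23 by apply: chom_fil.
have f24 : fil 1 y24 by apply: chom_fil.
have f34 : fil 1 y34 by apply: Adg_fil; apply: chom_fil.
have f0 : fil 1 (0 : S) by exact: fil_zero.
by case: i => [|[|[|[|[|i]]]]]; case: j => [|[|[|[|[|j]]]]].
Qed.

Lemma s1ysys i j : valid4 [:: i; j] -> s1 (ysys i j) = ysys (swp 1 i) (swp 1 j).
Proof.
case: i => [|[|[|[|[|i]]]]]; case: j => [|[|[|[|[|j]]]]] //= _;
  rewrite ?/swp /=; first [done | exact: chom0 | exact: s1y12 | exact: s1y23 | exact: s1y24 | exact: s1y34].
Qed.
Lemma S2ysys i j : valid4 [:: i; j] -> S2 (ysys i j) = ysys (swp 2 i) (swp 2 j).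
Proof.
case: i => [|[|[|[|[|i]]]]]; case: j => [|[|[|[|[|j]]]]] //= _;
  rewrite ?/swp /=; first [done | exact: (chom0 (Adg D2 \o s2)) | exact: S2y13 | exact: S2y23 | exact: S2y14 | exact: S2y34].
Qed.
Lemma S3ysys i j : valid4 [:: i; j] -> S3 (ysys i j) = ysys (swp 3 i) (swp 3 j).
Proof.
case: i => [|[|[|[|[|i]]]]]; case: j => [|[|[|[|[|j]]]]] //= _;
  rewrite ?/swp /=; first [done | exact: (chom0 (Adg (cinv H * s3 H) \o s3)) | exact: S3y12 | exact: S3y14 | exact: S3y23 | exact: S3y24 | exact: S3y34].
Qed.

Let R i j l := ysys i j * (ysys i l + ysys j l) = (ysys i l + ysys j l) * ysys i j.
Let R' i j l m := ysys i j * ysys l m = ysys l m * ysys i j.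

(** A relation is transported by an involution permuting the twisted elements, so that it has to be
    verified for one choice of labels only. *)
Lemma rel_move (op : chomType S S) a : (forall x, op (op x) = x) ->
  (forall i j, valid4 [:: i; j] -> op (ysys i j) = ysys (swp a i) (swp a j)) ->
  forall i j l, valid4 [:: i; j] -> valid4 [:: i; l] -> valid4 [:: j; l] ->
  R (swp a i) (swp a j) (swp a l) -> R i j l.
Proof.
move=> opK act i j l vij vil vjl H0; rewrite /R.
rewrite -[LHS]opK -[RHS]opK; congr (op _).
by rewrite !chomM !chomD !act.
Qed.
Lemma rel_move' (op : chomType S S) a : (forall x, op (op x) = x) ->
  (forall i j, valid4 [:: i; j] -> op (ysys i j) = ysys (swp a i) (swp a j)) ->
  forall i j l m, valid4 [:: i; j] -> valid4 [:: l; m] ->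
  R' (swp a i) (swp a j) (swp a l) (swp a m) -> R' i j l m.
Proof.
move=> opK act i j l m vij vlm H0; rewrite /R'.
rewrite -[LHS]opK -[RHS]opK; congr (op _).
by rewrite !chomM !act.
Qed.

Lemma y23E : y23 = Adg (cinv G) (t 2 3).
Proof.
rewrite /y23 /y13 /S2 (chom_Adg s1) ?s2t ?s1t /swp //=; last exact: gG.
rewrite /D2 s1_ev2 // !s1t /swp /= [t 2 1]ts.
by rewrite (gd (tf 1 2) (tf 2 3)).
Qed.
Lemma y13E : y13 = Adg (cinv (ev2 g (t 1 2) (t 1 3))) (t 1 3).
Proof. by rewrite /y13 /S2 /D2 s2t /swp /= (gd (tf 1 2) (tf 1 3)). Qed.
Lemma y123 : y13 + y23 = t 1 3 + t 2 3.
Proof.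
have := gs tri123; rewrite -y23E -y13E; set x := t 1 2; set u := t 2 3; set v := t 1 3.
move=> E; have -> : y13 + y23 = (x + y23 + y13) - x by ncring.
by rewrite E; ncring.
Qed.

Lemma Ly23 : Adg L y23 = t 2 3.
Proof.
rewrite y23E /L Adg_mul // AdgVK // Adg_id //; apply/esym/ev2_comm => //.
  have := t4_rel3 Ht (isT : valid4 [:: 2%N; 3%N; 1%N]).
  by rewrite [t 2 1]ts [t 3 1]ts.
by rewrite (t4_rel3 Ht).
Qed.

Lemma Ly24 : Adg L y24 = Adg (cinv (ev2 g (t 2 3) (t 2 4))) (t 2 4).
Proof.
by rewrite -S3y23 S3E AdgVK // Ly23 /R3 s3t /swp /= (gd (tf 2 3) (tf 2 4)).
Qed.

Lemma Ly34 : Adg L y34 = Adg (cinv G2) (t 3 4).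
Proof.
rewrite /y34 S2E AdgVK // Ly24 (chom_Adg s2); last by apply/grpV/gG.
rewrite chom_cinv // s2_ev2 // !s2t /swp /= [t 3 2]ts.
by [].
Qed.

Lemma Ly234 : Adg L (y24 + y34) = t 2 4 + t 3 4.
Proof.
rewrite AdgD Ly24 Ly34; have := gs tri234; set x := t 2 3; set u := t 3 4; set v := t 2 4.
rewrite -/G2 -/u -/v => E.
have -> : Adg (cinv (ev2 g x v)) v + Adg (cinv G2) u =
  (x + Adg (cinv G2) u + Adg (cinv (ev2 g x v)) v) - x by ncring.
by rewrite E; ncring.
Qed.

Let GK : grp (G2 * G1 * G). Proof. by grps. Qed.
Let GK' : grp (H1 * H). Proof. by grps. Qed.

Lemma KzV y : Adg (cinv (G2 * G1 * G)) y = Adg (cinv (H1 * H)) y.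
Proof. by rewrite -{1}[y](AdgVK _ GK') -Kz AdgK. Qed.

(** The formula through [L] involves [G2 G1 G]; conjugation by it is replaced by conjugation by
    [H1 H], and [H1] commutes with [t 3 4]. *)
Lemma y34E : y34 = Adg (cinv H) (t 3 4).
Proof.
have -> : y34 = Adg (cinv (G2 * G1 * G)) (t 3 4).
  rewrite -[LHS](AdgK _ GL) Ly34 -Adg_mul; try exact: grpV.
  by congr (Adg _ _); rewrite /L; gw.
rewrite KzV cinvM // Adg_mul; try exact: grpV; congr (Adg _ _).
rewrite Adg_id //; first exact: grpV.
apply/esym/centV => //; apply: ev2_comm => //; first by rewrite (t4_rel4 Ht).
have := t4_rel3 Ht (isT : valid4 [:: 3%N; 4%N; 2%N]).
by rewrite [t 3 2]ts [t 4 2]ts.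
Qed.

Lemma rel3_base : R 1 2 3.
Proof.
rewrite /R /= y123 /y12; exact: (t4_rel3 Ht).
Qed.
Lemma rel3_base' : R 2 1 3.
Proof. by rewrite /R /= [y23 + _]addrC; exact: rel3_base. Qed.
Lemma rel4_base : R' 1 2 3 4.
Proof.
rewrite /R' /= y34E /y12; apply: cent_Adg; [exact: grpV | apply: centV => //; exact: tH|].
exact: (t4_rel4 Ht).
Qed.

(** The cases (1, 2, 3) and (2, 1, 3) follow from [sumS] on strands 1, 2, 3; the three involutions
    carry them to all other ordered triples. *)
Lemma ysys_rel3 i j l : valid4 [:: i; j; l] -> R i j l.
Proof.
pose oS2 : chomType S S := Adg D2 \o s2.
pose oS3 : chomType S S := Adg (cinv H * s3 H) \o s3.
have m1 := rel_move (op := s1) s1K s1ysys.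
have m2 := rel_move (op := oS2) S2K S2ysys.
have m3 := rel_move (op := oS3) S3K S3ysys.
have r123 := rel3_base; have r213 := rel3_base'.
have r132 : R 1 3 2 by apply: m2.
have r312 : R 3 1 2 by apply: m2.
have r231 : R 2 3 1 by apply: m1.
have r321 : R 3 2 1 by apply: m1.
have r124 : R 1 2 4 by apply: m3.
have r214 : R 2 1 4 by apply: m3.
have r142 : R 1 4 2 by apply: m3.
have r412 : R 4 1 2 by apply: m3.
have r241 : R 2 4 1 by apply: m3.
have r421 : R 4 2 1 by apply: m3.
have r134 : R 1 3 4 by apply: m2.
have r314 : R 3 1 4 by apply: m2.
have r143 : R 1 4 3 by apply: m2.
have r413 : R 4 1 3 by apply: m2.
have r341 : R 3 4 1 by apply: m2.
have r431 : R 4 3 1 by apply: m2.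
have r234 : R 2 3 4 by apply: m1.
have r324 : R 3 2 4 by apply: m1.
have r243 : R 2 4 3 by apply: m1.
have r423 : R 4 2 3 by apply: m1.
have r342 : R 3 4 2 by apply: m1.
have r432 : R 4 3 2 by apply: m1.
move=> v; have /and3P[i5 j5 l5] : [&& i < 5, j < 5 & l < 5]%N.
  by move: v => /andP[_ /= /and4P[/andP[_ h1] /andP[_ h2] /andP[_ h3] _]]; rewrite !ltnS h1 h2 h3.
move: i5 j5 l5 v.
by case: i => [|[|[|[|[|i]]]]] //; case: j => [|[|[|[|[|j]]]]] //;
  case: l => [|[|[|[|[|l]]]]].
Qed.

Lemma ysys_rel4 i j l m : valid4 [:: i; j; l; m] -> R' i j l m.
Proof.
pose oS2 : chomType S S := Adg D2 \o s2.
pose oS3 : chomType S S := Adg (cinv H * s3 H) \o s3.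
have m1 := rel_move' (op := s1) s1K s1ysys.
have m2 := rel_move' (op := oS2) S2K S2ysys.
have m3 := rel_move' (op := oS3) S3K S3ysys.
have r1234 := rel4_base.
have r2134 : R' 2 1 3 4 by apply: m1.
have r1243 : R' 1 2 4 3 by apply: m3.
have r2143 : R' 2 1 4 3 by apply: m1.
have r1324 : R' 1 3 2 4 by apply: m2.
have r3124 : R' 3 1 2 4 by apply: m2.
have r1342 : R' 1 3 4 2 by apply: m2.
have r3142 : R' 3 1 4 2 by apply: m2.
have r2314 : R' 2 3 1 4 by apply: m1.
have r3214 : R' 3 2 1 4 by apply: m1.
have r2341 : R' 2 3 4 1 by apply: m1.
have r3241 : R' 3 2 4 1 by apply: m1.
have r3412 : R' 3 4 1 2 := esym r1234.
have r3421 : R' 3 4 2 1 := esym r2134.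
have r4312 : R' 4 3 1 2 := esym r1243.
have r4321 : R' 4 3 2 1 := esym r2143.
have r2413 : R' 2 4 1 3 := esym r1324.
have r2431 : R' 2 4 3 1 := esym r3124.
have r4213 : R' 4 2 1 3 := esym r1342.
have r4231 : R' 4 2 3 1 := esym r3142.
have r1423 : R' 1 4 2 3 := esym r2314.
have r1432 : R' 1 4 3 2 := esym r3214.
have r4123 : R' 4 1 2 3 := esym r2341.
have r4132 : R' 4 1 3 2 := esym r3241.
move=> v; have /and4P[i5 j5 l5 m5] : [&& i < 5, j < 5, l < 5 & m < 5]%N.
  by move: v => /andP[_ /= /and5P[/andP[_ h1] /andP[_ h2] /andP[_ h3] /andP[_ h4] _]]; rewrite !ltnS h1 h2 h3 h4.
move: i5 j5 l5 m5 v.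
by case: i => [|[|[|[|[|i]]]]] //; case: j => [|[|[|[|[|j]]]]] //;
  case: l => [|[|[|[|[|l]]]]] //; case: m => [|[|[|[|[|m]]]]].
Qed.

Lemma ysys_tsys : tsys4 ysys.
Proof.
split; [exact: ysys_fil | exact: ysys_sym | exact: ysys_rel3 | exact: ysys_rel4].
Qed.

(** The pentagon of [F] is evaluated on the twisted system. Each of its five factors is the matching
    factor for [twist F g] divided by that for [g], up to conjugation by [G], [L] or [H], and the
    products telescope. *)
Lemma pentagon_twist :
  cinv (pentL g t) * pentL (twist F g) t = cinv (pentR g t) * pentR (twist F g) t.
Proof.
have := Fp ysys_tsys; rewrite /pentL /pentR /=.
have TwK f (p q : S) : fil 1 p -> fil 1 q -> ev2 f p (Adg (cinv (ev2 g p q)) q) =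
    cinv (ev2 g p q) * ev2 (twist f g) p q.
  by move=> Hp Hq; rewrite ev2_twist' // gmulVKr //; exact: gG.
have E23 : ev2 F y12 y23 = cinv G * ev2 (twist F g) (t 1 2) (t 2 3).
  by rewrite y23E /y12 /G TwK.
have LV x : Adg (cinv L) (Adg L x) = x by rewrite AdgK.
have E34 : ev2 F y23 y34 = cinv L * (cinv G2 * ev2 (twist F g) (t 2 3) (t 3 4)) * L.
  rewrite -[y23]LV -[y34]LV Ly23 Ly34 -Adg_ev2 //; last exact: Adg_fil.
  by rewrite TwK // [LHS]AdgE ?cinvK //; exact: grpV.
have Y1 : y12 + y13 = Adg (cinv G) (t 1 2 + t 1 3).
  have [_ _ _ c12 c23] := tri123.
  have TG : (t 1 2 + t 2 3 + t 1 3) * G = G * (t 1 2 + t 2 3 + t 1 3) by apply: ev2_comm.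
  have TA : Adg (cinv G) (t 1 2 + t 2 3 + t 1 3) = t 1 2 + t 2 3 + t 1 3.
    by rewrite Adg_id //; [exact: grpV | apply/esym/centV].
  have -> : t 1 2 + t 1 3 = t 1 2 + t 2 3 + t 1 3 - t 2 3.
    by set x := t 1 2; set u := t 2 3; set v := t 1 3; ncring.
  rewrite AdgB TA -y23E; have := y123; rewrite /y12.
  set x := t 1 2; set u := t 2 3; set v := t 1 3 => E.
  have -> : x + y13 = x + (y13 + y23) - y23 by ncring.
  by rewrite E; ncring.
have Y2 : y24 + y34 = Adg (cinv L) (t 2 4 + t 3 4) by rewrite -Ly234 LV.
have E1 : ev2 F (y12 + y13) (y24 + y34) =
   cinv G * (cinv G1 * ev2 (twist F g) (t 1 2 + t 1 3) (t 2 4 + t 3 4)) * G.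
  rewrite Y1 Y2 /L cinvM // Adg_mul; try exact: grpV.
  rewrite -Adg_ev2 //; last exact: Adg_fil.
  by rewrite TwK // [LHS]AdgE ?cinvK //; exact: grpV.
have E4 : ev2 F (y13 + y23) y34 = cinv H * ev2 (twist F g) (t 1 3 + t 2 3) (t 3 4).
  by rewrite y123 y34E TwK.
have Y5 : y23 + y24 = Adg (cinv H) (Adg (cinv H1) (t 2 3 + t 2 4)).
  rewrite -Adg_mul -?cinvM -?KzV; try exact: grpV; try done.
  have [_ _ _ c12 c23] := tri234.
  have TG : (t 2 3 + t 3 4 + t 2 4) * G2 = G2 * (t 2 3 + t 3 4 + t 2 4) by apply: ev2_comm.
  have TA : Adg (cinv G2) (t 2 3 + t 3 4 + t 2 4) = t 2 3 + t 3 4 + t 2 4.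
    by rewrite Adg_id //; [exact: grpV | apply/esym/centV].
  have -> : cinv (G2 * G1 * G) = cinv L * cinv G2 by rewrite /L; gw.
  rewrite Adg_mul; try exact: grpV.
  rewrite -[LHS]LV; congr (Adg _ _).
  have -> : t 2 3 + t 2 4 = t 2 3 + t 3 4 + t 2 4 - t 3 4.
    by set x := t 2 3; set u := t 3 4; set v := t 2 4; ncring.
  rewrite AdgB TA -Ly34 AdgD Ly23; have := Ly234; rewrite AdgD.
  set x := t 2 3; set u := t 3 4; set v := t 2 4 => E.
  have -> : x + Adg L y24 = x + (Adg L y24 + Adg L y34) - Adg L y34 by ncring.
  by rewrite E; ncring.
have E5 : ev2 F y12 (y23 + y24) =
   cinv H * (cinv H1 * ev2 (twist F g) (t 1 2) (t 2 3 + t 2 4)) * H.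
  have -> : y12 = Adg (cinv H) (t 1 2).
    by rewrite Adg_id //; [exact: grpV | apply/esym/centV => //; exact: tH].
  rewrite Y5 -Adg_ev2 //; last exact: Adg_fil.
  by rewrite TwK // [LHS]AdgE ?cinvK //; exact: grpV.
rewrite E23 E34 E1 E4 E5 /L => E.
rewrite -/G -/G1 -/G2 -/H -/H1.
have GFt : grp (twist F g) by exact: grp_twist.
by gby E.
Qed.

End Pentagon.

Lemma lie_br_eq0 (S : pzRingType) (x y : S) : x * y - y * x = 0 -> x * y = y * x.
Proof. by move=> /eqP; rewrite subr_eq0 => /eqP. Qed.

(** * Universal systems for t_4 *)

Section TLetters.
Variables (k : comPzRingType) (n : nat).

Lemma sum_t_alph (V : nmodType) (F : nat -> nat -> V) i j :
  (0 < i <= n)%N -> (0 < j <= n)%N -> i != j ->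
  \sum_(q : t_alph n | ((val q).1.+1 == i) && ((val q).2.+1 == j))
    F (val q).1.+1 (val q).2.+1 = F i j.
Proof.
case: i j => [|i] [|j] //= i_n j_n ij.
have nq : Ordinal i_n != Ordinal j_n by rewrite -(inj_eq val_inj).
pose q0 : t_alph n := exist _ (Ordinal i_n, Ordinal j_n) nq.
rewrite (big_pred1 q0) // => q /=.
Qed.

Lemma t_invalid i j : ~~ [&& (0 < i <= n)%N, (0 < j <= n)%N & i != j] -> t k n i j = 0.
Proof.
move=> H; rewrite /t big_pred0 // => -[[u v] /= uv]; apply: contraNF H => /andP[/eqP<- /eqP<-].
by rewrite !ltn_ord /= eqSS.
Qed.

Lemma fil_t i j : fil 1 (t k n i j).
Proof. by apply: (@fil_sum _ (series k (t_alph n))) => q _; exact: fil_letter. Qed.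

Lemma t_letter (q : t_alph n) : t k n (val q).1.+1 (val q).2.+1 = letter k q.
Proof.
case: q => -[i j] /= ij; rewrite /t (big_pred1 (exist _ (i, j) ij)) // => q /=.
Qed.

Lemma chom_t (S : complAlgType k) (th : chomType (series k (t_alph n)) S) i j :
  th (t k n i j) = \sum_(q : t_alph n | ((val q).1.+1 == i) && ((val q).2.+1 == j)) th (letter k q).
Proof. exact: chom_sum. Qed.

Definition evt (S : complAlgType k) (t : nat -> nat -> S) : series k (t_alph n) -> S :=
  ev (fun q : t_alph n => t (val q).1.+1 (val q).2.+1).

Section Evt.
Variables (S : complAlgType k) (t : nat -> nat -> S).
Hypothesis tf : forall i j, fil 1 (t i j).

Lemma evt_t i j : (0 < i <= n)%N -> (0 < j <= n)%N -> i != j -> evt t (Defs.t k n i j) = t i j.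
Proof.
move=> Hi Hj ij; rewrite /evt chom_t -[RHS](sum_t_alph t Hi Hj ij).
by apply: eq_bigr => q _; rewrite /= ev_letter.
Qed.

End Evt.
End TLetters.

Lemma valid4_2 i j : valid4 [:: i; j] = [&& (0 < i <= 4)%N, (0 < j <= 4)%N & i != j].
Proof. by rewrite /valid4 /= inE !andbT [RHS]andbA andbC. Qed.

Section KillT4.
Variables (k : comPzRingType) (S : complAlgType k) (t : nat -> nat -> S).
Hypothesis Ht : tsys4 t.

Lemma evt_kill f : t_rel k 4 f -> evt (n := 4) t f = 0.
Proof.
have tf := t4_fil Ht.
have ET i j : i != j -> (i < 4)%N -> (j < 4)%N -> evt t (Defs.t k 4 i.+1 j.+1) = t i.+1 j.+1.
  by move=> ij Hi Hj; rewrite evt_t.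
have val_ord (l : seq 'I_4) : uniq l -> valid4 [seq (val i).+1 | i <- l].
  move=> ul; rewrite /valid4 map_inj_uniq ?ul /=; last by move=> u v [] /val_inj.
  by rewrite all_map; apply/allP => i _ /=; exact: ltn_ord.
case=> [i j ij|i j l u|i j l m u].
- rewrite /evt evB -!/(evt _ _) !ET ?ltn_ord //; last by rewrite eq_sym.
  by rewrite (t4_sym Ht) subrr.
- have := u; rewrite /= !inE negb_or => /and3P[/andP[ij il] jl _].
  rewrite /lie_br /evt evB !evM !evD -!/(evt _ _) !ET ?ltn_ord //.
  by rewrite (t4_rel3 Ht) ?subrr //; exact: (val_ord [:: i; j; l]).
- have := u; rewrite /= !inE !negb_or => /and4P[/and3P[ij _ _] _ lm _].
  rewrite /lie_br /evt evB !evM -!/(evt _ _) !ET ?ltn_ord //.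
  by rewrite (t4_rel4 Ht) ?subrr //; exact: (val_ord [:: i; j; l; m]).
Qed.
End KillT4.

Lemma kill_tsys (k : comPzRingType) (S : complAlgType k) (th : chomType (series k (t_alph 4)) S) :
  (forall f, t_rel k 4 f -> th f = 0) -> tsys4 (fun i j => th (t k 4 i j)).
Proof.
move=> rel.
have vord i : (0 < i <= 4)%N -> exists o : 'I_4, i = o.+1.
  by case: i => // i Hi; exists (Ordinal Hi).
have tf i j : fil 1 (th (t k 4 i j)) by apply: chom_fil; exact: fil_t.
have t0 i j : ~~ valid4 [:: i; j] -> th (t k 4 i j) = 0.
  by rewrite valid4_2 => /t_invalid ->; exact: chom0.
split=> [//|i j|i j l|i j l m].
- have [v|/negPf nv] := boolP (valid4 [:: i; j]); last first.
    by rewrite !t0 ?nv // (valid4_rot [:: i; j] : valid4 [:: j; i] = _) nv.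
  move: v; rewrite valid4_2 => /and3P[/vord[o ->] /vord[o' ->] oo'].
  have/rel : t_rel k 4 (t k 4 o.+1 o'.+1 - t k 4 o'.+1 o.+1).
    by constructor; rewrite -(inj_eq val_inj).
  by rewrite chomB => /subr0_eq.
- move=> /andP[/= u /and4P[/vord[oi Ei] /vord[oj Ej] /vord[ol El] _]].
  move: u; rewrite Ei Ej El !inE !eqSS !val_eqE => u.
  have/rel : t_rel k 4 (lie_br (t k 4 oi.+1 oj.+1) (t k 4 oi.+1 ol.+1 + t k 4 oj.+1 ol.+1)).
    by apply: t_rel3; rewrite /= !inE.
  by rewrite /lie_br chomB !chomM chomD => /lie_br_eq0.
- move=> /andP[/= u /and5P[/vord[oi Ei] /vord[oj Ej] /vord[ol El] /vord[om Em] _]].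
  move: u; rewrite Ei Ej El Em !inE !eqSS !val_eqE => u.
  have/rel : t_rel k 4 (lie_br (t k 4 oi.+1 oj.+1) (t k 4 ol.+1 om.+1)).
    by apply: t_rel4; rewrite /= !inE.
  by rewrite /lie_br chomB !chomM => /lie_br_eq0.
Qed.

Section U4.
Variables (k : comPzRingType) (N : nat).
Notation U := (quo (idtrunc (t_rel k 4) N)).
Notation pU := (qpi (idtrunc (t_rel k 4) N)).

Definition tU i j : U := pU (t k 4 i j).

Lemma tU_invalid i j : ~~ valid4 [:: i; j] -> tU i j = 0.
Proof. by rewrite valid4_2 => /t_invalid; rewrite /tU => ->. Qed.

Lemma tU_tsys : tsys4 tU.
Proof.
apply: (kill_tsys (th := pU)) => f Rf.
by rewrite -[RHS]qpi0; apply/qpiP; rewrite subr0; apply/idtr_gen/idgen_gen.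
Qed.

Lemma U_ext (S : complAlgType k) (th th' : chomType U S) :
  (forall i j, valid4 [:: i; j] -> th (tU i j) = th' (tU i j)) -> forall x, th x = th' x.
Proof.
move=> E x; rewrite -[x]qreprK.
apply: (chom_ext (th1 := th \o pU) (th2 := th' \o pU)) => q /=.
rewrite -t_letter; apply: E; case: q => -[i j] /= ij; rewrite valid4_2 !ltn_ord /= eqSS.
by rewrite (inj_eq val_inj).
Qed.

Lemma U_univ (S : complAlgType k) (t : nat -> nat -> S) : tsys4 t ->
  (forall x : S, fil N x -> x = 0) ->
  exists th : chomType U S, forall i j, valid4 [:: i; j] -> th (tU i j) = t i j.
Proof.
move=> Ht S0; pose ph : chomType _ _ := ev (fun q : t_alph 4 => t (val q).1.+1 (val q).2.+1).
have thI f : idtrunc (t_rel k 4) N f -> ph f = 0.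
  move=> [g Ig /(chom_fil ph)/S0]; rewrite chomB => /eqP; rewrite subr_eq0 => /eqP ->.
  apply: (idcl_kill (th := ph)); last exact: (idcl_gen Ig).
  by move=> h; exact: evt_kill.
exists (quo_map thI) => i j; rewrite valid4_2 => /and3P[Hi Hj ij].
by rewrite [LHS]quo_mapE; apply: evt_t => //; exact: t4_fil.
Qed.

Lemma swp_valid a i : (0 < a < 4)%N -> (0 < swp a i <= 4)%N = (0 < i <= 4)%N.
Proof.
rewrite /swp; case: a => [|[|[|[|a]]]] //; case: i => [|[|[|[|[|i]]]]] //.
Qed.
Lemma swpK a i : swp a (swp a i) = i.
Proof.
rewrite /swp; case: (eqVneq i a) => [->|ia]; first by rewrite eqxx gtn_eqF.
by case: (eqVneq i a.+1) => [->|/negPf ->]; rewrite ?eqxx // (negPf ia).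
Qed.
Lemma swp_valid4 a l : (0 < a < 4)%N -> valid4 (map (swp a) l) = valid4 l.
Proof.
move=> Ha; rewrite /valid4 (map_inj_uniq (can_inj (swpK a))) all_map; congr (_ && _).
by apply: eq_all => i /=; exact: swp_valid.
Qed.

(** Permutations of the labels act on the universal system, but need not act on a given algebra; the
    twisted pentagon is therefore first established in the universal one. *)
Lemma U_swp a : (0 < a < 4)%N ->
  exists th : chomType U U, forall i j, th (tU i j) = tU (swp a i) (swp a j).
Proof.
move=> Ha; have [tf ts t3 t4] := tU_tsys.
have Ht : tsys4 (fun i j => tU (swp a i) (swp a j)).
  split=> // [i j l v|i j l m v]; [apply: t3|apply: t4].
    by rewrite -[[:: _; _; _]]/(map (swp a) [:: i; j; l]) swp_valid4.
  by rewrite -[[:: _; _; _; _]]/(map (swp a) [:: i; j; l; m]) swp_valid4.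
have [th Hth] := U_univ Ht (@idtr_fil _ _ _ N); exists th => i j.
have [/Hth //|nv] := boolP (valid4 [:: i; j]).
rewrite !tU_invalid ?chom0 //.
by rewrite -[[:: _; _]]/(map (swp a) [:: i; j]) swp_valid4.
Qed.
End U4.

Lemma chom_pentL (k : comPzRingType) (S S' : complAlgType k) (th : chomType S S') F
    (t : nat -> nat -> S) : (forall i j, fil 1 (t i j)) ->
  th (pentL F t) = pentL F (fun i j => th (t i j)).
Proof.
move=> tf; have tD i j i' j' : fil 1 (t i j + t i' j') by apply: filD.
by rewrite /pentL !chomM !(chom_ev2 th) // !chomD.
Qed.
Lemma chom_pentR (k : comPzRingType) (S S' : complAlgType k) (th : chomType S S') F
    (t : nat -> nat -> S) : (forall i j, fil 1 (t i j)) ->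
  th (pentR F t) = pentR F (fun i j => th (t i j)).
Proof.
move=> tf; have tD i j i' j' : fil 1 (t i j + t i' j') by apply: filD.
by rewrite /pentR !chomM !(chom_ev2 th) // !chomD.
Qed.
Lemma eq_pentL (k : comPzRingType) (S : complAlgType k) F (t t' : nat -> nat -> S) :
  (forall i j, valid4 [:: i; j] -> t i j = t' i j) -> pentL F t = pentL F t'.
Proof. by move=> E; rewrite /pentL !E. Qed.
Lemma eq_pentR (k : comPzRingType) (S : complAlgType k) F (t t' : nat -> nat -> S) :
  (forall i j, valid4 [:: i; j] -> t i j = t' i j) -> pentR F t = pentR F t'.
Proof. by move=> E; rewrite /pentR !E. Qed.

(** The quotient of [u] and [v] differs from 1 by filtration [N], so it commutes with elements of
    filtration 1 when filtration [N.+1] vanishes. *)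
Lemma Adg_truncated (k : comPzRingType) (S : complAlgType k) N (u v y : S) :
  (forall x : S, fil N.+1 x -> x = 0) -> grp u -> grp v -> fil N (u - v) -> fil 1 y ->
  Adg u y = Adg v y.
Proof.
move=> S0 Gu Gv HN Hy.
have Hz : fil N (cinv v * u - 1) by rewrite -(gmulVr Gv) -mulrBr; apply: filMl.
have Ez : (cinv v * u - 1) * y = y * (cinv v * u - 1).
  transitivity (0 : S); first by apply: S0; have := filM Hz Hy; rewrite addn1.
  by apply/esym/S0; have := filM Hy Hz; rewrite add1n.
rewrite !AdgE //; apply: (mulrI_grp (grpV Gv)); apply: (mulIr_grp Gu).
transitivity (cinv v * u * y); first by gw.
transitivity (y * (cinv v * u)); last by gw.
by move: Ez; rewrite mulrBl mulrBr mul1r mulr1 => /addIr.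
Qed.

Section PentagonUniversal.
Variables (k : comPzRingType).
Notation pU N := (qpi (idtrunc (t_rel k 4) N)).
Implicit Types F g : series k bool.

Lemma pentL_tU F N : pentL F (@tU k N) = pU N (pentL F (t k 4)).
Proof. by rewrite chom_pentL // => i j; exact: fil_t. Qed.
Lemma pentR_tU F N : pentR F (@tU k N) = pU N (pentR F (t k 4)).
Proof. by rewrite chom_pentR // => i j; exact: fil_t. Qed.

Lemma pentS_U F : (forall N, pentL F (@tU k N) = pentR F (@tU k N)) -> pentS F.
Proof.
move=> H S t Ht; apply: eq_fil => N; have tf := t4_fil Ht.
pose th : chomType _ _ := ev (fun q : t_alph 4 => t (val q).1.+1 (val q).2.+1).
have EL : pentL F t = th (pentL F (Defs.t k 4)).
  rewrite chom_pentL; last by move=> i j; exact: fil_t.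
  by apply: eq_pentL => i j; rewrite valid4_2 => /and3P[Hi Hj ij]; exact/esym/evt_t.
have ER : pentR F t = th (pentR F (Defs.t k 4)).
  rewrite chom_pentR; last by move=> i j; exact: fil_t.
  by apply: eq_pentR => i j; rewrite valid4_2 => /and3P[Hi Hj ij]; exact/esym/evt_t.
have := H N; rewrite pentL_tU pentR_tU => /qpiP[h Ih Hh].
have /(chom_fil th) := Hh; rewrite chomB (_ : th h = 0) ?subr0 ?chomB ?EL ?ER //.
by apply: (idcl_kill (th := th)); [move=> r; exact: evt_kill | exact: idcl_gen].
Qed.

Lemma twist_pentagon_U F g N : grp F -> grp g -> dualS g -> cycS g -> sumS g -> pentS F ->
  (forall x, Adg (pentL g (@tU k N)) x = Adg (pentR g (@tU k N)) x) ->
  cinv (pentL g (@tU k N)) * pentL (twist F g) (@tU k N) =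
  cinv (pentR g (@tU k N)) * pentR (twist F g) (@tU k N).
Proof.
move=> GF Gg gd gc gs Fp Kz.
have [s1 s1t] := @U_swp k N 1 isT; have [s2 s2t] := @U_swp k N 2 isT.
have [s3 s3t] := @U_swp k N 3 isT; have Ht := tU_tsys k N.
have s13 x : s1 (s3 x) = s3 (s1 x).
  apply: (U_ext (th := s1 \o s3) (th' := s3 \o s1)) => i j /= v.
  rewrite !(s1t, s3t); congr (tU _ _ _ _); rewrite /swp;
  by [move: i {v} => [|[|[|[|[|i]]]]] | move: j {v} => [|[|[|[|[|j]]]]]].
have s121 x : s1 (s2 (s1 x)) = s2 (s1 (s2 x)).
  apply: (U_ext (th := s1 \o s2 \o s1) (th' := s2 \o s1 \o s2)) => i j /= v.
  rewrite !(s1t, s2t); congr (tU _ _ _ _); rewrite /swp;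
  by [move: i {v} => [|[|[|[|[|i]]]]] | move: j {v} => [|[|[|[|[|j]]]]]].
have s232 x : s2 (s3 (s2 x)) = s3 (s2 (s3 x)).
  apply: (U_ext (th := s2 \o s3 \o s2) (th' := s3 \o s2 \o s3)) => i j /= v.
  rewrite !(s2t, s3t); congr (tU _ _ _ _); rewrite /swp;
  by [move: i {v} => [|[|[|[|[|i]]]]] | move: j {v} => [|[|[|[|[|j]]]]]].
have sK (s : chomType _ _) a : (forall i j, s (tU k N i j) = tU k N (swp a i) (swp a j)) ->
    forall x, s (s x) = x.
  by move=> st x; apply: (U_ext (th := s \o s) (th' := idfun)) => i j /= v; rewrite !st !swpK.
apply: (pentagon_twist GF Gg gd gc gs Fp Ht (sK _ _ s1t) (sK _ _ s2t) (sK _ _ s3t)) => //.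
Qed.

Lemma twist_pent F g : grp F -> grp g -> dualS g -> cycS g -> sumS g ->
  pentS F -> pentS g -> pentS (twist F g).
Proof.
move=> GF Gg gd gc gs Fp gp; apply: pentS_U => N.
have Ht := tU_tsys k N; have E := gp _ _ Ht.
have := twist_pentagon_U (N := N) GF Gg gd gc gs Fp; rewrite E => /(_ (fun=> erefl)).
by apply: mulrI_grp; apply: grpV; rewrite /pentR; grps.
Qed.

(** Induction on the truncation. The pentagon modulo [N] makes both sides act equally by conjugation
    modulo [N.+1], so the twisted pentagon identity is available there, and the pentagon of
    [twist F g] cancels from it. *)
Lemma untwist_pent F g : grp F -> grp g -> dualS g -> cycS g -> sumS g ->
  pentS F -> pentS (twist F g) -> pentS g.
Proof.
move=> GF Gg gd gc gs Fp Fp'; apply: pentS_U; elim=> [|N IH].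
  apply/eqP; rewrite -subr_eq0; apply/eqP/idtr_fil; exact: fil0.
have GL : grp (pentL g (@tU k N.+1)) by rewrite /pentL; grps.
have GR : grp (pentR g (@tU k N.+1)) by rewrite /pentR; grps.
have HN : fil N (pentL g (@tU k N.+1) - pentR g (@tU k N.+1)).
  move: IH; rewrite pentL_tU pentR_tU => /qpiP[h Ih Hh].
  have E0 : pU N.+1 h = 0 by rewrite -[RHS]qpi0; apply/qpiP; rewrite subr0; apply: idtr_gen.
  have -> : pentL g (@tU k N.+1) - pentR g (@tU k N.+1) =
      pU N.+1 (pentL g (t k 4) - pentR g (t k 4) - h).
    by rewrite pentL_tU pentR_tU !qpiD !qpiN E0 subr0.
  exact: (chom_fil (pU N.+1)).
have Kz x : Adg (pentL g (@tU k N.+1)) x = Adg (pentR g (@tU k N.+1)) x.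
  have [f ->] : exists f, x = pU N.+1 f by exists (qrepr x); rewrite qreprK.
  apply: (chom_ext (th1 := Adg (pentL g (@tU k N.+1)) \o pU N.+1)
    (th2 := Adg (pentR g (@tU k N.+1)) \o pU N.+1)) => q /=.
  have Hq : fil 1 (letter k q) by exact: fil_letter.
  pose y := pU N.+1 (letter k q); rewrite -[qpi _ _]/y.
  have Hy : fil 1 y by exact: (chom_fil (pU N.+1)).
  exact: (Adg_truncated (@idtr_fil _ _ _ N.+1) GL GR HN Hy).
have := twist_pentagon_U (N := N.+1) GF Gg gd gc gs Fp Kz.
rewrite (Fp' _ _ (tU_tsys k N.+1)) => E.
have GT : grp (pentR (twist F g) (@tU k N.+1)) by rewrite /pentR; grps.
by rewrite -(cinvK GL) (mulIr_grp GT E) cinvK.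
Qed.
End PentagonUniversal.

(** * Elliptic systems *)

Definition br (S : pzRingType) (x y : S) := x * y - y * x.

Section EllSystems.
Variables (k : comPzRingType) (S : complAlgType k).
Implicit Types (p q r : bool -> S).

Lemma br_eq0 (x y : S) : br x y = 0 -> x * y = y * x.
Proof. exact: subr0_eq. Qed.
Lemma br_eq0P (x y : S) : x * y = y * x -> br x y = 0.
Proof. by rewrite /br => ->; rewrite subrr. Qed.

(* the relations of t_{1,3} for p = x_1, q = x_2, r = x_3 *)
Definition esys p q r :=
  [/\ [/\ forall s, fil 1 (p s), forall s, fil 1 (q s) & forall s, p s + q s + r s = 0],
      forall s, br (p s) (q s) = 0,
      br (p true) (q false) = br (q true) (p false)
    & forall s, br (r s) (br (p true) (q false)) = 0].

Definition et p q := br (p true) (q false).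

Section Facts.
Variables p q r : bool -> S.
Hypothesis H : esys p q r.

Lemma esys_r s : r s = - (p s + q s).
Proof.
case: H => -[_ _ H0 _ _ _]; have := H0 s; set u := p s; set v := q s => E.
have -> : r s = (u + v + r s) - (u + v) by ncring.
by rewrite E sub0r.
Qed.

Lemma esys_fil : [/\ forall s, fil 1 (p s), forall s, fil 1 (q s) & forall s, fil 1 (r s)].
Proof.
have E := esys_r; case: H => -[Hp Hq _ _ _ _]; split=> // s.
by rewrite E; apply/filN/filD.
Qed.

Lemma esys_swap : esys q p r.
Proof.
case: H => -[Hp Hq H0 H1 H2 H3]; split.
- by split=> // s; rewrite -(H0 s) [q s + p s]addrC.
- by move=> s; apply/br_eq0P/esym/br_eq0.
- by [].
- by move=> s; rewrite -H2.
Qed.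

Lemma esys_b : br (q true) (r false) = br (r true) (q false).
Proof.
have E := esys_r; case: H => -[_ _ _ _ H2 _]; rewrite !E; move: H2.
move: (p true) (p false) (q true) (q false) => P P' Q Q' H2.
have -> : br Q (- (P' + Q')) = - br Q P' - br Q Q' by rewrite /br; ncring.
by rewrite -H2 /br; ncring.
Qed.

Lemma esys_qr s : br (q s) (r s) = 0.
Proof.
rewrite esys_r; case: H => -[_ _ _ H1 _ _]; have := H1 s; set P := p s; set Q := q s => E.
have -> : br Q (- (P + Q)) = br P Q by rewrite /br; ncring.
by [].
Qed.

Lemma esys_pb s : br (p s) (br (q true) (r false)) = 0.
Proof.
have E := esys_r; case: H => -[_ _ _ H1 H2 H3]; have := H3 s; rewrite !E.
case: s; rewrite ?E.
- have := H1 true; move: (p true) (p false) (q true) (q false) H2 => P P' Q Q' H2 h1 h3.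
  have -> : br P (br Q (- (P' + Q'))) = - br P (br Q P') - br Q (br P Q') - br (br P Q) Q'.
    by rewrite /br; ncring.
  rewrite h1 -H2 -[RHS]h3; set z := br P Q'; rewrite /br; ncring.
- have := H1 false; move: (p true) (p false) (q true) (q false) H2 => P P' Q Q' H2 h1 h3.
  have -> : br P' (br Q (- (P' + Q'))) = - br P' (br Q P') + br Q' (br P' Q) - br Q (br P' Q').
    by rewrite /br; ncring.
  have -> : br P' Q = - br Q P' by rewrite /br; ncring.
  by rewrite h1 -H2 -[RHS]h3; set z := br P Q'; rewrite /br; ncring.
Qed.

(** [esys] records only the relations in which [p] and [q] lead. The others follow from the Jacobi
    identity after eliminating [r]; with [esys_swap] this gives symmetry under all permutations. *)
Lemma esys_rot : esys q r p.
Proof.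
have [Hp Hq Hr] := esys_fil; split.
- split=> // s; case: H => -[_ _ H0 _ _ _]; rewrite -(H0 s).
  by set x := p s; set y := q s; set z := r s; ncring.
- exact: esys_qr.
- exact: esys_b.
- exact: esys_pb.
Qed.
End Facts.

Section Triple.
Variables p q r : bool -> S.
Hypothesis H : esys p q r.
Let a := et p q.
Let b := et q r.
Let c := et p r.

Lemma et_sym : et p q = et q p. Proof. by case: H. Qed.
Lemma et_sym' : et q r = et r q. Proof. exact: (esys_b H). Qed.
Lemma et_fil2 : fil 2 a.
Proof. by have [Hp Hq _] := esys_fil H; apply: (@lie_br_fil _ _ 1 1). Qed.
Lemma et_r s : a * r s = r s * a.
Proof. by case: H => _ _ _ H3; apply/esym/br_eq0. Qed.
End Triple.

Section Triple2.
Variables p q r : bool -> S.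
Hypothesis H : esys p q r.
Let a := et p q.
Let b := et q r.
Let c := et p r.
Let H' := esys_rot H.
Let H'' := esys_rot H'.

Lemma et_sym'' : et p r = et r p. Proof. by rewrite (et_sym H''). Qed.
Lemma et_p s : b * p s = p s * b. Proof. exact: (et_r H'). Qed.
Lemma et_q s : c * q s = q s * c. Proof. by rewrite /c et_sym''; exact: (et_r H''). Qed.

Lemma et_ac : a + c = - br (p true) (p false).
Proof.
have := esys_r H false; rewrite /a /c /et => ->.
by move: (p false) (p true) (q false) => x y z; rewrite /br; ncring.
Qed.
Lemma et_bc : b + c = - br (r true) (r false).
Proof.
have := esys_r H true; rewrite /b /c /et => ->.
by move: (p true) (q true) (r false) => x y z; rewrite /br; ncring.
Qed.

(** [b + c] is a bracket in [r] alone, with which [a] commutes; [a + c] is a bracket in [p] alone,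
    with which [b] commutes. *)
Lemma et_tri : tri a b c.
Proof.
have fa := fil_le (isT : (1 <= 2)%N) (et_fil2 H).
have fb := fil_le (isT : (1 <= 2)%N) (et_fil2 H').
have fc : fil 1 c.
  rewrite /c et_sym''; exact: fil_le (isT : (1 <= 2)%N) (et_fil2 H'').
split=> //.
  have E : (b + c) * a = a * (b + c).
    by rewrite et_bc; apply/esym/centN/centD; [|apply: centN]; apply: centM; exact: (et_r H).
  have -> : (a + b + c) * a = a * a + (b + c) * a by move: b c {E fb fc}=> y z; ncring.
  by rewrite E; move: b c {E fb fc} => y z; ncring.
have E : (a + c) * b = b * (a + c).
  by rewrite et_ac; apply/esym/centN/centD; [|apply: centN]; apply: centM; exact: et_p.
have -> : (a + b + c) * b = b * b + (a + c) * b by move: a c {E fa fc} => y z; ncring.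
by rewrite E; move: a c {E fa fc} => y z; ncring.
Qed.
End Triple2.
End EllSystems.

(** * The elliptic relations and their twist *)

Section EllStatements.
Variables (k : comPzRingType) (iota : {rmorphism rat -> k}).
Implicit Types (F g A u : series k bool).
Local Notation e := (cex iota).

Definition evx (S : complAlgType k) A (p : bool -> S) := ev2 A (p true) (p false).

Definition alphaS nu F A := forall (S : complAlgType k) (p q r : bool -> S), esys p q r ->
  let a := et p q in let b := et q r in let c := et p r in
  (e nu (b + c) * evx A r * ev2 F c a) * (e nu (a + b) * evx A q * ev2 F b c) *
    (e nu (a + c) * evx A p * ev2 F a b) = 1.

Definition gcm (S : complAlgType k) (x y : S) := x * y * cinv x * cinv y.

Definition commS nu F Ap Am := forall (S : complAlgType k) (p q r : bool -> S), esys p q r ->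
  let a := et p q in let b := et q r in let c := et p r in
  e nu a * e nu a = gcm (cinv (ev2 F a b) * evx Am p * ev2 F a b)
    (cinv (e nu a) * cinv (ev2 F a c) * cinv (evx Ap q) * (ev2 F a c * cinv (e nu a))).

Section U.
Variables (g : series k bool) (u : bool -> series k bool).
Section V.
Variables (S : complAlgType k) (p q r : bool -> S).
Definition evu s (p : bool -> S) := evx (u s) p.
Definition uy1 s := Adg (cinv (ev2 g (et p q) (et q r))) (evu s p).
Definition uy2 s := Adg (cinv (ev2 g (et p q) (et p r))) (evu s q).
Definition uy3 s := evu s r.
End V.

Definition uS := forall (S : complAlgType k) (p q r : bool -> S), esys p q r ->
  [/\ forall s, uy1 p q r s + uy2 p q r s + uy3 r s = 0,
      forall s, br (uy1 p q r s) (uy3 r s) = 0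
    & br (uy1 p q r true) (uy2 p q r false) = et p q].
End U.

Section EllTwist.
Variables (g : series k bool) (u : bool -> series k bool).
Hypotheses (Gg : grp g) (gd : dualS g) (gc : cycS g) (gs : sumS g).
Hypotheses (uf : forall s, fil 1 (u s)) (gu : uS g u).

Section Y.
Variables (S : complAlgType k) (p q r : bool -> S).
Hypothesis H : esys p q r.
Let a := et p q.
Let b := et q r.
Let c := et p r.
Let y1 := uy1 g u p q r.
Let y2 := uy2 g u p q r.
Let y3 := uy3 u r.

Let evu_fil (x : bool -> S) s : (forall s, fil 1 (x s)) -> fil 1 (evu u s x).
Proof. by move=> Hx; apply: ev2_fil. Qed.
Let gG (x y : S) : grp (ev2 g x y). Proof. exact: ev2_grp. Qed.

Lemma uy_swap s : uy2 g u q p r s = y1 s /\ uy1 g u q p r s = y2 s.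
Proof. by split; rewrite /y1 /y2 /uy1 /uy2 -(et_sym H). Qed.

(** Rotating the system rotates the twisted system, up to conjugation by [g(a, b)]: the cyclic
    relation accounts for [y2] and duality for [y3]. *)
Lemma uy_rot s : let: h := Adg (cinv (ev2 g a b)) in
  [/\ y1 s = h (uy3 u p s), y2 s = h (uy1 g u q r p s) & y3 s = h (uy2 g u q r p s)].
Proof.
have [fp fq fr] := esys_fil H; have [Ha Hb Hc _ _] := et_tri H.
split=> //.
- rewrite /uy1 -(et_sym'' H) -/b -/c (cyc_bc (et_tri H) Gg gd gc) -/a.
  by rewrite -Adg_mul; [|by grps|by grps]; congr (Adg _ _); rewrite /a /b /c; gw.
- rewrite /uy2 -(et_sym H) -/b -/a (gd Ha Hb) cinvK // AdgK //.
Qed.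

(** Sum and commutation are those of [uS]. The symmetry of the mixed bracket comes from [uS] on the
    system with [p] and [q] exchanged, and t_12 commutes with [r], hence with any series in it. *)
Lemma uy_sys : esys y1 y2 y3.
Proof.
have [fp fq fr] := esys_fil H; have [h1 h2 h3] := gu H.
have f1 s : fil 1 (y1 s) by apply: Adg_fil; exact: evu_fil.
have f2 s : fil 1 (y2 s) by apply: Adg_fil; exact: evu_fil.
split=> [|s||s].
- by split.
- have := h1 s; rewrite -/(y1 s) -/(y2 s) -/(y3 s) => E; have := h2 s; rewrite -/(y1 s) -/(y3 s).
  have -> : y3 s = - (y1 s + y2 s).
    move: E; move: (y1 s) (y2 s) (y3 s) => x y z E.
    have -> : z = (x + y + z) - (x + y) by ncring.
    by rewrite E sub0r.
  move: (y1 s) (y2 s) => x y {}E; have -> : br x y = - br x (- (x + y)) by rewrite /br; ncring.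
  by rewrite E oppr0.
- rewrite h3; have [_ _] := gu (esys_swap H).
  have [-> _] := uy_swap false; have [_ ->] := uy_swap true.
  by rewrite -(et_sym H) => ->.
- rewrite h3; apply: br_eq0P; apply/esym; apply: ev2_comm => //; exact: (et_r H).
Qed.

Lemma uy_a : et y1 y2 = a. Proof. by have [_ _] := gu H. Qed.
Lemma uy_b : et y2 y3 = Adg (cinv (ev2 g a b)) b.
Proof.
have [_ E2 E3] := uy_rot true; have [_ E2' E3'] := uy_rot false.
rewrite /et E2 E3' /br -!AdgM -AdgB; congr (Adg _ _).
by have [_ _] := gu (esys_rot H).
Qed.
End Y.

Lemma uy_c (S : complAlgType k) (p q r : bool -> S) : esys p q r ->
  et (uy1 g u p q r) (uy3 u r) = Adg (cinv (ev2 g (et p q) (et p r))) (et p r).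
Proof.
move=> H; rewrite [et p q](et_sym H) -(uy_b (esys_swap H)) /et.
by have [-> _] := uy_swap H true.
Qed.

Let tw A : series k bool := ev2 A (u true) (u false).

Lemma evx_uy A (S : complAlgType k) (p : bool -> S) : (forall s, fil 1 (p s)) ->
  evx A (uy3 u p) = evx (tw A) p.
Proof. by move=> fp; rewrite /evx /tw ev2_ev2. Qed.
Lemma evx_Adg A (S : complAlgType k) (h : S) (p : bool -> S) : grp h -> (forall s, fil 1 (p s)) ->
  evx A (fun s => Adg h (evu u s p)) = Adg h (evx (tw A) p).
Proof.
move=> Gh fp; have fu s : fil 1 (evu u s p) by apply: ev2_fil.
by rewrite /evx -Adg_ev2 // /tw ev2_ev2.
Qed.

(** The relation of [A] is evaluated on the twisted system. Since the central sum is preserved, the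
    exponents [a + b'] and [a + c'] are conjugates of [a + b] and [a + c], after which the factors
    of [g] cancel. *)
Lemma alpha_twist nu F A : grp F -> grp A -> alphaS nu F A ->
  alphaS nu (twist F g) (tw A).
Proof.
move=> GF GA FA S p q r H a b c; have := FA _ _ _ _ (uy_sys H); lazy zeta.
have HT := et_tri H; have [Ha Hb Hc ca cb] := HT; have [fp fq fr] := esys_fil H.
have cc := tri_c HT.
rewrite (uy_a H) (uy_b H) (uy_c H) -/a -/b -/c.
have [E1 E2] := hex_twist nu HT GF Gg gd gs; rewrite -/a -/b -/c in E1 E2.
rewrite E1 E2 {E1 E2} (bc_twist HT GF Gg gd gc) evx_uy // !evx_Adg //; try by apply/grpV/ev2_grp.
have := gs HT; rewrite -/a -/b -/c; set b' := Adg _ b; set c' := Adg _ c => Es.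
have Gab := ev2_grp a b Gg; have Gac := ev2_grp a c Gg.
have TF x y : (a + b + c) * x = x * (a + b + c) -> (a + b + c) * y = y * (a + b + c) ->
   fil 1 x -> fil 1 y -> Adg (cinv (ev2 g x y)) (a + b + c) = a + b + c.
  by move=> cx cy fx fy; rewrite Adg_id; [|exact/grpV/ev2_grp|by apply/esym; cent].
have -> : b' + c' = b + c.
  by transitivity (a + b' + c' - a); [|rewrite Es]; ncring.
have -> : a + c' = Adg (cinv (ev2 g a b)) (a + c).
  have -> : a + c = (a + b + c) - b by ncring.
  rewrite AdgB TF // -/b' -Es; ncring.
have -> : a + b' = Adg (cinv (ev2 g a c)) (a + b).
  have -> : a + b = (a + b + c) - c by ncring.
  rewrite AdgB TF // -/c' -Es; ncring.
have fac : fil 1 (a + c) by exact: filD.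
have fab : fil 1 (a + b) by exact: filD.
rewrite -!Adg_cex // !AdgE ?cinvK //; try exact: grpV.
have GA' : grp (tw A) by apply: ev2_grp.
move=> E; have Ga1 := cex_grp iota nu (b + c); have GFt := grp_twist Gg GF.
by gby E; apply: ev2_grp.
Qed.

Lemma comm_twist nu F Ap Am : grp F -> grp Ap -> grp Am -> commS nu F Ap Am ->
  commS nu (twist F g) (tw Ap) (tw Am).
Proof.
move=> GF GAp GAm FA S p q r H a b c; have := FA _ _ _ _ (uy_sys H); lazy zeta.
have HT := et_tri H; have [Ha Hb Hc ca cb] := HT; have [fp fq fr] := esys_fil H.
rewrite (uy_a H) (uy_b H) (uy_c H) -/a -/b -/c => ->.
have Gab := ev2_grp a b Gg; have Gac := ev2_grp a c Gg.
have TwK x y : fil 1 x -> fil 1 y -> ev2 F x (Adg (cinv (ev2 g x y)) y) =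
    cinv (ev2 g x y) * ev2 (twist F g) x y.
  by move=> Hx Hy; rewrite ev2_twist' // gmulVKr //; exact: ev2_grp.
rewrite !TwK // !evx_Adg //; try exact: grpV.
rewrite !AdgE ?cinvK //; try exact: grpV.
have GAp' : grp (tw Ap) by apply: ev2_grp.
have GAm' : grp (tw Am) by apply: ev2_grp.
have GFt := grp_twist Gg GF.
by rewrite /gcm -/a -/b -/c; gw; apply: ev2_grp.
Qed.
End EllTwist.
End EllStatements.

(** * Group words attached to an elliptic associator *)

Section EllWords.
Variables (k : comPzRingType) (iota : {rmorphism rat -> k}).
Local Notation e := (cex iota).

Definition sg (s : bool) (nu : k) := if s then nu else - nu.

Section Words.
Variables (nu : k) (F : series k bool) (A : bool -> series k bool).
Variables (S : complAlgType k) (p q r : bool -> S).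

(** [W1], [W2], [W3] are modelled on the images of the generators X_i of the elliptic braid group on
    three strands. The sign [s] selects A_+ or A_-, and [sg s nu] the matching sign of the coupling
    constant. *)
Definition W1 s := cinv (ev2 F (et p q) (et q r)) * evx (A s) p * ev2 F (et p q) (et q r).
Definition W2 s := e (sg s nu) (et p q) *
  (cinv (ev2 F (et p q) (et p r)) * evx (A s) q * ev2 F (et p q) (et p r)) *
  e (sg s nu) (et p q).
Definition W3 s := e (sg s nu) (et q r + et p r) * evx (A s) r * e (sg s nu) (et q r + et p r).

Hypotheses (GF : grp F) (GA : forall s, grp (A s)) (Fd : dualS F)
  (Fh : forall s, hexS iota (sg s nu) F)
  (FA : forall s, alphaS iota (sg s nu) F (A s)) (FC : commS iota nu F (A true) (A false)).
Hypothesis H : esys p q r.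
Let a := et p q.
Let b := et q r.
Let c := et p r.
Let HT := et_tri H.

Let Ha : fil 1 a. Proof. by case: HT. Qed.
Let Hb : fil 1 b. Proof. by case: HT. Qed.
Let Hc : fil 1 c. Proof. by case: HT. Qed.
Let Hp s : fil 1 (p s). Proof. by case: (esys_fil H). Qed.
Let Hq s : fil 1 (q s). Proof. by case: (esys_fil H). Qed.
Let Hr s : fil 1 (r s). Proof. by case: (esys_fil H). Qed.
Let Ta : (a + b + c) * a = a * (a + b + c). Proof. by case: HT. Qed.
Let Tb : (a + b + c) * b = b * (a + b + c). Proof. by case: HT. Qed.
Let Tc : (a + b + c) * c = c * (a + b + c). Proof. exact: tri_c HT. Qed.

Let GE n (x : S) : grp (e n x). Proof. exact: cex_grp. Qed.
Let GX (x y : S) : grp (ev2 F x y). Proof. exact: ev2_grp. Qed.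
Let GY s (x : bool -> S) : grp (evx (A s) x). Proof. exact: ev2_grp. Qed.

Lemma W1_grp s : grp (W1 s). Proof. by rewrite /W1; grps. Qed.
Lemma W2_grp s : grp (W2 s). Proof. by rewrite /W2; grps. Qed.
Lemma W3_grp s : grp (W3 s). Proof. by rewrite /W3; grps. Qed.

Let tE n x : (a + b + c) * x = x * (a + b + c) -> fil 1 x ->
  e n (a + b + c) * e n x = e n x * e n (a + b + c).
Proof. by move=> cx fx; apply: cex_comm; [exact: tri_fil HT | exact/esym/cex_comm]. Qed.
Let tX n x y : (a + b + c) * x = x * (a + b + c) -> (a + b + c) * y = y * (a + b + c) ->
  fil 1 x -> fil 1 y -> e n (a + b + c) * ev2 F x y = ev2 F x y * e n (a + b + c).
Proof. by move=> cx cy fx fy; apply: cex_comm; [exact: tri_fil HT | exact: ev2_comm]. Qed.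

Let Da n : e n (b + c) * e n a = e n (a + b + c).
Proof.
rewrite -cexD //; [congr (e n _); ncring|exact: filD|].
have -> : (b + c) * a = (a + b + c) * a - a * a by ncring.
by rewrite Ta; ncring.
Qed.
Let Db n : e n (a + c) * e n b = e n (a + b + c).
Proof.
rewrite -cexD //; [congr (e n _); ncring|exact: filD|].
have -> : (a + c) * b = (a + b + c) * b - b * b by ncring.
by rewrite Tb; ncring.
Qed.
Let Dc n : e n (a + b) * e n c = e n (a + b + c).
Proof.
rewrite -cexD //; [exact: filD|].
have -> : (a + b) * c = (a + b + c) * c - c * c by ncring.
by rewrite Tc; ncring.
Qed.

Let cY n s : e n c * evx (A s) q = evx (A s) q * e n c.
Proof. by apply: cex_comm => //; apply: ev2_comm => //; exact: et_q. Qed.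
Let aY n s : e n a * evx (A s) r = evx (A s) r * e n a.
Proof. by apply: cex_comm => //; apply: ev2_comm => //; exact: et_r. Qed.

(** The [alphaS] relation combined with the hexagon for (a, c, b), which turns the product of [Phi]
    factors between [W2] and [W1] into [F(b, c)]; the exponential of t_13 passes through A(x_2). *)
Lemma word321 s : W3 s * W2 s * W1 s = 1.
Proof.
rewrite /W1 /W2 /W3 -/a -/b -/c; set n := sg s nu.
have := FA s H; lazy zeta; rewrite -/a -/b -/c -/n => al.
have := Fh s (tri_sym12 HT); rewrite -/a -/b -/c -/n.
have -> : a + c + b = a + b + c by ncring.
move: al; rewrite (Fd Hb Hc) (Fd Ha Hb) (Fd Ha Hc).
have := tX n Ta Tc Ha Hc; have := tX n Tb Tc Hb Hc.
have := tE n Tb Hb; have := cY n s; have := Da n; have := Db n; have := Dc n.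
move: (GE n a) (GE n b) (GE n c) (GE n (a + b + c)) (GE n (b + c)) (GE n (a + c)) (GE n (a + b)).
move: (GX a b) (GX a c) (GX b c) (GY s p) (GY s q) (GY s r).
move: (e n a) (e n b) (e n c) (e n (a + b + c)) (e n (b + c)) (e n (a + c)) (e n (a + b)).
move: (ev2 F a b) (ev2 F a c) (ev2 F b c) (evx (A s) p) (evx (A s) q) (evx (A s) r).
move=> xab xac xbc Ap Aq Ar ea eb ec t ebc eac eab.
move=> G1 G2 G3 G4 G5 G6 G7 G8 G9 Ga Gb Gc Gd dc db da cA teb txbc txac al hex.
have k1 : t * cinv xac * Aq = cinv xac * eab * Aq * ec.
  have tV : t * cinv xac = cinv xac * t by cent.
  by rewrite tV -dc -!mulrA cA.
have k2 : ec * xac * ea * cinv xab = xbc * eac.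
  transitivity (t * xbc * cinv eb); first by rewrite -hex; gw.
  by rewrite txbc -db; gw.
transitivity (ebc * Ar * (ebc * ea) * (cinv xac * Aq * xac * ea * cinv xab * Ap * xab)); first by gw.
rewrite da; transitivity (ebc * Ar * (t * cinv xac * Aq) * (xac * ea * cinv xab * Ap * xab)); first by gw.
rewrite k1; transitivity (ebc * Ar * (cinv xac * eab * Aq) * (ec * xac * ea * cinv xab) * (Ap * xab)); first by gw.
by rewrite k2; gby al.
Qed.

Lemma comm_E3 s n : e n a * W3 s = W3 s * e n a.
Proof.
have cbc : a * (b + c) = (b + c) * a.
  have -> : a * (b + c) = a * (a + b + c) - a * a by ncring.
  by rewrite -Ta; ncring.
have cE : e n a * e (sg s nu) (b + c) = e (sg s nu) (b + c) * e n a.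
  by apply: cex_comm => //; apply/esym/cex_comm => //; exact: filD.
rewrite /W3 -/a -/b -/c; apply: centM => //; apply: centM => //.
Qed.
End Words.

Section Words2.
Variables (nu : k) (F : series k bool) (A : bool -> series k bool).
Hypotheses (GF : grp F) (GA : forall s, grp (A s)) (Fd : dualS F)
  (Fh : forall s, hexS iota (sg s nu) F)
  (FA : forall s, alphaS iota (sg s nu) F (A s)) (FC : commS iota nu F (A true) (A false)).

Section Swap.
Variables (S : complAlgType k) (p q r : bool -> S).
Hypothesis H : esys p q r.

Lemma W1_swap s : W1 F A q p r s =
  cinv (e (sg s nu) (et p q)) * W2 nu F A p q r s * cinv (e (sg s nu) (et p q)).
Proof.
have GE := cex_grp iota (sg s nu) (et p q).
by rewrite /W1 /W2 -(et_sym H); gw; try exact: ev2_grp.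
Qed.
Lemma W2_swap s : W2 nu F A q p r s =
  e (sg s nu) (et p q) * W1 F A p q r s * e (sg s nu) (et p q).
Proof. by rewrite /W1 /W2 -(et_sym H). Qed.
Lemma W3_swap s : W3 nu A q p r s = W3 nu A p q r s.
Proof. by rewrite /W3 addrC. Qed.
End Swap.

Section Relations.
Variables (S : complAlgType k) (p q r : bool -> S).
Hypothesis H : esys p q r.
Let a := et p q.
Let b := et q r.
Let c := et p r.
Let HT := et_tri H.
Let Ha : fil 1 a. Proof. by case: HT. Qed.
Let Hb : fil 1 b. Proof. by case: HT. Qed.
Let Hc : fil 1 c. Proof. by case: HT. Qed.
Let X1 := W1 F A p q r.
Let X2 := W2 nu F A p q r.
Let X3 := W3 nu A p q r.
Let z := e nu a * e nu a.
Let Ga : grp (e nu a). Proof. exact: cex_grp. Qed.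
Let G1 s : grp (X1 s). Proof. exact: W1_grp. Qed.
Let G2 s : grp (X2 s). Proof. exact: W2_grp. Qed.
Let G3 s : grp (X3 s). Proof. exact: W3_grp. Qed.

(** The product relation is compared with its version for [p] and [q] exchanged: [W3] is the same in
    both and commutes with the exponential of [a]. *)
Lemma word12 s : X1 s * X2 s = X2 s * X1 s.
Proof.
have := word321 GF GA Fd Fh FA (esys_swap H) s.
rewrite (W1_swap H) W2_swap // W3_swap -/(X1 s) -/(X2 s) -/(X3 s) -/a.
have := comm_E3 nu A H s (sg s nu); rewrite -/a -/(X3 s).
have := word321 GF GA Fd Fh FA H s; rewrite -/(X1 s) -/(X2 s) -/(X3 s).
move: (G1 s) (G2 s) (G3 s) (cex_grp iota (sg s nu) a).
move: (X1 s) (X2 s) (X3 s) (e (sg s nu) a) => x y w f Gx Gy Gw Gf h1 h2 h3.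
have h4 : w * x * y = 1.
  transitivity (cinv f * (f * w) * x * y); first by gw.
  by rewrite h2; gby (congr1 (fun t => cinv f * t * f) h3).
by gby (congr1 (fun t => cinv w * t) (etrans h4 (esym h1))).
Qed.

Lemma z_word : z = gcm (X1 false) (cinv (X2 true)).
Proof.
have := FC H; lazy zeta; rewrite -/a -/b -/c -/z => ->.
have GA' s x : grp (evx (A s) x : S) by apply: ev2_grp.
have GX x y : grp (ev2 F x y : S) by apply: ev2_grp.
by rewrite /gcm /X1 /X2 /W1 /W2 /= -/a -/b -/c; gw.
Qed.

(** The commutator relation for [p] and [q] exchanged, conjugated by the exponential of [a].
    Equating the two expressions of [z] is what yields [x_1, y_2] = [x_2, y_1] in lowest degree. *)
Lemma z_word' : z = gcm (X2 false * z) (cinv z * cinv (X1 true)).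
Proof.
have := FC (esys_swap H); lazy zeta; rewrite -(et_sym H) -/a -/b -/c -/z.
have GA' s x : grp (evx (A s) x : S) by apply: ev2_grp.
have GX x y : grp (ev2 F x y : S) by apply: ev2_grp.
move=> E; transitivity (cinv (e nu a) * z * e nu a); first by rewrite /z; gw.
rewrite {1}E /gcm /X1 /X2 /W1 /W2 /= -/a -/b -/c cexN // /z.
by gw.
Qed.

Lemma z_word3 s : z * X3 s = X3 s * z.
Proof.
have := comm_E3 nu A H s nu; rewrite -/a -/(X3 s) => E.
by rewrite /z -mulrA E mulrA E mulrA.
Qed.

(** The commutator relation of the rotated system, conjugated by means of the hexagon for -nu, gives
    a commutator with a different second entry; the entry is then corrected by a factor commuting
    with the first one. *)
Lemma b_word : Yel iota nu F a b = gcm (X2 false * z) (cinv (X3 true)).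
Proof.
have := FC (esys_rot H); lazy zeta; rewrite -(et_sym'' H) -(et_sym H) -/a -/b -/c.
rewrite (Fd Ha Hb).
have fT : fil 1 (a + b + c) := tri_fil HT.
have Ta : (a + b + c) * a = a * (a + b + c) by case: HT.
have Tb : (a + b + c) * b = b * (a + b + c) by case: HT.
have := Fh false HT; rewrite /= !cexN // (Fd Ha Hc).
rewrite -/a -/b -/c.
have := hex_Y GF Fd (Fh true) HT; rewrite /= -/a -/b -/c [Yel _ _ _ a c]/Yel.
rewrite /X2 /X3 /W2 /W3 /= cexN // -/a -/b -/c.
have [fp fq fr] := esys_fil H.
have Ear : e nu a * evx (A true) r = evx (A true) r * e nu a.
  by apply: cex_comm => //; apply: ev2_comm => //; exact: et_r.
have Ecq : e nu c * evx (A false) q = evx (A false) q * e nu c.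
  by apply: cex_comm => //; apply: ev2_comm => //; exact: et_q.
have tX x : (a + b + c) * x = x * (a + b + c) -> e nu (a + b + c) * x = x * e nu (a + b + c).
  by move=> cx; apply: cex_comm.
have tga : e nu (a + b + c) * e nu a = e nu a * e nu (a + b + c).
  by apply: tX; apply/esym/cex_comm.
have tgb : e nu (a + b + c) * e nu b = e nu b * e nu (a + b + c).
  by apply: tX; apply/esym/cex_comm.
have txab : e nu (a + b + c) * ev2 F a b = ev2 F a b * e nu (a + b + c).
  by apply: tX; exact: ev2_comm.
have -> : e nu (b + c) = e nu (a + b + c) * cinv (e nu a).
  have -> : a + b + c = (b + c) + a by ncring.
  rewrite [e nu (b + c + a)]cexD //; [by gw | exact: filD|].
  have -> : (b + c) * a = (a + b + c) * a - a * a by ncring.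
  by rewrite Ta; ncring.
rewrite [Yel _ _ _ a b]/Yel /z /gcm.
have GA' s x : grp (evx (A s) x : S) by apply: ev2_grp.
have GX x y : grp (ev2 F x y : S) by apply: ev2_grp.
move: (GX a b) (GX a c) (GX b c) (GA' false q) (GA' true r).
move: Ear Ecq tga tgb txab {tX Ta Tb}.
move: (cex_grp iota nu a) (cex_grp iota nu b) (cex_grp iota nu c) (cex_grp iota nu (a + b + c)).
move: (e nu a) (e nu b) (e nu c) (e nu (a + b + c)).
move: (ev2 F a b) (ev2 F a c) (ev2 F b c) (evx (A false) q) (evx (A true) r).
move=> x y w Q R f g h t Gf Gg Gh Gt fR hQ tf tg tx Gx Gy Gw GQ GR hY hh cm.
pose Y := cinv x * (g * g) * x; pose x2 := cinv f * cinv y * Q * y * f.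
have GY : grp Y by rewrite /Y; grps.
have tY : t * Y = Y * t by rewrite /Y; cent.
(* The hexagon for -nu, solved for [w]. *)
have wE : w * cinv g * x * t = h * y * f.
  have -> : w = h * y * f * cinv x * g * cinv t.
    by gby (congr1 (fun u => h * y * f * cinv x * g * u) hh).
  rewrite -mulrA -tx; transitivity (h * y * f * cinv x * g * (cinv t * cinv g * t) * x); first by gw.
  have -> : cinv t * cinv g * t = cinv g.
    have tgV : t * cinv g = cinv g * t by cent.
    by rewrite -mulrA -tgV; gw.
  by gw.
have key1 : Y = x2 * (cinv t * cinv R * t * cinv Y) * cinv x2 * cinv (cinv t * cinv R * t * cinv Y).
  have E1 : cinv t * cinv x * g * (g * g) * cinv g * x * t = Y.
    transitivity (cinv t * (t * Y)); last by gw.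
    by rewrite tY /Y; gw.
  rewrite -{1}E1 cm.
  have E2 : x2 = cinv (w * cinv g * x * t) * Q * (w * cinv g * x * t).
    rewrite wE /x2; transitivity (cinv f * cinv y * cinv h * (h * Q) * y * f); first by gw.
    by rewrite hQ; gw.
  have E3 : cinv t * cinv R * t * cinv Y = cinv t * cinv R * cinv Y * t.
    have tYV : t * cinv Y = cinv Y * t by cent.
    by rewrite -!mulrA tYV.
  by rewrite E2 E3 /Y; gw.
(* The correcting factor. By [hY] it is a conjugate of e^(-2 nu c), and e^(nu c) commutes with
   A_-(x_2), so [m] commutes with [x2] and may be inserted in the commutator. *)
pose m := Y * cinv t * cinv t * f * f.
have mE : m = cinv f * (cinv y * cinv (h * h) * y) * f.
  have E1 : f * Y * f = cinv (cinv y * (h * h) * y) * t * t.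
    by rewrite hY -/Y; gw.
  have E2 : cinv t * cinv t * f = f * (cinv t * cinv t).
    have tV : f * cinv t = cinv t * f by cent.
    by rewrite -mulrA -tV mulrA -tV mulrA.
  transitivity (Y * (cinv t * cinv t * f) * f); first by rewrite /m; gw.
  rewrite E2; transitivity (cinv f * (f * Y * f) * (cinv t * cinv t * f)); first by gw.
  by rewrite E1; gw.
have Gm : grp m by rewrite mE; grps.
have mx : m * x2 = x2 * m.
  rewrite mE /x2.
  have E : Q * (cinv h * cinv h) = cinv h * cinv h * Q.
    have Qh := esym hQ; have hV : Q * cinv h = cinv h * Q by cent.
    by rewrite mulrA hV -mulrA hV mulrA.
  transitivity (cinv f * cinv y * (cinv h * cinv h * Q) * y * f); first by gw.
  by rewrite -E; gw.
have mx' : m * cinv x2 * cinv m = cinv x2.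
  transitivity (cinv x2 * (x2 * m) * cinv x2 * cinv m); first by gw.
  by rewrite -mx; gw.
rewrite -/Y {1}key1.
have -> : cinv f * (cinv y * Q * y) * cinv f * (f * f) = x2 by rewrite /x2; gw.
have -> : cinv (t * cinv f * R * (t * cinv f)) = cinv t * cinv R * t * cinv Y * m.
  rewrite /m.
  have fRV : f * cinv R = cinv R * f by cent.
  have ftV : f * cinv t = cinv t * f by cent.
  transitivity (f * cinv t * cinv R * f * cinv t); first by gw.
  rewrite ftV -(mulrA (cinv t)) fRV -!mulrA ftV.
  have -> : f * (cinv t * f) = cinv t * f * f by rewrite mulrA ftV.
  by rewrite /Y; gw.
rewrite [X in _ = X](_ : _ = x2 * (cinv t * cinv R * t * cinv Y) * (m * cinv x2 * cinv m) *
  cinv (cinv t * cinv R * t * cinv Y)); first by rewrite mx'.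
have Gx2 : grp x2 by rewrite /x2; grps.
by gw.
Qed.
End Relations.

Lemma c_word (S : complAlgType k) (p q r : bool -> S) : esys p q r ->
  Yel iota nu F (et p q) (et p r) = cinv (e nu (et p q)) *
    gcm (W1 F A p q r false) (cinv (W3 nu A p q r true)) * e nu (et p q).
Proof.
move=> H; rewrite [in LHS](et_sym H) (b_word (esys_swap H)) W2_swap // W3_swap // -(et_sym H) /=.
rewrite cexN; last by have [] := et_tri H.
have := comm_E3 nu A H true nu.
move: (W1_grp p q r GF GA false) (W3_grp nu p q r GA true) (cex_grp iota nu (et p q)).
move: (e nu (et p q)) (W1 F A p q r false) (W3 nu A p q r true) => f x w Gx Gw Gf fw.
rewrite /gcm; have fwV : f * cinv w = cinv w * f by cent.
transitivity (cinv f * x * (f * cinv w * cinv f) * cinv x * (f * w * cinv f) * f); first by gw.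
by rewrite fw fwV; gw.
Qed.
End Words2.
End EllWords.

(** * Transfer of relations through leading terms *)

Section Transfer.
Variables (k : comPzRingType) (X : finType).

Lemma chom_approx_lead (S : complAlgType k) (th1 th2 : chomType (series k X) S) d f :
  (forall x, fil 2 (th1 (letter k x) - th2 (letter k x))) -> fil d f ->
  fil d.+1 (th1 f - th2 f).
Proof.
move=> Hl; elim: d f => [|d IH] f Hf.
  by apply: chom_approx => x; apply: filS; exact: Hl.
rewrite (chom_decomp th1) (chom_decomp th2) opprD addrACA subrr add0r -sumrB.
apply: fil_sum => x _.
have -> : th1 (letter k x) * th1 (shift x f) - th2 (letter k x) * th2 (shift x f)
   = (th1 (letter k x) - th2 (letter k x)) * th1 (shift x f)
     + th2 (letter k x) * (th1 (shift x f) - th2 (shift x f)).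
  by rewrite mulrBl mulrBr addrA subrK.
apply: filD.
  by apply: (@filM _ _ 2%N) => //; apply: chom_fil; exact: sfil_shift.
by apply: (@filM _ _ 1%N); [apply: chom_fil; exact: fil_letter | apply/IH/sfil_shift].
Qed.

Lemma fil_sub_hcomp d (f : series k X) : fil d f -> fil d.+1 (f - hcomp d f).
Proof.
move=> Hf w; rewrite ltnS leq_eqVlt subsE /hcomp => /orP[/eqP->|ltw]; first by rewrite eqxx subrr.
by rewrite (ltn_eqF ltw) subr0; exact: Hf.
Qed.

Variable (R : series k X -> Prop).
Notation U := (quo (idclosure R)).
Notation pi := (qpi (idclosure R)).
Variables (S : complAlgType k) (ph : chomType (series k X) U) (ph' : chomType (series k X) S).
Hypothesis ph_lead : forall x, fil 2 (ph (letter k x) - pi (letter k x)).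
Hypothesis relators : forall f, R f -> exists d h,
  [/\ f = hcomp d f, ph h = 0, ph' h = 0 & fil d.+1 (h - f)].

Let P p := forall d, exists h, [/\ ph h = 0, ph' h = 0 & fil d.+1 (h - hcomp d p)].

Let P_idgen f : idgen R f -> P f.
Proof.
elim=> {f} [f Rf||f g _ If _ Ig|f g _ Ig|f g _ If] d.
- have [e [h [Ee h1 h2 h3]]] := relators Rf.
  have [->|ne] := eqVneq d e; first by exists h; rewrite -Ee.
  exists 0; rewrite !chom0 Ee hcomp_ne // subrr; split=> //; exact: fil_zero.
- by exists 0; rewrite !chom0 hcomp_zero subrr; split=> //; exact: fil_zero.
- have [h [h1 h2 h3]] := If d; have [h' [h1' h2' h3']] := Ig d.
  exists (h + h'); rewrite !chomD h1 h2 h1' h2' !addr0; split=> //.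
  by rewrite hcompD opprD addrACA; apply: filD.
- have [F HF] := choice Ig.
  exists (\sum_(i < d.+1) hcomp i f * F (d - i)%N); split.
  + by rewrite chom_sum big1 // => i _; have [E _ _] := HF (d - i)%N; rewrite chomM E mulr0.
  + by rewrite chom_sum big1 // => i _; have [_ E _] := HF (d - i)%N; rewrite chomM E mulr0.
  rewrite hcompM -sumrB; apply: (@fil_sum _ (series k X)) => i _; rewrite -mulrBr.
  have [_ _ /(filM (@hcomp_fil _ _ i f))] := HF (d - i)%N.
  by rewrite addnS subnKC // -ltnS.
- have [F HF] := choice If.
  exists (\sum_(i < d.+1) F i * hcomp (d - i) g); split.
  + by rewrite chom_sum big1 // => i _; have [E _ _] := HF i; rewrite chomM E mul0r.
  + by rewrite chom_sum big1 // => i _; have [_ E _] := HF i; rewrite chomM E mul0r.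
  rewrite hcompM -sumrB; apply: (@fil_sum _ (series k X)) => i _; rewrite -mulrBl.
  have [_ _ H] := HF i; have := filM H (@hcomp_fil _ _ (d - i)%N g).
  by rewrite addSn subnKC // -ltnS.
Qed.

Let P_idcl f : idclosure R f -> P f.
Proof.
move=> If d; have [g /P_idgen/(_ d)[h [h1 h2 h3]] /eq_hcomp E] := If d.+1.
by exists h; rewrite (E d).
Qed.

(** The leading term of an element killed by [ph] lies in the ideal of relators, because [ph] is the
    projection to first order. Subtracting a common zero of [ph] and [ph'] with that leading term
    raises the filtration without changing the image under [ph']. *)
Let ph_ker f : ph f = 0 -> ph' f = 0.
Proof.
move=> E; suff H n : exists h, [/\ fil n h, ph h = 0 & ph' h = ph' f].
  apply: fil_sep => n; have [h [Hh _ <-]] := H n; exact: chom_fil.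
elim: n => [|n [h [Hh h1 h2]]]; first by exists f; split=> //; exact: fil0.
have := chom_approx_lead (th1 := ph) (th2 := pi) ph_lead Hh.
rewrite h1 sub0r => /filN; rewrite opprK => /qpi_filP[g Ig Hg].
have [h' [h1' h2' h3']] := P_idcl Ig n.
exists (h - h'); rewrite !chomB h1 h1' h2 h2' !subr0; split=> //.
apply: (@fil_trans _ _ _ _ (hcomp n h)); first exact: fil_sub_hcomp.
by rewrite (eq_hcomp Hg) // ; apply: filBC.
Qed.

(** [ph] is the projection composed with an invertible substitution [v] of the letters, so it is
    onto; by [ph_ker], [ph'] factors through it. *)
Lemma quo_transfer : exists tau : chomType U S, forall f, tau (ph f) = ph' f.
Proof.
have /choice[v Hv] x : exists v, pi v = ph (letter k x) /\ fil 2 (v - letter k x).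
  have : fil 2 (pi (qrepr (ph (letter k x)) - letter k x)) by rewrite qpiD qpiN qreprK.
  move=> /qpi_filP[g Ig Hg]; exists (qrepr (ph (letter k x)) - g); split.
    rewrite -[RHS]qreprK; apply/qpiP; rewrite [_ - g]addrC addrK; exact: ciN.
  by move: Hg; rewrite addrAC.
have fl x : fil 1 (letter k x : series k X) by exact: fil_letter.
have fv x : fil 1 (v x).
  by rewrite -[v x](subrK (letter k x)); apply: filD => //; apply: filS; case: (Hv x).
pose I (x y : X) : k := (x == y)%:R.
have sumI (V : X -> series k X) x : \sum_y I x y *: V y = V x.
  rewrite (bigD1 x) //= /I eqxx scale1r big1 ?addr0 // => y; rewrite eq_sym => /negPf->.
  by rewrite scale0r.
have II x z : \sum_y I x y * I y z = (x == z)%:R.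
  rewrite (bigD1 x) //= /I eqxx mul1r big1 ?addr0 // => y; rewrite eq_sym => /negPf->.
  by rewrite mul0r.
have solve (w : X -> series k X) : (forall x, fil 2 (w x - letter k x)) ->
    exists2 u : X -> series k X, forall x, fil 1 (u x) & forall x, ev u (w x) = letter k x.
  move=> Hw; have [||||||u [u1 _ u2]] := @series_solve k X X w (fun x => letter k x) I I False => //.
    by move=> x; rewrite sumI.
  by exists u.
(* [solve] yields one-sided inverses; applied to [v] and then to [u] it shows that they are inverse
   on both sides. *)
have [u fu uv] : exists2 u : X -> series k X, forall x, fil 1 (u x) & forall x, ev u (v x) = letter k x.
  by apply: solve => x; case: (Hv x).
have [u' fu' uu] : exists2 u' : X -> series k X, forall x, fil 1 (u' x) & forall x, ev u' (u x) = letter k x.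
  apply: solve => x; have [_ /(chom_fil (ev u))] := Hv x.
  by rewrite chomB /= uv ev_letter // => /filBC.
have uvK f : ev u (ev v f) = f.
  by apply: (chom_ext (th1 := ev u \o ev v) (th2 := idfun)) => x /=; rewrite ev_letter.
have uuK f : ev u' (ev u f) = f.
  by apply: (chom_ext (th1 := ev u' \o ev u) (th2 := idfun)) => x /=; rewrite ev_letter.
have vuK f : ev v (ev u f) = f by rewrite -[ev v _]uuK uvK uuK.
have phE f : ph f = pi (ev v f).
  apply: (chom_ext (th1 := ph) (th2 := pi \o ev v)) => x /=; rewrite ev_letter //.
  by case: (Hv x).
pose t0 : chomType _ _ := ph' \o ev u.
have t0I f : idclosure R f -> t0 f = 0.
  by move=> If; apply: ph_ker; rewrite phE vuK -[RHS]qpi0; apply/qpiP; rewrite subr0.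
by exists (quo_map t0I) => f; rewrite phE [LHS]quo_mapE /= uvK.
Qed.
End Transfer.

Section Homogeneous.
Variables (k : comPzRingType) (X : finType).
Implicit Types f g : series k X.
Definition homog d f := hcomp d f = f.
Lemma homogM i j f g : homog i f -> homog j g -> homog (i + j) (f * g).
Proof.
move=> Hf Hg; have lt : (i < (i + j).+1)%N by rewrite ltnS leq_addr.
rewrite /homog hcompM (bigD1 (Ordinal lt)) //= addKn Hf Hg big1 ?addr0 // => l /eqP nl.
rewrite -Hf hcomp_ne ?mul0r //; apply/eqP => E; apply: nl; exact: val_inj.
Qed.
Lemma homogB d f g : homog d f -> homog d g -> homog d (f - g).
Proof. by rewrite /homog hcompB => -> ->. Qed.
Lemma homogD d f g : homog d f -> homog d g -> homog d (f + g).
Proof. by rewrite /homog hcompD => -> ->. Qed.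
Lemma homog_sum d I (r : seq I) (P : pred I) (F : I -> series k X) :
  (forall i, P i -> homog d (F i)) -> homog d (\sum_(i <- r | P i) F i).
Proof. by move=> HF; rewrite /homog hcomp_sum; apply: eq_bigr. Qed.
Lemma homog_br i j f g : homog i f -> homog j g -> homog (i + j) (br f g).
Proof. by move=> Hf Hg; apply: homogB; [|rewrite addnC]; apply: homogM. Qed.
Lemma homog_letter x : homog 1 (letter k x). Proof. by rewrite /homog hcomp_letter. Qed.
End Homogeneous.

Section Leading.
Variables (k : comPzRingType) (S : complAlgType k).
Implicit Types x y X Y : S.

Definition lead x X := fil 1 X /\ fil 2 (x - 1 - X).

Lemma lead_grp x X : lead x X -> grp x.
Proof. by case=> HX /filS H; have := filD H HX; rewrite subrK. Qed.
Lemma leadM x y X Y : lead x X -> lead y Y -> lead (x * y) (X + Y).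
Proof.
move=> Hx Hy; have Gx := lead_grp Hx; have Gy := lead_grp Hy.
case: Hx Hy => HX Hx [HY Hy]; split; first exact: filD.
have -> : x * y - 1 - (X + Y) = (x - 1) * (y - 1) + (x - 1 - X) + (y - 1 - Y) by ncring.
by apply: filD => //; apply: filD => //; apply: (@filM _ _ 1 1).
Qed.
Lemma lead_eq x X Y : X = Y -> lead x X -> lead x Y. Proof. by move=> ->. Qed.
Lemma leadV x X : lead x X -> lead (cinv x) (- X).
Proof.
move=> Hx; have Gx := lead_grp Hx; case: Hx => HX Hx; split; first exact: filN.
have -> : cinv x - 1 - - X = cinv x * ((x - 1) * X - (x - 1 - X)).
  have -> : (x - 1) * X - (x - 1 - X) = x * (X - 1) + 1 by ncring.
  by rewrite mulrDr mulrA gmulVr //; move: (cinv x) => y; ncring.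
by apply/filMl/filB => //; apply: (@filM _ _ 1 1).
Qed.
Lemma lead0 x : fil 2 (x - 1) -> lead x 0.
Proof. by move=> Hx; split; [exact: fil_zero | rewrite subr0]. Qed.
Lemma lead_conj x h X : grp h -> lead x X -> lead (cinv h * x * h) X.
Proof.
move=> Gh Hx; have Gx := lead_grp Hx; case: Hx => HX Hx; split=> //.
have := conj_approx Gh (Gx : fil 1 (x - 1)); have -> : cinv h * (x - 1) * h = cinv h * x * h - 1.
  by rewrite mulrBr mulrBl mulr1 gmulVr.
by move=> H; have := filD H Hx; rewrite addrA subrK.
Qed.
Lemma lead_cex iota n a : fil 2 a -> lead (cex iota n a) 0.
Proof.
move=> Ha; have fa : fil 1 a by apply: filS.
apply: lead0; have := filD (cex_approx2 iota n fa) (filcst n Ha).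
by rewrite subrK.
Qed.

Lemma br_fil i j x y : fil i x -> fil j y -> fil (i + j) (br x y).
Proof. exact: lie_br_fil. Qed.

Lemma br_lead i j x y X Y : fil i X -> fil j.+1 (y - Y) -> fil i.+1 (x - X) -> fil j y ->
  fil (i + j).+1 (br x y - br X Y).
Proof.
move=> fX fy fx fY; have -> : br x y - br X Y = br (x - X) y + br X (y - Y).
  by rewrite /br; ncring.
apply: filD; first by rewrite -addSn; apply: br_fil.
by rewrite -addnS; apply: br_fil.
Qed.

Lemma gcm_lead x y X Y : lead x X -> lead y Y -> fil 3 (gcm x y - 1 - br X Y).
Proof.
move=> Hx Hy; have Gx := lead_grp Hx; have Gy := lead_grp Hy; case: Hx Hy => HX Hx [HY Hy].
have E : br x y = br (x - 1) (y - 1) by rewrite /br; ncring.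
have Gxy : grp (cinv x * cinv y) by grps.
have -> : gcm x y - 1 - br X Y = br (x - 1) (y - 1) * (cinv x * cinv y - 1) +
   (br (x - 1) (y - 1) - br X Y).
  have -> : gcm x y - 1 = br (x - 1) (y - 1) * (cinv x * cinv y).
    rewrite -E /br /gcm mulrBl; congr (_ - _); first by rewrite !mulrA.
    by gw.
  by move: (br (x - 1) _) (br X Y) (cinv x * _) => u v w; ncring.
apply: filD; first by apply: (@filM _ _ 2 1) => //; apply: (@br_fil 1 1).
exact: (@br_lead 1 1).
Qed.
End Leading.

(** * The relators of t_{1,3} as leading terms of relations between words *)

Section Letters4.
Variables (k : comPzRingType).
Notation L := (series k (bool * bool)%type).
Definition l1 (s : bool) : L := letter k (false, s).
Definition l2 (s : bool) : L := letter k (true, s).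

(* generators x_1 = l1, x_2 = l2 of t_{1,3}, the third one being eliminated *)
Inductive minR : L -> Prop :=
| minR1 s : minR (br (l1 s) (l2 s))
| minR2 : minR (br (l1 true) (l2 false) - br (l2 true) (l1 false))
| minR3 s : minR (br (l1 s + l2 s) (br (l1 true) (l2 false))).

Notation U := (quo (idclosure minR)).
Notation pi := (qpi (idclosure minR)).
Definition pU s : U := pi (l1 s).
Definition qU s : U := pi (l2 s).
Definition rU s : U := - (pU s + qU s).

Lemma U_esys : esys pU qU rU.
Proof.
have rel f : minR f -> pi f = 0.
  by move=> Rf; rewrite -[RHS]qpi0; apply/qpiP; rewrite subr0; apply/idcl_gen/idgen_gen.
have brE f g : pi (br f g) = br (pi f) (pi g) by rewrite /br qpiD qpiN !qpiM.
have fl x : fil 1 (letter k x : L) by exact: fil_letter.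
split.
- split=> [s|s|s]; last by rewrite /rU subrr.
    by apply: (chom_fil pi); exact: fl.
  by apply: (chom_fil pi); exact: fl.
- by move=> s; rewrite -brE rel //; constructor.
- by have := rel _ minR2; rewrite qpiD qpiN !brE => /subr0_eq.
- move=> s; have := rel _ (minR3 s); rewrite !brE qpiD -/(pU s) -/(qU s).
  rewrite /rU -/(pU true) -/(qU false); set w := br (pU true) _; set x := _ + _.
  have -> : br (- x) w = - br x w by rewrite /br; ncring.
  by move=> ->; rewrite oppr0.
Qed.

Section Kernel.
Variables (M N : bool -> bool -> k).
Hypothesis NM : forall s t, \sum_j N s j * M j t = (s == t)%:R.
Hypothesis MN : forall s t, \sum_j M s j * N j t = (s == t)%:R.

(** [La] is the linear part prescribed by the matrix [M]; [Om] stands for a group word having this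
    linear part. *)
Definition La (l : bool -> L) s : L := \sum_t cst (M s t) * l t.
Definition Om l s : L := 1 + La l s.

Lemma cst_sum (S : complAlgType k) I (r : seq I) (P : pred I) (F : I -> k) :
  cst (\sum_(i <- r | P i) F i) = \sum_(i <- r | P i) cst (F i) :> S.
Proof. exact: (big_morph _ (@cstD _ S) (cst0 S)). Qed.

Lemma sum_inv (S : complAlgType k) (P Q : bool -> bool -> k) (l : bool -> S) s :
  (forall s t, \sum_j P s j * Q j t = (s == t)%:R) ->
  \sum_t cst (P s t) * (\sum_t' cst (Q t t') * l t') = l s.
Proof.
move=> PQ; under eq_bigr => t _ do rewrite mulr_sumr.
rewrite exchange_big /= (bigD1 s) //= [X in _ + X]big1 => [|t ts].
  under eq_bigr do rewrite mulrA -cstM; rewrite -mulr_suml -cst_sum PQ eqxx cst1 mul1r addr0 //.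
under eq_bigr do rewrite mulrA -cstM; rewrite -mulr_suml -cst_sum PQ eq_sym (negPf ts).
by rewrite cst0 mul0r.
Qed.

Let fl x : fil 1 (letter k x : L). Proof. exact: fil_letter. Qed.
Let fL (l : bool -> L) s : (forall s, fil 1 (l s)) -> fil 1 (La l s).
Proof. by move=> H; rewrite /La big_bool /=; apply: filD; apply: filcst. Qed.
Let f1 s : fil 1 (La l1 s). Proof. by apply: fL => t; exact: fl. Qed.
Let f2 s : fil 1 (La l2 s). Proof. by apply: fL => t; exact: fl. Qed.
Let B s t : L := br (La l1 s) (La l2 t).
Let fB s t : fil 2 (B s t). Proof. exact: (@br_fil _ _ 1 1). Qed.
Let O1 s : lead (Om l1 s) (La l1 s).
Proof.
split=> //; have -> : Om l1 s - 1 - La l1 s = 0 by rewrite /Om; ncring.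
exact: fil_zero.
Qed.
Let O2 s : lead (Om l2 s) (La l2 s).
Proof.
split=> //; have -> : Om l2 s - 1 - La l2 s = 0 by rewrite /Om; ncring.
exact: fil_zero.
Qed.

(** The relations between the words, written for the models [Om]: [W1] and [W2] commute, the two
    expressions of [z] agree, and [z] commutes with the product of [W2] and [W1], the inverse of
    [W3]. *)
Definition kap1 s := br (Om l1 s) (Om l2 s).
Definition kapZ := gcm (Om l1 false) (cinv (Om l2 true)).
Definition kap2 := kapZ - gcm (Om l2 false * kapZ) (cinv kapZ * cinv (Om l1 true)).
Definition kap3 s := br (Om l2 s * Om l1 s) kapZ.

Let Z_lead : fil 3 (kapZ - 1 + B false true).
Proof.
have := gcm_lead (O1 false) (leadV (O2 true)); rewrite -/kapZ.
have -> : br (La l1 false) (- La l2 true) = - B false true by rewrite /B /br; ncring.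
by rewrite opprK.
Qed.
Let Z_lead0 : lead kapZ 0.
Proof.
by apply: lead0; have := filB (filS Z_lead) (fB false true); rewrite addrK.
Qed.
Let kap1E s : kap1 s = B s s.
Proof. by rewrite /kap1 /B /Om /br; ncring. Qed.
Let kap2_lead : fil 3 (kap2 + B true false + B false true).
Proof.
have h1 : lead (Om l2 false * kapZ) (La l2 false).
  by apply: lead_eq (leadM (O2 false) Z_lead0); rewrite addr0.
have h2 : lead (cinv kapZ * cinv (Om l1 true)) (- La l1 true).
  by apply: lead_eq (leadM (leadV Z_lead0) (leadV (O1 true))); rewrite oppr0 add0r.
have := gcm_lead h1 h2; have -> : br (La l2 false) (- La l1 true) = B true false.
  by rewrite /B /br; ncring.
move=> h3; rewrite /kap2; have := filB Z_lead h3.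
by congr (fil _ _); ncring.
Qed.
Let kap3_lead s : fil 4 (kap3 s + br (La l1 s + La l2 s) (B false true)).
Proof.
have [h1 h2] := leadM (O2 s) (O1 s).
have h3 : fil 3 (kapZ - 1 - - B false true) by rewrite opprK; exact: Z_lead.
have h4 : fil 2 (kapZ - 1) by have [_] := Z_lead0; rewrite subr0.
have := @br_lead _ _ 1 2 _ _ _ _ h1 h3 h2 h4; rewrite /kap3.
move: (La l1 s) (La l2 s) (B false true) kapZ (Om l2 s * _) => u v w z y.
by congr (fil _ _); rewrite /br; ncring.
Qed.

Let lE (l : bool -> L) s : l s = cst (N s true) * La l true + cst (N s false) * La l false.
Proof. by rewrite -[LHS](sum_inv l s NM) big_bool. Qed.

Let bE s t : br (l1 s) (l2 t) =
  cst (N s true * N t true) * B true true + cst (N s true * N t false) * B true false +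
  (cst (N s false * N t true) * B false true + cst (N s false * N t false) * B false false).
Proof.
have E c d (u v : L) : br (cst c * u) (cst d * v) = cst (c * d) * br u v.
  rewrite /br mulrBr cstM -!mulrA; congr (_ - _); first by rewrite !mulrA -(mulrA (cst c)) -(cstC d u) !mulrA.
  by rewrite (mulrA v) -(cstC c v) !mulrA -!cstM mulrC.
rewrite (lE l1) (lE l2) /B -!E; move: (cst (N s true) * _) (cst (N s false) * _).
by move: (cst (N t true) * _) (cst (N t false) * _) => u v w y; rewrite /br; ncring.
Qed.

(** The leading terms of the [kap] are the relators in the basis [La]; the inverse matrix [N]
    returns them to the original letters. *)
Lemma minR_kap f : minR f -> exists d h, [/\ f = hcomp d f, fil d.+1 (h - f) &
  forall (S : complAlgType k) (th : chomType L S), (forall s, th (kap1 s) = 0) ->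
    th kap2 = 0 -> (forall s, th (kap3 s) = 0) -> th h = 0].
Proof.
have hl (x : bool * bool) : homog 1 (letter k x) := homog_letter k x.
case=> [s||s].
(* In the expansion [bE] the diagonal terms are the [kap1]; the mixed terms carry equal coefficients
   and add up to minus the leading term of [kap2]. *)
- exists 2%N, (cst (N s true * N s true) * kap1 true + cst (N s false * N s false) * kap1 false
    - cst (N s true * N s false) * kap2); split.
  + by rewrite (homog_br (hl _) (hl _)).
  + rewrite bE [N s false * N s true]mulrC !kap1E.
    have := filN (filcst (N s true * N s false) kap2_lead).
    move: (cst _) (cst _) (cst _) kap2 (B true true) (B true false) (B false true) (B false false).
    by move=> c1 c2 c3 u v w v' w'; congr (fil _ _); ncring.
  + by move=> S th e1 e2 _; rewrite chomB chomD !chomM !e1 e2 !mulr0 addr0 subr0.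
- pose c11 := N true true * N false true; pose c22 := N true false * N false false.
  pose c12 := N true true * N false false; pose c21 := N true false * N false true.
  exists 2%N, ((cst c11 + cst c11) * kap1 true + (cst c22 + cst c22) * kap1 false
    - (cst c12 + cst c21) * kap2); split.
  + by rewrite (homogB (homog_br (hl _) (hl _)) (homog_br (hl _) (hl _))).
  + have -> : br (l2 true) (l1 false) = - br (l1 false) (l2 true) by rewrite /br opprB.
    rewrite !bE ![N false _ * N true _]mulrC !kap1E -/c11 -/c22 -/c12 -/c21.
    have := filN (filcst c12 kap2_lead); have := filN (filcst c21 kap2_lead) => h1 h2.
    move: (filD h1 h2) => {h1 h2}.
    move: (cst c11) (cst c22) (cst c12) (cst c21) => d1 d2 d3 d4.
    move: kap2 (B true true) (B true false) (B false true) (B false false).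
    by move=> u v w v' w'; congr (fil _ _); ncring.
  + by move=> S th e1 e2 _; rewrite chomB chomD !chomM !e1 e2 !mulr0 addr0 subr0.
- pose c11 := N true true * N false true; pose c22 := N true false * N false false.
  pose c12 := N true true * N false false; pose c21 := N true false * N false true.
  (* The mixed coefficients differ here, so [h] reaches the bracket [x_1, y_2] only up to
     [B false true] times minus the determinant of [N]; after bracketing with x_1 + x_2 this
     multiple is supplied by [kap3]. *)
  pose h := cst c11 * kap1 true + cst c22 * kap1 false - cst c12 * kap2.
  have Hh : fil 3 (h - br (l1 true) (l2 false) + cst (c21 - c12) * B false true).
    rewrite bE -/c11 -/c22 -/c12 -/c21 /h !kap1E.
    have := filN (filcst c12 kap2_lead); have -> : cst (c21 - c12) = cst c21 - cst c12 :> L.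
      by rewrite cstD cstN.
    move: (cst c11) (cst c22) (cst c12) (cst c21) => d1 d2 d3 d4.
    move: kap2 (B true true) (B true false) (B false true) (B false false).
    by move=> u v w v' w'; congr (fil _ _); ncring.
  exists 3%N, (br (l1 s + l2 s) h - cst (c21 - c12) *
     (cst (N s true) * kap3 true + cst (N s false) * kap3 false)); split.
  + by rewrite (homog_br (homogD (hl _) (hl _)) (homog_br (hl _) (hl _))).
  + have fs : fil 1 (l1 s + l2 s) by apply: filD; exact: fl.
    have h1 := @br_fil _ _ 1 3 _ _ fs Hh.
    have h2 t := filcst (c21 - c12) (filcst (N s t) (kap3_lead t)).
    have := filB (filB h1 (h2 true)) (h2 false).
    have -> : br (l1 s + l2 s) (h - br (l1 true) (l2 false) + cst (c21 - c12) * B false true) =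
      br (l1 s + l2 s) h - br (l1 s + l2 s) (br (l1 true) (l2 false)) +
      cst (c21 - c12) * (cst (N s true) * br (La l1 true + La l2 true) (B false true) +
      cst (N s false) * br (La l1 false + La l2 false) (B false true)).
      have E c (u v : L) : br u (cst c * v) = cst c * br u v.
        by rewrite /br mulrBr !mulrA (cstC c u).
      have E' c (u v : L) : br (cst c * u) v = cst c * br u v.
        by rewrite /br mulrBr !mulrA -(cstC c v).
      have -> : cst (N s true) * br (La l1 true + La l2 true) (B false true) +
          cst (N s false) * br (La l1 false + La l2 false) (B false true) =
          br (l1 s + l2 s) (B false true).
        by rewrite -!E' [in RHS](lE l1 s) [in RHS](lE l2 s) !mulrDr /br; ncring.
      rewrite -[cst _ * br (l1 s + _) _]E.
      move: (cst (c21 - c12) * B false true) => u; rewrite /br; ncring.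
    by congr (fil _ _); ncring.
  + move=> S th e1 e2 e3.
    have h0 : th h = 0 by rewrite /h chomB chomD !chomM !e1 e2 !mulr0 addr0 subr0.
    by rewrite chomB /br chomB !chomM h0 !mulr0 !mul0r subrr sub0r chomD !chomM !e3 !mulr0 addr0 mulr0 oppr0.
Qed.
End Kernel.
End Letters4.

Lemma cex_approx3 (k : comPzRingType) (iota : {rmorphism rat -> k}) (S : complAlgType k)
  c (x : S) : fil 2 x -> fil 3 (cex iota c x - 1 - cst c * x).
Proof.
move=> Hx; have := cexp_approx iota 3 (filS (filcst c Hx)).
rewrite !big_ord_recl big_ord0 /= !invr1 !rmorph1 !cst1 !mul1r addr0 expr0.
set y := cst _ * _ ^+ bump _ _; rewrite -[_ ^+ bump 0 0]/(cst c * x) => H.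
have H2 : fil 3 y.
  rewrite /y -[_ ^+ _]/(cst c * x * (cst c * x)); apply: filMl.
  exact: fil_le (filM (filcst c Hx) (filcst c Hx)).
by have := filD H H2; congr (fil _ _); rewrite /cex; ncring.
Qed.

Section EvxLead.
Variables (k : comPzRingType).
(** The letter [false] is x_1, which has sign [true], hence the negation. *)
Definition mat1 (A : bool -> series k bool) (s t : bool) : k := A s [:: ~~ t].

Lemma evx_lead A (S : complAlgType k) (p : bool -> S) s : grp (A s) -> (forall t, fil 1 (p t)) ->
  lead (evx (A s) p) (\sum_t cst (mat1 A s t) * p t).
Proof.
move=> GA fp; rewrite big_bool /mat1 /=; split; first by apply: filD; apply: filcst.
have H : fil 2 (A s - 1 - (cst (A s [:: false]) * lA k + cst (A s [:: true]) * lB k)).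
  have A0 : A s [::] = 1 by apply/eqP; rewrite -subr_eq0; apply/eqP; exact: (GA [::] isT).
  move=> [|x [|y w]] //= _; rewrite !subsE addsE -!scale_cst !scalesE ?onesE; last first.
    by rewrite /lA /lB /letter !eqseq_cons !andbT; case: x;
      rewrite /= ?mulr0 ?mulr1 ?add0r ?addr0 subr0 subrr.
  by rewrite A0 /lA /lB /letter /= !mulr0 addr0 subrr subr0.
have := chom_fil (ev (fun l : bool => if l then p false else p true)) H.
by rewrite !chomB chomD !chomM !chom_cst chom1 /= -/(ev2 _ _ _) -/(ev2 _ _ _) -/(ev2 _ _ _) ev2_A ?ev2_B.
Qed.
End EvxLead.

Lemma chom_gcm (k : comPzRingType) (S S' : complAlgType k) (th : chomType S S') x y :
  grp x -> grp y -> th (gcm x y) = gcm (th x) (th y).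
Proof. by move=> Gx Gy; rewrite /gcm !chomM !chom_cinv. Qed.

Lemma brc (k : comPzRingType) (S : complAlgType k) (c d : k) (u v : S) :
  br (cst c * u) (cst d * v) = cst (c * d) * br u v.
Proof.
rewrite /br mulrBr cstM -!mulrA; congr (_ - _).
  by rewrite !mulrA -(mulrA (cst c)) -(cstC d u) !mulrA.
by rewrite (mulrA v) -(cstC c v) !mulrA -!cstM mulrC.
Qed.

Section Det.
Variables (k : comPzRingType) (iota : {rmorphism rat -> k}).
Local Notation e := (cex iota).
Variables (nu : k) (F : series k bool) (A : bool -> series k bool).
Hypotheses (GF : grp F) (GA : forall s, grp (A s)).
Hypothesis (FC : commS iota nu F (A true) (A false)).

(* t_{1,3} -> t_{1,2}: x_1 |-> x_1, x_2 |-> - x_1, x_3 |-> 0 *)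
Lemma mat1_det :
  mat1 A true true * mat1 A false false - mat1 A true false * mat1 A false true = nu + nu.
Proof.
pose p (s : bool) : series k bool := if s then lA k else lB k.
pose q (s : bool) : series k bool := - p s.
pose r (s : bool) : series k bool := 0.
have fp s : fil 1 (p s) by case: s; exact: fil_letter.
have fq s : fil 1 (q s) by apply: filN.
have H : esys p q r.
  split=> [|s||s].
  - by split=> // s; rewrite /q /r subrr addr0.
  - by rewrite /q /br mulrN mulNr subrr.
  - by rewrite /q /br /=; move: (lA k) (lB k) => x y; ncring.
  - by rewrite /r /br mul0r mulr0 subrr.
have := FC H; lazy zeta; set a := et p q; set c := et p r.
have fa : fil 2 a := et_fil2 H.
have fa1 : fil 1 a by apply: filS.
have lf := evx_lead (s := false) (GA false) fp.
have lt := leadV (evx_lead (s := true) (GA true) fq).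
have GX x y : grp (ev2 F x y : series k bool) by apply: ev2_grp.
have l1 := lead_conj (GX a (et q r)) lf.
have le := leadV (lead_cex iota nu fa).
have l2 := leadM (leadM le (lead_conj (GX a c) lt)) le.
have Gt : grp (evx (A true) q) by apply: ev2_grp.
(* Both sides of the commutator relation are expanded to second order: one has leading term a
   bracket of linear parts, the other 2 nu times [a]. *)
have h := gcm_lead l1 l2; have h' := cex_approx3 iota (nu + nu) fa.
rewrite cexDl // in h'.
have -> : cinv (e nu a) * cinv (ev2 F a c) * cinv (evx (A true) q) * (ev2 F a c * cinv (e nu a)) =
    cinv (e nu a) * (cinv (ev2 F a c) * cinv (evx (A true) q) * ev2 F a c) * cinv (e nu a).
  by rewrite !mulrA.
move=> E; move: h; rewrite -E {E} => h.
have := filB h h'.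
set X := (Z in br Z _); set Y := (Z in br _ Z).
have EX : X = cst (mat1 A false true) * lA k + cst (mat1 A false false) * lB k by rewrite /X big_bool.
have EY : Y = cst (mat1 A true true) * lA k + cst (mat1 A true false) * lB k.
  by rewrite /Y big_bool /q /p /= oppr0 add0r addr0 !mulrN -opprD opprK.
have EXY : br X Y = cst (mat1 A false true * mat1 A true false -
    mat1 A false false * mat1 A true true) * br (lA k) (lB k).
  rewrite cstD cstN mulrBl -!brc EX EY.
  have E0 c1 c2 (u : series k bool) : br (cst c1 * u) (cst c2 * u) = 0 by rewrite brc /br subrr mulr0.
  have -> : br (cst (mat1 A false false) * lA k) (cst (mat1 A true true) * lB k) =
    - br (cst (mat1 A false false) * lB k) (cst (mat1 A true true) * lA k).
    by rewrite !brc -mulrN; congr (_ * _); rewrite /br opprB.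
  move: (E0 (mat1 A false true) (mat1 A true true) (lA k)) (E0 (mat1 A false false) (mat1 A true false) (lB k)).
  move: (cst (mat1 A false true) * lA k) (cst (mat1 A false false) * lB k) => x y.
  move: (cst (mat1 A true true) * lA k) (cst (mat1 A true false) * lB k) => z w e1 e2.
  have -> : br (x + y) (z + w) = br x z + br x w + br y z + br y w by rewrite /br; ncring.
  by rewrite e1 e2 add0r addr0 opprK.
have Ea : a = - br (lA k) (lB k) by rewrite /a /et /q /p /br mulrN mulNr opprB opprK addrC.
have -> : e nu a * e nu a - 1 - br X Y - (e nu a * e nu a - 1 - cst (nu + nu) * a) =
   - (cst (mat1 A false true * mat1 A true false - mat1 A false false * mat1 A true true
      + (nu + nu)) * br (lA k) (lB k)).
  rewrite EXY Ea; move: (e nu _ * e nu _) => ee; rewrite [in RHS]cstD mulrN.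
  by move: (br (lA k) (lB k)) (cst (nu + nu)) (cst (_ - _)) => z c1 c2; ncring.
(* The coefficient of the word x_1 y_1, on which the bracket of the two letters takes the value
   1. *)
move=> /(_ [:: false; true] isT).
rewrite oppsE -scale_cst scalesE /br subsE /lA /lB.
have El x y : (letter k x * letter k y) [:: false; true] = ((false == x) && (true == y))%:R.
  rewrite -[LHS]/(shift false (letter k x * letter k y) [:: true]) shift_letterM.
  by case: (false == x) => //; rewrite /letter eqseq_cons andbT.
rewrite !El /= subr0 mulr1 => /eqP; rewrite oppr_eq0 => /eqP E1.
apply/eqP; rewrite -subr_eq0; apply/eqP; rewrite -[RHS]oppr0 -E1; ring.
Qed.
End Det.

(** * Morphisms between the words of two elliptic associators *)

Section EllTransfer.
Variables (k : comPzRingType) (iota : {rmorphism rat -> k}).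
Variables (nu nu' : k) (nuV : (nu + nu) * nu' = 1).
Local Notation e := (cex iota).

Definition ellS (F : series k bool) (A : bool -> series k bool) :=
  [/\ grp F /\ (forall s, grp (A s)), dualS F, forall s, hexS iota (sg s nu) F,
      forall s, alphaS iota (sg s nu) F (A s) & commS iota nu F (A true) (A false)].

(** Cramer's formula for the inverse of [mat1 A]; [nu'] inverts its determinant, which is 2 nu. *)
Definition inv1 (A : bool -> series k bool) (s t : bool) : k :=
  nu' * (if s then if t then mat1 A false false else - mat1 A true false
         else if t then - mat1 A false true else mat1 A true true).

Lemma mat1_inv A F : ellS F A ->
  (forall s t, \sum_j inv1 A s j * mat1 A j t = (s == t)%:R) /\
  (forall s t, \sum_j mat1 A s j * inv1 A j t = (s == t)%:R).
Proof.
move=> [[GF GA] _ _ _ FC]; have := mat1_det GF GA FC.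
move=> E; have D : (mat1 A true true * mat1 A false false -
  mat1 A true false * mat1 A false true) * nu' = 1 by rewrite E.
by split=> -[] []; rewrite big_bool /inv1 /= ?mulr0n ?mulr1n -?D; ring.
Qed.

Lemma W_lead F A (S : complAlgType k) (p q r : bool -> S) : ellS F A -> esys p q r ->
  (forall s, lead (W1 F A p q r s) (\sum_t cst (mat1 A s t) * p t)) /\
  (forall s, lead (W2 iota nu F A p q r s) (\sum_t cst (mat1 A s t) * q t)).
Proof.
move=> [[GF GA] _ _ _ _] H; have [fp fq fr] := esys_fil H.
split=> s; first by apply: lead_conj; [exact: ev2_grp | exact: evx_lead].
have le := lead_cex iota (sg s nu) (et_fil2 H).
have l1 := lead_conj (ev2_grp (et p q) (et p r) GF) (evx_lead (GA s) fq).
by apply: lead_eq (leadM (leadM le l1) le); rewrite add0r addr0.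
Qed.

Section Generic.
Variables (F F2 : series k bool) (A A2 : bool -> series k bool).
Hypotheses (HF : ellS F A) (HF2 : ellS F2 A2).
Variables (S : complAlgType k) (p q r : bool -> S).
Hypothesis H : esys p q r.
Notation U := (quo (idclosure (@minR k))).
Let M := mat1 A.
Let N := inv1 A.

(** The letters are sent to N (w - 1), which undoes the definition of [Om]. *)
Definition thW (V : complAlgType k) (w1 w2 : bool -> V) : series k (bool * bool)%type -> V :=
  ev (fun x : bool * bool => \sum_t cst (N x.2 t) * ((if x.1 then w2 else w1) t - 1)).

Lemma thW_fil (V : complAlgType k) (w1 w2 : bool -> V) :
  (forall s, grp (w1 s)) -> (forall s, grp (w2 s)) -> forall x : bool * bool,
  fil 1 (\sum_t cst (N x.2 t) * ((if x.1 then w2 else w1) t - 1)).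
Proof.
by move=> G1 G2 [j s]; apply: fil_sum => t _; apply: filcst; case: j; [exact: G2 | exact: G1].
Qed.

Lemma thW_Om (V : complAlgType k) (w1 w2 : bool -> V) :
  (forall s, grp (w1 s)) -> (forall s, grp (w2 s)) -> forall s,
  thW w1 w2 (Om M (@l1 k) s) = w1 s /\ thW w1 w2 (Om M (@l2 k) s) = w2 s.
Proof.
have [_ MN] := mat1_inv HF; move=> G1 G2 s; have fW := thW_fil G1 G2.
have E (l : bool -> series k (bool * bool)%type) (w : bool -> V) :
    (forall t, thW w1 w2 (l t) = \sum_t' cst (N t t') * (w t' - 1)) ->
    thW w1 w2 (Om M l s) = w s.
  move=> El; rewrite /Om /La /thW evD ev_one ev_sum.
  rewrite (eq_bigr (fun t => cst (M s t) * \sum_t' cst (N t t') * (w t' - 1))).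
    by rewrite (sum_inv (fun t => w t - 1) s MN) addrC subrK.
  by move=> t _; rewrite evM -El; congr (_ * _); exact: (chom_cst (ev _)).
by split; apply: E => t; rewrite /thW ev_letter.
Qed.

(** The pair (F0, A0) may differ from (F, A), whose matrix [M] enters [Om]: the relations between
    words do not involve the matrix, so the same series are killed for both associators. *)
Lemma kap_kill (V : complAlgType k) (x y z : bool -> V) F0 A0
    (th : chomType (series k (bool * bool)%type) V) : ellS F0 A0 -> esys x y z ->
  (forall s, th (Om M (@l1 k) s) = W1 F0 A0 x y z s) ->
  (forall s, th (Om M (@l2 k) s) = W2 iota nu F0 A0 x y z s) ->
  [/\ forall s, th (kap1 M s) = 0, th (kap2 M) = 0 & forall s, th (kap3 M s) = 0].
Proof.
move=> [[GF GA] Fd Fh Fal FC] Hxyz E1 E2.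
pose w1 := W1 F0 A0 x y z; pose w2 := W2 iota nu F0 A0 x y z.
have G1 s : grp (w1 s) by apply: W1_grp.
have G2 s : grp (w2 s) by apply: W2_grp.
have brE (u v : series k (bool * bool)%type) : th (br u v) = br (th u) (th v).
  by rewrite /br chomB !chomM.
have [fp fq _] : [/\ forall s, fil 1 (l1 k s), forall s, fil 1 (l2 k s) & True].
  by split=> // s; exact: fil_letter.
have fLa l s : (forall s, fil 1 (l s)) -> grp (Om M l s : series k (bool * bool)%type).
  move=> fl; rewrite /grp /Om addrC addKr /La.
  by apply: (@fil_sum _ (series k (bool * bool)%type)) => t _; apply: filcst.
have O1 s : grp (Om M (@l1 k) s) by apply: fLa.
have O2 s : grp (Om M (@l2 k) s) by apply: fLa.
have Ez : th (kapZ M) = e nu (et x y) * e nu (et x y).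
  rewrite /kapZ chom_gcm ?(chom_cinv th) ?E1 ?E2 //; last exact: grpV.
  by rewrite -(z_word GF GA FC Hxyz).
have GZ : grp (kapZ M) by rewrite /kapZ /gcm; grps.
split=> [s||s].
- by rewrite brE E1 E2; apply: br_eq0P; apply: word12.
- have E3 : th (gcm (Om M (@l2 k) false * kapZ M) (cinv (kapZ M) * cinv (Om M (@l1 k) true))) =
    gcm (w2 false * (e nu (et x y) * e nu (et x y)))
        (cinv (e nu (et x y) * e nu (et x y)) * cinv (w1 true)).
    rewrite chom_gcm; [congr gcm | by grps | by grps]; first by rewrite chomM E2 Ez.
    by rewrite chomM !(chom_cinv th) // Ez E1.
  rewrite /kap2 chomB E3 Ez; apply/eqP; rewrite subr_eq0; apply/eqP.
  exact: (z_word' GF GA FC Hxyz).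
- rewrite brE chomM E1 E2 Ez; apply: br_eq0P.
  have E := word321 GF GA Fd Fh Fal Hxyz s.
  have -> : w2 s * w1 s = cinv (W3 iota nu A0 x y z s).
    have G3 : grp (W3 iota nu A0 x y z s) by apply: W3_grp.
    by apply: (mulrI_grp G3); rewrite mulrA E gmulrV.
  apply/esym/centV; first by apply: W3_grp.
  exact: z_word3.
Qed.

(** An instance of [quo_transfer]: the words of (F, A) in the universal system have the letters as
    linear parts once [N] is applied, and the lifts of the relators given by [minR_kap] are killed
    by the words of either associator. *)
Lemma ell_transfer : exists tau : chomType U S,
  (forall s, tau (W1 F A (@pU k) (@qU k) (@rU k) s) = W1 F2 A2 p q r s) /\
  (forall s, tau (W2 iota nu F A (@pU k) (@qU k) (@rU k) s) = W2 iota nu F2 A2 p q r s).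
Proof.
pose w1 := W1 F A (@pU k) (@qU k) (@rU k); pose w2 := W2 iota nu F A (@pU k) (@qU k) (@rU k).
pose v1 := W1 F2 A2 p q r; pose v2 := W2 iota nu F2 A2 p q r.
have [[GF GA] _ _ _ _] := HF; have [[GF2 GA2] _ _ _ _] := HF2.
pose ph : chomType _ U := thW w1 w2; pose ph' : chomType _ S := thW v1 v2.
have G1 s : grp (w1 s) by apply: W1_grp.
have G2 s : grp (w2 s) by apply: W2_grp.
have G1' s : grp (v1 s) by apply: W1_grp.
have G2' s : grp (v2 s) by apply: W2_grp.
have E1 s : ph (Om M (@l1 k) s) = w1 s by case: (thW_Om G1 G2 s).
have E2 s : ph (Om M (@l2 k) s) = w2 s by case: (thW_Om G1 G2 s).
have E1' s : ph' (Om M (@l1 k) s) = v1 s by case: (thW_Om G1' G2' s).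
have E2' s : ph' (Om M (@l2 k) s) = v2 s by case: (thW_Om G1' G2' s).
have [a1 a2 a3] := kap_kill HF (U_esys k) E1 E2.
have [b1 b2 b3] := kap_kill HF2 H E1' E2'.
have [NM MN] := mat1_inv HF; have [L1 L2] := W_lead HF (U_esys k).
have lead_x x : fil 2 (ph (letter k x) - qpi (idclosure (@minR k)) (letter k x)).
  have E (w y : bool -> U) s : (forall t, lead (w t) (\sum_t' cst (M t t') * y t')) ->
      fil 2 (\sum_t cst (N s t) * (w t - 1) - y s).
    move=> Hw; rewrite -[y s](sum_inv y s NM) -sumrB; apply: fil_sum => t _.
    by rewrite -mulrBr; apply: filMl; case: (Hw t).
  rewrite /ph /thW /= ev_letter; last exact: thW_fil.
  by case: x => -[] s /=; [exact: (E w2 (@qU k) s L2) | exact: (E w1 (@pU k) s L1)].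
have [f Rf|tau Htau] := @quo_transfer k _ (@minR k) S ph ph' lead_x.
  have [d [h [h1 h2 h3]]] := minR_kap NM Rf.
  by exists d, h; split=> //; apply: h3.
exists tau; split=> s.
  exact: etrans (congr1 tau (esym (E1 s))) (etrans (Htau _) (E1' s)).
exact: etrans (congr1 tau (esym (E2 s))) (etrans (Htau _) (E2' s)).
Qed.
End Generic.
End EllTransfer.

(** * Relations of u deduced from two elliptic associators *)

Section EllUntwist.
Variables (k : comPzRingType) (iota : {rmorphism rat -> k}).
Variables (nu mu' : k) (nuV : nu * mu' = 1).
Local Notation e := (cex iota).
Variables (F g : series k bool) (A u : bool -> series k bool).
Hypotheses (Gg : grp g) (gd : dualS g) (gc : cycS g) (gs : sumS g).
Hypotheses (uf : forall s, fil 1 (u s)).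
Let A2 s : series k bool := ev2 (A s) (u true) (u false).
Hypotheses (HF : ellS iota nu F A) (HF2 : ellS iota nu (twist F g) A2).

Let half2 : iota (1 / 2%:R) + iota (1 / 2%:R) = 1.
Proof.
by rewrite -rmorphD (_ : 1 / 2%:R + 1 / 2%:R = 1 :> rat) ?rmorph1 //; apply/eqP.
Qed.
Let nu2V : (nu + nu) * (iota (1 / 2%:R) * mu') = 1.
Proof.
by rewrite mulrCA mulrDl nuV mulrDr mulr1.
Qed.

(** The linear part of [A] is invertible, so the two series [A s - 1] generate the algebra and
    [chom_gen] applies. *)
Lemma evx_inj (S : complAlgType k) (x y : bool -> S) :
  (forall s, fil 1 (x s)) -> (forall s, fil 1 (y s)) ->
  (forall s, evx (A s) x = evx (A s) y) -> forall s, x s = y s.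
Proof.
move=> fx fy E; have [[GF GA] _ _ _ _] := HF.
have [NM _] := mat1_inv nu2V HF.
pose ltr (s : bool) : series k bool := letter k (~~ s).
have fl s : fil 1 (ltr s) by exact: fil_letter.
pose a (l : bool) := A (~~ l) - 1.
pose N (l l' : bool) := inv1 (iota (1 / 2%:R) * mu') A (~~ l) (~~ l').
have Eid s : evx (A s) ltr = A s.
  by rewrite -[RHS]ev_id; apply: eq_ev => -[].
have Hgen l : fil 2 (letter k l - \sum_l' N l l' *: a l').
  have -> : letter k l = ltr (~~ l) by rewrite /ltr negbK.
  rewrite -(sum_inv ltr (~~ l) NM).
  have -> : \sum_l' N l l' *: a l' =
      \sum_s cst (inv1 (iota (1 / 2%:R) * mu') A (~~ l) s) * (A s - 1).
    by rewrite !big_bool !scale_cst /N /a /= addrC.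
  rewrite -sumrB; apply: (@fil_sum _ (series k bool)) => s _; rewrite -mulrBr; apply: filMl.
  by apply: filBC; have [_] := evx_lead (GA s) fl; rewrite Eid.
have key := chom_gen (th1 := ev (fun l : bool => if l then x false else x true))
  (th2 := ev (fun l : bool => if l then y false else y true)) (a := a) (N := N) Hgen.
move=> s; have := key _ (ltr s); rewrite /= /ltr !ev_letter; [| by case | by case].
have -> : (if ~~ s then x false else x true) = x s by case: s.
have -> : (if ~~ s then y false else y true) = y s by case: s.
by apply=> l; rewrite /a !evB !ev_one; congr (_ - _); exact: E.
Qed.

(** [tau] carries [z] to [z], hence [a'] to [a]; through [b_word] and [c_word] it carries [b'] and
    [c'] to the conjugates of [b] and [c]. Stripping the words down to the values of [A] shows that
    it carries the generators to the twisted ones, so the relations wanted are images of those in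
    [V]. *)
Lemma untwist_ell_tau (V S : complAlgType k) (pU qU rU : bool -> V) (p q r : bool -> S)
    (tau : chomType V S) : esys pU qU rU -> esys p q r ->
  (forall s, tau (W1 F A pU qU rU s) = W1 (twist F g) A2 p q r s) ->
  (forall s, tau (W2 iota nu F A pU qU rU s) = W2 iota nu (twist F g) A2 p q r s) ->
  [/\ forall s, uy1 g u p q r s + uy2 g u p q r s + uy3 u r s = 0,
      forall s, br (uy1 g u p q r s) (uy3 u r s) = 0
    & br (uy1 g u p q r true) (uy2 g u p q r false) = et p q].
Proof.
move=> HU H T1 T2; have [[GF GA] Fd Fh Fal FC] := HF.
have [[GF2 GA2] Fd2 Fh2 Fal2 FC2] := HF2; have [fpU fqU frU] := esys_fil HU; have [fp fq fr] := esys_fil H.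
pose a := et p q; pose b := et q r; pose c := et p r.
pose a' := et pU qU; pose b' := et qU rU; pose c' := et pU rU.
have [Ha Hb Hc Ta Tb] : tri a b c := et_tri H.
have [Ha' Hb' Hc' Ta' Tb'] : tri a' b' c' := et_tri HU.
have Gab := ev2_grp a b Gg; have Gac := ev2_grp a c Gg.
have G1' s : grp (W1 F A pU qU rU s) by apply: W1_grp.
have G2' s : grp (W2 iota nu F A pU qU rU s) by apply: W2_grp.
have G3' s : grp (W3 iota nu A pU qU rU s) by apply: W3_grp.
have G1 s : grp (W1 (twist F g) A2 p q r s) by apply: W1_grp.
have G2 s : grp (W2 iota nu (twist F g) A2 p q r s) by apply: W2_grp.
have G3 s : grp (W3 iota nu A2 p q r s) by apply: W3_grp.
have T3 s : tau (W3 iota nu A pU qU rU s) = W3 iota nu A2 p q r s.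
  have E1 := word321 GF GA Fd Fh Fal HU s; have E2 := word321 GF2 GA2 Fd2 Fh2 Fal2 H s.
  have -> : W3 iota nu A2 p q r s = cinv (W2 iota nu (twist F g) A2 p q r s *
      W1 (twist F g) A2 p q r s).
    by rewrite -mulrA in E2; apply: (mulIr_grp (grpM (G2 s) (G1 s))); rewrite E2 gmulVr //; grps.
  have -> : W3 iota nu A pU qU rU s = cinv (W2 iota nu F A pU qU rU s * W1 F A pU qU rU s).
    by rewrite -mulrA in E1; apply: (mulIr_grp (grpM (G2' s) (G1' s))); rewrite E1 gmulVr //; grps.
  have Gw := grpM (G2' s) (G1' s).
  by rewrite (chom_cinv tau) // (chomM tau) T1 T2.
have ta : tau a' = a.
  apply: (cex_inj (nu := nu + nu) nu2V (iota := iota)) => //; first exact: chom_fil.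
  rewrite -chom_cex // !cexDl // (z_word GF GA FC HU) (z_word GF2 GA2 FC2 H).
  by rewrite chom_gcm ?(chom_cinv tau) ?T1 ?T2 //; grps.
have tgcm x y : grp x -> grp y -> tau (gcm x y) = gcm (tau x) (tau y) by exact: chom_gcm.
have tYel x y : fil 1 x -> fil 1 y -> tau (Yel iota nu F x y) = Yel iota nu F (tau x) (tau y).
  move=> fx fy; rewrite /Yel !chomM chom_cinv ?(chom_ev2 tau) ?chom_cex //; exact: ev2_grp.
have te : tau (e nu a') = e nu a by rewrite chom_cex // ta.
have tb : tau b' = Adg (cinv (ev2 g a b)) b.
  apply: (Yel_inj (iota := iota) nuV GF Ha); [exact: chom_fil | exact: Adg_fil |].
  rewrite (Yel_twist iota nu GF Gg Ha Hb).
  transitivity (tau (Yel iota nu F a' b')); first by rewrite tYel // ta.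
  rewrite (b_word GF GA Fd Fh FC HU) (b_word GF2 GA2 Fd2 Fh2 FC2 H) -/a' -/a.
  have Ge := cex_grp iota nu a'.
  rewrite tgcm; [| by grps | by grps].
  by rewrite (chom_cinv tau) // T3 (chomM tau) T2 (chomM tau) te.
have tc : tau c' = Adg (cinv (ev2 g a c)) c.
  apply: (Yel_inj (iota := iota) nuV GF Ha); [exact: chom_fil | exact: Adg_fil |].
  rewrite (Yel_twist iota nu GF Gg Ha Hc).
  transitivity (tau (Yel iota nu F a' c')); first by rewrite tYel // ta.
  rewrite (c_word GF GA Fd Fh FC HU) (c_word GF2 GA2 Fd2 Fh2 FC2 H) -/a' -/a.
  have Ge := cex_grp iota nu a'.
  rewrite (chomM tau) (chomM tau) tgcm; [| by grps | by grps].
  by rewrite !(chom_cinv tau) // T3 T1 te.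
have tevx s x : (forall s, fil 1 (x s)) -> tau (evx (A s) x) = evx (A s) (fun j => tau (x j)).
  by move=> fx; rewrite /evx (chom_ev2 tau).
have TwK x y : fil 1 x -> fil 1 y -> ev2 F x (Adg (cinv (ev2 g x y)) y) =
    cinv (ev2 g x y) * ev2 (twist F g) x y.
  by move=> Hx Hy; rewrite ev2_twist' // gmulVKr //; exact: ev2_grp.
have GX2 x y : grp (ev2 (twist F g) x y : S) by apply: ev2_grp.
have GY s (x : bool -> S) : grp (evx (A s) x) by apply: ev2_grp.
have GY2 s (x : bool -> S) : grp (evx (A2 s) x) by apply: ev2_grp.
have fu s (x : bool -> S) : (forall s, fil 1 (x s)) -> fil 1 (evu u s x).
  by move=> fx; apply: ev2_fil.
have tp s : tau (pU s) = uy1 g u p q r s.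
  apply: (evx_inj (x := fun j => tau (pU j))) => [j|j|j]; first exact: chom_fil.
    by apply: Adg_fil; exact: fu.
  rewrite [RHS](_ : _ = Adg (cinv (ev2 g a b)) (evx (A2 j) p)); last exact: (evx_Adg uf (A j) (grpV Gab) fp).
  rewrite -tevx // AdgE ?cinvK //; last exact: grpV.
  have := T1 j; rewrite /W1 -/a' -/b' -/a -/b !chomM (chom_cinv tau); last exact: ev2_grp.
  rewrite (chom_ev2 tau) // ta tb TwK // => E.
  have := tevx j pU fpU; move: (tau (evx _ _)) E => y E Ey.
  have Gy : grp y by rewrite Ey.
  by gby (congr1 (fun z => cinv (ev2 g a b) * ev2 (twist F g) a b * z *
    cinv (ev2 (twist F g) a b) * ev2 g a b) E).
have tq s : tau (qU s) = uy2 g u p q r s.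
  apply: (evx_inj (x := fun j => tau (qU j))) => [j|j|j]; first exact: chom_fil.
    by apply: Adg_fil; exact: fu.
  rewrite [RHS](_ : _ = Adg (cinv (ev2 g a c)) (evx (A2 j) q)); last exact: (evx_Adg uf (A j) (grpV Gac) fq).
  rewrite -tevx // AdgE ?cinvK //; last exact: grpV.
  have := T2 j; rewrite /W2 -/a' -/c' -/a -/c !chomM (chom_cinv tau); last exact: ev2_grp.
  rewrite (chom_ev2 tau) // chom_cex // ta tc TwK // => E.
  have := tevx j qU fqU; move: (tau (evx _ _)) E => y E Ey.
  have Gy : grp y by rewrite Ey.
  have Ge := cex_grp iota (sg j nu) a.
  by gby (congr1 (fun z => cinv (ev2 g a c) * ev2 (twist F g) a c * (cinv (e (sg j nu) a) * z *
    cinv (e (sg j nu) a)) * cinv (ev2 (twist F g) a c) * ev2 g a c) E).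
have tr s : tau (rU s) = uy3 u r s.
  apply: (evx_inj (x := fun j => tau (rU j))) => [j|j|j]; [exact: chom_fil | exact: fu|].
  rewrite [RHS](_ : _ = evx (A2 j) r); last exact: (evx_uy uf (A j) fr).
  rewrite -tevx //.
  have := T3 j; rewrite /W3 -/b' -/c' -/b -/c !chomM chom_cex; last exact: filD.
  have -> : tau (b' + c') = b + c.
    rewrite chomD tb tc; have := gs (et_tri H); rewrite -/a -/b -/c.
    move: (Adg _ b) (Adg _ c) => y z E.
    by transitivity (a + y + z - a); [|rewrite E]; ncring.
  move=> E; have := tevx j rU frU; move: (tau (evx _ _)) E => y E Ey.
  have Gy : grp y by rewrite Ey.
  have Ge := cex_grp iota (sg j nu) (b + c).
  by gby (congr1 (fun z => cinv (e (sg j nu) (b + c)) * z * cinv (e (sg j nu) (b + c))) E).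
have brE x y : br (tau x) (tau y) = tau (br x y) by rewrite /br chomB !chomM.
case: (HU) => -[_ _ h0] h1 h2 h3; split=> [s|s|].
- by rewrite -tp -tq -tr -!chomD h0 chom0.
- by rewrite -tp -tr brE (esys_qr (esys_swap HU)) chom0.
- by rewrite -tp -tq brE; exact: ta.
Qed.

Lemma untwist_ell : uS g u.
Proof.
move=> S p q r H; have [tau [T1 T2]] := ell_transfer nu2V HF HF2 H.
exact: (untwist_ell_tau (U_esys k) H T1 T2).
Qed.
End EllUntwist.

(** * Presentations and systems of elements *)

Section Relators.
Variables (k : comPzRingType) (n : nat).

Lemma free_lie_t i j : free_lie (t k n i j).
Proof. by apply: free_lie_sum => q _; constructor. Qed.
Lemma free_lie_x s i : free_lie (x_ k n s i).
Proof. by apply: free_lie_sum => q _; constructor. Qed.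
Lemma homog_t i j : homog 1 (t k n i j).
Proof. by apply: homog_sum => q _; exact: homog_letter. Qed.
Lemma homog_x s i : homog 1 (x_ k n s i).
Proof. by apply: homog_sum => q _; exact: homog_letter. Qed.
Lemma fil_x s i : fil 1 (x_ k n s i).
Proof. by apply/lie_series_fil/free_lie_series/free_lie_x. Qed.

Lemma free_lieB (X : finType) (f g : series k X) : free_lie f -> free_lie g -> free_lie (f - g).
Proof. by move=> Hf Hg; apply: free_lieD => //; apply: free_lieN. Qed.

Lemma t_rel_lie f : t_rel k n f -> free_lie f.
Proof.
case=> *; [apply: free_lieB | apply: free_lie_br | apply: free_lie_br]; try exact: free_lie_t.
by apply: free_lieD; exact: free_lie_t.
Qed.
Lemma t_rel_homog f : t_rel k n f -> exists d, f = hcomp d f.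
Proof.
have h := homog_t; case=> [i j _|i j l _|i j l m _].
- by exists 1%N; rewrite (homogB (h _ _) (h _ _)).
- by exists 2%N; rewrite (homog_br (h _ _) (homogD (h _ _) (h _ _))).
- by exists 2%N; rewrite (homog_br (h _ _) (h _ _)).
Qed.
Lemma e_rel_lie f : e_rel k n f -> free_lie f.
Proof.
have h := free_lie_x; case=> *.
- by apply: free_lie_sum => i _.
- exact: free_lie_br.
- by apply: free_lieB; apply: free_lie_br.
- by apply: free_lie_br => //; apply: free_lie_br.
Qed.
Lemma e_rel_homog f : e_rel k n f -> exists d, f = hcomp d f.
Proof.
have h := homog_x; case=> [s|s i j _|i j _|s i j l _].
- by exists 1%N; rewrite homog_sum.
- by exists 2%N; rewrite (homog_br (h _ _) (h _ _)).
- by exists 2%N; rewrite (homogB (homog_br (h _ _) (h _ _)) (homog_br (h _ _) (h _ _))).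
- by exists 3%N; rewrite (homog_br (h _ _) (homog_br (h _ _) (h _ _))).
Qed.

Lemma sum_e_alph (V : nmodType) (F : bool -> nat -> V) s i : (0 < i <= n)%N ->
  \sum_(q : e_alph n | (q.1 == s) && (q.2.+1 == i)) F q.1 q.2.+1 = F s i.
Proof.
case: i => [|i] //= Hi; rewrite (big_pred1 (s, Ordinal Hi)) // => -[s' j] /=.
Qed.
End Relators.

Lemma rel_univ (k : comPzRingType) (X : finType) (R : series k X -> Prop) f g :
  qpi (idclosure R) f = qpi (idclosure R) g <->
  forall (S : complAlgType k) (th : chomType (series k X) S),
    (forall h, R h -> th h = 0) -> th f = th g.
Proof.
split=> [/qpiP E S th HR|H].
  by apply/eqP; rewrite -subr_eq0 -chomB; apply/eqP; exact: (idcl_kill HR).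
apply: (H (quo (idclosure R)) (qpi (idclosure R))) => h Rh.
by rewrite -[RHS]qpi0; apply/qpiP; rewrite subr0; apply/idcl_gen/idgen_gen.
Qed.

Section Insertions.
Variables (k : comPzRingType).
Implicit Types f : series k bool.

Definition tI p (I J : seq nat) : series k (t_alph p) := \sum_(a <- I) \sum_(b <- J) t k p a b.
Arguments tI : clear implicits.

Lemma lie_tI p I J : lie_series (tI p I J).
Proof.
by apply: lie_series_sum => i _; apply: lie_series_sum => j _; apply/free_lie_series/free_lie_t.
Qed.
Lemma fil_tI p I J : fil 1 (tI p I J). Proof. exact/lie_series_fil/lie_tI. Qed.

Lemma subst2E (Y : finType) f (a b : series k Y) : fil 1 a -> fil 1 b -> subst2 f a b = ev2 f a b.
Proof. by move=> Ha Hb; rewrite /subst2 -ev_subst // => -[]. Qed.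

Lemma f2_insE p I J K f : f2_ins p I J K f = ev2 f (tI p I J) (tI p J K).
Proof.
(* Labels count from 1 and positions in a list from 0, hence the predecessors. *)
pose F i j := tI p (nth [::] [:: I; J; K] i.-1) (nth [::] [:: I; J; K] j.-1).
have fF i j : fil 1 (F i j) by exact: fil_tI.
rewrite /f2_ins /t_ins -ev_subst; last by move=> q; exact: fil_tI.
rewrite -[ev _]/(evt F) /f2_t3 subst2E; try exact: fil_t.
have -> : evt F (ev2 f (t k 3 1 2) (t k 3 2 3)) = ev2 f (evt F (t k 3 1 2)) (evt F (t k 3 2 3)).
  by apply: chom_ev2; exact: fil_t.
by rewrite !evt_t.
Qed.

Lemma curlyE n (f : series k (t_alph n)) : curly f =
  evt (fun i j => br (x_ k n true i) (x_ k n false j)) f.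
Proof.
by rewrite /curly -ev_subst // => q; apply: filS; apply: (@br_fil _ _ 1 1); exact: fil_x.
Qed.

Lemma e_insE n p (I : seq (seq nat)) (f : series k (e_alph n)) : e_ins p I f =
  ev (fun q : e_alph n => \sum_(a <- nth [::] I q.2) x_ k p q.1 a) f.
Proof.
by rewrite /e_ins -ev_subst // => q; apply: (@fil_sum _ (series k (e_alph p))) => a _; exact: fil_x.
Qed.

Lemma e_ins_x n p (I : seq (seq nat)) s i : (0 < i <= n)%N ->
  ev (fun q : e_alph n => \sum_(a <- nth [::] I q.2) x_ k p q.1 a) (x_ k n s i) =
  \sum_(a <- nth [::] I i.-1) x_ k p s a.
Proof.
move=> Hi; rewrite -(sum_e_alph (fun s i => \sum_(a <- nth [::] I i.-1) x_ k p s a) s Hi).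
rewrite [x_ k n s i]/x_ ev_sum; apply: eq_bigr => q _; rewrite ev_letter // => {}q.
by apply: (@fil_sum _ (series k (e_alph p))) => a _; exact: fil_x.
Qed.

Lemma t12_insE p I J f : t12_ins p I J f =
  ev2 f (\sum_(a <- I) x_ k p true a) (\sum_(a <- I) x_ k p false a).
Proof.
rewrite /t12_ins e_insE /f2_t12 subst2E; try exact: fil_x.
pose th : chomType _ (series k (e_alph p)) :=
  ev (fun q : e_alph 2 => \sum_(a <- nth [::] [:: I; J] q.2) x_ k p q.1 a).
have Ex b : th (x_ k 2 b 1) = \sum_(a <- I) x_ k p b a by exact: e_ins_x.
by rewrite -!Ex; apply: (chom_ev2 th); exact: fil_x.
Qed.
End Insertions.

(** * Translation of the relations of M and GRT_1 *)

Section Forms.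
Variables (k : comPzRingType) (iota : {rmorphism rat -> k}).
Implicit Types f g F : series k bool.

Lemma chom_sexp (X : finType) (S : complAlgType k) (th : chomType (series k X) S) c
    (h : series k X) : fil 1 h -> th (sexp iota (c *: h)) = cex iota c (th h).
Proof.
move=> Hh; have Hc : fil 1 (c *: h) by apply: sfilZ.
by rewrite sexpE // chom_cexp // scale_cst chomM chom_cst.
Qed.

Lemma chom_ins p (S : complAlgType k) (th : chomType (series k (t_alph p)) S) I J K f :
  th (f2_ins p I J K f) = ev2 f (\sum_(a <- I) \sum_(b <- J) th (t k p a b))
    (\sum_(a <- J) \sum_(b <- K) th (t k p a b)).
Proof.
rewrite f2_insE chom_ev2; try exact: fil_tI.
by rewrite !chom_sum; congr ev2; apply: eq_bigr => a _; rewrite chom_sum.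
Qed.

Lemma exp_lie_ins p I J K f : exp_lie iota f -> exp_lie iota (f2_ins p I J K f).
Proof. by move=> Ef; rewrite f2_insE; apply: exp_lie_ev => // -[]; exact: lie_tI. Qed.

Lemma exp_lie_exp (X : finType) c (h : series k X) : lie_series h ->
  exp_lie iota (sexp iota (c *: h)).
Proof. by move=> Lf; apply: exp_lie_sexp; apply: lie_seriesZ. Qed.

Lemma lie_t n i j : lie_series (t k n i j). Proof. exact/free_lie_series/free_lie_t. Qed.
Lemma lie_x n s i : lie_series (x_ k n s i). Proof. exact/free_lie_series/free_lie_x. Qed.

Section T3.
Variables (S : complAlgType k) (th : chomType (series k (t_alph 3)) S).
Hypothesis kill : forall h, t_rel k 3 h -> th h = 0.

Lemma kill_sym3 i j : th (t k 3 i j) = th (t k 3 j i).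
Proof.
have [/and3P[Hi Hj ij]|nv] := boolP [&& (0 < i <= 3)%N, (0 < j <= 3)%N & i != j]; last first.
  rewrite (t_invalid k nv) t_invalid //; apply: contra nv => /and3P[-> -> ] /=.
  by rewrite eq_sym.
case: i j Hi Hj ij => [|i] [|j] //= Hi Hj ij.
apply/subr0_eq; rewrite -chomB; apply: kill.
by apply: (@t_rel_sym k 3 (Ordinal Hi) (Ordinal Hj)).
Qed.

Lemma kill_tri : tri (th (t k 3 1 2)) (th (t k 3 2 3)) (th (t k 3 1 3)).
Proof.
have tf i j : fil 1 (th (t k 3 i j)) by apply: chom_fil; exact: fil_t.
have r3 (i j l : 'I_3) : uniq [:: i; j; l] ->
    th (t k 3 i.+1 j.+1) * (th (t k 3 i.+1 l.+1) + th (t k 3 j.+1 l.+1)) =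
    (th (t k 3 i.+1 l.+1) + th (t k 3 j.+1 l.+1)) * th (t k 3 i.+1 j.+1).
  move=> u; have/kill : t_rel k 3 (lie_br (t k 3 i.+1 j.+1) (t k 3 i.+1 l.+1 + t k 3 j.+1 l.+1)).
    by apply: t_rel3.
  by rewrite /lie_br chomB !chomM chomD => /subr0_eq.
have E1 := @r3 (@Ordinal 3 0 isT) (@Ordinal 3 1 isT) (@Ordinal 3 2 isT) isT.
have E2 := @r3 (@Ordinal 3 1 isT) (@Ordinal 3 2 isT) (@Ordinal 3 0 isT) isT.
move: E1 E2; rewrite /= (kill_sym3 2 1) (kill_sym3 3 1).
move: (tf 1 2) (tf 2 3) (tf 1 3) => f1 f2 f3 E1 E2; split=> //.
  move: (th (t k 3 1 2)) (th (t k 3 2 3)) (th (t k 3 1 3)) E1 {E2 f1 f2 f3} => x y z E.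
  have -> : (x + y + z) * x = x * x + (z + y) * x by ncring.
  by rewrite -E; ncring.
move: (th (t k 3 1 2)) (th (t k 3 2 3)) (th (t k 3 1 3)) E2 {E1 f1 f2 f3} => x y z E.
have -> : (x + y + z) * y = y * y + (x + z) * y by ncring.
by rewrite -E; ncring.
Qed.
End T3.

Lemma tri_kill (S : complAlgType k) (a b c : S) : tri a b c ->
  exists th : chomType (series k (t_alph 3)) S, [/\ forall h, t_rel k 3 h -> th h = 0,
    th (t k 3 1 2) = a, th (t k 3 2 3) = b & th (t k 3 1 3) = c].
Proof.
move=> H; have cc := tri_c H; have [Ha Hb Hc ca cb] := H.
pose T (i j : nat) : S := match i, j with
  | 1%N, 2%N | 2%N, 1%N => a | 2%N, 3%N | 3%N, 2%N => b | 1%N, 3%N | 3%N, 1%N => c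
  | _, _ => 0 end.
have fT i j : fil 1 (T i j).
  by case: i => [|[|[|[|i]]]]; case: j => [|[|[|[|j]]]] //=; exact: fil_zero.
have [th E] : exists th : chomType (series k (t_alph 3)) S, forall i j,
    (0 < i <= 3)%N -> (0 < j <= 3)%N -> i != j -> th (t k 3 i j) = T i j.
  exists (ev (fun q : t_alph 3 => T (val q).1.+1 (val q).2.+1)) => i j Hi Hj ij.
  exact: evt_t.
exists th; split; try by rewrite E.
have h1 : a * (b + c) = (b + c) * a.
  have -> : a * (b + c) = a * (a + b + c) - a * a by ncring.
  by rewrite -ca; ncring.
have h2 : b * (a + c) = (a + c) * b.
  have -> : b * (a + c) = b * (a + b + c) - b * b by ncring.
  by rewrite -cb; ncring.
have h3 : c * (a + b) = (a + b) * c.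
  have -> : c * (a + b) = c * (a + b + c) - c * c by ncring.
  by rewrite -cc; ncring.
have h1' : a * (c + b) = (c + b) * a by rewrite [c + b]addrC.
have h2' : b * (c + a) = (c + a) * b by rewrite [c + a]addrC.
have h3' : c * (b + a) = (b + a) * c by rewrite [b + a]addrC.
move=> h; case=> {h} [i j ij|i j l u|i j l m u].
- rewrite chomB !E ?ltn_ord //; last by rewrite eqSS eq_sym.
  have -> : T j.+1 i.+1 = T i.+1 j.+1.
    by case: i j ij => [[|[|[|i]]] //= Hi] [[|[|[|j]]] //= Hj].
  by rewrite subrr.
- have [ij il jl] : [/\ i.+1 != j.+1, i.+1 != l.+1 & j.+1 != l.+1].
    by move: u; rewrite /= !inE !negb_or !eqSS andbT => /andP[/andP[-> ->] ->].
  rewrite /lie_br chomB !chomM chomD !E ?ltn_ord //; apply/eqP; rewrite subr_eq0; apply/eqP.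
  move: ij il jl; case: i j l {u} => [[|[|[|i]]] //= Hi] [[|[|[|j]]] //= Hj] [[|[|[|l]]] //= Hl] //= _ _ _;
    first [exact: h1 | exact: h2 | exact: h3 | exact: h1' | exact: h2' | exact: h3'].
(* Four distinct labels do not exist among three. *)
- by have := max_card (mem [:: i; j; l; m]); rewrite (card_uniqP u) card_ord.
Qed.

Section TranslationT.
Variable F : series k bool.
Hypothesis EF : exp_lie iota F.
Let GF : grp F. Proof. exact: exp_lie_grp EF. Qed.
Let t3P (f g : series k (t_alph 3)) := exp_eqP (iota := iota) (@t_rel_lie k 3) (@t_rel_homog k 3) (f := f) (g := g).
Let t4P (f g : series k (t_alph 4)) := exp_eqP (iota := iota) (@t_rel_lie k 4) (@t_rel_homog k 4) (f := f) (g := g).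
Let EI p I J K : exp_lie iota (f2_ins p I J K F). Proof. exact: exp_lie_ins. Qed.

Lemma duality_iff : duality iota F <-> dualS F.
Proof.
rewrite /duality sinvE; last exact: exp_lie_grp (EI _ _ _ _).
have EV := exp_lieV (EI 3 [:: 1] [:: 2] [:: 3])%N.
rewrite t3P // rel_univ; split=> [H S a b Ha Hb|H S th kill].
  (* Any two elements of positive filtration complete to a triple of sum zero, so duality imposes no
     relation between its arguments. *)
  have HT : tri a b (- a - b).
    have E : a + b + (- a - b) = 0 by ncring.
    split=> //; rewrite ?E ?mul0r ?mulr0 //; by apply: filB => //; apply: filN.
  have [th [kill e1 e2 e3]] := tri_kill HT; have := H _ th kill.
  rewrite chom_cinv ?chom_ins ?big_seq1 ?e1 ?e2; last by apply: exp_lie_grp; exact: EI.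
  by rewrite (kill_sym3 kill 3 2) (kill_sym3 kill 2 1) e1 e2.
rewrite chom_cinv; last by apply: exp_lie_grp; exact: EI.
rewrite !chom_ins !big_seq1 (kill_sym3 kill 3 2) (kill_sym3 kill 2 1).
by apply: H; apply: chom_fil; exact: fil_t.
Qed.

Lemma hexagon_iff nu :
  exp_eq iota (t_rel k 3) (sexp iota (nu *: t k 3 2 3) * f2_ins 3 [:: 1%N] [:: 2%N] [:: 3%N] F
      * sexp iota (nu *: t k 3 1 2) * f2_ins 3 [:: 3%N] [:: 1%N] [:: 2%N] F
      * sexp iota (nu *: t k 3 3 1) * f2_ins 3 [:: 2%N] [:: 3%N] [:: 1%N] F)
    (sexp iota (nu *: (t k 3 1 2 + t k 3 1 3 + t k 3 2 3))) <-> hexS iota nu F.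
Proof.
have L := lie_t 3; have LS : lie_series (t k 3 1 2 + t k 3 1 3 + t k 3 2 3).
  by apply: lie_seriesD => //; apply: lie_seriesD.
rewrite t3P; [|by repeat first [exact: EI | exact: exp_lie_exp | apply: exp_lieM]|exact: exp_lie_exp].
have form (S : complAlgType k) (th : chomType (series k (t_alph 3)) S) :
   (forall h, t_rel k 3 h -> th h = 0) -> 
   let a := th (t k 3 1 2) in let b := th (t k 3 2 3) in let c := th (t k 3 1 3) in
   th (sexp iota (nu *: t k 3 2 3) * f2_ins 3 [:: 1%N] [:: 2%N] [:: 3%N] F
      * sexp iota (nu *: t k 3 1 2) * f2_ins 3 [:: 3%N] [:: 1%N] [:: 2%N] F
      * sexp iota (nu *: t k 3 3 1) * f2_ins 3 [:: 2%N] [:: 3%N] [:: 1%N] F) =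
   cex iota nu b * ev2 F a b * cex iota nu a * ev2 F c a * cex iota nu c * ev2 F b c /\
   th (sexp iota (nu *: (t k 3 1 2 + t k 3 1 3 + t k 3 2 3))) = cex iota nu (a + b + c).
  move=> kill a b c; rewrite !chomM !chom_sexp ?chom_ins ?big_seq1; try exact: lie_series_fil.
  rewrite !(kill_sym3 kill 3 1) -/a -/b -/c; split=> //; congr cex.
  by rewrite !chomD -/a -/b -/c; ncring.
rewrite rel_univ; split=> [H S a b c HT|H S th kill].
  have [th [kill e1 e2 e3]] := tri_kill HT; have := H _ th kill.
  by have [-> ->] := form _ th kill; rewrite e1 e2 e3.
by have [-> ->] := form _ th kill; apply: H; exact: kill_tri.
Qed.

Lemma cyc_iff :
  exp_eq iota (t_rel k 3) (f2_ins 3 [:: 3%N] [:: 1%N] [:: 2%N] F * f2_ins 3 [:: 2%N] [:: 3%N] [:: 1%N] F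
    * f2_ins 3 [:: 1%N] [:: 2%N] [:: 3%N] F) 1 <-> cycS F.
Proof.
rewrite t3P; [|by do 2! [apply: exp_lieM => //]|exact: exp_lie1].
rewrite rel_univ; split=> [H S a b c HT|H S th kill].
  have [th [kill e1 e2 e3]] := tri_kill HT; have := H _ th kill.
  by rewrite !chomM !chom_ins !big_seq1 chom1 !(kill_sym3 kill 3 1) e1 e2 e3.
rewrite !chomM !chom_ins !big_seq1 chom1 !(kill_sym3 kill 3 1).
by apply: H; exact: kill_tri.
Qed.

Lemma sum_iff : lie_eq (t_rel k 3)
    (t k 3 1 2 + AdV (f2_ins 3 [:: 1%N] [:: 2%N] [:: 3%N] F) (t k 3 2 3)
      + AdV (f2_ins 3 [:: 2%N] [:: 1%N] [:: 3%N] F) (t k 3 1 3))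
    (t k 3 1 2 + t k 3 1 3 + t k 3 2 3) <-> sumS F.
Proof.
have L := lie_t 3.
have GI p I J K : grp (f2_ins p I J K F) by exact: exp_lie_grp (EI _ _ _ _).
rewrite /AdV !sinvE //.
rewrite (lie_eqP iota (@t_rel_lie k 3) (@t_rel_homog k 3)); first last.
- by apply: lie_seriesD => //; apply: lie_seriesD.
- by apply: lie_seriesD; [apply: lie_seriesD => //|]; exact: AdV_lie.
have form (S : complAlgType k) (th : chomType (series k (t_alph 3)) S) :
   (forall h, t_rel k 3 h -> th h = 0) -> 
   let a := th (t k 3 1 2) in let b := th (t k 3 2 3) in let c := th (t k 3 1 3) in
   th (t k 3 1 2 + cinv (f2_ins 3 [:: 1%N] [:: 2%N] [:: 3%N] F) * t k 3 2 3 * f2_ins 3 [:: 1%N] [:: 2%N] [:: 3%N] F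
      + cinv (f2_ins 3 [:: 2%N] [:: 1%N] [:: 3%N] F) * t k 3 1 3 * f2_ins 3 [:: 2%N] [:: 1%N] [:: 3%N] F) =
   a + Adg (cinv (ev2 F a b)) b + Adg (cinv (ev2 F a c)) c /\
   th (t k 3 1 2 + t k 3 1 3 + t k 3 2 3) = a + b + c.
  move=> kill a b c; have Gab := ev2_grp a b GF; have Gac := ev2_grp a c GF.
  rewrite !AdgE ?cinvK //; try exact: grpV.
  have e1 : th (f2_ins 3 [:: 1%N] [:: 2%N] [:: 3%N] F) = ev2 F a b by rewrite chom_ins !big_seq1.
  have e2 : th (f2_ins 3 [:: 2%N] [:: 1%N] [:: 3%N] F) = ev2 F a c.
    by rewrite chom_ins !big_seq1 (kill_sym3 kill 2 1).
  move: (GI 3 [:: 1%N] [:: 2%N] [:: 3%N])%N (GI 3 [:: 2%N] [:: 1%N] [:: 3%N])%N e1 e2.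
  move: (f2_ins 3 _ _ _ F) (f2_ins 3 _ _ _ F) => f1 f2 G1 G2 e1 e2.
  rewrite !chomD !chomM !(chom_cinv th) // -/a -/b -/c.
  by split; [rewrite ?e1 ?e2 | ncring].
rewrite rel_univ; split=> [H S a b c HT|H S th kill].
  have [th [kill e1 e2 e3]] := tri_kill HT; have := H _ th kill.
  by have [-> ->] := form _ th kill; rewrite e1 e2 e3.
by have [-> ->] := form _ th kill; apply: H; exact: kill_tri.
Qed.

Lemma pentagon_iff : pentagon iota F <-> pentS F.
Proof.
rewrite /pentagon t4P; [|by do 2! [apply: exp_lieM => //]|exact: exp_lieM].
have formL (S : complAlgType k) (th : chomType (series k (t_alph 4)) S) :
   th (f2_ins 4 [:: 2%N] [:: 3%N] [:: 4%N] F * f2_ins 4 [:: 1%N] [:: 2%N; 3%N] [:: 4%N] F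
    * f2_ins 4 [:: 1%N] [:: 2%N] [:: 3%N] F) = pentL F (fun i j => th (t k 4 i j)).
  by rewrite !chomM !chom_ins !big_cons !big_nil !addr0.
have formR (S : complAlgType k) (th : chomType (series k (t_alph 4)) S) :
   th (f2_ins 4 [:: 1%N] [:: 2%N] [:: 3%N; 4%N] F * f2_ins 4 [:: 1%N; 2%N] [:: 3%N] [:: 4%N] F)
   = pentR F (fun i j => th (t k 4 i j)).
  by rewrite !chomM !chom_ins !big_cons !big_nil !addr0.
rewrite rel_univ; split=> [H S T HT|H S th kill]; last first.
  by rewrite formL formR; apply: H; exact: kill_tsys.
have tf := t4_fil HT.
pose th : chomType _ S := ev (fun q : t_alph 4 => T (val q).1.+1 (val q).2.+1).
have e i j : valid4 [:: i; j] -> T i j = th (t k 4 i j).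
  by rewrite valid4_2 => /and3P[Hi Hj ij]; exact/esym/evt_t.
have := H S th (fun h => evt_kill HT (f := h)); rewrite formL formR.
by rewrite (eq_pentL F e) (eq_pentR F e).
Qed.
End TranslationT.

Lemma M_iff mu F : M_ iota mu F <->
  [/\ exp_lie iota F, dualS F, hexS iota (mu * iota (1 / 2%:R)) F & pentS F].
Proof.
split=> -[E h1 h2 h3]; split=> //.
- by apply/duality_iff.
- by apply/hexagon_iff.
- by apply/pentagon_iff.
- by apply/duality_iff.
- by apply/hexagon_iff.
- by apply/pentagon_iff.
Qed.

Lemma GRT1_iff g : GRT1 iota g <-> [/\ exp_lie iota g, dualS g, cycS g, sumS g & pentS g].
Proof.
split=> -[E h1 h2 h3 h4]; split=> //.
- by apply/duality_iff.
- by apply/cyc_iff.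
- by apply/sum_iff.
- by apply/pentagon_iff.
- by apply/duality_iff.
- by apply/cyc_iff.
- by apply/sum_iff.
- by apply/pentagon_iff.
Qed.
End Forms.

Section HexNeg.
Variables (k : comPzRingType) (iota : {rmorphism rat -> k}).

(** The inverse of the hexagon for the reversed triple (c, b, a), rewritten by duality. It supplies
    the hexagon that accompanies A_-, whose relation involves -mu. *)
Lemma hexS_neg nu F : grp F -> dualS F -> hexS iota nu F -> hexS iota (- nu) F.
Proof.
move=> GF Fd Fh S a b c HT; have [Ha Hb Hc ca cb] := HT.
have fT := tri_fil HT; have := Fh _ _ _ _ (tri_rot (tri_sym12 HT)).
have -> : c + b + a = a + b + c by ncring.
rewrite !cexN // (Fd _ c a) // (Fd _ a b) // (Fd _ b c) // ?cinvK; try exact: ev2_grp.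
have Tb : cex iota nu (a + b + c) * cex iota nu b = cex iota nu b * cex iota nu (a + b + c).
  by apply: cex_comm => //; apply/esym/cex_comm.
move: (ev2_grp a b GF) (ev2_grp c a GF) (ev2_grp b c GF) Tb.
move: (cex_grp iota nu a) (cex_grp iota nu b) (cex_grp iota nu c) (cex_grp iota nu (a + b + c)).
move: (ev2 F a b) (ev2 F c a) (ev2 F b c) (cex iota nu a) (cex iota nu b) (cex iota nu c).
move: (cex iota nu (a + b + c)) => t x y w ea eb ec Ga Gb Gc Gt Gx Gy Gw tb E.
have tV : cinv eb * cinv t = cinv t * cinv eb by rewrite -!cinvM // tb.
transitivity (cinv eb * cinv t * eb); last by rewrite tV; gw.
by rewrite -E; gw.
Qed.
End HexNeg.

(** * Translation of the elliptic relations *)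

Section Forms13.
Variables (k : comPzRingType) (iota : {rmorphism rat -> k}).
Implicit Types F g A u : series k bool.
Notation half := (iota (1 / 2%:R)).

Lemma exp_lie_curly n (f : series k (t_alph n)) : exp_lie iota f -> exp_lie iota (@curly k n f).
Proof.
move=> Ef; rewrite curlyE; apply: exp_lie_ev => // q.
by apply: (@lie_series_br k _); exact: lie_x.
Qed.
Lemma lie_curly n (f : series k (t_alph n)) : lie_series f -> lie_series (@curly k n f).
Proof.
move=> Ef; rewrite curlyE; apply: lie_series_ev => // q.
by apply: (@lie_series_br k _); exact: lie_x.
Qed.
Lemma exp_lie_e_ins n p I (f : series k (e_alph n)) : exp_lie iota f -> exp_lie iota (@e_ins k n p I f).
Proof.
move=> Ef; rewrite e_insE; apply: exp_lie_ev => // q.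
by apply: lie_series_sum => a _; exact: lie_x.
Qed.
Lemma exp_lie_t12 p I J (f : series k bool) : exp_lie iota f -> exp_lie iota (t12_ins p I J f).
Proof.
move=> Ef; rewrite t12_insE; apply: exp_lie_ev => // -[];
  by apply: lie_series_sum => a _; exact: lie_x.
Qed.
Lemma lie_t12 p I J (f : series k bool) : lie_series f -> lie_series (t12_ins p I J f).
Proof.
move=> Ef; rewrite t12_insE; apply: lie_series_ev => // -[];
  by apply: lie_series_sum => a _; exact: lie_x.
Qed.

Section Kill.
Variables (S : complAlgType k) (th : chomType (series k (e_alph 3)) S).
Hypothesis kill : forall h, e_rel k 3 h -> th h = 0.

Lemma kill_esys : esys (fun s => th (x_ k 3 s 1)) (fun s => th (x_ k 3 s 2)) (fun s => th (x_ k 3 s 3)).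
Proof.
have brE (f g : series k (e_alph 3)) : th (lie_br f g) = br (th f) (th g) by rewrite /lie_br /br chomB !chomM.
pose o0 := @Ordinal 3 0 isT; pose o1 := @Ordinal 3 1 isT; pose o2 := @Ordinal 3 2 isT.
have fx s i : fil 1 (th (x_ k 3 s i)) by apply: chom_fil; exact: fil_x.
split.
- split=> // s; have := kill (e_rel_sum k s); rewrite chom_sum !big_ord_recl big_ord0 addr0.
  by rewrite addrA.
- by move=> s; rewrite -brE; apply: kill; exact: (@e_rel_comm k 3 s o0 o1 isT).
- have := kill (@e_rel_sym k 3 o0 o1 isT); rewrite chomB !brE; exact: subr0_eq.
- by move=> s; rewrite -!brE; apply: kill; exact: (@e_rel3 k 3 s o0 o1 o2 isT).
Qed.
End Kill.

Lemma esys_kill (S : complAlgType k) (p q r : bool -> S) : esys p q r ->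
  exists th : chomType (series k (e_alph 3)) S, [/\ forall h, e_rel k 3 h -> th h = 0,
    forall s, th (x_ k 3 s 1) = p s, forall s, th (x_ k 3 s 2) = q s
    & forall s, th (x_ k 3 s 3) = r s].
Proof.
move=> H; have [fp fq fr] := esys_fil H.
pose T (s : bool) (i : nat) : S :=
  match i with 1%N => p s | 2%N => q s | 3%N => r s | _ => 0 end.
have fT s i : fil 1 (T s i) by case: i => [|[|[|[|i]]]] //=; exact: fil_zero.
have [th E] : exists th : chomType (series k (e_alph 3)) S, forall s i,
    (0 < i <= 3)%N -> th (x_ k 3 s i) = T s i.
  exists (ev (fun x : e_alph 3 => T x.1 x.2.+1)) => s i Hi.
  rewrite -(sum_e_alph T s Hi) [x_ k 3 s i]/x_ /= ev_sum; apply: eq_bigr => x _.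
  by rewrite ev_letter // => y; exact: (fT y.1 y.2.+1).
exists th; split; try by move=> s; rewrite E.
have brE (f g : series k (e_alph 3)) : th (lie_br f g) = br (th f) (th g) by rewrite /lie_br /br chomB !chomM.
have Hr := esys_rot H; have Hrr := esys_rot Hr.
have Hs := esys_swap H; have Hsr := esys_rot Hs; have Hsrr := esys_rot Hsr.
have [[_ _ H0] a1 a2 a3] := H; have [_ b1 b2 b3] := Hr; have [_ c1 c2 c3] := Hrr.
have [_ d1 d2 d3] := Hs; have [_ e1 e2 e3] := Hsr; have [_ f1 f2 f3] := Hsrr.
move=> h; case=> {h} [s|s i j ij|i j ij|s i j l u].
- by rewrite chom_sum !big_ord_recl big_ord0 addr0 !E //= addrA.
- rewrite brE !E ?ltn_ord //.
  by case: i j ij => [[|[|[|i]]] //= Hi] [[|[|[|j]]] //= Hj] _;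
    first [exact: a1 | exact: b1 | exact: c1 | exact: d1 | exact: e1 | exact: f1].
- rewrite chomB !brE !E ?ltn_ord //; apply/eqP; rewrite subr_eq0; apply/eqP.
  by case: i j ij => [[|[|[|i]]] //= Hi] [[|[|[|j]]] //= Hj] _;
    first [exact: a2 | exact: b2 | exact: c2 | exact: d2 | exact: e2 | exact: f2].
- rewrite !brE !E ?ltn_ord //.
  by case: i j l u => [[|[|[|i]]] //= Hi] [[|[|[|j]]] //= Hj] [[|[|[|l]]] //= Hl] //= _;
    first [exact: a3 | exact: b3 | exact: c3 | exact: d3 | exact: e3 | exact: f3].
Qed.

Section Values.
Variables (S : complAlgType k) (th : chomType (series k (e_alph 3)) S).
Let p s := th (x_ k 3 s 1).
Let q s := th (x_ k 3 s 2).
Let r s := th (x_ k 3 s 3).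

Lemma chom_curly : exists cu : chomType (series k (t_alph 3)) S,
  (forall f, th (curly f) = cu f) /\ (forall i j, (0 < i <= 3)%N -> (0 < j <= 3)%N -> i != j ->
    cu (t k 3 i j) = br (th (x_ k 3 true i)) (th (x_ k 3 false j))).
Proof.
pose c : chomType _ (series k (e_alph 3)) :=
  ev (fun q : t_alph 3 => br (x_ k 3 true (val q).1.+1) (x_ k 3 false (val q).2.+1)).
exists (th \o c); split=> [f|i j Hi Hj ij]; first by rewrite curlyE.
transitivity (th (br (x_ k 3 true i) (x_ k 3 false j))).
  rewrite /= -[ev _ _]/(evt (fun i j => br (x_ k 3 true i) (x_ k 3 false j)) _) evt_t //.
  by move=> i' j'; apply: filS; apply: (@br_fil _ _ 1 1); exact: fil_x.
by rewrite /br chomB !chomM.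
Qed.

Lemma chom_alpha mu F A : th (alpha iota mu F A) =
  cex iota (mu * half) (et p q + et p r) * evx A p * ev2 F (et p q) (et q r).
Proof.
have [cu [cuE cut]] := chom_curly.
rewrite /alpha !chomM !cuE chom_sexp; last by apply: filD; exact: fil_t.
rewrite chom_ins !big_seq1 chomD !cut // t12_insE !big_seq1 chom_ev2 //; exact: fil_x.
Qed.

Lemma chom_e_ins i j l : (0 < i <= 3)%N -> (0 < j <= 3)%N -> (0 < l <= 3)%N ->
  exists th' : chomType (series k (e_alph 3)) S,
  [/\ forall f, th (e_ins 3 [:: [:: i]; [:: j]; [:: l]] f) = th' f,
      forall s, th' (x_ k 3 s 1) = th (x_ k 3 s i), forall s, th' (x_ k 3 s 2) = th (x_ k 3 s j)
    & forall s, th' (x_ k 3 s 3) = th (x_ k 3 s l)].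
Proof.
move=> Hi Hj Hl.
pose c : chomType _ (series k (e_alph 3)) := ev (fun q : e_alph 3 =>
  \sum_(a <- nth [::] [:: [:: i]; [:: j]; [:: l]] q.2) x_ k 3 q.1 a).
by exists (th \o c); split=> [f|s|s|s]; [rewrite e_insE | | |]; rewrite /= ?e_ins_x ?big_seq1.
Qed.
End Values.

Section TranslationE.
Variables (F Ap Am : series k bool) (mu : k).
Hypotheses (EF : exp_lie iota F) (EAp : exp_lie iota Ap) (EAm : exp_lie iota Am).
Let GF : grp F. Proof. exact: exp_lie_grp EF. Qed.
Let eP (f g : series k (e_alph 3)) := exp_eqP (iota := iota) (@e_rel_lie k 3) (@e_rel_homog k 3) (f := f) (g := g).

Lemma alpha_iff nu A : exp_lie iota A ->
  alpha_rel iota nu F A <-> alphaS iota (nu * half) F A.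
Proof.
move=> EA; have Ea : exp_lie iota (alpha iota nu F A).
  apply: exp_lieM; last by apply/exp_lie_curly/exp_lie_ins.
  apply: exp_lieM; last exact: exp_lie_t12.
  by apply/exp_lie_curly/exp_lie_exp; apply: lie_seriesD; exact: lie_t.
rewrite /alpha_rel eP; [|by apply: exp_lieM; [apply: exp_lieM|]; exact: exp_lie_e_ins|exact: exp_lie1].
have form (S : complAlgType k) (th : chomType (series k (e_alph 3)) S) (p q r : bool -> S) :
    esys p q r -> (forall s, th (x_ k 3 s 1) = p s) -> (forall s, th (x_ k 3 s 2) = q s) ->
    (forall s, th (x_ k 3 s 3) = r s) ->
    th (e_ins 3 [:: [:: 3%N]; [:: 1%N]; [:: 2%N]] (alpha iota nu F A)
  * e_ins 3 [:: [:: 2%N]; [:: 3%N]; [:: 1%N]] (alpha iota nu F A)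
  * e_ins 3 [:: [:: 1%N]; [:: 2%N]; [:: 3%N]] (alpha iota nu F A)) =
  let a := et p q in let b := et q r in let c := et p r in let n := nu * half in
  (cex iota n (b + c) * evx A r * ev2 F c a) * (cex iota n (a + b) * evx A q * ev2 F b c) *
    (cex iota n (a + c) * evx A p * ev2 F a b).
  move=> H e1 e2 e3 /=; rewrite !chomM.
  have [t1 [-> u1 u2 u3]] := chom_e_ins th (isT : 0 < 3 <= 3)%N (isT : 0 < 1 <= 3)%N (isT : 0 < 2 <= 3)%N.
  have [t2 [-> v1 v2 v3]] := chom_e_ins th (isT : 0 < 2 <= 3)%N (isT : 0 < 3 <= 3)%N (isT : 0 < 1 <= 3)%N.
  have [t3 [-> w1 w2 w3]] := chom_e_ins th (isT : 0 < 1 <= 3)%N (isT : 0 < 2 <= 3)%N (isT : 0 < 3 <= 3)%N.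
  rewrite !chom_alpha /et /evx !u1 !u2 !u3 !v1 !v2 !v3 !w1 !w2 !w3 !e1 !e2 !e3.
  rewrite -/(et p q) -/(et q r) -/(et p r) -/(et r p) -/(et r q) -/(et q p).
  rewrite -(et_sym'' H) -(et_sym' H) -(et_sym H).
  by rewrite [et p r + et q r]addrC [et q r + et p q]addrC.
rewrite rel_univ; split=> [H S p q r Hs|H S th kill].
  have [th [kill e1 e2 e3]] := esys_kill Hs; have := H _ th kill.
  by rewrite (form _ _ _ _ _ Hs e1 e2 e3) chom1.
have Hs := kill_esys kill.
by rewrite (form _ th _ _ _ Hs) // chom1; exact: (H _ _ _ _ Hs).
Qed.

Lemma comm_iff : comm_rel iota mu F Ap Am <-> commS iota (mu * half) F Ap Am.
Proof.
have half2 : mu * half + mu * half = mu.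
  by rewrite -mulrDr -rmorphD (_ : 1 / 2%:R + 1 / 2%:R = 1 :> rat) ?rmorph1 ?mulr1 //; apply/eqP.
have Ei I J K : exp_lie iota (f2_ins 3 I J K F) by exact: exp_lie_ins.
have Ec I J K : exp_lie iota (curly (f2_ins 3 I J K F)) by apply: exp_lie_curly.
have Et i j c : exp_lie iota (sexp iota (c *: t k 3 i j)) by apply: exp_lie_exp; exact: lie_t.
have Gi I J K := exp_lie_grp (Ei I J K); have Gc I J K := exp_lie_grp (Ec I J K).
have EtP I J := exp_lie_t12 3 I J EAp; have EtM I J := exp_lie_t12 3 I J EAm.
have GtP I J := exp_lie_grp (EtP I J).
rewrite /comm_rel /gcomm !(sinvE (Gc _ _ _)) !(sinvE (Gi _ _ _)) !(sinvE (GtP _ _)).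
have Ex : exp_lie iota (cinv (curly (f2_ins 3 [:: 1%N] [:: 2%N] [:: 3%N] F)) *
    t12_ins 3 [:: 1%N] [:: 2%N; 3%N] Am * curly (f2_ins 3 [:: 1%N] [:: 2%N] [:: 3%N] F)).
  by apply: exp_lieM => //; apply: exp_lieM => //; exact: exp_lieV.
have Ey : exp_lie iota (curly (sexp iota ((- (mu * half)) *: t k 3 1 2) * cinv (f2_ins 3 [:: 2%N] [:: 1%N] [:: 3%N] F)) *
    cinv (t12_ins 3 [:: 2%N] [:: 1%N; 3%N] Ap) *
    curly (f2_ins 3 [:: 2%N] [:: 1%N] [:: 3%N] F * sexp iota ((- (mu * half)) *: t k 3 1 2))).
  apply: exp_lieM; [apply: exp_lieM; [|exact: exp_lieV]|]; apply: exp_lie_curly;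
    by apply: exp_lieM => //; exact: exp_lieV.
set x := cinv (curly _) * _ * _ in Ex *; set y := curly _ * _ * _ in Ey *.
have Gx := exp_lie_grp Ex; have Gy := exp_lie_grp Ey.
rewrite !(sinvE Gx) !(sinvE Gy).
rewrite eP; first last.
- by repeat first [exact: Ex | exact: Ey | apply: exp_lieV | apply: exp_lieM].
- exact: exp_lie_curly.
have form (S : complAlgType k) (th : chomType (series k (e_alph 3)) S) (p q r : bool -> S) :
    esys p q r -> (forall s, th (x_ k 3 s 1) = p s) -> (forall s, th (x_ k 3 s 2) = q s) ->
    (forall s, th (x_ k 3 s 3) = r s) -> let a := et p q in let b := et q r in let c := et p r in
    let e := cex iota (mu * half) in
    [/\ th (curly (sexp iota (mu *: t k 3 1 2))) = e a * e a,
        th x = cinv (ev2 F a b) * evx Am p * ev2 F a b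
      & th y = cinv (e a) * cinv (ev2 F a c) * cinv (evx Ap q) * (ev2 F a c * cinv (e a))].
  move=> H e1 e2 e3 a b c e; have [cu [cuE cut]] := chom_curly th.
  have fa : fil 1 a by have [] := et_tri H.
  have c1 : cu (f2_ins 3 [:: 1%N] [:: 2%N] [:: 3%N] F) = ev2 F a b.
    by rewrite chom_ins !big_seq1 !cut // !e1 !e2 !e3.
  have c2 : cu (f2_ins 3 [:: 2%N] [:: 1%N] [:: 3%N] F) = ev2 F a c.
    by rewrite chom_ins !big_seq1 !cut // !e1 !e2 !e3 /a (et_sym H).
  have c3 n : cu (sexp iota (n *: t k 3 1 2)) = cex iota n a.
    by rewrite chom_sexp ?cut ?e1 ?e2 //; exact: fil_t.
  have c4 : th (t12_ins 3 [:: 1%N] [:: 2%N; 3%N] Am) = evx Am p.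
    by rewrite t12_insE !big_seq1 (chom_ev2 th) ?e1 //; exact: fil_x.
  have c5 : th (t12_ins 3 [:: 2%N] [:: 1%N; 3%N] Ap) = evx Ap q.
    by rewrite t12_insE !big_seq1 (chom_ev2 th) ?e2 //; exact: fil_x.
  have d1 : th (curly (f2_ins 3 [:: 1%N] [:: 2%N] [:: 3%N] F)) = ev2 F a b by rewrite cuE.
  have d2 : th (curly (sexp iota ((- (mu * half)) *: t k 3 1 2) * cinv (f2_ins 3 [:: 2%N] [:: 1%N] [:: 3%N] F)))
    = cinv (e a) * cinv (ev2 F a c).
    by rewrite cuE (chomM cu) c3 (chom_cinv cu) // c2 cexN.
  have d3 : th (curly (f2_ins 3 [:: 2%N] [:: 1%N] [:: 3%N] F * sexp iota ((- (mu * half)) *: t k 3 1 2)))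
    = ev2 F a c * cinv (e a).
    by rewrite cuE (chomM cu) c3 c2 cexN.
  split; first by rewrite cuE c3 -cexDl // half2.
    rewrite /x; move: (Gc [:: 1%N] [:: 2%N] [:: 3%N])%N c4 d1.
    move: (curly _) (t12_ins _ _ _ _) => f g Gf c4 d1.
    by rewrite !chomM (chom_cinv th) // c4 d1.
  rewrite /y; move: (GtP [:: 2%N] [:: 1%N; 3%N])%N c5 d2 d3.
  move: (t12_ins _ _ _ _) (curly _) (curly _) => f g h Gf c5 d2 d3.
  by rewrite !chomM (chom_cinv th) // c5 ?d2 ?d3.
have gcE (S : complAlgType k) (th : chomType (series k (e_alph 3)) S) :
   th (x * y * cinv x * cinv y) = gcm (th x) (th y).
  by move: x y {Ex Ey form} Gx Gy => x y Gx Gy; rewrite /gcm !chomM !(chom_cinv th).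
rewrite rel_univ; split=> [H S p q r Hs|H S th kill].
  have [th [kill e1 e2 e3]] := esys_kill Hs; have := H _ th kill; rewrite gcE.
  by have [-> -> ->] := form _ _ _ _ _ Hs e1 e2 e3.
have Hs := kill_esys kill; rewrite gcE.
have [//|//|//|-> -> ->] := form _ th _ _ _ Hs; exact: (H _ _ _ _ Hs).
Qed.
End TranslationE.

Section TranslationU.
Variables (g up um : series k bool).
Hypotheses (Eg : exp_lie iota g) (Lp : lie_series up) (Lm : lie_series um).
Let Gg : grp g. Proof. exact: exp_lie_grp Eg. Qed.
Let u s := if s then up else um.
Let lP (f h : series k (e_alph 3)) := lie_eqP iota (@e_rel_lie k 3) (@e_rel_homog k 3) (f := f) (g := h).

Lemma lie_u1 v : lie_series v -> lie_series (u1_23 g v).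
Proof.
move=> Lv; have E := exp_lie_curly (exp_lie_ins 3 [:: 1%N] [:: 2%N] [:: 3%N] Eg)%N.
rewrite /u1_23 /AdV sinvE; last exact: exp_lie_grp E.
exact: AdV_lie E (lie_t12 3 [:: 1%N] [:: 2%N; 3%N] Lv).
Qed.
Lemma lie_u2 v : lie_series v -> lie_series (u2_13 g v).
Proof.
move=> Lv; have E := exp_lie_curly (exp_lie_ins 3 [:: 2%N] [:: 1%N] [:: 3%N] Eg)%N.
rewrite /u2_13 /AdV sinvE; last exact: exp_lie_grp E.
exact: AdV_lie E (lie_t12 3 [:: 2%N] [:: 1%N; 3%N] Lv).
Qed.

Lemma chom_u (S : complAlgType k) (th : chomType (series k (e_alph 3)) S) (p q r : bool -> S) :
    esys p q r -> (forall s, th (x_ k 3 s 1) = p s) -> (forall s, th (x_ k 3 s 2) = q s) ->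
    (forall s, th (x_ k 3 s 3) = r s) -> forall s,
  [/\ th (u1_23 g (u s)) = uy1 g u p q r s, th (u2_13 g (u s)) = uy2 g u p q r s,
      th (u3_12 (u s)) = uy3 u r s & th (curly (t k 3 1 2)) = et p q].
Proof.
move=> H e1 e2 e3 s; have [cu [cuE cut]] := chom_curly th.
have E1 := exp_lie_curly (exp_lie_ins 3 [:: 1%N] [:: 2%N] [:: 3%N] Eg)%N.
have E2 := exp_lie_curly (exp_lie_ins 3 [:: 2%N] [:: 1%N] [:: 3%N] Eg)%N.
have c1 : th (curly (f2_ins 3 [:: 1%N] [:: 2%N] [:: 3%N] g)) = ev2 g (et p q) (et q r).
  by rewrite cuE chom_ins !big_seq1 !cut // !e1 !e2 !e3.
have c2 : th (curly (f2_ins 3 [:: 2%N] [:: 1%N] [:: 3%N] g)) = ev2 g (et p q) (et p r).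
  by rewrite cuE chom_ins !big_seq1 !cut // !e1 !e2 !e3 (et_sym H).
have d I x : th (t12_ins 3 [:: I] x (u s)) = ev2 (u s) (th (x_ k 3 true I)) (th (x_ k 3 false I)).
  by rewrite t12_insE !big_seq1 (chom_ev2 th) //; exact: fil_x.
split.
- rewrite /u1_23 /AdV sinvE; last exact: exp_lie_grp E1.
  rewrite /uy1 AdgE; last by apply/grpV/ev2_grp.
  rewrite cinvK; last exact: ev2_grp.
  move: (exp_lie_grp E1) c1 (d 1%N [:: 2%N; 3%N]); move: (curly _) (t12_ins _ _ _ _) => f h Gf c3 d1.
  by rewrite !chomM (chom_cinv th) // c3 d1 !e1.
- rewrite /u2_13 /AdV sinvE; last exact: exp_lie_grp E2.
  rewrite /uy2 AdgE; last by apply/grpV/ev2_grp.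
  rewrite cinvK; last exact: ev2_grp.
  move: (exp_lie_grp E2) c2 (d 2%N [:: 1%N; 3%N]); move: (curly _) (t12_ins _ _ _ _) => f h Gf c3 d1.
  by rewrite !chomM (chom_cinv th) // c3 d1 !e2.
- by rewrite /u3_12 d !e3.
- by rewrite cuE cut // e1 e2.
Qed.

Lemma u_iff : [/\ u_rel g up, u_rel g um &
    lie_eq (e_rel k 3) (lie_br (u1_23 g up) (u2_13 g um)) (curly (t k 3 1 2))] <-> uS g u.
Proof.
have Lu s : lie_series (u s) by case: (s).
have L1 s := lie_u1 (Lu s); have L2 s := lie_u2 (Lu s); have L3 s : lie_series (u3_12 (u s)).
  exact: lie_t12.
have brE (S : complAlgType k) (th : chomType (series k (e_alph 3)) S) f h :
    th (lie_br f h) = br (th f) (th h) by rewrite /lie_br /br chomB !chomM.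
have sumP s : lie_eq (e_rel k 3) (u1_23 g (u s) + u2_13 g (u s) + u3_12 (u s)) 0 <->
    forall (S : complAlgType k) (p q r : bool -> S), esys p q r ->
      uy1 g u p q r s + uy2 g u p q r s + uy3 u r s = 0.
  rewrite lP; [|by apply: lie_seriesD => //; apply: lie_seriesD|exact: lie_series0].
  rewrite rel_univ; split=> [H S p q r Hs|H S th kill].
    have [th [kill e1 e2 e3]] := esys_kill Hs; have := H _ th kill; rewrite !chomD chom0.
    by have [-> -> -> _] := chom_u Hs e1 e2 e3 s.
  have Hs := kill_esys kill; rewrite !chomD chom0.
  by have [//|//|//|-> -> -> _] := chom_u (th := th) Hs _ _ _ s; exact: H.
have brP s : lie_eq (e_rel k 3) (lie_br (u1_23 g (u s)) (u3_12 (u s))) 0 <->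
    forall (S : complAlgType k) (p q r : bool -> S), esys p q r ->
      br (uy1 g u p q r s) (uy3 u r s) = 0.
  rewrite lP; [|exact: lie_series_br|exact: lie_series0].
  rewrite rel_univ; split=> [H S p q r Hs|H S th kill].
    have [th [kill e1 e2 e3]] := esys_kill Hs; have := H _ th kill; rewrite brE chom0.
    by have [-> _ -> _] := chom_u Hs e1 e2 e3 s.
  have Hs := kill_esys kill; rewrite brE chom0.
  by have [//|//|//|-> _ -> _] := chom_u (th := th) Hs _ _ _ s; exact: H.
have tP : lie_eq (e_rel k 3) (lie_br (u1_23 g up) (u2_13 g um)) (curly (t k 3 1 2)) <->
    forall (S : complAlgType k) (p q r : bool -> S), esys p q r ->
      br (uy1 g u p q r true) (uy2 g u p q r false) = et p q.
  rewrite -[up]/(u true) -[um]/(u false) lP; [|exact: lie_series_br|apply: lie_curly; exact: lie_t].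
  rewrite rel_univ; split=> [H S p q r Hs|H S th kill].
    have [th [kill e1 e2 e3]] := esys_kill Hs; have := H _ th kill; rewrite brE.
    have [-> _ _ ->] := chom_u Hs e1 e2 e3 true.
    by have [_ -> _ _] := chom_u Hs e1 e2 e3 false.
  have Hs := kill_esys kill; rewrite brE.
  have [//|//|//|-> _ _ ->] := chom_u (th := th) Hs _ _ _ true.
  by have [//|//|//|_ -> _ _] := chom_u (th := th) Hs _ _ _ false; exact: H.
split=> [[[s1 b1] [s2 b2] t1] S p q r Hs|H].
  split; last exact: (iffLR tP t1 _ _ _ _ Hs).
    by case; [exact: (iffLR (sumP true) s1 _ _ _ _ Hs) | exact: (iffLR (sumP false) s2 _ _ _ _ Hs)].
  by case; [exact: (iffLR (brP true) b1 _ _ _ _ Hs) | exact: (iffLR (brP false) b2 _ _ _ _ Hs)].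
have h1 s (S : complAlgType k) (p q r : bool -> S) (Hs : esys p q r) : uy1 g u p q r s + uy2 g u p q r s + uy3 u r s = 0 by have [] := H S p q r Hs.
have h2 s (S : complAlgType k) (p q r : bool -> S) (Hs : esys p q r) : br (uy1 g u p q r s) (uy3 u r s) = 0 by have [] := H S p q r Hs.
split; last by apply/tP => S p q r Hs; have [] := H S p q r Hs.
  by split; [apply/(sumP true) => S p q r; exact: h1 | apply/(brP true) => S p q r; exact: h2].
by split; [apply/(sumP false) => S p q r; exact: h1 | apply/(brP false) => S p q r; exact: h2].
Qed.
End TranslationU.

Definition Asg (Ap Am : series k bool) (s : bool) := if s then Ap else Am.

Lemma Ell_iff e : Ell_ iota e <->
  [/\ exp_lie iota (ell_Phi e), forall s, exp_lie iota (Asg (ell_Ap e) (ell_Am e) s),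
      pentS (ell_Phi e)
    & ellS iota (ell_mu e * half) (ell_Phi e) (Asg (ell_Ap e) (ell_Am e))].
Proof.
case: e => mu F Ap Am; rewrite /Ell_ /=; split.
  move=> [/M_iff[EF Fd Fh Fp] [EAp EAm] a1 a2 cm]; have GF := exp_lie_grp EF.
  split=> //; first by case.
  split=> //.
  - by split=> // -[] /=; apply: exp_lie_grp; eassumption.
  - by case=> //=; exact: hexS_neg.
  - by case=> /=; [exact: (iffLR (alpha_iff EF _ EAp) a1) | rewrite -mulNr; exact: (iffLR (alpha_iff EF _ EAm) a2)].
  - exact/comm_iff.
move=> [EF EA Fp [[GF GA] Fd Fh Fa Fc]]; have EAp := EA true; have EAm := EA false.
split=> //.
- by apply/M_iff; split=> //; exact: (Fh true).
- by apply/alpha_iff => //; exact: (Fa true).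
- by apply/alpha_iff => //; rewrite mulNr; exact: (Fa false).
- by apply/comm_iff.
Qed.

Lemma GRT1ell_iff g up um : GRT1ell iota (Grt1Data g up um) <->
  [/\ [/\ exp_lie iota g, dualS g, cycS g, sumS g & pentS g],
      forall s, lie_series (Asg up um s) & uS g (Asg up um)].
Proof.
rewrite /GRT1ell; split.
  move=> [/GRT1_iff[Eg d c s p] [Lp Lm] r1 r2 r3]; split=> //; first by case.
  by apply/(u_iff Eg Lp Lm).
move=> [[Eg d c s p] L U]; have Lp := L true; have Lm := L false.
have /(u_iff Eg Lp Lm)[r1 r2 r3] := U.
by split=> //; apply/GRT1_iff.
Qed.
End Forms13.

(** * The action *)

Section Actions.
Variables (k : comPzRingType) (iota : {rmorphism rat -> k}).
Implicit Types (F g : series k bool) (c : k).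
Notation half := (iota (1 / 2%:R)).

Let fA : fil 1 (lA k). Proof. exact: fil_letter. Qed.
Let fB : fil 1 (lB k). Proof. exact: fil_letter. Qed.

Lemma ev2_id F : ev2 F (lA k) (lB k) = F.
Proof. by rewrite -[RHS]ev_id; apply: eq_ev => -[]. Qed.

Lemma AdE g (x : series k bool) : grp g -> Ad g x = Adg g x.
Proof. by move=> Gg; rewrite AdgE // /Ad sinvE. Qed.

Lemma subst2_twist F g : grp g -> subst2 F (Ad g (lA k)) (lB k) * g = twist F g.
Proof. by move=> Gg; rewrite AdE // subst2E //; exact: Adg_fil. Qed.

Lemma twist_twist F g h : grp g -> grp h -> twist (twist F g) h = twist F (twist g h).
Proof.
move=> Gg Gh; have fh : fil 1 (Adg h (lA k)) by exact: Adg_fil.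
have fg : fil 1 (Adg g (lA k)) by exact: Adg_fil.
have GE := ev2_grp (Adg h (lA k)) (lB k) Gg.
rewrite /twist ev2M ev2_ev2 // -!mulrA; congr (ev2 F _ _ * _); last by rewrite ev2_B.
rewrite Adg_mul //; pose th : chomType (series k bool) _ :=
  ev (fun l : bool => if l then lB k else Adg h (lA k)).
by rewrite -[ev2 (Adg g _) _ _]/(th _) (chom_Adg th) //= -/(ev2 _ _ _) -/(ev2 _ _ _) ev2_A.
Qed.

Lemma twist1 F : twist F 1 = F.
Proof. by rewrite /twist Adg1 mulr1 ev2_id. Qed.

Lemma ellS_twist nu F A g u : ellS iota nu F A -> grp g -> dualS g -> cycS g -> sumS g ->
  (forall s, fil 1 (u s)) -> uS g u ->
  ellS iota nu (twist F g) (fun s => ev2 (A s) (u true) (u false)).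
Proof.
move=> [[GF GA] Fd Fh Fal FC] Gg gd gc gs fu gu; split.
- by split=> [|s]; [exact: grp_twist | exact: ev2_grp].
- exact: twist_dual.
- by move=> s; apply: twist_hex.
- by move=> s; apply: alpha_twist.
- by apply: comm_twist.
Qed.

Lemma exp_lie_twist F g : exp_lie iota F -> exp_lie iota g -> exp_lie iota (twist F g).
Proof.
move=> EF Eg; apply: exp_lieM => //; apply: exp_lie_ev => // -[]; first exact: lie_series_letter.
rewrite AdgE; last exact: exp_lie_grp Eg.
by apply: (Ad_lie Eg); exact: lie_series_letter.
Qed.

(** Conditions under which [subst2] and [Ad] in the action agree with evaluations and [twist]. *)
Definition good (s : grt1_data k) :=
  [/\ grp (grt_g s), fil 1 (grt_up s) & fil 1 (grt_um s)].

Lemma GRT1ell_good s : GRT1ell iota s -> good s.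
Proof.
case: s => g up um /GRT1ell_iff[[Eg _ _ _ _] L _].
by split; [exact: exp_lie_grp Eg | exact: lie_series_fil (L true) | exact: lie_series_fil (L false)].
Qed.

Lemma act1E e s : good s -> act1 e s = EllData (ell_mu e) (twist (ell_Phi e) (grt_g s))
  (ev2 (ell_Ap e) (grt_up s) (grt_um s)) (ev2 (ell_Am e) (grt_up s) (grt_um s)).
Proof. by move=> [Gg fp fm]; rewrite /act1 subst2_twist // !subst2E. Qed.

Lemma act1_Ell e s : Ell_ iota e -> GRT1ell iota s -> Ell_ iota (act1 e s).
Proof.
move=> /Ell_iff[EF EA Fp HF] Hs; rewrite act1E; last exact: GRT1ell_good.
case: s Hs => g up um /GRT1ell_iff[[Eg gd gc gs gp] L gu]; have Gg := exp_lie_grp Eg.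
have fu s : fil 1 (Asg up um s) by apply: lie_series_fil.
have [[GF GA] _ _ _ _] := HF.
apply/Ell_iff; split=> /=; first exact: exp_lie_twist.
- by case; apply: exp_lie_ev; try (by case; [exact: (L false) | exact: (L true)]);
    [exact: (EA true) | exact: (EA false)].
- exact: twist_pent.
- have := ellS_twist HF Gg gd gc gs fu gu; congr ellS.
  by apply/funext => -[].
Qed.

(** * Scaling by units *)

Section Scale.
Variables (c : k) (S : complAlgType k).
(** A unit scales the y_i only, hence every t_ij by the same factor; this matches its action on both
    arguments of [Phi] and on [mu]. *)
Definition scB (p : bool -> S) (s : bool) := if s then p true else cst c * p false.
Let brc1 (x y : S) : br x (cst c * y) = cst c * br x y.
Proof. by rewrite -[x in LHS]mul1r -cst1 brc mul1r. Qed.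
Let brc2 (x y : S) : br (cst c * x) y = cst c * br x y.
Proof. by rewrite -[y in LHS]mul1r -cst1 brc mulr1. Qed.
Lemma et_scB (p q : bool -> S) : et (scB p) (scB q) = cst c * et p q. Proof. exact: brc1. Qed.
Lemma esys_scB (p q r : bool -> S) : esys p q r -> esys (scB p) (scB q) (scB r).
Proof.
move=> [[fp fq h0] h1 h2 h3]; split.
- split=> -[] /=; rewrite ?fp ?fq ?h0 //; try (by apply: filcst).
  by rewrite -!mulrDr h0 mulr0.
- by case; rewrite /= ?h1 // brc1 brc2 h1 !mulr0.
- by rewrite /= !brc1 h2.
- by case; rewrite /= !brc1 ?brc2 !h3 !mulr0.
Qed.
Lemma tri_scale (a b d : S) : tri a b d -> tri (cst c * a) (cst c * b) (cst c * d).
Proof.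
move=> [Ha Hb Hd ca cb]; split; try exact: filcst.
  by rewrite -!mulrDr; apply: cst_commr; apply/esym/cst_commr.
by rewrite -!mulrDr; apply: cst_commr; apply/esym/cst_commr.
Qed.
Lemma tsys4_scale (T : nat -> nat -> S) : tsys4 T -> tsys4 (fun i j => cst c * T i j).
Proof.
move=> [fT sT r3 r4]; split=> [i j|i j|i j l v|i j l m v]; first exact: filcst.
- by rewrite sT.
- by rewrite -mulrDr; apply: cst_commr; apply/esym/cst_commr; rewrite r3.
- by apply: cst_commr; apply/esym/cst_commr/esym/r4.
Qed.
End Scale.

Lemma cex_scale (S : complAlgType k) c nu (x : S) : cex iota (c * nu) x = cex iota nu (cst c * x).
Proof. by rewrite /cex mulrA -cstM mulrC. Qed.

Definition scF c F := ev2 F (c *: lA k) (c *: lB k).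
Definition scA c F := ev2 F (lA k) (c *: lB k).

Lemma ev2_scF (S : complAlgType k) c F (a b : S) : fil 1 a -> fil 1 b ->
  ev2 (scF c F) a b = ev2 F (cst c * a) (cst c * b).
Proof.
move=> Ha Hb; rewrite /scF ev2_ev2; [|exact: sfilZ|exact: sfilZ].
by rewrite /ev2 !evZ -!/(ev2 _ _ _) ev2_A ?ev2_B.
Qed.
Lemma ev2_scA (S : complAlgType k) c F (a b : S) : fil 1 a -> fil 1 b ->
  ev2 (scA c F) a b = ev2 F a (cst c * b).
Proof.
move=> Ha Hb; rewrite /scA ev2_ev2 //; last exact: sfilZ.
by rewrite [ev2 (_ *: _) _ _]evZ -/(ev2 _ _ _) ev2_A ?ev2_B.
Qed.

Lemma ellS_scale c nu F A : ellS iota nu F A ->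
  ellS iota (c * nu) (scF c F) (fun s => scA c (A s)).
Proof.
move=> [[GF GA] Fd Fh Fal FC].
have sgE s : sg s (c * nu) = c * sg s nu by case: s => //=; rewrite mulrN.
have evxE s (S : complAlgType k) (p : bool -> S) : (forall s, fil 1 (p s)) ->
    evx (scA c (A s)) p = evx (A s) (scB c p) by move=> fp; exact: ev2_scA.
split.
- by split=> [|s]; exact: ev2_grp.
- by move=> S a b Ha Hb; rewrite !ev2_scF //; apply: Fd; exact: filcst.
- move=> s S a b d HT; have [Ha Hb Hd _ _] := HT.
  by rewrite sgE !cex_scale !ev2_scF // !mulrDr; exact: (Fh s _ _ _ _ (tri_scale c HT)).
- move=> s S p q r H a b d; have [fp fq fr] := esys_fil H; have [Ha Hb Hd _ _] := et_tri H.
  rewrite sgE !cex_scale !ev2_scF // !evxE //.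
  by have := Fal s _ _ _ _ (esys_scB c H); lazy zeta; rewrite !et_scB -!mulrDr.
- move=> S p q r H a b d; have [fp fq fr] := esys_fil H; have [Ha Hb Hd _ _] := et_tri H.
  rewrite !cex_scale !ev2_scF // (evxE true) // (evxE false) //.
  by have := FC _ _ _ _ (esys_scB c H); lazy zeta; rewrite !et_scB.
Qed.

Lemma pentS_scale c F : pentS F -> pentS (scF c F).
Proof.
move=> Fp S T HT; have := Fp _ _ (tsys4_scale c HT); have fT := t4_fil HT.
have fD i j i' j' : fil 1 (T i j + T i' j') by apply: filD.
by rewrite /pentL /pentR !ev2_scF // !mulrDr.
Qed.

Lemma act_unitE (e : ell_data k) (c : kunits k) : act_unit e c = EllData (uval c * ell_mu e)
  (scF (uval c) (ell_Phi e)) (scA (uval c) (ell_Ap e)) (scA (uval c) (ell_Am e)).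
Proof. by rewrite /act_unit !subst2E //; exact: sfilZ. Qed.

Lemma act_unit_Ell e (c : kunits k) : Ell_ iota e -> Ell_ iota (act_unit e c).
Proof.
have lA' := lie_series_letter k (false : bool); have lB' := lie_series_letter k (true : bool).
move=> /Ell_iff[EF EA Fp HF]; rewrite act_unitE; apply/Ell_iff; split=> /=.
- by apply: exp_lie_ev => // -[]; apply: lie_seriesZ.
- case; apply: exp_lie_ev; try (by case=> //; apply: lie_seriesZ);
    [exact: (EA true) | exact: (EA false)].
- exact: pentS_scale.
- have := ellS_scale (uval c) HF; rewrite mulrA; congr ellS.
  by apply/funext => -[].
Qed.

Lemma uvalK (c : kunits k) : uval c * uinv c = 1. Proof. exact: (eqP (valP c)). Qed.

Lemma Ell_act e (s : grt_data k) : Ell iota e -> GRTell iota s -> Ell iota (ell_act e s).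
Proof.
move=> [He [m mm]] Hs; split; first by apply: act_unit_Ell; exact: act1_Ell.
exists (uinv s.2 * m) => /=; rewrite mulrACA uvalK mul1r; exact: mm.
Qed.

Lemma kunits_eq (c d : kunits k) : uval c = uval d -> c = d.
Proof.
move=> E; apply: val_inj; have := uvalK c; have := uvalK d.
move: E; rewrite /uval /uinv; case: (val c) (val d) => a a' [b b'] /= -> h1 h2.
by congr (_, _); rewrite -[a']mul1r -h1 mulrAC h2 mul1r.
Qed.

Lemma act_unit1 e (c : kunits k) : uval c = 1 -> act_unit e c = e.
Proof.
by case: e => mu F Ap Am c1; rewrite act_unitE c1 /scF /scA !scale1r !ev2_id mul1r.
Qed.

Lemma ell_act1 (e : ell_data k) : ell_act e (GRTell_one k) = e.
Proof.
rewrite /ell_act act_unit1 // act1E; last by split; [exact: grp1 | exact: fA | exact: fB].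
by case: e => mu F Ap Am /=; rewrite twist1 !ev2_id.
Qed.

Lemma act1_act1 e s t : good s -> good t -> act1 (act1 e s) t = act1 e (GRT1ell_mul s t).
Proof.
move=> gs gt; have [Gg fp fm] := gs; have [Gh fp' fm'] := gt.
have good_mul : good (GRT1ell_mul s t).
  split=> /=; first by rewrite /GRT1_mul subst2_twist //; exact: grp_twist.
    by rewrite subst2E //; exact: ev2_fil.
  by rewrite subst2E //; exact: ev2_fil.
rewrite !act1E //=; congr EllData.
- by rewrite /GRT1_mul subst2_twist // twist_twist.
- by rewrite ev2_ev2 // !subst2E.
- by rewrite ev2_ev2 // !subst2E.
Qed.

Lemma act_unit_mul (e : ell_data k) (c d : kunits k) : act_unit (act_unit e c) d = act_unit e (kunits_mul c d).
Proof.
rewrite !act_unitE /= /uval /=; set x := (val c).1; set y := (val d).1.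
have fZ z (w : series k bool) : fil 1 w -> fil 1 (z *: w) by exact: sfilZ.
have sF F : scF y (scF x F) = scF (x * y) F.
  rewrite {1}/scF ev2_scF; [|exact: fZ|exact: fZ].
  by rewrite !scale_cst !mulrA -!cstM -!scale_cst.
have sA F : scA y (scA x F) = scA (x * y) F.
  rewrite {1}/scA ev2_scA //; last exact: fZ.
  by rewrite !scale_cst !mulrA -!cstM -!scale_cst.
by rewrite sF !sA mulrCA mulrA.
Qed.

(** The commutation rule behind the semidirect product: the inverse scalings in [unit_act] cancel
    those of [act_unit], and the extra factor on u_- matches the scaling of y_1 in A_+ and A_-. *)
Lemma act1_act_unit (e : ell_data k) (c : kunits k) s : good s ->
  act1 (act_unit e c) s = act_unit (act1 e (unit_act c s)) c.
Proof.
case: s => g up um; move=> gs; have [/= Gg fp fm] := gs.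
have fZ z (w : series k bool) : fil 1 w -> fil 1 (z *: w) by exact: sfilZ.
have cc : cst (uval c) * cst (uinv c) = 1 :> series k bool by rewrite -cstM uvalK cst1.
have cc' : cst (uinv c) * cst (uval c) = 1 :> series k bool by rewrite -cstM mulrC uvalK cst1.
have fcA z (w : series k bool) : fil 1 w -> fil 1 (cst z * w) by exact: filcst.
have gu : good (unit_act c (Grt1Data g up um)).
  split=> /=; rewrite subst2E ?(fZ _ (lA k)) ?(fZ _ (lB k)) //; try exact: fZ.
  - exact: ev2_grp.
  - exact: ev2_fil.
  - by apply: fZ; exact: ev2_fil.
rewrite !(act1E, act_unitE) //=.
have E1 : subst2 g (uinv c *: lA k) (uinv c *: lB k) = scF (uinv c) g by rewrite subst2E //; exact: fZ.
have E2 (v : series k bool) : subst2 v (lA k) (uinv c *: lB k) = scA (uinv c) v by rewrite subst2E //; exact: fZ.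
rewrite E1 !E2.
have K1 : ev2 (scF (uinv c) g) (uval c *: lA k) (uval c *: lB k) = g.
  by rewrite ev2_scF ?scale_cst ?mulrA ?cc' ?mul1r ?ev2_id //; exact: fcA.
have K2 v : ev2 (scA (uinv c) v) (lA k) (uval c *: lB k) = v.
  by rewrite ev2_scA ?scale_cst ?mulrA ?cc' ?mul1r ?ev2_id //; exact: fcA.
have K3 v : ev2 (uval c *: scA (uinv c) v) (lA k) (uval c *: lB k) = cst (uval c) * v.
  by rewrite scale_cst ev2M K2; congr (_ * _); exact: (chom_cst (ev _)).
have K4 v : scA (uval c) (ev2 v (scA (uinv c) up) (uval c *: scA (uinv c) um)) =
    ev2 v up (cst (uval c) * um).
  by rewrite [LHS]ev2_ev2 ?K2 ?K3 //; [exact: ev2_fil | apply: fZ; exact: ev2_fil].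
congr EllData.
- rewrite /twist {2}/scF ev2M K1; congr (_ * _).
  rewrite ev2_scF //; last exact: Adg_fil.
  transitivity (ev2 (ell_Phi e) (ev2 (Adg (scF (uinv c) g) (lA k)) (uval c *: lA k) (uval c *: lB k))
    (ev2 (lB k) (uval c *: lA k) (uval c *: lB k))); last first.
    by rewrite ev2_ev2 //; first [exact: Adg_fil | exact: fZ].
  rewrite ev2_B; [|exact: fZ|exact: fZ].
  rewrite -!scale_cst; congr (ev2 _ _ _).
  pose th : chomType (series k bool) _ :=
    ev (fun l : bool => if l then uval c *: lB k else uval c *: lA k).
  rewrite -[RHS]/(th _) (chom_Adg th) //=; last exact: ev2_grp.
  rewrite -/(ev2 _ _ _) -/(ev2 _ _ _) K1 ev2_A; [|exact: fZ|exact: fZ].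
  by rewrite !scale_cst (chomM (Adg g)) (chom_cst (Adg g)).
- by rewrite ev2_scA // K4.
- by rewrite ev2_scA // K4.
Qed.

Lemma good_unit_act (c : kunits k) s : good s -> good (unit_act c s).
Proof.
case: s => g up um [/= Gg fp fm].
have fZ z (w : series k bool) : fil 1 w -> fil 1 (z *: w) by exact: sfilZ.
split=> /=; rewrite subst2E; try exact: fZ; try exact: fA.
- exact: ev2_grp.
- exact: ev2_fil.
- by apply: fZ; exact: ev2_fil.
Qed.

Lemma ell_act_mul (e : ell_data k) (s t : grt_data k) : good s.1 -> good t.1 ->
  ell_act (ell_act e s) t = ell_act e (GRTell_mul s t).
Proof.
move=> gs gt; rewrite /ell_act /= act1_act_unit // act_unit_mul act1_act1 //.
exact: good_unit_act.
Qed.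

(** * Freeness and transitivity *)

Lemma half_half : half + half = 1.
Proof.
by rewrite -rmorphD (_ : 1 / 2%:R + 1 / 2%:R = 1 :> rat) ?rmorph1 //; apply/eqP.
Qed.

Lemma mu_half_inv mu m : mu * m = 1 -> (mu * half) * (m + m) = 1.
Proof. by move=> E; rewrite mulrDr -!mulrA ![half * m]mulrC !mulrA E !mul1r half_half. Qed.

(** The action on the invertible [mu] forces c = 1, then [twist_inj] forces g = 1, and [evx_inj]
    forces u to consist of the two letters. *)
Lemma Ell_free : free_action (GRTell iota) (GRTell_one k) (Ell iota) (@ell_act k).
Proof.
case=> mu F Ap Am [[g up um] c] [He [m mm]] Hs; move: (He) => /Ell_iff[/= EF EA Fp HF].
have gs := GRT1ell_good Hs; have [/= Gg fp fm] := gs; rewrite /= in mm.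
rewrite /ell_act act_unitE act1E //= => -[E1 E2 E3 E4].
have c1 : uval c = 1 by rewrite -[uval c]mulr1 -mm mulrA E1.
move: E2 E3 E4; rewrite c1 /scF /scA !scale1r !ev2_id => E2 E3 E4.
have [[GF GA] _ _ _ _] := HF.
have -> : c = kunits_one k by apply: kunits_eq.
have Eg : g = 1.
  apply: (twist_inj (F := F) fA fB Gg (grp1 _)) => //.
  by rewrite -/(twist F g) -/(twist F 1) E2 twist1.
have key := evx_inj (mu_half_inv mm) HF (x := Asg up um) (y := Asg (lA k) (lB k)).
have Eu s : Asg up um s = Asg (lA k) (lB k) s.
  by apply: key => -[] //=; rewrite /evx /= ?E3 ?E4 ev2_id.
by rewrite Eg (Eu true : up = _) (Eu false : um = _).
Qed.

Lemma slog_lead g : grp g -> fil 2 (g - 1 - slog iota g).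
Proof.
move=> Gg; have Hl : fil 1 (slog iota g) by rewrite slogE //; apply/ev_fil/fil_lser.
have := cex_approx2 iota 1 Hl; rewrite /cex cst1 !mul1r.
by rewrite -sexpE // sexp_slog.
Qed.

(** [g] comes from [twist_surj] and u from solving for A_+ and A_- at once; only then are the
    relations of g and u deduced, from those of the two given elements. *)
Lemma act1_transitive e1 e m1 : Ell_ iota e1 -> ell_mu e1 * m1 = 1 ->
  Ell_ iota e -> ell_mu e = ell_mu e1 -> exists2 s, GRT1ell iota s & act1 e1 s = e.
Proof.
move: e1 e => [mu F Ap Am] [mu' F' Ap' Am'] /= H1 mm H2 E; subst mu'.
move: H1 H2 => /Ell_iff[/= EF EA Fp HF] /Ell_iff[/= EF' EA' Fp' HF'].
have [g Eg Etw] := twist_surj EF EF'; subst F'.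
have Gg := exp_lie_grp Eg.
have [[GF GA] Fd Fh Fal FC] := HF; have [[GF' GA'] Fd' Fh' Fal' FC'] := HF'.
have nuV := mu_half_inv mm; set nu := mu * half in HF HF' Fh Fal FC Fh' Fal' FC' nuV *.
have nu2V : (nu + nu) * (half * (m1 + m1)) = 1.
  by rewrite mulrCA [_ * (m1 + m1)]mulrDl nuV mulrDr !mulr1 half_half.
have [NM MN] := mat1_inv nu2V HF.
pose A := Asg Ap Am; pose A' := Asg Ap' Am'.
(* Signs and letters are related by negation, so rows and columns of the matrices are reindexed. *)
pose M (x y : bool) := mat1 A (~~ x) (~~ y).
pose N (x y : bool) := inv1 (half * (m1 + m1)) A (~~ x) (~~ y).
have negsum (V : nmodType) (f : bool -> V) : \sum_y f (~~ y) = \sum_y f y.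
  by rewrite !big_bool; exact: addrC.
(* The equations are solved for the logarithms, which are Lie series, so that the solution is a pair
   of Lie series. *)
have [||||||u [fu Lu Eu]] := @series_solve k bool bool (fun x => slog iota (A (~~ x)))
    (fun x => slog iota (A' (~~ x))) M N True.
- move=> x; have fl s : fil 1 (letter k (~~ s) : series k bool) by exact: fil_letter.
  have ES : \sum_y M x y *: letter k y = \sum_t cst (mat1 A (~~ x) t) * letter k (~~ t).
    by rewrite !big_bool /M /= !scale_cst addrC.
  have [_ h] := evx_lead (p := fun s => letter k (~~ s)) (GA (~~ x)) fl.
  move: h; rewrite ES (ev2_id _ : evx (A (~~ x)) (fun s => letter k (~~ s)) = A (~~ x)).
  move=> h; have := filB h (slog_lead (GA (~~ x))); rewrite -/A.
  by congr (fil _ _); ncring.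
- move=> x z; rewrite (negsum _ (fun y => inv1 (half * (m1 + m1)) A (~~ x) y * mat1 A y (~~ z))).
  by rewrite NM (inj_eq negb_inj).
- move=> x z; rewrite (negsum _ (fun y => mat1 A (~~ x) y * inv1 (half * (m1 + m1)) A y (~~ z))).
  by rewrite MN (inj_eq negb_inj).
- by move=> x; rewrite slogE; [apply/ev_fil/fil_lser | exact: GA'].
- by move=> _ x; have /exp_lieE[] := EA (~~ x).
- by move=> _ x; have /exp_lieE[] := EA' (~~ x).
pose up := u false; pose um := u true.
have Lu' := Lu I.
have EA2 s : ev2 (A s) up um = A' s.
  have Eu' : ev u (slog iota (A s)) = slog iota (A' s) by have := Eu (~~ s); rewrite negbK.
  have -> : ev2 (A s) up um = ev u (A s) by apply: eq_ev => -[].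
  have Gs : grp (A s) := GA s; have Gs' : grp (A' s) := GA' s.
  have Hl : fil 1 (slog iota (A s)) by rewrite slogE //; apply/ev_fil/fil_lser.
  have Hl' : fil 1 (slog iota (A' s)) by rewrite slogE //; apply/ev_fil/fil_lser.
  rewrite -{1}(sexp_slog iota Gs) -(sexp_slog iota Gs') !sexpE //.
  by rewrite (chom_cexp iota (ev u)) //= Eu'.
have HF2 : ellS iota nu (twist F g) (fun s => ev2 (A s) (Asg up um true) (Asg up um false)).
  by rewrite (_ : (fun s => _) = A') //; apply/funext => s; exact: EA2.
have gd : dualS g := untwist_dual GF Gg Fd Fd'.
have gs : sumS g := untwist_sum nuV GF Gg Fd (Fh true) Fd' (Fh' true).
have gc : cycS g := untwist_cyc nuV GF Gg Fd (Fh true) Fd' (Fh' true).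
have gp : pentS g := untwist_pent GF Gg gd gc gs Fp Fp'.
have fu' s : fil 1 (Asg up um s) by case: s; exact: fu.
have gu : uS g (Asg up um) := untwist_ell nuV Gg gs fu' HF HF2.
exists (Grt1Data g up um).
  by apply/GRT1ell_iff; split; [by split | by case; exact: Lu' | exact: gu].
rewrite act1E; last by split; [exact: Gg | exact: fu | exact: fu].
by rewrite /= (EA2 true : ev2 Ap up um = _) (EA2 false : ev2 Am up um = _).
Qed.

(** Reduction to equal constants: [d] scales the second element to the [mu] of the first, and [c] is
    its inverse. *)
Lemma Ell_transitive : transitive_action (GRTell iota) (Ell iota) (@ell_act k).
Proof.
move=> e1 e2 [H1 [m1 mm1]] [H2 [m2 mm2]].
have cP : (ell_mu e2 * m1, ell_mu e1 * m2).1 * (ell_mu e2 * m1, ell_mu e1 * m2).2 == 1.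
  apply/eqP => /=; transitivity ((ell_mu e1 * m1) * (ell_mu e2 * m2)); first by ring.
  by rewrite mm1 mm2 mulr1.
pose c : kunits k := exist _ (ell_mu e2 * m1, ell_mu e1 * m2) cP.
have dP : (ell_mu e1 * m2, ell_mu e2 * m1).1 * (ell_mu e1 * m2, ell_mu e2 * m1).2 == 1.
  by rewrite /= mulrC; exact: cP.
pose d : kunits k := exist _ (ell_mu e1 * m2, ell_mu e2 * m1) dP.
have dc : act_unit (act_unit e2 d) c = e2.
  by rewrite act_unit_mul act_unit1 // /uval /= mulrC; apply/eqP.
have Emu : ell_mu (act_unit e2 d) = ell_mu e1.
  by rewrite act_unitE /= /uval /= -mulrA [m2 * _]mulrC mm2 mulr1.
have [s Hs Es] := act1_transitive H1 mm1 (act_unit_Ell d H2) Emu.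
by exists (s, c) => //; rewrite /ell_act /= Es.
Qed.
End Actions.

Theorem proposition4p12 (k : comPzRingType) (iota : {rmorphism rat -> k}) :
  [/\ right_action (GRTell iota) (@GRTell_mul k) (@GRTell_one k)
        (Ell iota) (@ell_act k),
      free_action (GRTell iota) (@GRTell_one k) (Ell iota) (@ell_act k)
    & transitive_action (GRTell iota) (Ell iota) (@ell_act k)].
Proof.
split; [split | exact: Ell_free | exact: Ell_transitive].
- exact: Ell_act.
- by move=> e _; exact: ell_act1.
- move=> e s t _ Hs Ht; have gs := GRT1ell_good Hs; have gt := GRT1ell_good Ht.
  exact: ell_act_mul.
Qed.
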